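(* Let $G$, $K$, $\pi$, $V$, $\mu$, $f_v$, $N_\pi$, $\mathrm{spec}$ and $\varDelta_v$ be as defined in the context, let $v\in V\setminus\{0\}$, and put $L:=N_\pi^2$. Let $p^*$ be the minimum-norm point of the moment polytope $\varDelta_v$. Let $(x_k)_{k\ge0}$ in $P_n\cap G$ and $(g_k)_{k\ge0}$ in $G$ be the gradient-descent sequences $$x_{k+1} = \exp_{x_k} \Bigl(- \frac{1}{L} \nabla f_v(x_k)\Bigr),\ x_0 = I,\qquad g_{k+1} = e^{-\frac{1}{2L}\mu(\pi(g_k)v)}g_k,\ g_0=I,$$ and let $(H_k)_{k\ge1}$ be the sequence in $i\mathfrak{k}$ defined by $x_k = e^{k H_k/L}$. Suppose that $\inf_{g \in G} \|\pi(g)v\| = 0$. Then both $\mathrm{spec}\, \mu(\pi(g_k) v)$ and $\mathrm{spec}\, (- H_k)$ converge to $p^*$ for $k \to \infty$.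
   Context: $G\subseteq GL_n(\mathbb{C})$ is a connected reductive algebraic group over $\mathbb{C}$ with $G=G^\dagger$, where $\dagger$ is conjugate transpose. $K=G\cap U_n$ is its maximal compact subgroup with Lie algebra $\mathfrak{k}$; the Lie algebra of $G$ is $\mathfrak{g}=\mathfrak{k}+i\mathfrak{k}$, where $i\mathfrak{k}$ consists of Hermitian matrices. $\mathfrak g$ carries the inner product $\langle X,Y\rangle:=\mathrm{Re}\,\mathrm{tr}\,XY^\dagger$ with norm $\|\cdot\|$. $V$ is a finite-dimensional complex vector space with a $K$-invariant Hermitian inner product $(\cdot,\cdot)$ and norm $\|\cdot\|$; $\pi:G\to GL(V)$ is a rational representation with Lie algebra representation $\Pi(X):=\frac{d}{dt}\pi(e^{tX})|_{t=0}$. The moment map $\mu:V\setminus\{0\}\to i\mathfrak{k}$ is defined by $\langle\mu(w),H\rangle:=(w,\Pi(H)w)/(w,w)$ for $H\in i\mathfrak{k}$. $N_\pi$ is the maximum of the norm of a weight for $\pi$: for $T$ a maximal torus of $K$ with Lie algebra $\mathfrak{t}$, a weight is an $\omega\in i\mathfrak{t}$ such that for some nonzero $w\in V$, $\Pi(H)w=\langle\omega,H\rangle w$ for all $H\in i\mathfrak t$; its norm is $\|\omega\|$. $P_n$ is the manifold of $n\times n$ positive definite Hermitian matrices with metric $\langle X,Y\rangle_x=\mathrm{tr}\,x^{-1}Xx^{-1}Y$; $P_n\cap G$ is a totally geodesic submanifold with $T_I(P_n\cap G)=i\mathfrak{k}$ and exponential map $\exp_x(H)=x^{1/2}e^{x^{-1/2}Hx^{-1/2}}x^{1/2}$.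 The Kempf–Ness function is $f_v(x):=\log(\pi(x)v,v)$ $(x\in P_n\cap G)$ and $\nabla f_v$ is its Riemannian gradient. $\mathcal{C}_\pi\subseteq i\mathfrak{k}$ is a positive Weyl chamber: a convex cone such that for any $H\in i\mathfrak{k}$ there is a unique point $\mathrm{spec}\,H\in\mathcal{C}_\pi$ with $\mathrm{spec}\,H=kHk^\dagger$ for some $k\in K$. The moment polytope is $\varDelta_v:=\overline{\{\mathrm{spec}\,\mu(\pi(g)v)\mid g\in G\}}$; by the convexity theorem (Guillemin–Sternberg, Kirwan) it is a convex polytope, so its minimum-norm point is unique. *)

(* Defs.v *)
From HB Require Import structures.
From mathcomp Require Import all_boot all_order all_algebra.
From mathcomp Require Import complex.
From mathcomp Require Import all_classical all_reals all_analysis.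
From mathcomp Require mpoly.

Set Implicit Arguments.
Unset Strict Implicit.
Unset Printing Implicit Defensive.

Import Order.TTheory GRing.Theory Num.Theory.
Import numFieldNormedType.Exports.

Local Open Scope ring_scope.
Local Open Scope complex_scope.
Local Open Scope sesquilinear_scope.
Local Open Scope classical_set_scope.

(* R[i] gets the topology of its modulus, hence 'M[R[i]]_n the product
   topology; the library only does this for abstract fields. *)
#[non_forgetful_inheritance]
HB.instance Definition _ (R : realType) :=
  PseudoPointedMetric.copy R[i] R[i]^o.
#[non_forgetful_inheritance]
HB.instance Definition _ (R : realType) := NormedModule.copy R[i] R[i]^o.

Definition mx_eval (R : realType) (n : nat) (p : mpoly.mpoly (n * n) R[i])
  (g : 'M[R[i]]_n) : R[i] := mpoly.meval (fun k => mxvec g ord0 k) p.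

Definition zariski_closed (R : realType) (n : nat) (Z : set 'M[R[i]]_n) : Prop :=
  exists S : set (mpoly.mpoly (n * n) R[i]),
    Z = [set g | g \in unitmx /\ forall p, S p -> mx_eval p g = 0].

Definition zariski_connected (R : realType) (n : nat)
    (A : set 'M[R[i]]_n) : Prop :=
  forall Z1 Z2 : set 'M[R[i]]_n, zariski_closed Z1 -> zariski_closed Z2 ->
    A `<=` Z1 `|` Z2 -> A `&` Z1 `&` Z2 = set0 -> A `<=` Z1 \/ A `<=` Z2.

Definition is_subgroup (R : realType) (n : nat) (H : set 'M[R[i]]_n) : Prop :=
  [/\ H `<=` [set g | g \in unitmx], H 1%:M,
      forall g h, H g -> H h -> H (g *m h) & forall g, H g -> H (invmx g)].

Definition is_algebraic_group (R : realType) (n : nat)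
    (G : set 'M[R[i]]_n) : Prop := is_subgroup G /\ zariski_closed G.

Definition is_unipotent (R : realType) (n : nat) (u : 'M[R[i]]_n) : Prop :=
  exists k : nat, (u - 1%:M) ^+ k = 0.

(* The unipotent radical, i.e. the largest connected normal unipotent closed
   subgroup, is trivial. *)
Definition is_reductive (R : realType) (n : nat) (G : set 'M[R[i]]_n) : Prop :=
  forall U : set 'M[R[i]]_n,
    U `<=` G -> is_algebraic_group U -> zariski_connected U ->
    (forall g u, G g -> U u -> U (g *m u *m invmx g)) ->
    (forall u, U u -> is_unipotent u) -> U = [set 1%:M].

Definition self_adjoint (R : realType) (n : nat) (G : set 'M[R[i]]_n) : Prop :=
  [set g ^t* | g in G] = G.

Definition unitary_part (R : realType) (n : nat) (G : set 'M[R[i]]_n) :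
  set 'M[R[i]]_n := G `&` [set g | g \is unitarymx].

Definition expmx (R : realType) (n : nat) (A : 'M[R[i]]_n) : 'M[R[i]]_n :=
  limn (series (fun k : nat => (k`!%:R)^-1 *: A ^+ k)).

Definition lie_algebra (R : realType) (n : nat) (H : set 'M[R[i]]_n) :
  set 'M[R[i]]_n := [set X | forall t : R, H (expmx (t%:C *: X))].

Definition ilie (R : realType) (n : nat) (H : set 'M[R[i]]_n) :
  set 'M[R[i]]_n := [set 'i *: X | X in lie_algebra H].

Definition mx_inner (R : realType) (n : nat) (X Y : 'M[R[i]]_n) : R :=
  complex.Re (\tr (X *m Y ^t*)).

Definition mx_fnorm (R : realType) (n : nat) (X : 'M[R[i]]_n) : R :=
  Num.sqrt (mx_inner X X).

Definition hnorm (R : realType) (V : vectType R[i])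
    (ip : {dot V for @Num.conj R[i]}) (w : V) : R :=
  Num.sqrt (complex.Re (ip w w)).

(* A rational representation of G on V; only the values of pi on G matter. The
   coordinate ring of G consists of the restrictions of p / det ^ k. *)
Definition is_rational_rep (R : realType) (n : nat) (V : vectType R[i])
    (G : set 'M[R[i]]_n) (pi : 'M[R[i]]_n -> 'End(V)) : Prop :=
  [/\ forall w, pi 1%:M w = w,
      forall g h w, G g -> G h -> pi (g *m h) w = pi g (pi h w) &
      forall (phi : 'Hom(V, R[i]^o)) (w : V),
        exists (p : mpoly.mpoly (n * n) R[i]) (k : nat),
        forall g, G g -> phi (pi g w) = mx_eval p g / \det g ^+ k].

Definition invariant_product (R : realType) (n : nat) (V : vectType R[i])
    (K : set 'M[R[i]]_n) (pi : 'M[R[i]]_n -> 'End(V))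
    (ip : {dot V for @Num.conj R[i]}) : Prop :=
  forall k u w, K k -> ip (pi k u) (pi k w) = ip u w.

(* Pi X is the derivative of pi (e^(t X)) at t = 0, for the norm of V. *)
Definition is_lie_rep (R : realType) (n : nat) (V : vectType R[i])
    (ip : {dot V for @Num.conj R[i]}) (G : set 'M[R[i]]_n)
    (pi Pi : 'M[R[i]]_n -> 'End(V)) : Prop :=
  forall X w, lie_algebra G X ->
    hnorm ip ((t^-1)%:C *: (pi (expmx (t%:C *: X)) w - w) - Pi X w)
      @[t --> (0 : R)^'] --> (0 : R).

Definition is_moment_map (R : realType) (n : nat) (V : vectType R[i])
    (ip : {dot V for @Num.conj R[i]}) (K : set 'M[R[i]]_n)
    (Pi : 'M[R[i]]_n -> 'End(V)) (mu : V -> 'M[R[i]]_n) : Prop :=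
  forall w, w != 0 -> ilie K (mu w) /\
    forall H, ilie K H -> (mx_inner (mu w) H)%:C = ip w (Pi H w) / ip w w.

Definition is_torus (R : realType) (n : nat) (K T : set 'M[R[i]]_n) : Prop :=
  [/\ T `<=` K, is_subgroup T, closed T, connected T &
      forall s t, T s -> T t -> s *m t = t *m s].

Definition is_maximal_torus (R : realType) (n : nat)
    (K T : set 'M[R[i]]_n) : Prop :=
  is_torus K T /\ forall T', is_torus K T' -> T `<=` T' -> T' = T.

Definition is_weight (R : realType) (n : nat) (V : vectType R[i])
    (T : set 'M[R[i]]_n) (Pi : 'M[R[i]]_n -> 'End(V))
    (omega : 'M[R[i]]_n) : Prop :=
  ilie T omega /\ exists2 w : V, w != 0 &
    forall H, ilie T H -> Pi H w = (mx_inner omega H)%:C *: w.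

Definition is_max_weight_norm (R : realType) (n : nat) (V : vectType R[i])
    (T : set 'M[R[i]]_n) (Pi : 'M[R[i]]_n -> 'End(V)) (N : R) : Prop :=
  (exists2 omega, is_weight T Pi omega & mx_fnorm omega = N) /\
  forall omega, is_weight T Pi omega -> mx_fnorm omega <= N.

Definition is_convex_cone (R : realType) (n : nat)
    (C : set 'M[R[i]]_n) : Prop :=
  (forall (a : R) X, 0 <= a -> C X -> C (a%:C *: X)) /\
  (forall X Y, C X -> C Y -> C (X + Y)).

Definition adjoint_conj (R : realType) (n : nat) (K : set 'M[R[i]]_n)
    (H P : 'M[R[i]]_n) : Prop := exists2 k, K k & P = k *m H *m k ^t*.

(* Inside i Lie(T) for a maximal torus T, the convex cones meeting every orbit
   of K exactly once are the closed Weyl chambers of T. *)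
Definition is_weyl_chamber (R : realType) (n : nat)
    (K C : set 'M[R[i]]_n) : Prop :=
  [/\ exists2 T, is_maximal_torus K T & C `<=` ilie T,
      is_convex_cone C &
      forall H, ilie K H -> exists! P, C P /\ adjoint_conj K H P].

Definition is_spec (R : realType) (n : nat) (K C : set 'M[R[i]]_n)
    (spec : 'M[R[i]]_n -> 'M[R[i]]_n) : Prop :=
  forall H, ilie K H -> C (spec H) /\ adjoint_conj K H (spec H).

Definition moment_polytope (R : realType) (n : nat) (V : vectType R[i])
    (G : set 'M[R[i]]_n) (pi : 'M[R[i]]_n -> 'End(V)) (mu : V -> 'M[R[i]]_n)
    (spec : 'M[R[i]]_n -> 'M[R[i]]_n) (v : V) : set 'M[R[i]]_n :=
  closure [set spec (mu (pi g v)) | g in G].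

Definition is_min_norm_point (R : realType) (n : nat)
    (D : set 'M[R[i]]_n) (p : 'M[R[i]]_n) : Prop :=
  D p /\ forall q, D q -> mx_fnorm p <= mx_fnorm q.

Definition posdef (R : realType) (n : nat) : set 'M[R[i]]_n :=
  [set x | x \is hermsymmx /\
     forall u : 'cV[R[i]]_n, u != 0 -> 0 < (u ^t* *m x *m u) ord0 ord0].

Definition sqrtmx (R : realType) (n : nat) (x : 'M[R[i]]_n) : 'M[R[i]]_n :=
  xget 0 [set s | posdef s /\ s *m s = x].

Definition pd_metric (R : realType) (n : nat) (x X Y : 'M[R[i]]_n) : R :=
  complex.Re (\tr (invmx x *m X *m invmx x *m Y)).

Definition pd_exp (R : realType) (n : nat) (x H : 'M[R[i]]_n) : 'M[R[i]]_n :=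
  let s := sqrtmx x in s *m expmx (invmx s *m H *m invmx s) *m s.

Definition curve_through (R : realType) (n : nat) (M : set 'M[R[i]]_n)
    (x X : 'M[R[i]]_n) (c : R -> 'M[R[i]]_n) : Prop :=
  [/\ forall t, M (c t), c 0 = x &
      (t^-1)%:C *: (c t - c 0) @[t --> (0 : R)^'] --> X].

Definition tangent_space (R : realType) (n : nat) (M : set 'M[R[i]]_n)
    (x : 'M[R[i]]_n) : set 'M[R[i]]_n :=
  [set X | exists c, curve_through M x X c].

(* For f smooth near a submanifold M of P_n, the derivative of f \o c at 0
   depends only on the velocity X of c, so these conditions determine Y. *)
Definition is_gradient_at (R : realType) (n : nat) (M : set 'M[R[i]]_n)
    (f : 'M[R[i]]_n -> R) (x Y : 'M[R[i]]_n) : Prop :=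
  tangent_space M x Y /\
  forall X c, curve_through M x X c ->
    is_derive (0 : R) 1 (f \o c) (pd_metric x Y X).

Definition kempf_ness (R : realType) (n : nat) (V : vectType R[i])
    (ip : {dot V for @Num.conj R[i]}) (pi : 'M[R[i]]_n -> 'End(V)) (v : V)
    (x : 'M[R[i]]_n) : R := ln (complex.Re (ip (pi x v) v)).

(* Main.v *)
Require Import Defs.
From HB Require Import structures.
From mathcomp Require Import all_boot all_order all_algebra.
From mathcomp Require Import complex.
From mathcomp Require Import all_classical all_reals all_analysis.
From mathcomp Require mpoly.
From mathcomp Require Import perm ring lra.

Set Implicit Arguments.
Unset Strict Implicit.
Unset Printing Implicit Defensive.

Import Order.TTheory GRing.Theory Num.Theory.
Import numFieldNormedType.Exports.

Local Open Scope ring_scope.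
Local Open Scope complex_scope.
Local Open Scope sesquilinear_scope.
Local Open Scope classical_set_scope.

(** Write m_k = μ(π(g_k)v). The gradient of f_v at g†g is g† μ(π(g)v) g, so x_k = g_k† g_k
    ([kempf_ness_gradient], [pd_exp_gram]). Since Π(X) has operator norm at most N‖X‖ on i𝔨
    ([La_bound]), a step of size 1/L satisfies ⟨m_{k+1}, m_{k+1}⟩ ≤ ⟨m_{k+1}, m_k⟩ ([step_gradient])
    and lowers log‖π(g_k)v‖² by at least ⟨m_{k+1}, m_k⟩/L ([step_value]). Hence ‖m_k‖ decreases to
    some κ, and f_v(x_k) ≤ f_v(I) - kκ²/L ([descent_log]). The triangle inequality in P_n bounds
    ‖H_k‖ by the mean of ‖m_0‖, ..., ‖m_{k-1}‖, so every limit point H₀ of the H_k has ‖H₀‖ ≤ κ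
    ([limit_direction_le]); convexity of f_v along geodesics gives f_v(e^{sH₀}) ≤ f_v(I) - sκ²
    ([limit_direction_decay]).

    Thus H₀ destabilises v at rate κ². By Iwasawa any h in G is kb with k in K and e^{tH₀} b
    e^{-tH₀} bounded for t ≥ 0, so π(b)v decays at the same rate, and Jensen's inequality yields
    ⟨μ(π(h)v), kH₀k†⟩ ≤ -κ² ([moment_halfspace]). With ‖H₀‖ ≤ κ this gives ‖μ(π(h)v) + kH₀k†‖² ≤
    ‖μ(π(h)v)‖² - κ². So along any sequence whose moment norms tend to a value at most κ, the
    moments are asymptotically conjugate to -H₀ ([moment_asymptotic]). This applies to g_k, and also
    to a sequence realising p*, because spec(-H₀) lies in the polytope and has norm at most κ. Both
    spectra therefore tend to spec(-H₀), which must be p* ([min_norm_point_limit]). Limits are taken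
    along ultrafilters instead of subsequences; all of them give p*.

    Passing spec to the limit needs the Weyl chamber to be closed, although it is given only as a
    convex cone in a torus algebra that meets each K-orbit once. A suitable interior point c is
    chosen, and every chamber point is shown to maximise ⟨c, ·⟩ on its orbit ([chamber_orbit_max]),
    a maximiser being unique on each orbit ([maximizer_unique]). Uniqueness comes from the flow
    e^{sc}g: for generic g the K-part of e^{sc}g relative to a maximiser Y moves Y back to Y in the
    limit ([flow_limit]), and one g is generic for two maximisers at once because G is irreducible
    ([G_irreducible]). The geometry of P_n enters through Busemann functions written with leading
    minors; they give the distance estimates ([fnorm_log_le], [fnorm_log_sub]), the latter of which
    yields the Iwasawa decomposition ([iwasawa]). *)

HB.lock Definition adj (R : realType) m n (X : 'M[R[i]]_(m, n)) : 'M[R[i]]_(n, m) :=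
  X^t*.
Reserved Notation "X ^H" (at level 8, format "X ^H").
Notation "X ^H" := (adj X) : ring_scope.

(** * Adjoints and the Frobenius inner product *)

Section Adjoint.
Variable R : realType.
Notation C := R[i].
Notation Re := (@complex.Re R).

Lemma adj_trmxC m n (X : 'M[C]_(m, n)) : X^t* = X^H.
Proof. by rewrite unlock. Qed.

Lemma adjE m n (X : 'M[C]_(m, n)) i j : X^H i j = conjc (X j i).
Proof. by rewrite -adj_trmxC !mxE. Qed.

End Adjoint.

(** Rectangular matrices are allowed so that vectors of the representation space, taken as columns,
    carry the same inner product as the Lie algebra. *)
HB.lock Definition rinner (R : realType) m n (X Y : 'M[R[i]]_(m, n)) : R :=
  complex.Re (\tr (X *m Y^H)).

HB.lock Definition fnorm (R : realType) m n (X : 'M[R[i]]_(m, n)) : R :=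
  Num.sqrt (rinner X X).

Section InnerDef.
Variable R : realType.
Notation C := R[i].
Notation Re := (@complex.Re R).

Lemma rinner_tr m n (X Y : 'M[C]_(m, n)) : rinner X Y = Re (\tr (X *m Y^H)).
Proof. by rewrite rinner.unlock. Qed.

Lemma fnorm_def m n (X : 'M[C]_(m, n)) : fnorm X = Num.sqrt (rinner X X).
Proof. by rewrite fnorm.unlock. Qed.

Lemma mx_innerE n (X Y : 'M[C]_n) : mx_inner X Y = rinner X Y.
Proof. by rewrite /mx_inner adj_trmxC rinner_tr. Qed.

Lemma mx_fnormE n (X : 'M[C]_n) : mx_fnorm X = fnorm X.
Proof. by rewrite /mx_fnorm mx_innerE fnorm_def. Qed.

Definition is_unitary n (U : 'M[C]_n) : Prop := U^H *m U = 1%:M.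

Lemma unitarymxE n (U : 'M[C]_n) : (U \is unitarymx) <-> is_unitary U.
Proof.
rewrite /is_unitary -adj_trmxC.
by split=> [/unitarymxP/mulmx1C|/mulmx1C h]; [|apply/unitarymxP].
Qed.

End InnerDef.

Section MatrixInner.
Variable R : realType.
Notation C := R[i].
Notation Re := (@complex.Re R).
Notation Im := (@complex.Im R).

Lemma ReD (x y : C) : Re (x + y) = Re x + Re y. Proof. by case: x y => ? ? []. Qed.
Lemma ImD (x y : C) : Im (x + y) = Im x + Im y. Proof. by case: x y => ? ? []. Qed.
Lemma ReN (x : C) : Re (- x) = - Re x. Proof. by case: x. Qed.
Lemma ImN (x : C) : Im (- x) = - Im x. Proof. by case: x. Qed.
Lemma ReB (x y : C) : Re (x - y) = Re x - Re y. Proof. by rewrite ReD ReN. Qed.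
Lemma ImB (x y : C) : Im (x - y) = Im x - Im y. Proof. by rewrite ImD ImN. Qed.
Lemma ReM (x y : C) : Re (x * y) = Re x * Re y - Im x * Im y.
Proof. by case: x y => ? ? []. Qed.
Lemma ImM (x y : C) : Im (x * y) = Re x * Im y + Im x * Re y.
Proof. by case: x y => ? ? []. Qed.
Lemma ReJ (x : C) : Re (conjc x) = Re x. Proof. by case: x. Qed.
Lemma ImJ (x : C) : Im (conjc x) = - Im x. Proof. by case: x. Qed.
Lemma ReZ (a : R) (x : C) : Re (a%:C * x) = a * Re x.
Proof. by rewrite ReM /= mul0r subr0. Qed.
Lemma ImZ (a : R) (x : C) : Im (a%:C * x) = a * Im x.
Proof. by rewrite ImM /= mul0r addr0. Qed.
Lemma Re_sum I (r : seq I) (P : pred I) (F : I -> C) :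
  Re (\sum_(i <- r | P i) F i) = \sum_(i <- r | P i) Re (F i).
Proof. by apply: (big_morph Re ReD). Qed.
Lemma Im_sum I (r : seq I) (P : pred I) (F : I -> C) :
  Im (\sum_(i <- r | P i) F i) = \sum_(i <- r | P i) Im (F i).
Proof. by apply: (big_morph Im ImD). Qed.

Lemma complexP (x y : C) : Re x = Re y -> Im x = Im y -> x = y.
Proof. by case: x y => ? ? [? ?] /= -> ->. Qed.

Lemma conj_real (a : R) : conjc a%:C = a%:C.
Proof. by apply: complexP; rewrite ?ReJ ?ImJ //= oppr0. Qed.

Lemma adjK m n (X : 'M[C]_(m, n)) : X^H^H = X.
Proof. by apply/matrixP => i j; rewrite !adjE conjcK. Qed.
Lemma adjM m n p (X : 'M[C]_(m, n)) (Y : 'M[C]_(n, p)) :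
  (X *m Y)^H = Y^H *m X^H.
Proof.
apply/matrixP => i j; rewrite adjE !mxE rmorph_sum; apply: eq_bigr => k _.
by rewrite rmorphM mulrC !adjE.
Qed.
Lemma adjD m n (X Y : 'M[C]_(m, n)) : (X + Y)^H = X^H + Y^H.
Proof. by apply/matrixP => i j; rewrite mxE !adjE mxE rmorphD. Qed.
Lemma adjN m n (X : 'M[C]_(m, n)) : (- X)^H = - X^H.
Proof. by apply/matrixP => i j; rewrite mxE !adjE mxE rmorphN. Qed.
Lemma adjB m n (X Y : 'M[C]_(m, n)) : (X - Y)^H = X^H - Y^H.
Proof. by rewrite adjD adjN. Qed.
Lemma adjZ m n (a : C) (X : 'M[C]_(m, n)) : (a *: X)^H = conjc a *: X^H.
Proof. by apply/matrixP => i j; rewrite mxE !adjE mxE rmorphM. Qed.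
Lemma adjZr m n (a : R) (X : 'M[C]_(m, n)) : (a%:C *: X)^H = a%:C *: X^H.
Proof. by rewrite adjZ conj_real. Qed.
Lemma adj1 n : (1%:M : 'M[C]_n)^H = 1%:M.
Proof. by apply/matrixP => i j; rewrite adjE !mxE eq_sym; case: eqP; rewrite (rmorph1, rmorph0). Qed.
Lemma adj0 m n : (0 : 'M[C]_(m, n))^H = 0.
Proof. by apply/matrixP => i j; rewrite adjE !mxE rmorph0. Qed.
Lemma det_adj n (X : 'M[C]_n) : \det X^H = conjc (\det X).
Proof. by rewrite -adj_trmxC det_map_mx det_tr. Qed.

Lemma rinnerE m n (X Y : 'M[C]_(m, n)) : rinner X Y =
  \sum_i \sum_j (Re (X i j) * Re (Y i j) + Im (X i j) * Im (Y i j)).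
Proof.
rewrite !rinner_tr /mxtrace Re_sum; apply: eq_bigr => i _.
rewrite !mxE Re_sum; apply: eq_bigr => j _.
by rewrite adjE ReM ReJ ImJ mulrN opprK.
Qed.

Lemma rinnerC m n (X Y : 'M[C]_(m, n)) : rinner X Y = rinner Y X.
Proof.
rewrite !rinnerE; apply: eq_bigr => i _; apply: eq_bigr => j _; ring.
Qed.

Lemma rinnerDl m n (X Y Z : 'M[C]_(m, n)) :
  rinner (X + Y) Z = rinner X Z + rinner Y Z.
Proof. by rewrite !rinner_tr mulmxDl mxtraceD ReD. Qed.

Lemma rinnerZl m n a (X Z : 'M[C]_(m, n)) :
  rinner (a%:C *: X) Z = a * rinner X Z.
Proof. by rewrite !rinner_tr -scalemxAl mxtraceZ ReZ. Qed.

Lemma rinnerNl m n (X Z : 'M[C]_(m, n)) : rinner (- X) Z = - rinner X Z.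
Proof. by rewrite !rinner_tr mulNmx linearN ReN. Qed.

Lemma rinnerBl m n (X Y Z : 'M[C]_(m, n)) :
  rinner (X - Y) Z = rinner X Z - rinner Y Z.
Proof. by rewrite rinnerDl rinnerNl. Qed.

Lemma rinnerDr m n (X Y Z : 'M[C]_(m, n)) :
  rinner Z (X + Y) = rinner Z X + rinner Z Y.
Proof. by rewrite !(rinnerC Z) rinnerDl. Qed.

Lemma rinnerZr m n a (X Z : 'M[C]_(m, n)) :
  rinner Z (a%:C *: X) = a * rinner Z X.
Proof. by rewrite !(rinnerC Z) rinnerZl. Qed.

Lemma rinnerNr m n (X Z : 'M[C]_(m, n)) : rinner Z (- X) = - rinner Z X.
Proof. by rewrite !(rinnerC Z) rinnerNl. Qed.

Lemma rinnerBr m n (X Y Z : 'M[C]_(m, n)) :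
  rinner Z (X - Y) = rinner Z X - rinner Z Y.
Proof. by rewrite !(rinnerC Z) rinnerBl. Qed.

Lemma rinner0l m n (Z : 'M[C]_(m, n)) : rinner 0 Z = 0.
Proof. by rewrite !rinner_tr mul0mx mxtrace0. Qed.

Lemma rinner0r m n (Z : 'M[C]_(m, n)) : rinner Z 0 = 0.
Proof. by rewrite rinnerC rinner0l. Qed.

Lemma rinner_ge0 m n (X : 'M[C]_(m, n)) : 0 <= rinner X X.
Proof.
rewrite rinnerE; apply: sumr_ge0 => i _; apply: sumr_ge0 => j _.
by rewrite addr_ge0 // -expr2 sqr_ge0.
Qed.

Lemma entry_le_rinner m n (X : 'M[C]_(m, n)) i j :
  Re (X i j) ^+ 2 + Im (X i j) ^+ 2 <= rinner X X.
Proof.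
rewrite rinnerE (bigD1 i) //= (bigD1 j) //= -!expr2 -addrA lerDl.
apply: addr_ge0; first by apply: sumr_ge0 => k _; rewrite addr_ge0 // -expr2 sqr_ge0.
apply: sumr_ge0 => k _; apply: sumr_ge0 => l _.
by rewrite addr_ge0 // -expr2 sqr_ge0.
Qed.

Lemma rinner_eq0 m n (X : 'M[C]_(m, n)) : rinner X X = 0 -> X = 0.
Proof.
move=> X0; apply/matrixP => i j; rewrite mxE.
have := entry_le_rinner X i j; rewrite X0 => h.
have h1 := sqr_ge0 (Re (X i j)); have h2 := sqr_ge0 (Im (X i j)).
apply: complexP => /=; apply/eqP; rewrite -sqrf_eq0; apply/eqP; lra.
Qed.

Lemma fnorm_ge0 m n (X : 'M[C]_(m, n)) : 0 <= fnorm X.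
Proof. by rewrite fnorm_def sqrtr_ge0. Qed.

Lemma fnorm_sqr m n (X : 'M[C]_(m, n)) : fnorm X ^+ 2 = rinner X X.
Proof. by rewrite fnorm_def sqr_sqrtr // rinner_ge0. Qed.

Lemma fnorm0 m n : fnorm (0 : 'M[C]_(m, n)) = 0.
Proof. by rewrite !fnorm_def rinner0l sqrtr0. Qed.

Lemma fnorm_eq0 m n (X : 'M[C]_(m, n)) : fnorm X = 0 -> X = 0.
Proof. by move=> h; apply: rinner_eq0; rewrite -fnorm_sqr h expr0n. Qed.

Lemma fnormN m n (X : 'M[C]_(m, n)) : fnorm (- X) = fnorm X.
Proof. by rewrite !fnorm_def rinnerNl rinnerNr opprK. Qed.

Lemma fnormZ m n a (X : 'M[C]_(m, n)) : fnorm (a%:C *: X) = `|a| * fnorm X.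
Proof.
by rewrite !fnorm_def rinnerZl rinnerZr mulrA -expr2 sqrtrM ?sqr_ge0 // sqrtr_sqr.
Qed.

Lemma rinner_le_fnorm m n (X Y : 'M[C]_(m, n)) : rinner X Y <= fnorm X * fnorm Y.
Proof.
have [Y0|Yn0] := eqVneq (fnorm Y) 0.
  by rewrite (fnorm_eq0 Y0) rinner0r fnorm0 mulr0.
have Yp : 0 < fnorm Y by rewrite lt_def Yn0 fnorm_ge0.
have [X0|Xn0] := eqVneq (fnorm X) 0.
  by rewrite (fnorm_eq0 X0) rinner0l fnorm0 mul0r.
have Xp : 0 < fnorm X by rewrite lt_def Xn0 fnorm_ge0.
have := rinner_ge0 ((fnorm Y)%:C *: X - (fnorm X)%:C *: Y).
rewrite !(rinnerBl, rinnerBr, rinnerZl, rinnerZr) (rinnerC Y X) -!fnorm_sqr.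
set a := fnorm X; set b := fnorm Y; set c := rinner X Y.
move=> h; have {h} : 0 <= (2 * (a * b)) * (a * b - c) by move: h; rewrite -/a -/b -/c; lra.
by rewrite pmulr_rge0 ?subr_ge0 // !mulr_gt0.
Qed.

Lemma normr_rinner_le m n (X Y : 'M[C]_(m, n)) : `|rinner X Y| <= fnorm X * fnorm Y.
Proof.
rewrite ler_norml rinner_le_fnorm andbT lerNl -rinnerNl.
by rewrite -(fnormN X) rinner_le_fnorm.
Qed.

Lemma fnormD m n (X Y : 'M[C]_(m, n)) : fnorm (X + Y) <= fnorm X + fnorm Y.
Proof.
rewrite -(@ler_pXn2r _ 2) ?nnegrE ?addr_ge0 ?fnorm_ge0 // fnorm_sqr.
rewrite rinnerDl !rinnerDr (rinnerC Y X) sqrrD -!fnorm_sqr.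
have := rinner_le_fnorm X Y; lra.
Qed.

Lemma fnormB m n (X Y : 'M[C]_(m, n)) : fnorm (X - Y) <= fnorm X + fnorm Y.
Proof. by rewrite -(fnormN Y) fnormD. Qed.

Lemma fnorm_sum m n I (r : seq I) (P : pred I) (F : I -> 'M[C]_(m, n)) :
  fnorm (\sum_(i <- r | P i) F i) <= \sum_(i <- r | P i) fnorm (F i).
Proof.
elim/big_rec2: _ => [|i x y _ h]; first by rewrite fnorm0.
by apply: le_trans (fnormD _ _) _; rewrite lerD2l.
Qed.

Lemma rinner_adj m n (X Y : 'M[C]_(m, n)) : rinner (X^H) (Y^H) = rinner X Y.
Proof.
rewrite !rinnerE exchange_big; apply: eq_bigr => i _; apply: eq_bigr => j _.
by rewrite !adjE !ReJ !ImJ mulrNN.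
Qed.

Lemma rinner_mull m n p (A : 'M[C]_(m, n)) (X : 'M[C]_(n, p)) Y :
  rinner (A *m X) Y = rinner X (A^H *m Y).
Proof.
by rewrite !rinner_tr adjM adjK mulmxA (mxtrace_mulC _ A) mulmxA.
Qed.

Lemma rinner_mulr m n p (A : 'M[C]_(n, p)) (X : 'M[C]_(m, n)) Y :
  rinner (X *m A) Y = rinner X (Y *m A^H).
Proof. by rewrite !rinner_tr adjM adjK mulmxA. Qed.

Lemma rinner_mull2 m n p (A : 'M[C]_(m, n)) (X : 'M[C]_(n, p)) Y :
  rinner Y (A *m X) = rinner (A^H *m Y) X.
Proof. by rewrite rinnerC rinner_mull rinnerC. Qed.

Lemma rinner_mulr2 m n p (A : 'M[C]_(n, p)) (X : 'M[C]_(m, n)) Y :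
  rinner Y (X *m A) = rinner (Y *m A^H) X.
Proof. by rewrite rinnerC rinner_mulr rinnerC. Qed.

Lemma fnorm_adj m n (X : 'M[C]_(m, n)) : fnorm (X^H) = fnorm X.
Proof. by rewrite !fnorm_def rinner_adj. Qed.

(** Cauchy-Schwarz for each entry of the product, summed over the rows of [X] and the columns of
    [Y]. *)
Lemma fnorm_mul m n p (X : 'M[C]_(m, n)) (Y : 'M[C]_(n, p)) :
  fnorm (X *m Y) <= fnorm X * fnorm Y.
Proof.
rewrite -(@ler_pXn2r _ 2) ?nnegrE ?mulr_ge0 ?fnorm_ge0 // exprMn !fnorm_sqr.
have rowE a b (Z : 'M[C]_(a, b)) : rinner Z Z = \sum_i rinner (row i Z) (row i Z).
  rewrite rinnerE; apply: eq_bigr => i _; rewrite rinnerE big_ord1.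
  by apply: eq_bigr => j _; rewrite !mxE.
have colE a b (Z : 'M[C]_(a, b)) : rinner Z Z = \sum_j rinner (col j Z) (col j Z).
  rewrite rinnerE exchange_big; apply: eq_bigr => j _; rewrite rinnerE.
  by apply: eq_bigr => i _; rewrite big_ord1 !mxE.
rewrite [leLHS]rinnerE (rowE _ _ X) (colE _ _ Y) mulr_suml ler_sum // => i _.
rewrite mulr_sumr ler_sum // => j _.
set x := row i X; set y := (col j Y)^H.
have -> : (X *m Y) i j = \tr (x *m y^H).
  by rewrite trace_mx11 /y adjK !mxE; apply: eq_bigr => k _; rewrite !mxE.
rewrite -!expr2 -(rinner_adj (col j Y)) -/y.
set z := \tr _.
have [->|z0] := eqVneq (Re z ^+ 2 + Im z ^+ 2) 0.
  by rewrite mulr_ge0 // rinner_ge0.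
have zp : 0 < Re z ^+ 2 + Im z ^+ 2 by rewrite lt_def z0 addr_ge0 // sqr_ge0.
(* The real inner product sees only the real part of [z]; multiplying the row by the conjugate of
   [z] turns it into the squared modulus. *)
have h : rinner (conjc z *: x) y = Re z ^+ 2 + Im z ^+ 2.
  by rewrite !rinner_tr -scalemxAl mxtraceZ -/z ReM ReJ ImJ mulNr opprK -!expr2.
have nz : rinner (conjc z *: x) (conjc z *: x) = (Re z ^+ 2 + Im z ^+ 2) * rinner x x.
  rewrite !rinnerE !big_ord1 mulr_sumr; apply: eq_bigr => k _.
  rewrite !mxE !ReM !ImM !ReJ !ImJ; ring.
have := rinner_le_fnorm (conjc z *: x) y; rewrite h => h2.
rewrite -(ler_pM2l zp).
rewrite mulrA -nz -!fnorm_sqr -exprMn -expr2.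
rewrite ler_pXn2r ?nnegrE ?mulr_ge0 ?fnorm_ge0 //; exact: ltW.
Qed.

End MatrixInner.

(** * Convergence of reals, complex numbers and matrices along filters *)

Section RealConvergence.
Variable R : realType.
Variables (T : Type) (F : set_system T).
Context {FF : Filter F}.

Lemma rcvgP (g : T -> R) (l : R) :
  (g x @[x --> F] --> l) <-> forall e, 0 < e -> F [set x | `|g x - l| <= e].
Proof.
split=> [/cvgrPdist_le h e e0|h].
  by have := h e e0; apply: filterS => x /=; rewrite distrC.
by apply/cvgrPdist_le => e e0; have := h e e0; apply: filterS => x /=; rewrite distrC.
Qed.

Lemma rcvg_dom (f g : T -> R) (l : R) : F [set x | `|g x - l| <= f x] ->
  f x @[x --> F] --> (0 : R) -> g x @[x --> F] --> l.
Proof.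
move=> gf /rcvgP f0; apply/rcvgP => e e0; have := f0 e e0.
apply: filterS2 gf => x /= h1; rewrite subr0 => h2.
exact: le_trans h1 (le_trans (ler_norm _) h2).
Qed.

End RealConvergence.

Section Convergence.
Variable R : realType.
Notation C := R[i].
Notation Re := (@complex.Re R).
Notation Im := (@complex.Im R).
Variables (T : Type) (F : set_system T).
Context {FF : Filter F}.

(** Convergence is encoded through real coordinates, so that the real limit theorems apply for every
    filter and every matrix shape; [mcvgE] ties it to the topology of square matrices. *)
Definition ccvg (f : T -> C) (c : C) : Prop :=
  Re (f x) @[x --> F] --> Re c /\ Im (f x) @[x --> F] --> Im c.

Definition mcvg m n (f : T -> 'M[C]_(m, n)) (L : 'M[C]_(m, n)) : Prop :=
  forall i j, ccvg (fun x => f x i j) (L i j).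

Lemma ccvg_cst c : ccvg (fun=> c) c.
Proof. by split; exact: cvg_cst. Qed.

Lemma ccvgD f g a b : ccvg f a -> ccvg g b -> ccvg (fun x => f x + g x) (a + b).
Proof.
move=> [f1 f2] [g1 g2]; split; rewrite ?ReD ?ImD.
  by under eq_fun do rewrite ReD; exact: cvgD.
by under eq_fun do rewrite ImD; exact: cvgD.
Qed.

Lemma ccvgN f a : ccvg f a -> ccvg (fun x => - f x) (- a).
Proof.
move=> [f1 f2]; split; rewrite ?ReN ?ImN.
  by under eq_fun do rewrite ReN; exact: cvgN.
by under eq_fun do rewrite ImN; exact: cvgN.
Qed.

Lemma ccvgM f g a b : ccvg f a -> ccvg g b -> ccvg (fun x => f x * g x) (a * b).
Proof.
move=> [f1 f2] [g1 g2]; split; rewrite ?ReM ?ImM.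
  by under eq_fun do rewrite ReM; apply: cvgB; apply: cvgM.
by under eq_fun do rewrite ImM; apply: cvgD; apply: cvgM.
Qed.

Lemma ccvgJ f a : ccvg f a -> ccvg (fun x => conjc (f x)) (conjc a).
Proof.
move=> [f1 f2]; split; rewrite ?ReJ ?ImJ.
  by under eq_fun do rewrite ReJ.
by under eq_fun do rewrite ImJ; exact: cvgN.
Qed.

Lemma ccvg_real (f : T -> R) (a : R) : f x @[x --> F] --> a -> ccvg (fun x => (f x)%:C) a%:C.
Proof. by move=> fa; split => //=; exact: cvg_cst. Qed.

Lemma ccvg_sum I (r : seq I) (P : pred I) (f : I -> T -> C) (a : I -> C) :
  (forall i, P i -> ccvg (f i) (a i)) ->
  ccvg (fun x => \sum_(i <- r | P i) f i x) (\sum_(i <- r | P i) a i).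
Proof.
move=> h; elim: r => [|i r IH].
  by under eq_fun do rewrite big_nil; rewrite big_nil; exact: ccvg_cst.
under eq_fun do rewrite big_cons; rewrite big_cons.
by case: ifP => Pi //; apply: ccvgD => //; exact: h.
Qed.

Lemma ccvg_prod I (r : seq I) (P : pred I) (f : I -> T -> C) (a : I -> C) :
  (forall i, P i -> ccvg (f i) (a i)) ->
  ccvg (fun x => \prod_(i <- r | P i) f i x) (\prod_(i <- r | P i) a i).
Proof.
move=> h; elim: r => [|i r IH].
  by under eq_fun do rewrite big_nil; rewrite big_nil; exact: ccvg_cst.
under eq_fun do rewrite big_cons; rewrite big_cons.
by case: ifP => Pi //; apply: ccvgM => //; exact: h.
Qed.

Lemma mcvg_cst m n (L : 'M[C]_(m, n)) : mcvg (fun=> L) L.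
Proof. by move=> i j; exact: ccvg_cst. Qed.

Lemma mcvgD m n (f g : T -> 'M[C]_(m, n)) a b :
  mcvg f a -> mcvg g b -> mcvg (fun x => f x + g x) (a + b).
Proof.
move=> fa gb i j; rewrite mxE; under eq_fun do rewrite mxE.
exact: ccvgD.
Qed.

Lemma mcvgN m n (f : T -> 'M[C]_(m, n)) a : mcvg f a -> mcvg (fun x => - f x) (- a).
Proof. by move=> fa i j; rewrite mxE; under eq_fun do rewrite mxE; exact: ccvgN. Qed.

Lemma mcvgB m n (f g : T -> 'M[C]_(m, n)) a b :
  mcvg f a -> mcvg g b -> mcvg (fun x => f x - g x) (a - b).
Proof. by move=> fa gb; apply: mcvgD => //; exact: mcvgN. Qed.

Lemma mcvgZ m n (c : T -> C) (f : T -> 'M[C]_(m, n)) k a :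
  ccvg c k -> mcvg f a -> mcvg (fun x => c x *: f x) (k *: a).
Proof. by move=> ck fa i j; rewrite mxE; under eq_fun do rewrite mxE; exact: ccvgM. Qed.

Lemma mcvg_mul m n p (f : T -> 'M[C]_(m, n)) (g : T -> 'M[C]_(n, p)) a b :
  mcvg f a -> mcvg g b -> mcvg (fun x => f x *m g x) (a *m b).
Proof.
move=> fa gb i j; rewrite mxE; under eq_fun do rewrite mxE.
by apply: ccvg_sum => k _; exact: ccvgM.
Qed.

Lemma mcvg_adj m n (f : T -> 'M[C]_(m, n)) a :
  mcvg f a -> mcvg (fun x => (f x)^H) a^H.
Proof.
move=> fa i j; rewrite adjE; under eq_fun do rewrite adjE.
exact: ccvgJ.
Qed.

Lemma ccvg_det n (f : T -> 'M[C]_n) a : mcvg f a -> ccvg (fun x => \det (f x)) (\det a).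
Proof.
move=> fa; rewrite /determinant; apply: ccvg_sum => s _; apply: ccvgM; first exact: ccvg_cst.
by apply: ccvg_prod.
Qed.

Lemma cvg_rinner m n (f g : T -> 'M[C]_(m, n)) a b :
  mcvg f a -> mcvg g b -> rinner (f x) (g x) @[x --> F] --> rinner a b.
Proof.
move=> fa gb; rewrite rinner_tr; under eq_fun do rewrite rinner_tr; apply: (proj1 (_ : ccvg (fun x => \tr (f x *m (g x)^H)) _)).
apply: ccvg_sum => i _; apply: mcvg_mul => //; exact: mcvg_adj.
Qed.

Lemma cvg_fnorm m n (f : T -> 'M[C]_(m, n)) a :
  mcvg f a -> fnorm (f x) @[x --> F] --> fnorm a.
Proof.
move=> fa; rewrite fnorm_def; under eq_fun do rewrite fnorm_def.
apply: (@continuous_cvg _ R R F FF (fun x => rinner (f x) (f x)) Num.sqrt).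
  exact: sqrt_continuous.
exact: cvg_rinner.
Qed.

Lemma mcvg_fnorm0 m n (f : T -> 'M[C]_(m, n)) a :
  fnorm (f x - a) @[x --> F] --> (0 : R) -> mcvg f a.
Proof.
move=> h i j.
have key (g : T -> R) (l : R) : (forall x, `|g x - l| <= fnorm (f x - a)) -> g x @[x --> F] --> l.
  by move=> gl; apply: rcvg_dom h; exact: filterE.
split; apply: key => x; have := entry_le_rinner (f x - a) i j;
  rewrite -fnorm_sqr !mxE => hx; rewrite -(@ler_pXn2r _ 2) ?nnegrE ?fnorm_ge0 //;
  rewrite real_normK ?num_real //; apply: le_trans hx.
  by rewrite ReB lerDl sqr_ge0.
by rewrite ImB lerDr sqr_ge0.
Qed.

Lemma mcvg_fnormP m n (f : T -> 'M[C]_(m, n)) a :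
  mcvg f a <-> fnorm (f x - a) @[x --> F] --> (0 : R).
Proof.
split; last exact: mcvg_fnorm0.
move=> fa; rewrite -(fnorm0 R m n) -(subrr a); apply: cvg_fnorm.
by apply: mcvgB => //; exact: mcvg_cst.
Qed.

Lemma mcvg_squeeze m n (f : T -> 'M[C]_(m, n)) a (e : T -> R) :
  (\forall x \near F, fnorm (f x - a) <= e x) -> e x @[x --> F] --> (0 : R) -> mcvg f a.
Proof.
move=> fe e0; apply: mcvg_fnorm0; apply: rcvg_dom e0.
by apply: filterS fe => x; rewrite /= subr0 ger0_norm ?fnorm_ge0.
Qed.

Lemma near_mcvg m n (f g : T -> 'M[C]_(m, n)) a :
  (\forall x \near F, f x = g x) -> mcvg f a -> mcvg g a.
Proof.
move=> fg /mcvg_fnormP fa; apply: (mcvg_squeeze (e := fun x => fnorm (f x - a))) => //.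
by apply: filterS fg => x ->.
Qed.

End Convergence.

Lemma rcvg_le (R : realType) (T : Type) (F : set_system T) (f g : T -> R) (a b : R) :
  ProperFilter F -> f x @[x --> F] --> a -> g x @[x --> F] --> b ->
  F [set x | f x <= g x] -> a <= b.
Proof.
move=> FF fa gb fg; rewrite leNgt; apply/negP => ba.
have e0 : 0 < (a - b) / 3 by rewrite divr_gt0 // subr_gt0.
have /rcvgP/(_ _ e0) h1 := fa; have /rcvgP/(_ _ e0) h2 := gb.
have [x [/= fgx []]] := filter_ex (filterI fg (filterI h1 h2)).
rewrite /= !ler_norml => /andP[A1 _] /andP[_ A2]; lra.
Qed.

Section ConvergenceProper.
Variable R : realType.
Notation C := R[i].
Variables (T : Type) (F : set_system T).
Context {FF : ProperFilter F}.

Lemma ccvg_unique (f : T -> C) a b : ccvg F f a -> ccvg F f b -> a = b.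
Proof.
move=> [f1 f2] [g1 g2]; apply: complexP.
  exact: (@cvg_unique _ (@norm_hausdorff _ R) _ _ _ _ f1 g1).
exact: (@cvg_unique _ (@norm_hausdorff _ R) _ _ _ _ f2 g2).
Qed.

Lemma mcvg_unique m n (f : T -> 'M[C]_(m, n)) a b : mcvg F f a -> mcvg F f b -> a = b.
Proof. by move=> fa fb; apply/matrixP => i j; exact: ccvg_unique. Qed.

Lemma mcvg_eq m n (f g : T -> 'M[C]_(m, n)) a b :
  (forall x, f x = g x) -> mcvg F f a -> mcvg F g b -> a = b.
Proof. by move=> fg fa gb; apply: (mcvg_unique (f := f)) => //; rewrite (funext fg). Qed.

End ConvergenceProper.

(** * Ultrafilters in place of convergent subsequences *)

Lemma ultra_fmap (T X : Type) (f : T -> X) (U : set_system T) :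
  UltraFilter U -> UltraFilter (f @ U).
Proof.
move=> UU; split; first exact: fmap_proper_filter.
move=> G GG fG; rewrite predeqE => A; split; last exact: fG.
move=> GA; have [//|nA] := in_ultra_setVsetC (f @^-1` A) UU.
have : G (~` A) by exact: fG.
by move=> GnA; have [x [+ +]] := filter_ex (filterI GA GnA).
Qed.

Section Ultra.
Variable R : realType.
Notation C := R[i].
Variables (T : Type) (U : set_system T).
Context {UU : UltraFilter U}.

(** The image ultrafilter contains a segment, which is compact. This is how limit points are
    obtained throughout. *)
Lemma ultra_cvg_bounded (f : T -> R) M :
  (\forall x \near U, `|f x| <= M) -> exists l : R, f x @[x --> U] --> l.
Proof.
move=> fM; have := @segment_compact R (- M) M; rewrite compact_ultra => /(_ (f @ U)).
case; first exact: ultra_fmap.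
  by apply: filterS fM => x; rewrite /= in_itv /= ler_norml.
by move=> l [_ fl]; exists l.
Qed.

Lemma ultra_mcvg_bounded m n (f : T -> 'M[C]_(m, n)) M :
  (\forall x \near U, fnorm (f x) <= M) -> exists L, mcvg U f L.
Proof.
move=> fM.
have key (g : T -> R) : (forall x, `|g x| <= fnorm (f x)) -> exists l : R, g x @[x --> U] --> l.
  move=> gl; apply: (@ultra_cvg_bounded _ M); apply: filterS fM => x hx.
  exact: le_trans (gl x) hx.
have kr i j : exists l : R, complex.Re (f x i j) @[x --> U] --> l.
  apply: key => x; have := entry_le_rinner (f x) i j; rewrite -fnorm_sqr => hx.
  rewrite -(@ler_pXn2r _ 2) ?nnegrE ?fnorm_ge0 // real_normK ?num_real //.
  by apply: le_trans hx; rewrite lerDl sqr_ge0.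
have ki i j : exists l : R, complex.Im (f x i j) @[x --> U] --> l.
  apply: key => x; have := entry_le_rinner (f x) i j; rewrite -fnorm_sqr => hx.
  rewrite -(@ler_pXn2r _ 2) ?nnegrE ?fnorm_ge0 // real_normK ?num_real //.
  by apply: le_trans hx; rewrite lerDr sqr_ge0.
exists (\matrix_(i, j) Complex (projT1 (cid (kr i j))) (projT1 (cid (ki i j)))).
by move=> i j; rewrite mxE; split => /=; [case: cid|case: cid].
Qed.

End Ultra.

Section CvgUltra.

(** Were a neighbourhood of [l] missed along [F], then [F] together with the complement of its
    preimage would extend to an ultrafilter contradicting the hypothesis. A limit thus has to be
    identified only along ultrafilters, where bounded auxiliary sequences converge as well. *)
Lemma cvg_ultraP (T : Type) (X : topologicalType) (F : set_system T) (f : T -> X) (l : X) :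
  Filter F -> (forall U : set_system T, UltraFilter U -> F `<=` U -> f @ U --> l) ->
  f @ F --> l.
Proof.
move=> FF h A Al; apply: contrapT => nA.
pose G := filter_from F (fun B => B `\` (f @^-1` A)).
have GF : ProperFilter G.
  apply: filter_from_proper; last first.
    move=> B FB; apply: contrapT => B0; apply: nA.
    suff : F (f @^-1` A) by [].
    by apply: filterS FB => x Bx; apply: contrapT => nx; apply: B0; exists x.
  apply: filter_from_filter; first by exists setT; exact: filterT.
  move=> B D FB FD; exists (B `&` D); first exact: filterI.
  by move=> x [[Bx Dx] nx].
have [U [UU GU]] := ultraFilterLemma GF.
have FU : F `<=` U by move=> B FB; apply: GU; exists B => // x [].
have UA : U (f @^-1` A) := h U UU FU A Al.
have UnA : U (~` (f @^-1` A)).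
  by apply: GU; exists setT; [exact: filterT | move=> x []].
by have [x []] := filter_ex (filterI UA UnA).
Qed.

Lemma mcvg_comp (R : realType) (S T : Type) (F : set_system S) (G : set_system T)
    (h : S -> T) m n (f : T -> 'M[R[i]]_(m, n)) L :
  h @ F --> G -> mcvg G f L -> mcvg F (fun x => f (h x)) L.
Proof.
move=> hFG fL i j; have [f1 f2] := fL i j.
by split; [exact: cvg_comp hFG f1|exact: cvg_comp hFG f2].
Qed.

Lemma mcvg_sub (R : realType) (T : Type) (F U : set_system T)
    m n (f : T -> 'M[R[i]]_(m, n)) L : F `<=` U -> mcvg F f L -> mcvg U f L.
Proof. by move=> FU; apply: (mcvg_comp (h := id)) => A; exact: FU. Qed.

End CvgUltra.

(** * The Frobenius norm and the topology of square matrices *)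

Section Bridge.
Variable R : realType.
Notation C := R[i].

Lemma mx_nbhsP n (x : 'M[C]_n) (A : set 'M[C]_n) :
  nbhs x A <-> exists2 e : R, 0 < e & forall y : 'M[C]_n, fnorm (y - x) < e -> A y.
Proof.
have ballE (y z : 'M[C]_n) (e : C) :
  ball y e z = (0 < e /\ forall i j, `|y i j - z i j| < e) by [].
split.
  move=> /nbhs_ballP[e /= e0 eA].
  have ee : e = (complex.Re e)%:C.
    by move: e0; rewrite ltcE /= => /andP[/eqP h _]; case: e h {eA} => a b /= ->.
  exists (complex.Re e); first by move: e0; rewrite ltcE => /andP[].
  move=> y Hy; apply: eA; rewrite ballE; split => // i j.
  rewrite ee normc_def ltcR; apply: le_lt_trans Hy.
  rewrite -fnormN opprB fnorm_def; apply: ler_wsqrtr.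
  by have := entry_le_rinner (x - y) i j; rewrite !mxE.
move=> [e e0 eA]; apply/nbhs_ballP.
(* The Frobenius norm is at most the sum of the n² moduli of the entries; the successor makes the
   estimate strict and covers n = 0. *)
exists (e / (n ^ 2).+1%:R)%:C => /=; first by rewrite ltcR divr_gt0.
move=> y; rewrite ballE => -[_ h]; apply: eA.
rewrite -fnormN opprB.
have : fnorm (x - y) <= \sum_(i < n) \sum_(j < n) (e / (n ^ 2).+1%:R).
  rewrite [X in fnorm X]matrix_sum_delta.
  apply: le_trans (fnorm_sum _ _ _) _; apply: ler_sum => i _.
  apply: le_trans (fnorm_sum _ _ _) _; apply: ler_sum => j _.
  have := h i j; rewrite normc_def ltcR => /ltW; apply: le_trans.
  rewrite fnorm_def; apply: ler_wsqrtr; rewrite rinnerE (bigD1 i) //= (bigD1 j) //=.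
  rewrite big1 => [|k kj]; last first.
    by rewrite !mxE (negPf kj) andbF mulr0 /= mulr0 addr0.
  rewrite big1 => [|k ki]; last first.
    by apply: big1 => l _; rewrite !mxE (negPf ki) /= mulr0 /= mulr0 addr0.
  by rewrite !mxE !eqxx mulr1 !addr0 -!expr2.
move=> /le_lt_trans; apply; rewrite !sumr_const card_ord -mulrnA mulnn.
rewrite -[X in X < _]mulr_natr mulrAC ltr_pdivrMr // ltr_pM2l // ltr_nat.
by [].
Qed.

Lemma mcvgE (T : Type) (F : set_system T) n (f : T -> 'M[C]_n) L : Filter F ->
  (f x @[x --> F] --> L) <-> mcvg F f L.
Proof.
move=> FF; split.
  move=> fL; apply: mcvg_fnorm0; apply/rcvgP => e e0.
  have : nbhs L [set y | fnorm (y - L) < e] by apply/mx_nbhsP; exists e.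
  move=> /fL fe; have {fe} : F [set x | fnorm (f x - L) < e] by [].
  by apply: filterS => x /=; rewrite subr0 ger0_norm ?fnorm_ge0 // => /ltW.
move=> /mcvg_fnormP/rcvgP fL A /mx_nbhsP[e e0 eA].
suff : F [set x | A (f x)] by [].
have := fL (e / 2) (divr_gt0 e0 (ltr0Sn _ 1)); apply: filterS => x /=.
rewrite subr0 ger0_norm ?fnorm_ge0 // => hx; apply: eA; apply: le_lt_trans hx _; lra.
Qed.

Lemma closureP n (A : set 'M[C]_n) (x : 'M[C]_n) :
  closure A x <-> forall e : R, 0 < e -> exists2 y, A y & fnorm (y - x) < e.
Proof.
split.
  move=> clx e e0; have [|y [Ay ye]] := clx [set y | fnorm (y - x) < e].
    by apply/mx_nbhsP; exists e.
  by exists y.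
move=> h B /mx_nbhsP[e e0 eB]; have [y Ay ye] := h e e0.
by exists y; split => //; exact: eB.
Qed.

End Bridge.

(** * The matrix exponential *)

HB.lock Definition mexp (R : realType) n (A : 'M[R[i]]_n) : 'M[R[i]]_n := expmx A.

Section Expmx.
Variable R : realType.
Notation C := R[i].
Notation Re := (@complex.Re R).
Notation Im := (@complex.Im R).

Definition expseq n (A : 'M[C]_n) : nat -> 'M[C]_n :=
  series (fun k : nat => (k`!%:R)^-1 *: A ^+ k).

Lemma natr_complex (k : nat) : k%:R = (k%:R : R)%:C :> C.
Proof. by rewrite rmorph_nat. Qed.

Lemma invr_complex (a : R) : (a%:C)^-1 = (a^-1)%:C :> C.
Proof. by rewrite fmorphV. Qed.

(** The factor accounts for the exponent 0: the Frobenius norm of the identity is √n. *)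
Lemma fnorm_exp_le n (A : 'M[C]_n) k :
  fnorm (A ^+ k) <= fnorm (1%:M : 'M[C]_n) * fnorm A ^+ k.
Proof.
elim: k => [|k IH]; first by rewrite !expr0 mulr1.
rewrite !exprS; apply: le_trans (fnorm_mul _ _) _.
by rewrite mulrCA ler_wpM2l // fnorm_ge0.
Qed.

Lemma exp_term_le n (A : 'M[C]_n) k :
  fnorm ((k`!%:R)^-1 *: A ^+ k) <=
  fnorm (1%:M : 'M[C]_n) * exp_coeff (fnorm A) k.
Proof.
rewrite natr_complex invr_complex fnormZ ger0_norm ?invr_ge0 // /exp_coeff /=.
by rewrite mulrA [X in _ <= X]mulrC ler_wpM2l ?invr_ge0 // fnorm_exp_le.
Qed.

Lemma expmx_exists n (A : 'M[C]_n) : exists L, mcvg \oo (expseq A) L.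
Proof.
pose c := fnorm (1%:M : 'M[C]_n).
have key (u : nat -> R) : (forall k, `|u k| <= c * exp_coeff (fnorm A) k) ->
    exists l : R, series u x @[x --> \oo] --> l.
  move=> uc; apply/cvg_ex; apply: normed_cvg.
  have e0 k : 0 <= c * exp_coeff (fnorm A) k.
    by rewrite mulr_ge0 ?exp_coeff_ge0 ?fnorm_ge0.
  have ce : cvgn (series (fun k => c * exp_coeff (fnorm A) k)).
    exact: (is_cvg_seriesZ (is_cvg_series_exp_coeff (fnorm A))).
  exact: (series_le_cvg (fun k => normr_ge0 (u k)) e0 uc ce).
have ent k i j : `|Re (((k`!%:R)^-1 *: A ^+ k) i j)| <= c * exp_coeff (fnorm A) k /\
    `|Im (((k`!%:R)^-1 *: A ^+ k) i j)| <= c * exp_coeff (fnorm A) k.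
  have h := exp_term_le A k; have h2 := entry_le_rinner ((k`!%:R)^-1 *: A ^+ k) i j.
  by split; apply: le_trans h; rewrite -(@ler_pXn2r _ 2) ?nnegrE ?fnorm_ge0 //
    real_normK ?num_real // fnorm_sqr; apply: le_trans h2; rewrite (lerDl, lerDr) sqr_ge0.
have kr i j := key _ (fun k => (ent k i j).1).
have ki i j := key _ (fun k => (ent k i j).2).
exists (\matrix_(i, j) Complex (projT1 (cid (kr i j))) (projT1 (cid (ki i j)))).
move=> i j; rewrite mxE; split => /=; case: cid => l /=.
  by apply: cvg_trans; apply: near_eq_cvg; apply: nearW => x;
    rewrite /expseq /series /= summxE Re_sum.
by apply: cvg_trans; apply: near_eq_cvg; apply: nearW => x;
  rewrite /expseq /series /= summxE Im_sum.
Qed.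

Lemma mexpE n (A : 'M[C]_n) : expmx A = mexp A.
Proof. by rewrite mexp.unlock. Qed.

Lemma expmx_unique n (A : 'M[C]_n) L : mcvg \oo (expseq A) L -> mexp A = L.
Proof.
move=> AL; rewrite -mexpE; apply: (@mcvg_unique _ _ \oo _ _ _ (expseq A)) => //; apply/mcvgE.
have : exists l : 'M[C]_n, expseq A x @[x --> \oo] --> l by exists L; apply/mcvgE.
by move=> /getPex.
Qed.

Lemma expmx_cvg n (A : 'M[C]_n) : mcvg \oo (expseq A) (mexp A).
Proof. by have [L AL] := expmx_exists A; rewrite (expmx_unique AL). Qed.

(** The difference is the tail of the series from degree 2 on; since ‖A‖ ≤ 1 a factor ‖A‖² splits
    off and the series for e remains. *)
Lemma expmx_linear_approx n (A : 'M[C]_n) : fnorm A <= 1 ->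
  fnorm (mexp A - 1%:M - A) <= fnorm (1%:M : 'M[C]_n) * expR 1 * fnorm A ^+ 2.
Proof.
move=> A1; set c := fnorm (1%:M : 'M[C]_n).
have c0 : 0 <= c by exact: fnorm_ge0.
have h : fnorm (expseq A m.+2 - 1%:M - A) @[m --> \oo] --> fnorm (mexp A - 1%:M - A).
  apply: cvg_fnorm; apply: mcvgB; last exact: mcvg_cst.
  apply: mcvgB; last exact: mcvg_cst.
  apply: (mcvg_comp (h := fun m : nat => m.+2) _ (expmx_cvg A)).
  by have := @cvg_addnl 2.
apply: (rcvg_le _ h (cvg_cst _)); apply: filterE => m /=.
have -> : expseq A m.+2 - 1%:M - A = \sum_(2 <= k < m.+2) (k`!%:R)^-1 *: A ^+ k.
  rewrite /expseq /series /= big_ltn // big_ltn // fact0 invr1 !scale1r expr0 expr1.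
  by rewrite [X in X - _ - _]addrC addrK [X in X - _]addrC addrK.
apply: le_trans (fnorm_sum _ _ _) _.
have : \sum_(2 <= k < m.+2) fnorm ((k`!%:R)^-1 *: A ^+ k) <=
   \sum_(2 <= k < m.+2) (c * fnorm A ^+ 2) * exp_coeff 1 k.
  rewrite big_nat_cond [leRHS]big_nat_cond; apply: ler_sum => k /andP[/andP[k2 _] _].
  apply: le_trans (exp_term_le A k) _; rewrite -/c -mulrA ler_wpM2l // /exp_coeff /= expr1n.
  rewrite mulrA mulr1 ler_wpM2r ?invr_ge0 //.
  by rewrite -(subnKC k2) exprD ler_piMr ?exprn_ge0 ?fnorm_ge0 // exprn_ile1 ?fnorm_ge0.
move=> /le_trans; apply; rewrite -mulr_sumr mulrAC ler_wpM2r ?exprn_ge0 ?fnorm_ge0 // ler_wpM2l //.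
rewrite /expR; have nd : nondecreasing_seq (series (exp_coeff (1 : R))).
  by apply/nondecreasing_seqP => k; rewrite /series /= big_nat_recr //= lerDl exp_coeff_ge0.
apply: le_trans (nondecreasing_cvgn_le nd (@is_cvg_series_exp_coeff R 1) m.+2).
rewrite /series /= [leRHS](@big_cat_nat _ _ _ 2) //= lerDr.
by apply: sumr_ge0 => k _; exact: exp_coeff_ge0.
Qed.

Lemma expmx_conj n (P Q A : 'M[C]_n) : Q *m P = 1%:M ->
  mexp (P *m A *m Q) = P *m mexp A *m Q.
Proof.
move=> QP; apply: expmx_unique.
have -> : expseq (P *m A *m Q) = fun k => P *m expseq A k *m Q.
  apply/funext => k; rewrite /expseq /series /= mulmx_sumr mulmx_suml; apply: eq_bigr => j _.
  rewrite -scalemxAr -scalemxAl; congr (_ *: _); elim: j => [|j IH].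
    by rewrite !expr0 mulmx1 (mulmx1C QP).
  rewrite !exprS IH /GRing.mul /= !mulmxA.
  by rewrite -!mulmxA (mulmxA Q) QP mul1mx.
by apply: mcvg_mul; [apply: mcvg_mul; [exact: mcvg_cst|exact: expmx_cvg]|exact: mcvg_cst].
Qed.

(** A relation rather than a function: the scalar exponential is met only at real and at purely
    imaginary arguments, where [expR], [cos] and [sin] give its value. *)
Definition is_cexp (z e : C) : Prop := ccvg \oo (series (fun k => (k`!%:R)^-1 * z ^+ k)) e.

Lemma expmx_diag n (d e : 'rV[C]_n) : (forall j, is_cexp (d 0 j) (e 0 j)) ->
  mexp (diag_mx d) = diag_mx e.
Proof.
move=> de; apply: expmx_unique => i j.
have -> : (fun x => expseq (diag_mx d) x i j) =
    fun x => series (fun k => (k`!%:R)^-1 * d 0 i ^+ k) x *+ (i == j).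
  apply/funext => x; rewrite /expseq /series /= summxE -sumrMnl; apply: eq_bigr => k _.
  have -> : diag_mx d ^+ k = diag_mx (\row_l d 0 l ^+ k).
    elim: k => [|k IH].
      by rewrite expr0; apply/matrixP => a b; rewrite !mxE expr0.
    rewrite exprS IH /GRing.mul /= mulmx_diag; congr diag_mx.
    by apply/rowP => l; rewrite !mxE exprS.
  by rewrite !mxE mulrnAr.
rewrite mxE; have [_|_] := eqVneq i j; first exact: de.
by rewrite mulr0n; under eq_fun do rewrite mulr0n; exact: ccvg_cst.
Qed.

Lemma is_cexp_real (y : R) : is_cexp y%:C (expR y)%:C.
Proof.
rewrite /is_cexp; have -> : series (fun k => (k`!%:R)^-1 * y%:C ^+ k) =
   fun x => (series (exp_coeff y) x)%:C.
  apply/funext => x; rewrite /series /= rmorph_sum; apply: eq_bigr => k _.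
  by rewrite natr_complex invr_complex -rmorphXn -rmorphM mulrC.
by apply: ccvg_real; exact: is_cvg_series_exp_coeff.
Qed.

Lemma exp_imaginary (y : R) k : (Complex 0 y) ^+ k =
  Complex ((~~ odd k)%:R * (-1) ^+ k./2 * y ^+ k) ((odd k)%:R * (-1) ^+ k.-1./2 * y ^+ k).
Proof.
have -> : Complex 0 y = 'i * y%:C by apply: complexP => /=; ring.
rewrite exprMn -rmorphXn -[in 'i ^+ k](odd_double_half k).
have i2 m : 'i ^+ m.*2 = ((-1) ^+ m)%:C :> C.
  rewrite -mul2n exprM (sqr_i R) rmorphXn rmorphN rmorph1; done.
rewrite exprD i2; have [ok|ek] := boolP (odd k).
  have -> : k.-1./2 = k./2 by rewrite -[in LHS](odd_double_half k) ok /= doubleK.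
  by rewrite expr1; apply: complexP => /=; ring.
by rewrite expr0; apply: complexP => /=; ring.
Qed.

Lemma is_cexp_imaginary (y : R) : is_cexp (Complex 0 y) (Complex (cos y) (sin y)).
Proof.
have term k : (k`!%:R)^-1 * (Complex 0 y) ^+ k = Complex (cos_coeff y k) (sin_coeff y k).
  rewrite exp_imaginary natr_complex invr_complex /cos_coeff /sin_coeff /=.
  by apply: complexP; rewrite (ReZ, ImZ) /= mulrC.
split => /=.
  have -> : (fun x => Re (series (fun k => (k`!%:R)^-1 * (Complex 0 y) ^+ k) x)) = series (cos_coeff y).
    by apply/funext => x; rewrite /series /= Re_sum; apply: eq_bigr => k _; rewrite term.
  have -> : cos y = limn (series (cos_coeff y)) by rewrite unlock.
  exact: is_cvg_series_cos_coeff.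
have -> : (fun x => Im (series (fun k => (k`!%:R)^-1 * (Complex 0 y) ^+ k) x)) = series (sin_coeff y).
  by apply/funext => x; rewrite /series /= Im_sum; apply: eq_bigr => k _; rewrite term.
have -> : sin y = limn (series (sin_coeff y)) by rewrite unlock.
exact: is_cvg_series_sin_coeff.
Qed.

End Expmx.

(** * Unitary matrices *)

Section Unitary.
Variable R : realType.
Notation C := R[i].

Lemma unitary_adjK n (U : 'M[C]_n) : is_unitary U -> U^H *m U = 1%:M.
Proof. by []. Qed.

Lemma unitary_mul_adj n (U : 'M[C]_n) : is_unitary U -> U *m U^H = 1%:M.
Proof. exact: mulmx1C. Qed.

Lemma unitary_adj n (U : 'M[C]_n) : is_unitary U -> is_unitary U^H.
Proof. by move=> /unitary_mul_adj; rewrite /is_unitary adjK. Qed.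

Lemma unitarymx1 n : is_unitary (1%:M : 'M[C]_n).
Proof. by rewrite /is_unitary adj1 mulmx1. Qed.

Lemma unitary_mul n (U V : 'M[C]_n) : is_unitary U -> is_unitary V -> is_unitary (U *m V).
Proof.
by move=> UU VV; rewrite /is_unitary adjM mulmxA -(mulmxA V^H) UU mulmx1 VV.
Qed.

Lemma cmulmx1_unit n (A B : 'M[C]_n) : A *m B = 1%:M -> A \in unitmx.
Proof. by move=> /mulmx1_unit[]. Qed.

Lemma cmulmx1_invmx n (A B : 'M[C]_n) : A *m B = 1%:M -> invmx A = B.
Proof.
move=> AB; have uA := cmulmx1_unit AB.
by apply: (can_inj (mulKmx uA)); rewrite mulmxV // AB.
Qed.

Lemma unitary_unit n (U : 'M[C]_n) : is_unitary U -> U \in unitmx.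
Proof. by move=> /mulmx1_unit[]. Qed.

Lemma unitary_inv n (U : 'M[C]_n) : is_unitary U -> invmx U = U^H.
Proof.
by move=> UU; rewrite -[LHS]mul1mx -UU mulmxK // unitary_unit.
Qed.

Lemma rinner_unitaryl n p (U : 'M[C]_n) (X Y : 'M[C]_(n, p)) : is_unitary U ->
  rinner (U *m X) (U *m Y) = rinner X Y.
Proof. by move=> UU; rewrite rinner_mull mulmxA UU mul1mx. Qed.

Lemma rinner_unitaryr n p (U : 'M[C]_n) (X Y : 'M[C]_(p, n)) : is_unitary U ->
  rinner (X *m U) (Y *m U) = rinner X Y.
Proof. by move=> /unitary_mul_adj UU; rewrite rinner_mulr -mulmxA UU mulmx1. Qed.

Lemma fnorm_unitaryl n p (U : 'M[C]_n) (X : 'M[C]_(n, p)) : is_unitary U ->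
  fnorm (U *m X) = fnorm X.
Proof. by move=> UU; rewrite !fnorm_def rinner_unitaryl. Qed.

Lemma fnorm_unitaryr n p (U : 'M[C]_n) (X : 'M[C]_(p, n)) : is_unitary U ->
  fnorm (X *m U) = fnorm X.
Proof. by move=> UU; rewrite !fnorm_def rinner_unitaryr. Qed.

Lemma fnorm_conj n (U X : 'M[C]_n) : is_unitary U ->
  fnorm (U *m X *m U^H) = fnorm X.
Proof. by move=> UU; rewrite fnorm_unitaryr ?fnorm_unitaryl //; exact: unitary_adj. Qed.

Lemma fnorm_unitary n (U : 'M[C]_n) : is_unitary U -> fnorm U = fnorm (1%:M : 'M[C]_n).
Proof. by move=> UU; rewrite -[U]mulmx1 fnorm_unitaryl. Qed.

Lemma mxexprS n (A : 'M[C]_n) m : A ^+ m.+1 = A *m A ^+ m.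
Proof. by rewrite exprS. Qed.

Lemma unitarymx_exp n (U : 'M[C]_n) m : is_unitary U -> is_unitary (U ^+ m).
Proof.
move=> UU; elim: m => [|m IH]; first by rewrite expr0; exact: unitarymx1.
by rewrite mxexprS; exact: unitary_mul.
Qed.

(** Telescoping; each of the m terms keeps the norm of A - B because unitary factors preserve it. *)
Lemma fnorm_exp_diff n (A B : 'M[C]_n) m : is_unitary A -> is_unitary B ->
  fnorm (A ^+ m - B ^+ m) <= m%:R * fnorm (A - B).
Proof.
move=> AU BU; elim: m => [|m IH]; first by rewrite !expr0 subrr fnorm0 mul0r.
have -> : A ^+ m.+1 - B ^+ m.+1 = (A *m (A ^+ m - B ^+ m)) + (A - B) *m B ^+ m.
  by rewrite mulmxBr mulmxBl !mxexprS addrA subrK.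
apply: le_trans (fnormD _ _) _; rewrite fnorm_unitaryl // (fnorm_unitaryr _ (unitarymx_exp m BU)).
by rewrite -natr1 mulrDl mul1r lerD2r.
Qed.

Lemma unitarymx_closed n (T : Type) (F : set_system T) (f : T -> 'M[C]_n) L :
  ProperFilter F -> F [set x | is_unitary (f x)] -> mcvg F f L -> is_unitary L.
Proof.
move=> FF fU fL.
apply: (@mcvg_unique _ _ F _ _ _ (fun x => (f x)^H *m f x)).
  exact: (mcvg_mul (mcvg_adj fL) fL).
apply: (near_mcvg (f := fun=> 1%:M)); last exact: mcvg_cst.
by apply: filterS fU => x ->.
Qed.

Lemma expmx_comm n (X A : 'M[C]_n) : X *m A = A *m X -> X *m mexp A = mexp A *m X.
Proof.
move=> XA; apply: (@mcvg_unique _ _ \oo _ _ _ (fun k => X *m expseq A k)).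
  by apply: mcvg_mul; [exact: mcvg_cst|exact: expmx_cvg].
have -> : (fun k => X *m expseq A k) = fun k => expseq A k *m X.
  apply/funext => k; rewrite /expseq /series /= mulmx_sumr mulmx_suml; apply: eq_bigr => j _.
  rewrite -scalemxAr -scalemxAl; congr (_ *: _); elim: j => [|j IH].
    by rewrite !expr0 mulmx1 mul1mx.
  by rewrite mxexprS mulmxA XA -!mulmxA IH.
by apply: mcvg_mul; [exact: expmx_cvg|exact: mcvg_cst].
Qed.

Lemma expmx0 n : mexp (0 : 'M[C]_n) = 1%:M.
Proof.
apply/eqP; rewrite -subr_eq0; apply/eqP/fnorm_eq0/le_anti; rewrite fnorm_ge0 andbT.
have := @expmx_linear_approx _ _ (0 : 'M[C]_n).
by rewrite fnorm0 subr0 expr0n mulr0; apply.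
Qed.

End Unitary.

(** * Functional calculus of Hermitian matrices *)

Section FunctionalCalculus.
Variable R : realType.
Notation C := R[i].

(** The value of [f] at the Hermitian matrix U diag(y) U†. The eigenframe stays explicit, so that
    several functions of one matrix are compared eigenvalue by eigenvalue. *)
Definition ufun n (U : 'M[C]_n) (f : R -> C) (y : 'rV[R]_n) : 'M[C]_n :=
  U *m diag_mx (\row_j f (y 0 j)) *m U^H.

Definition dgr n (y : 'rV[R]_n) : 'M[C]_n := diag_mx (map_mx (real_complex R) y).

Lemma ufun_id n (U : 'M[C]_n) (y : 'rV[R]_n) : ufun U (real_complex R) y = U *m dgr y *m U^H.
Proof. by congr (_ *m diag_mx _ *m _); apply/rowP => j; rewrite !mxE. Qed.

Lemma ufunM n (U : 'M[C]_n) f g (y : 'rV[R]_n) : is_unitary U ->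
  ufun U f y *m ufun U g y = ufun U (fun x => f x * g x) y.
Proof.
move=> UU; rewrite /ufun !mulmxA -(mulmxA (U *m _)) (unitary_adjK UU) mulmx1.
rewrite -(mulmxA U) mulmx_diag; congr (_ *m diag_mx _ *m _).
by apply/rowP => j; rewrite !mxE.
Qed.

Lemma ufun_adj n (U : 'M[C]_n) f (y : 'rV[R]_n) : (ufun U f y)^H = ufun U (fun x => conjc (f x)) y.
Proof.
rewrite /ufun adjM adjM adjK mulmxA; congr (_ *m _ *m _).
apply/matrixP => i j; rewrite adjE !mxE eq_sym.
by case: eqVneq => [->|_]; rewrite ?mulr1n ?mulr0n ?rmorph0.
Qed.

Lemma ufun_eq n (U : 'M[C]_n) f g (y : 'rV[R]_n) : (forall j, f (y 0 j) = g (y 0 j)) -> ufun U f y = ufun U g y.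
Proof.
by move=> fg; congr (_ *m diag_mx _ *m _); apply/rowP => j; rewrite !mxE fg.
Qed.

Lemma ufun1 n (U : 'M[C]_n) (y : 'rV[R]_n) : is_unitary U -> ufun U (fun=> 1) y = 1%:M.
Proof.
move=> UU; rewrite /ufun (_ : diag_mx _ = 1%:M) ?mulmx1 ?(unitary_mul_adj UU) //.
by apply/matrixP => i j; rewrite !mxE.
Qed.

Lemma ufunZ n (U : 'M[C]_n) (c : C) f y : c *: ufun U f y = ufun U (fun x => c * f x) y.
Proof.
rewrite /ufun scalemxAl scalemxAr; congr (_ *m _ *m _).
by apply/matrixP => i j; rewrite !mxE mulrnAr.
Qed.

Lemma ufun_comp n (U : 'M[C]_n) (h : R -> R) f y :
  ufun U f (map_mx h y) = ufun U (fun x => f (h x)) y.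
Proof. by congr (_ *m diag_mx _ *m _); apply/rowP => j; rewrite !mxE. Qed.

Lemma det_ufun n (U : 'M[C]_n) f (y : 'rV[R]_n) : is_unitary U ->
  \det (ufun U f y) = \prod_j f (y 0 j).
Proof.
move=> UU; rewrite /ufun !det_mulmx det_diag mulrAC -det_mulmx (unitary_mul_adj UU) det1 mul1r.
by apply: eq_bigr => j _; rewrite mxE.
Qed.

Lemma expmx_ufun n (U : 'M[C]_n) f e (y : 'rV[R]_n) : is_unitary U -> (forall x, is_cexp (f x) (e x)) ->
  mexp (ufun U f y) = ufun U e y.
Proof.
move=> UU fe; rewrite /ufun expmx_conj //; congr (_ *m _ *m _).
by apply: expmx_diag => j; rewrite !mxE.
Qed.

Lemma expmx_real n (U : 'M[C]_n) (y : 'rV[R]_n) (a : R) : is_unitary U ->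
  mexp (a%:C *: (U *m dgr y *m U^H)) = ufun U (fun x => (expR (a * x))%:C) y.
Proof.
move=> UU; rewrite -ufun_id ufunZ; apply: expmx_ufun => // x.
by rewrite -rmorphM; exact: is_cexp_real.
Qed.

Lemma expmx_imaginary n (U : 'M[C]_n) (y : 'rV[R]_n) (a : R) : is_unitary U ->
  mexp (Complex 0 a *: (U *m dgr y *m U^H)) =
  ufun U (fun x => Complex (cos (a * x)) (sin (a * x))) y.
Proof.
move=> UU; rewrite -ufun_id ufunZ; apply: expmx_ufun => // x.
have -> : Complex 0 a * x%:C = Complex 0 (a * x) by apply: complexP => /=; ring.
exact: is_cexp_imaginary.
Qed.

Lemma herm_spectral n (H : 'M[C]_n) : H^H = H ->
  exists U : 'M[C]_n, exists y : 'rV[R]_n, is_unitary U /\ H = U *m dgr y *m U^H.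
Proof.
move=> HH; have Hh : H \is hermsymmx by apply/is_hermitianmxP; rewrite expr0 scale1r adj_trmxC HH.
have /orthomx_spectralP E := hermitian_normalmx Hh.
have /mxOverP dr := hermitian_spectral_diag_real Hh.
pose V := (spectralmx H)^H; exists V; exists (map_mx (@complex.Re R) (spectral_diag H)).
have /unitarymxE PU := spectral_unitarymx H; split; first exact: unitary_adj.
rewrite [LHS]E unitary_inv // /V adjK; congr (_ *m diag_mx _ *m _).
by apply/rowP => j; rewrite !mxE; have := dr 0 j; move/RRe_real.
Qed.

Lemma herm_dgr n (U : 'M[C]_n) (y : 'rV[R]_n) : (U *m dgr y *m U^H)^H = U *m dgr y *m U^H.
Proof. by rewrite -ufun_id ufun_adj; apply: ufun_eq => j; rewrite conj_real. Qed.

Section OneHermitian.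
Variables (n : nat) (H : 'M[C]_n).
Hypothesis HH : H^H = H.

Lemma expmx_hermD (a b : R) :
  mexp ((a + b)%:C *: H) = mexp (a%:C *: H) *m mexp (b%:C *: H).
Proof.
have [U [y [UU ->]]] := herm_spectral HH; rewrite !expmx_real // ufunM //.
by apply: ufun_eq => j; rewrite -rmorphM -expRD mulrDl.
Qed.

Lemma expmx_hermNK (a : R) : mexp (a%:C *: H) *m mexp ((- a)%:C *: H) = 1%:M.
Proof. by rewrite -expmx_hermD subrr scale0r expmx0. Qed.

Lemma expmx_herm_unit (a : R) : mexp (a%:C *: H) \in unitmx.
Proof. exact: cmulmx1_unit (expmx_hermNK a). Qed.

Lemma expmx_hermV (a : R) : invmx (mexp (a%:C *: H)) = mexp ((- a)%:C *: H).
Proof. exact: cmulmx1_invmx (expmx_hermNK a). Qed.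

Lemma expmx_herm (a : R) : (mexp (a%:C *: H))^H = mexp (a%:C *: H).
Proof.
have [U [y [UU ->]]] := herm_spectral HH; rewrite expmx_real // ufun_adj.
by apply: ufun_eq => j; rewrite conj_real.
Qed.

Lemma expmx_herm_unitary (a : R) : is_unitary (mexp (Complex 0 a *: H)).
Proof.
have [U [y [UU ->]]] := herm_spectral HH; rewrite expmx_imaginary //.
rewrite /is_unitary ufun_adj ufunM // -[RHS](ufun1 y UU).
apply: ufun_eq => j; apply: complexP => /=; last by ring.
by have := cos2Dsin2 (a * y 0 j); rewrite !expr2 mulNr opprK.
Qed.

Lemma expmx_herm_posdef (a : R) : @posdef R n (mexp (a%:C *: H)).
Proof.
split; first by apply/is_hermitianmxP; rewrite expr0 scale1r adj_trmxC expmx_herm.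
move=> u u0; rewrite adj_trmxC; set b := a / 2.
have -> : a = b + b by rewrite /b; lra.
rewrite expmx_hermD -{1}(expmx_herm b); set E := mexp _.
have E0 : E *m u != 0.
  apply: contra u0 => /eqP Eu; rewrite -[u]mul1mx -(mulVmx (expmx_herm_unit b)) -/E.
  by rewrite -mulmxA Eu mulmx0.
rewrite !mulmxA -adjM -mulmxA.
have -> : ((E *m u)^H *m (E *m u)) 0 0 = (rinner (E *m u) (E *m u))%:C.
  apply: complexP => /=.
    by rewrite -rinner_adj rinner_tr adjK trace_mx11.
  rewrite mxE Im_sum big1 // => k _; rewrite adjE ImM ReJ ImJ; ring.
rewrite ltcR lt_def rinner_ge0 andbT; apply: contra E0 => /eqP/rinner_eq0 ->; exact: eqxx.
Qed.

End OneHermitian.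

Lemma posdef_log n (x : 'M[C]_n) : @posdef R n x ->
  exists2 H : 'M[C]_n, H^H = H & x = mexp H.
Proof.
move=> [/is_hermitianmxP]; rewrite expr0 scale1r adj_trmxC => /esym xH xp.
have [U [y [UU E]]] := herm_spectral xH.
have y0 j : 0 < y 0 j.
  have := xp (U *m delta_mx j 0); rewrite adj_trmxC.
  have -> : U *m delta_mx j 0 != 0 :> 'cV_n.
    apply/eqP => /(congr1 (mulmx U^H)); rewrite mulmxA (unitary_adjK UU) mul1mx mulmx0.
    by move=> /matrixP/(_ j 0); rewrite !mxE !eqxx => /eqP; rewrite oner_eq0.
  move=> /(_ isT); rewrite E adjM -!mulmxA (mulmxA (U^H) U) (unitary_adjK UU) mul1mx.
  rewrite (mulmxA (U^H) U) (unitary_adjK UU) mul1mx.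
  have -> : (delta_mx j 0 : 'cV[C]_n)^H = delta_mx 0 j.
    by apply/matrixP => a b; rewrite adjE !mxE andbC; case: (_ && _); rewrite (rmorph1, rmorph0).
  rewrite -rowE -colE !mxE eqxx mulr1n ltcR; exact.
exists (U *m dgr (map_mx (@ln R) y) *m U^H); first exact: herm_dgr.
have := @expmx_real n U (map_mx (@ln R) y) 1 UU; rewrite scale1r => ->.
rewrite E -ufun_id ufun_comp; apply: ufun_eq => j.
by rewrite mul1r lnK // posrE.
Qed.

Lemma fnorm_dgr n (U : 'M[C]_n) (y : 'rV[R]_n) : is_unitary U ->
  fnorm (U *m dgr y *m U^H) ^+ 2 = \sum_j y 0 j ^+ 2.
Proof.
move=> UU; rewrite fnorm_conj // fnorm_sqr rinnerE; apply: eq_bigr => i _.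
rewrite (bigD1 i) //= big1 => [|j ji].
  by rewrite !mxE eqxx mulr1n /= mulr0 !addr0 -expr2.
by rewrite !mxE eq_sym (negPf ji) mulr0n /= !mulr0 addr0.
Qed.

End FunctionalCalculus.

(** * Triangular factorisation and leading principal minors *)

Lemma trig_schmidt (C : numClosedFieldType) n (A : 'M[C]_n) :
  exists L S : 'M[C]_n, [/\ S \is unitarymx, is_trig_mx L & A = L *m S].
Proof.
have SU : schmidt A \is unitarymx by exact: schmidt_unitarymx.
exists (A *m (schmidt A)^t*), (schmidt A); split=> //; last first.
  by rewrite -mulmxA (mulmx1C (unitarymxP SU)) mulmx1.
apply/is_trig_mxP => i j ij.
have /sub_sumsmxP[u rowA] := row_schmidt_sub A i.
have gen k : exists c : 'rV[C]_1, u k *m <<row k (schmidt A)>>%MS = c *m row k (schmidt A).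
  have /submxP[D ->] : (u k *m <<row k (schmidt A)>> <= row k (schmidt A))%MS.
    by rewrite mulmx_sub // genmxE.
  by exists D.
have -> : (A *m (schmidt A)^t*) i j = (row i A *m (row j (schmidt A))^t*) 0 0.
  by rewrite !mxE; apply: eq_bigr => k _; rewrite !mxE.
rewrite rowA mulmx_suml summxE big1 // => k ki; have [c ->] := gen k.
rewrite -mulmxA.
have -> : row k (schmidt A) *m (row j (schmidt A))^t* = 0.
  apply/matrixP => a b; rewrite !ord1 mxE.
  have kj : (k == j) = false by apply/eqP => kj; move: ki; rewrite kj leqNgt ij.
  have h : (schmidt A *m (schmidt A)^t*) k j = (1%:M : 'M[C]_n) k j by rewrite (unitarymxP SU).
  rewrite [in RHS]mxE kj in h.
  by rewrite [RHS]mxE -[RHS]h mxE; apply: eq_bigr => l _; rewrite !mxE.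
by rewrite mulmx0 mxE.
Qed.

Section LeadingMinors.
Variable R : realType.
Notation C := R[i].
Notation Re := (@complex.Re R).
Notation Im := (@complex.Im R).

(** The leading block is padded by the identity to full size, so that all leading minors are
    determinants of matrices of one type. *)
Definition blk n (i : nat) (A : 'M[C]_n) : 'M[C]_n :=
  \matrix_(a, b) if (a < i)%N && (b < i)%N then A a b else (a == b)%:R.

Definition minor n (i : nat) (A : 'M[C]_n) : C := \det (blk i A).

Definition upper n (P : 'M[C]_n) : Prop := forall a b : 'I_n, (b < a)%N -> P a b = 0.

(** Block upper triangular with respect to the cut at [i]; exactly the shape that makes the i-th
    leading minor multiplicative in a right factor. *)
Definition bupper n (i : nat) (P : 'M[C]_n) : Prop :=
  forall a b : 'I_n, (b < i)%N -> (i <= a)%N -> P a b = 0.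

Lemma upper_bupper n i (P : 'M[C]_n) : upper P -> bupper i P.
Proof. by move=> uP a b bi ia; apply: uP; exact: leq_trans bi ia. Qed.

Lemma upper_qr n (h : 'M[C]_n) : exists q r : 'M[C]_n, [/\ is_unitary q, upper r & h = q *m r].
Proof.
have [L [S [/unitarymxE SU /is_trig_mxP LT E]]] := trig_schmidt h^H.
exists S^H, L^H; split; first exact: unitary_adj.
  by move=> a b ab; rewrite adjE LT // conjc0.
by rewrite -adjM -E adjK.
Qed.

Lemma blkM n i (A P : 'M[C]_n) : bupper i P -> blk i (A *m P) = blk i A *m blk i P.
Proof.
move=> uP; apply/matrixP => a b; rewrite !mxE.
have [ai|ia] /= := ltnP a i; last first.
  rewrite (bigD1 a) //= !mxE ltnNge ia /= eqxx mul1r big1 ?addr0 // => k ka.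
  by rewrite !mxE ltnNge ia /= eq_sym (negPf ka) mul0r.
have [bi|ib] := ltnP b i.
  apply: eq_bigr => k _; rewrite !mxE ai bi /=.
  have [ki|ik] //= := ltnP k i.
  by rewrite uP // mulr0 (_ : (k == b) = false) ?mulr0 //; apply/eqP => kb; move: ik; rewrite kb leqNgt bi.
rewrite (bigD1 b) //= !mxE ai ltnNge ib /= eqxx mulr1 big1 ?addr0 // => k kb.
by rewrite !mxE [(b < i)%N]ltnNge ib /= andbF (negPf kb) mulr0.
Qed.

Lemma blk_adj n i (A : 'M[C]_n) : blk i A^H = (blk i A)^H.
Proof.
apply/matrixP => a b; rewrite adjE !mxE adjE andbC.
by case: ifP => // _; rewrite eq_sym; case: eqP; rewrite (conjc1, conjc0).
Qed.

Lemma minorM n i (A P : 'M[C]_n) : bupper i P -> minor i (A *m P) = minor i A * minor i P.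
Proof. by move=> uP; rewrite /minor blkM // det_mulmx. Qed.

Lemma minor_adj n i (A : 'M[C]_n) : minor i A^H = conjc (minor i A).
Proof. by rewrite /minor blk_adj det_adj. Qed.

Lemma minor_frame n i (A P : 'M[C]_n) : bupper i P ->
  minor i (P^H *m A *m P) = conjc (minor i P) * minor i A * minor i P.
Proof.
move=> uP; rewrite minorM //; congr (_ * _).
by rewrite -[P^H *m A]adjK minor_adj adjM adjK minorM // rmorphM /= minor_adj conjcK mulrC.
Qed.

Lemma minor_full n (A : 'M[C]_n) : minor n A = \det A.
Proof. by congr (\det _); apply/matrixP => a b; rewrite mxE !ltn_ord. Qed.

Lemma minor0 n (A : 'M[C]_n) : minor 0 A = 1.
Proof.
by rewrite /minor (_ : blk 0 A = 1%:M) ?det1 //; apply/matrixP => a b; rewrite !mxE.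
Qed.

Lemma minor_upper n i (P : 'M[C]_n) : upper P ->
  minor i P = \prod_(a < n | (a < i)%N) P a a.
Proof.
move=> uP; rewrite /minor -det_tr det_trig; last first.
  apply/is_trig_mxP => a b ab; rewrite !mxE; case: ifP => _; first exact: uP.
  by rewrite -val_eqE /= gtn_eqF.
rewrite [RHS]big_mkcond; apply: eq_bigr => a _; rewrite !mxE eqxx.
by case: (a < i)%N.
Qed.

Lemma minor_upper_neq0 n i (P : 'M[C]_n) : upper P -> P \in unitmx -> minor i P != 0.
Proof.
move=> uP; rewrite unitmxE -minor_full minor_upper // unitfE => /prodf_neq0 h.
by rewrite minor_upper //; apply/prodf_neq0 => a _; apply: h; rewrite ltn_ord.
Qed.

(** The tangent line of the exponential at [m], taken at each eigenvalue of [B]. Leaving [m] free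
    covers vectors that are not normalised. *)
Lemma rinner_expmx_ge n p (B : 'M[C]_n) (v : 'M[C]_(n, p)) (m : R) : B^H = B ->
  expR m * ((1 - m) * rinner v v + rinner v (B *m v)) <= rinner v (mexp B *m v).
Proof.
move=> /herm_spectral[U [y [UU ->]]].
have := @expmx_real _ n U y 1 UU; rewrite scale1r => ->.
rewrite -ufun_id /ufun; set w := U^H *m v.
have ww : rinner v v = rinner w w by rewrite /w rinner_unitaryl //; exact: unitary_adj.
have fE (f : R -> C) : rinner v (U *m diag_mx (\row_j f (y 0 j)) *m U^H *m v) =
    \sum_j \sum_k Re (f (y 0 j)) * (Re (w j k) ^+ 2 + Im (w j k) ^+ 2).
  rewrite -!mulmxA rinner_mull2 -/w rinnerE; apply: eq_bigr => j _; apply: eq_bigr => k _.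
  rewrite mul_diag_mx !mxE ReM ImM; ring.
rewrite ww (fE (real_complex R)) (fE (fun x => (expR (1 * x))%:C)) rinnerE mulr_sumr -big_split /= mulr_sumr; apply: ler_sum => j _.
rewrite !mulr_sumr -big_split /= mulr_sumr; apply: ler_sum => k _.
rewrite -!expr2 -mulrDl mulrA ler_wpM2r ?addr_ge0 ?sqr_ge0 // mul1r.
have em : expR m * expR (y 0 j - m) = expR (y 0 j) by rewrite -expRD addrC subrK.
have := ler_wpM2l (expR_ge0 m) (expR_ge1Dx (y 0 j - m)); rewrite em.
by apply: le_trans; rewrite ler_pM2l ?expR_gt0 //; lra.
Qed.

(** The padded block of e^B has eigenvalues ρ_j with eigenvectors u_j, and Jensen's inequality gives
    ρ_j ≥ exp⟨Eu_j, B Eu_j⟩, where E projects on the first i coordinates. The minor is the product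
    of the ρ_j, and the exponents sum to the trace of the leading block of B. *)
Lemma minor_expmx_ge n i (B : 'M[C]_n) : B^H = B ->
  [/\ Im (minor i (mexp B)) = 0, 0 < Re (minor i (mexp B)) &
  \sum_(a < n | (a < i)%N) Re (B a a) <= ln (Re (minor i (mexp B)))].
Proof.
move=> BH; set M := blk i (mexp B).
have eH : (mexp B)^H = mexp B by have := expmx_herm BH 1; rewrite scale1r.
have MH : M^H = M by rewrite /M -blk_adj eH.
have [U [rho [UU ME]]] := herm_spectral MH.
pose e := \row_(a < n) ((a < i)%N%:R : C).
pose E := diag_mx e : 'M[C]_n.
have EH : E^H = E.
  apply/matrixP => a b; rewrite adjE !mxE eq_sym; case: eqVneq => [->|_].
    by rewrite !mulr1n; case: (_ < _)%N; rewrite (rmorph1, rmorph0).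
  by rewrite !mulr0n rmorph0.
(* The padded block is a compression of e^B plus the identity on the complement. *)
have MB : M = E *m mexp B *m E + (1%:M - E).
  apply/matrixP => a b; rewrite /E mul_mx_diag mul_diag_mx !mxE.
  have [ai|ia] := ltnP a i; have [bi|ib] := ltnP b i; rewrite /= ?mul1r ?mulr1 ?mul0r ?mulr0 ?add0r.
  - by have [->|_] := eqVneq a b; rewrite ?mulr1n ?subrr ?mulr0n ?subr0 addr0.
  - have [ab|_] := eqVneq a b; first by move: ai; rewrite ab ltnNge ib.
    by rewrite mulr0n subr0.
  - by rewrite mul0rn subr0.
  - by rewrite mul0rn subr0.
have EE : E *m E = E.
  apply/matrixP => a b; rewrite /E mul_diag_mx !mxE.
  by case: (a < i)%N; rewrite ?mul1r ?mul0r ?mul0rn.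
have rhoE j : rho 0 j = rinner (col j U) (M *m col j U).
  rewrite ME -!mulmxA rinner_mull2.
  have -> : U^H *m col j U = delta_mx j 0 :> 'cV[C]_n.
    by rewrite colE mulmxA UU mul1mx.
  rewrite rinnerE (bigD1 j) //= [X in _ + X]big1 => [|k kj]; last first.
    by rewrite big_ord1 !mxE (negPf kj) /= !mul0r addr0.
  rewrite big_ord1 addr0 /dgr mul_diag_mx !mxE !eqxx /= !mul1r mulr1 !mul0r; ring.
have col1 j : rinner (col j U) (col j U) = 1.
  rewrite colE rinner_unitaryl // rinnerE (bigD1 j) //= [X in _ + X]big1 => [|k kj]; last first.
    by rewrite big_ord1 !mxE (negPf kj) /= !mul0r addr0.
  by rewrite big_ord1 addr0 !mxE !eqxx /= mul1r mul0r addr0.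
(* The vector Eu_j may be shorter than 1; the missing mass sits at the eigenvalue 1 = e⁰ of the
   padding, so Jensen's inequality for total mass 1 still holds with mean [m]. *)
have rho_ge j : expR (rinner (E *m col j U) (B *m (E *m col j U))) <= rho 0 j.
  rewrite rhoE MB mulmxDl rinnerDr -!mulmxA (rinner_mull2 E) EH.
  set u := col j U; set v := E *m u; set m := rinner v (B *m v).
  have s1 : rinner v v = rinner u v by rewrite /v rinner_mull EH mulmxA EE.
  have -> : rinner u ((1%:M - E) *m u) = 1 - rinner v v.
    by rewrite mulmxBl mul1mx rinnerBr col1 s1.
  have s0 : rinner v v <= 1.
    rewrite -subr_ge0 -(col1 j) -/u s1 -rinnerBr.
    have -> : rinner u (u - v) = rinner (u - v) (u - v).
      by rewrite rinnerBl rinnerBr -[rinner v (u - v)]/(rinner v (u - v)) rinnerBr s1 (rinnerC v u) subrr subr0.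
    exact: rinner_ge0.
  have := rinner_expmx_ge v m BH; rewrite -/m => h.
  have := ler_wpM2l (expR_ge0 m) (expR_ge1Dx (- m)); rewrite -expRD subrr expR0 => k.
  have {}k : 0 <= (1 - rinner v v) * (1 - expR m * (1 - m)) by rewrite mulr_ge0 ?subr_ge0.
  apply: (@le_trans _ _ (expR m * ((1 - m) * rinner v v + m) + (1 - rinner v v))).
    have aux (x t : R) : (1 - t) * (1 - x * (1 - m)) = x * ((1 - m) * t + m) + (1 - t) - x.
      by ring.
    by rewrite -subr_ge0 -aux.
  by rewrite lerD2r.
have rho_gt0 j : 0 < rho 0 j by apply: lt_le_trans (rho_ge j); exact: expR_gt0.
have detE : minor i (mexp B) = (\prod_j rho 0 j)%:C.
  rewrite /minor -/M ME -ufun_id det_ufun // rmorph_prod; done.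
have p0 : 0 < \prod_j rho 0 j by apply: prodr_gt0 => j _.
split; rewrite detE //=.
rewrite -ler_expR lnK ?posrE //.
have -> : \sum_(a < n | (a < i)%N) Re (B a a) =
    \sum_j rinner (E *m col j U) (B *m (E *m col j U)).
  have -> : \sum_j rinner (E *m col j U) (B *m (E *m col j U)) = rinner (E *m U) (B *m (E *m U)).
    rewrite [RHS]rinnerE exchange_big; apply: eq_bigr => j _; rewrite rinnerE.
    apply: eq_bigr => k _; rewrite big_ord1.
    have cE (A : 'M[C]_n) : (A *m col j U) k 0 = (A *m U) k j.
      by rewrite colE mulmxA -colE mxE.
    by rewrite mulmxA !cE mulmxA.
  rewrite rinner_tr !adjM EH BH !mulmxA -(mulmxA E U) (unitary_mul_adj UU) mulmx1 EE.
  rewrite /mxtrace Re_sum [LHS]big_mkcond /=; apply: eq_bigr => a _.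
  by rewrite /E mul_diag_mx !mxE; case: (a < i)%N; rewrite ?mul1r ?mul0r.
rewrite expR_sum; apply: ler_prod => j _; rewrite expR_ge0 /=; exact: rho_ge.
Qed.

End LeadingMinors.

(** * Busemann functions and distance estimates on positive definite matrices *)

Section Busemann.
Variable R : realType.
Notation C := R[i].
Notation Re := (@complex.Re R).
Notation Im := (@complex.Im R).

(** Summation by parts: as f vanishes at both ends, only the products of f with the drops of y
    remain. *)
Lemma abel_sum_ge0 (y f : nat -> R) n :
  (forall i j, (i <= j < n)%N -> y j <= y i) -> (forall i, 0 <= f i) ->
  f 0%N = 0 -> f n = 0 -> 0 <= \sum_(j < n) y j * (f j.+1 - f j).
Proof.
move=> ym f0 f00.
have key m : (m < n)%N -> y m * f m.+1 <= \sum_(j < m.+1) y j * (f j.+1 - f j).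
  elim: m => [|m IH] mn; first by rewrite big_ord1 f00 subr0.
  rewrite big_ord_recr /=; have := IH (ltnW mn).
  have := ler_wpM2r (f0 m.+1) (ym m m.+1 _); rewrite leqnSn mn => /(_ isT).
  move: (\sum_(_ < _) _) => s; lra.
case: n ym key => [|n] ym key fn; first by rewrite big_ord0.
by apply: le_trans (key n (leqnn _)); rewrite fn mulr0.
Qed.

Lemma normc2 (z : C) : conjc z * z = (Re z ^+ 2 + Im z ^+ 2)%:C.
Proof. by apply: complexP; case: z => a b /=; ring. Qed.

Lemma normc2_gt0 (z : C) : z != 0 -> 0 < Re z ^+ 2 + Im z ^+ 2.
Proof.
move=> z0; rewrite lt_def addr_ge0 ?sqr_ge0 // andbT; apply: contra z0 => /eqP h.
have h1 := sqr_ge0 (Re z); have h2 := sqr_ge0 (Im z).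
by apply/eqP; apply: complexP => /=; apply/eqP; rewrite -sqrf_eq0; apply/eqP; lra.
Qed.

Definition sqn (z : C) : R := Re z ^+ 2 + Im z ^+ 2.

Definition rv n (y : nat -> R) : 'rV[R]_n := \row_j y j.

(** Logarithm of a generalised power function. For nonincreasing [y] it is ‖y‖ times the Busemann
    function of the ray e^{-t diag(y)} in P_n. *)
Definition bus n (y : nat -> R) (x : 'M[C]_n) : R :=
  \sum_(j < n) y j * (ln (Re (minor j.+1 x)) - ln (Re (minor j x))).

Definition nonincr n (y : nat -> R) : Prop := forall i j, (i <= j < n)%N -> y j <= y i.

(** Convexity of Busemann functions along geodesics from the identity. The bounds [minor_expmx_ge]
    are combined by summation by parts; the full minor has equality because det e^B = e^{tr B}. *)
Lemma bus_expmx_ge n y (B : 'M[C]_n) : nonincr n y -> B^H = B ->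
  \sum_(j < n) y j * Re (B j j) <= bus y (mexp B).
Proof.
move=> ym BH; pose f i := ln (Re (minor i (mexp B))) - \sum_(a < n | (a < i)%N) Re (B a a).
have fge i : 0 <= f i by rewrite subr_ge0; have [] := minor_expmx_ge i BH.
have f0 : f 0%N = 0 by rewrite /f minor0 /= ln1 big_pred0 // subr0.
have fn : f n = 0.
  apply: le_anti; rewrite fge andbT /f minor_full subr_le0.
  have [U [z [UU BE]]] := herm_spectral BH.
  have := @expmx_real _ n U z 1 UU; rewrite scale1r -BE => ->.
  rewrite det_ufun // -rmorph_prod /= -expR_sum expRK.
  rewrite (eq_bigl xpredT) => [|a]; last by rewrite ltn_ord.
  have -> : \sum_(i < n) Re (B i i) = Re (\tr B) by rewrite /mxtrace Re_sum.
  rewrite BE mxtrace_mulC mulmxA UU mul1mx mxtrace_diag Re_sum; apply: ler_sum => j _.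
  by rewrite mxE mul1r.
have h := abel_sum_ge0 ym fge f0 fn.
rewrite /bus -subr_ge0; apply: le_trans h _; rewrite -sumrB le_eqVlt; apply/orP; left.
apply/eqP; apply: eq_bigr => j _; rewrite -mulrBr; congr (_ * _); rewrite /f.
have -> : \sum_(a < n | (a < j.+1)%N) Re (B a a) = Re (B j j) + \sum_(a < n | (a < j)%N) Re (B a a).
  rewrite (bigD1 j) //=; congr (_ + _); apply: eq_bigl => a.
  by rewrite ltnS andbC -val_eqE /= ltn_neqAle.
set s := \sum_(_ < _ | _) _; set p := ln _; set q := ln _; ring.
Qed.

(** Upper triangular matrices fix the flag, so they only add a constant: each minor is multiplied by
    the squared modulus of a minor of [r]. *)
Lemma bus_frame n y (x r : 'M[C]_n) : x^H = x ->
  (forall i, (i <= n)%N -> Im (minor i x) = 0 /\ 0 < Re (minor i x)) ->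
  upper r -> r \in unitmx ->
  bus y (r^H *m x *m r) = bus y x + bus y (r^H *m r).
Proof.
move=> xH xp ur rU; rewrite /bus -big_split; apply: eq_bigr => j _ /=.
have key i : (i <= n)%N -> ln (Re (minor i (r^H *m x *m r))) =
    ln (Re (minor i x)) + ln (Re (minor i (r^H *m r))).
  move=> ilen; have [i0 ip] := xp i ilen.
  have z0 := minor_upper_neq0 i ur rU.
  have b := @upper_bupper _ _ i _ ur.
  rewrite minor_frame // -[r^H in RHS]mulmx1 minor_frame //.
  have -> : minor i (1%:M : 'M[C]_n) = 1.
    rewrite /minor (_ : blk i 1%:M = 1%:M) ?det1 //.
    by apply/matrixP => p q; rewrite !mxE if_same.
  rewrite mulr1 normc2 mulrAC normc2 ReZ lnM ?posrE ?normc2_gt0 //; ring.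
have jn := ltn_ord j; have jn' := ltnW jn; rewrite (key _ jn).
rewrite (key _ jn').
by rewrite opprD addrACA mulrDr.
Qed.

Lemma rinner_herm_diag n (B : 'M[C]_n) (y : 'rV[R]_n) :
  rinner (dgr y) B = \sum_j y 0 j * Re (B j j).
Proof.
rewrite rinnerE; apply: eq_bigr => i _; rewrite (bigD1 i) //= big1 => [|j ji].
  by rewrite !mxE eqxx mulr1n /= mul0r !addr0.
by rewrite !mxE eq_sym (negPf ji) mulr0n /= !mul0r addr0.
Qed.

Lemma herm_conj n (U B : 'M[C]_n) : B^H = B -> (U^H *m B *m U)^H = U^H *m B *m U.
Proof. by move=> BH; rewrite !adjM adjK BH mulmxA. Qed.

(** The gradient inequality of a convex function at the base point h†h. The factorisation hV = qr
    moves this point to the identity and the frame V to q, and the cocycle of r cancels; then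
    [bus_expmx_ge] applies. *)
Lemma bus_step n y (V q r h B : 'M[C]_n) : nonincr n y ->
  is_unitary q -> upper r -> r \in unitmx -> B^H = B -> h *m V = q *m r ->
  rinner (q *m dgr (rv n y) *m q^H) B <=
  bus y (V^H *m (h^H *m mexp B *m h) *m V) - bus y (V^H *m (h^H *m h) *m V).
Proof.
move=> ym qU ur rU BH hV.
have B'H := herm_conj q BH; set B' := q^H *m B *m q in B'H.
have eB' : q^H *m mexp B *m q = mexp B'.
  rewrite expmx_conj //; exact: unitary_mul_adj.
have -> : V^H *m (h^H *m mexp B *m h) *m V = r^H *m mexp B' *m r.
  by rewrite -eB' -!mulmxA hV !mulmxA -adjM hV adjM.
have -> : V^H *m (h^H *m h) *m V = r^H *m r.
  by rewrite -!mulmxA hV !mulmxA -adjM hV adjM -!mulmxA (mulmxA q^H) qU mul1mx.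
rewrite bus_frame //; last 2 first.
- by have := expmx_herm B'H 1; rewrite scale1r.
- by move=> i _; have [] := minor_expmx_ge i B'H.
rewrite addrK; apply: le_trans (bus_expmx_ge ym B'H).
rewrite rinner_mulr rinner_mull rinner_herm_diag adjK mulmxA.
by rewrite le_eqVlt; apply/orP; left; apply/eqP; apply: eq_bigr => j _; rewrite mxE.
Qed.

Lemma unit_upper n (V h q r : 'M[C]_n) : is_unitary V -> h \in unitmx ->
  is_unitary q -> h *m V = q *m r -> r \in unitmx.
Proof.
move=> VU hU qU hV; have -> : r = q^H *m (h *m V) by rewrite hV mulmxA qU mul1mx.
by rewrite !unitmx_mul hU !unitary_unit //; exact: unitary_adj.
Qed.

Lemma fnorm_herm_conj n (q Y : 'M[C]_n) : is_unitary q -> fnorm (q *m Y *m q^H) = fnorm Y.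
Proof. exact: fnorm_conj. Qed.

Lemma bus_lip_ge n y (V h B : 'M[C]_n) : nonincr n y -> is_unitary V -> h \in unitmx ->
  B^H = B -> - (fnorm (dgr (rv n y)) * fnorm B) <=
  bus y (V^H *m (h^H *m mexp B *m h) *m V) - bus y (V^H *m (h^H *m h) *m V).
Proof.
move=> ym VU hU BH; have [q [r [qU ur hV]]] := upper_qr (h *m V).
have rU := unit_upper VU hU qU hV.
apply: le_trans (bus_step ym qU ur rU BH hV).
have := normr_rinner_le (q *m dgr (rv n y) *m q^H) B.
by rewrite fnorm_conj // ler_norml => /andP[].
Qed.

Lemma scaleN1c n (B : 'M[C]_n) : (-1)%:C *: B = - B.
Proof. by rewrite rmorphN1 scaleN1r. Qed.

Lemma expmx_hermN n (B : 'M[C]_n) : B^H = B -> mexp (- B) *m mexp B = 1%:M.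
Proof.
move=> BH; have := expmx_hermNK BH (-1); rewrite opprK scaleN1c.
by rewrite (scale1r B).
Qed.

Lemma expmx_unit n (B : 'M[C]_n) : B^H = B -> mexp B \in unitmx.
Proof. by move=> BH; have := expmx_herm_unit BH 1; rewrite scale1r. Qed.

Lemma expmx_half n (B : 'M[C]_n) : B^H = B ->
  mexp (2^-1%:C *: B) *m mexp (2^-1%:C *: B) = mexp B.
Proof.
have h : 2^-1 + 2^-1 = 1 :> R by rewrite [RHS]splitr mul1r.
by move=> BH; rewrite -(expmx_hermD BH) h (scale1r B).
Qed.

(** The lower bound read from the other end: the base point e^{B/2}h with displacement -B leads back
    to h†h. *)
Lemma bus_lip_le n y (V h B : 'M[C]_n) : nonincr n y -> is_unitary V -> h \in unitmx ->
  B^H = B -> bus y (V^H *m (h^H *m mexp B *m h) *m V) - bus y (V^H *m (h^H *m h) *m V)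
  <= fnorm (dgr (rv n y)) * fnorm B.
Proof.
move=> ym VU hU BH.
have E2 := expmx_half BH; set E := mexp (2^-1%:C *: B) in E2.
have EH : E^H = E by exact: expmx_herm.
have EU : E \in unitmx by exact: expmx_herm_unit.
have NBH : (- B)^H = - B by rewrite adjN BH.
have ENE : E *m mexp (- B) *m E = 1%:M.
  have c : mexp (- B) *m E = E *m mexp (- B).
    by symmetry; apply: expmx_comm; rewrite mulmxN mulNmx -expmx_comm // -scalemxAr -scalemxAl.
  by rewrite -mulmxA c mulmxA E2; have := expmx_hermN NBH; rewrite opprK.
have := bus_lip_ge ym VU (h := E *m h) _ NBH; rewrite unitmx_mul EU hU => /(_ isT).
rewrite fnormN !adjM EH.
have -> : h^H *m E *m mexp (- B) *m (E *m h) = h^H *m h.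
  by rewrite -!mulmxA (mulmxA (mexp _)) (mulmxA E) (mulmxA E) ENE mul1mx.
have -> : h^H *m E *m (E *m h) = h^H *m mexp B *m h.
  by rewrite -!mulmxA (mulmxA E) E2.
by move=> l; rewrite -lerN2 opprB.
Qed.

Lemma bus_dgr n y (t : R) : bus y (mexp (t%:C *: dgr (rv n y))) = t * \sum_(j < n) y j ^+ 2.
Proof.
have := @expmx_real _ n 1%:M (rv n y) t (@unitarymx1 _ n).
rewrite adj1 mulmx1 mul1mx /ufun adj1 mulmx1 mul1mx => ->.
rewrite /bus mulr_sumr; apply: eq_bigr => j _.
have key i : Re (minor i (diag_mx (\row_k (expR (t * (rv n y) 0 k))%:C))) =
    expR (\sum_(a < n | (a < i)%N) t * y a).
  rewrite minor_upper; last by move=> a b ba; rewrite !mxE -val_eqE gtn_eqF.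
  rewrite expR_sum (eq_bigr (fun a : 'I_n => (expR (t * y a))%:C)).
    by rewrite -rmorph_prod.
  by move=> a _; rewrite !mxE eqxx mulr1n.
rewrite !key !expRK.
have -> : \sum_(a < n | (a < j.+1)%N) t * y a = t * y j + \sum_(a < n | (a < j)%N) t * y a.
  rewrite (bigD1 j) //=; congr (_ + _); apply: eq_bigl => a.
  by rewrite ltnS andbC -val_eqE /= ltn_neqAle.
rewrite addrK; ring.
Qed.

Lemma sort_row n (z : 'rV[R]_n) :
  exists p : 'S_n, exists2 y : nat -> R, nonincr n y & rv n y = col_perm p z.
Proof.
pose t := [tuple z 0 j | j < n].
pose s := sort (fun a b : R => b <= a) t.
have ss : size s == n by rewrite size_sort size_tuple.
have /tuple_permP[p sp] : perm_eq (Tuple ss) t by rewrite perm_sort.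
exists p, (nth 0 s); last first.
  apply/rowP => j; rewrite !mxE.
  have -> : nth 0 s j = tnth (Tuple ss) j by rewrite (tnth_nth 0).
  have -> : Tuple ss = [tuple tnth t (p i) | i < n] by exact/val_inj.
  by rewrite !tnth_mktuple.
move=> i j /andP[ij jn]; have := @sort_sorted _ (fun a b : R => b <= a) _ t.
move=> /(_ (fun a b => le_total b a)) st.
apply: (sorted_leq_nth _ _ 0 st) => //; rewrite ?inE.
- by move=> a b c ba cb; exact: le_trans cb ba.
- by rewrite (eqP ss) (leq_ltn_trans ij jn).
- by rewrite (eqP ss).
Qed.

Lemma col_perm_frame n (p : 'S_n) (U : 'M[C]_n) : is_unitary U ->
  is_unitary (col_perm p U) /\ forall z : 'rV[R]_n, col_perm p U *m dgr (col_perm p z) *m (col_perm p U)^H = U *m dgr z *m U^H.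
Proof.
move=> UU.
have conjE (z : 'rV[R]_n) : col_perm p U *m dgr (col_perm p z) *m (col_perm p U)^H = U *m dgr z *m U^H.
  apply/matrixP => a b; rewrite !mul_mx_diag !mxE [RHS](reindex_inj (@perm_inj _ p)) /=.
  by apply: eq_bigr => j _; rewrite !mxE !adjE !mxE.
split=> //; have o : dgr (const_mx 1 : 'rV[R]_n) = 1%:M.
  by apply/matrixP => a b; rewrite !mxE.
have := conjE (const_mx 1); have -> : col_perm p (const_mx 1 : 'rV[R]_n) = const_mx 1.
  by apply/rowP => j; rewrite !mxE.
rewrite !o !mulmx1 (unitary_mul_adj UU) => h.
exact: mulmx1C.
Qed.

Lemma herm_spectral_sorted n (H : 'M[C]_n) : H^H = H ->
  exists U : 'M[C]_n, exists y : nat -> R,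
    [/\ is_unitary U, nonincr n y & H = U *m dgr (rv n y) *m U^H].
Proof.
move=> /herm_spectral[U [z [UU HE]]]; have [p [y ym yE]] := sort_row z.
have [pU pE] := col_perm_frame p UU; exists (col_perm p U), y.
by split=> //; rewrite yE pE.
Qed.

(** The Lipschitz constant ‖y‖ is attained along this geodesic, which turns Lipschitz bounds for
    [bus] into bounds on norms of logarithms. *)
Lemma bus_conj_exp n y (V : 'M[C]_n) (t : R) : is_unitary V ->
  bus y (V^H *m mexp (t%:C *: (V *m dgr (rv n y) *m V^H)) *m V) =
  t * fnorm (V *m dgr (rv n y) *m V^H) ^+ 2.
Proof.
move=> VU; rewrite fnorm_dgr // scalemxAl scalemxAr expmx_conj //.
rewrite -!mulmxA VU mulmx1 mulmxA VU mul1mx bus_dgr; congr (_ * _).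
by apply: eq_bigr => j _; rewrite mxE.
Qed.

(* Triangle inequality for the metric of P_n along [g_{k+1} = e^{A_k/2} g_k]. *)
Lemma fnorm_log_le n (X : 'M[C]_n) (A g : nat -> 'M[C]_n) k : X^H = X ->
  (forall i, (A i)^H = A i) -> g 0%N = 1%:M ->
  (forall i, g i.+1 = mexp (2^-1%:C *: A i) *m g i) ->
  mexp X = (g k)^H *m g k -> fnorm X <= \sum_(i < k) fnorm (A i).
Proof.
move=> XH AH g0 gS XE; have [V [y [VU ym XV]]] := herm_spectral_sorted XH.
have gU i : g i \in unitmx.
  elim: i => [|i IH]; first by rewrite g0 unitmx1.
  by rewrite gS unitmx_mul IH expmx_herm_unit.
have nX : fnorm (dgr (rv n y)) = fnorm X by rewrite XV fnorm_conj.
have step i : bus y (V^H *m ((g i)^H *m g i) *m V) <= fnorm X * \sum_(j < i) fnorm (A j).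
  elim: i => [|i IH].
    rewrite g0 adj1 mulmx1 big_ord0 mulr0.
    have := bus_conj_exp y 0 VU; rewrite scale0r expmx0 mul0r => ->; exact: lexx.
  rewrite big_ord_recr /= mulrDr; have := bus_lip_le ym VU (gU i) (AH i); rewrite nX.
  have -> : (g i.+1)^H *m g i.+1 = (g i)^H *m mexp (A i) *m g i.
    by rewrite gS adjM expmx_herm // -(expmx_half (AH i)) !mulmxA.
  by rewrite lerBlDr addrC => l; apply: le_trans l _; rewrite lerD2r.
have := step k; rewrite -XE.
have := bus_conj_exp y 1 VU; rewrite -XV scale1r => ->; rewrite mul1r expr2.
have [->|X0] := eqVneq (fnorm X) 0; first by move=> _; apply: sumr_ge0 => i _; exact: fnorm_ge0.
by rewrite ler_pM2l // lt_def X0 fnorm_ge0.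
Qed.

Let aux_sub (a b w w' c p q : R) : - w <= - a - p -> q - - b <= w' -> - c <= p -> - c <= q ->
  a - c - (c - b) <= w + w'.
Proof. by lra. Qed.

(* A weak form of the exponential metric increasing property. *)
Lemma fnorm_log_sub n (A B W h : 'M[C]_n) : A^H = A -> B^H = B -> W^H = W -> h \in unitmx ->
  mexp B = h^H *m h -> mexp A = h^H *m mexp W *m h ->
  fnorm (A - B) ^+ 2 <= (fnorm A + fnorm B) * fnorm W.
Proof.
move=> AH BH WH hU BE AE.
have lower (X Z : 'M[C]_n) : X^H = X -> Z^H = Z -> exists V : 'M[C]_n, exists y : nat -> R,
    [/\ is_unitary V, nonincr n y, X = V *m dgr (rv n y) *m V^H &
     rinner X Z <= bus y (V^H *m mexp Z *m V)].
  move=> XH ZH; have [V [y [VU ym XV]]] := herm_spectral_sorted XH.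
  exists V, y; split => //.
  have u1 : upper (1%:M : 'M[C]_n) by move=> a b ba; rewrite mxE -val_eqE gtn_eqF.
  have e : 1%:M *m V = V *m 1%:M by rewrite mulmx1 mul1mx.
  have := bus_step ym VU u1 (unitmx1 _ _) ZH e; rewrite -XV adj1 !mulmx1 !mul1mx VU.
  by have := bus_conj_exp y 0 VU; rewrite scale0r expmx0 mul0r mulmx1 VU => ->; rewrite subr0.
have diag (X V : 'M[C]_n) y : is_unitary V -> - X = V *m dgr (rv n y) *m V^H ->
    bus y (V^H *m mexp X *m V) = - fnorm X ^+ 2 /\ fnorm (dgr (rv n y)) = fnorm X.
  move=> VU XV; have nX : fnorm (dgr (rv n y)) = fnorm X.
    by rewrite -(fnormN X) XV fnorm_conj.
  split=> //; have := bus_conj_exp y (-1) VU; rewrite -XV fnormN.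
  by rewrite scaleN1c opprK mulN1r.
have NH (X : 'M[C]_n) : X^H = X -> (- X)^H = - X by move=> XH; rewrite adjN XH.
have [V [y [VU ym AV lo]]] := lower _ _ (NH A AH) BH.
have [b1 n1] := diag _ _ _ VU AV.
have := bus_lip_ge ym VU hU WH; rewrite -AE -BE b1 n1 => l1.
have [V' [y' [VU' ym' BV lo']]] := lower _ _ (NH B BH) AH.
have [b2 n2] := diag _ _ _ VU' BV.
have := bus_lip_le ym' VU' hU WH; rewrite -AE -BE b2 n2 => l2.
move: lo lo'; rewrite !rinnerNl (rinnerC B A) => lo lo'.
rewrite fnorm_sqr rinnerBl !rinnerBr (rinnerC B A) -!fnorm_sqr mulrDl.
exact: aux_sub l1 l2 lo lo'.
Qed.

End Busemann.

Import (canonicals) mpoly.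

(** * Polynomial functions on one-parameter groups *)

Section PolynomialFunctions.
Variable R : realType.
Notation C := R[i].

(** Polynomial functions of the entries, given inductively so that their properties follow by
    structural induction; [mx_eval_polyfun] and [polyfun_mx_eval] match them with evaluated
    polynomials. *)
Inductive polyfun n : ('M[C]_n -> C) -> Prop :=
| polyfun_cst c : polyfun (fun=> c)
| polyfun_coord i j : polyfun (fun g => g i j)
| polyfun_add f h : polyfun f -> polyfun h -> polyfun (fun g => f g + h g)
| polyfun_mul f h : polyfun f -> polyfun h -> polyfun (fun g => f g * h g).

Lemma polyfun_ext n (f h : 'M[C]_n -> C) : polyfun f -> f =1 h -> polyfun h.
Proof. by move=> pf /funext <-. Qed.

Lemma polyfun_sum n I (r : seq I) (P : pred I) (f : I -> 'M[C]_n -> C) :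
  (forall i, polyfun (f i)) -> polyfun (fun g => \sum_(i <- r | P i) f i g).
Proof.
move=> pf; elim: r => [|i r IH].
  by apply: polyfun_ext (@polyfun_cst n 0) _ => g; rewrite big_nil.
case Pi : (P i).
  by apply: polyfun_ext (polyfun_add (pf i) IH) _ => g; rewrite big_cons Pi.
by apply: polyfun_ext IH _ => g; rewrite big_cons Pi.
Qed.

Lemma polyfun_prod n I (r : seq I) (P : pred I) (f : I -> 'M[C]_n -> C) :
  (forall i, polyfun (f i)) -> polyfun (fun g => \prod_(i <- r | P i) f i g).
Proof.
move=> pf; elim: r => [|i r IH].
  by apply: polyfun_ext (@polyfun_cst n 1) _ => g; rewrite big_nil.
case Pi : (P i).
  by apply: polyfun_ext (polyfun_mul (pf i) IH) _ => g; rewrite big_cons Pi.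
by apply: polyfun_ext IH _ => g; rewrite big_cons Pi.
Qed.

Lemma polyfun_exp n (f : 'M[C]_n -> C) k : polyfun f -> polyfun (fun g => f g ^+ k).
Proof.
move=> pf; elim: k => [|k IH].
  by apply: polyfun_ext (@polyfun_cst n 1) _ => g; rewrite expr0.
by apply: polyfun_ext (polyfun_mul pf IH) _ => g; rewrite exprS.
Qed.

Lemma polyfun_det n k (F : 'M[C]_n -> 'M[C]_k) : (forall i j, polyfun (fun g => F g i j)) ->
  polyfun (fun g => \det (F g)).
Proof.
move=> pF; rewrite /determinant; apply: polyfun_sum => s.
by apply: polyfun_mul; [exact: polyfun_cst|apply: polyfun_prod].
Qed.

Lemma polyfun_comp n k (F : 'M[C]_n -> 'M[C]_k) f : (forall i j, polyfun (fun g => F g i j)) ->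
  polyfun f -> polyfun (fun g => f (F g)).
Proof.
move=> pF; elim=> [c|i j|f1 f2 _ h1 _ h2|f1 f2 _ h1 _ h2].
- exact: polyfun_cst.
- exact: pF.
- exact: polyfun_add.
- exact: polyfun_mul.
Qed.

Lemma polyfun_mulmx n (A B : 'M[C]_n) f : polyfun f -> polyfun (fun g => f (A *m g *m B)).
Proof.
apply: polyfun_comp => i j.
have p : polyfun (fun g : 'M[C]_n => \sum_k (\sum_l A i l * g l k) * B k j).
  apply: polyfun_sum => k; apply: polyfun_mul; last exact: polyfun_cst.
  by apply: polyfun_sum => l; apply: polyfun_mul; [exact: polyfun_cst|exact: polyfun_coord].
by apply: polyfun_ext p _ => g; rewrite mxE; apply: eq_bigr => k _; rewrite mxE.
Qed.

Lemma mx_eval_polyfun n (p : mpoly.mpoly (n * n) C) : polyfun (mx_eval p).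
Proof.
have q : polyfun (fun g : 'M[C]_n => \sum_(m <- mpoly.msupp p)
    mpoly.mcoeff m p * \prod_(k < n * n) mxvec g 0 k ^+ mpoly.fun_of_multinom m k).
  apply: polyfun_sum => m; apply: polyfun_mul; first exact: polyfun_cst.
  apply: polyfun_prod => k; apply: polyfun_exp.
  case/mxvec_indexP: k => i j; apply: polyfun_ext (polyfun_coord i j) _ => g.
  by rewrite mxvecE.
by apply: polyfun_ext q _ => g; rewrite /mx_eval mpoly.mevalE.
Qed.

Lemma polyfun_mx_eval n (f : 'M[C]_n -> C) : polyfun f ->
  exists p : mpoly.mpoly (n * n) C, forall g, f g = mx_eval p g.
Proof.
elim=> [c|i j|f1 f2 _ [p1 h1] _ [p2 h2]|f1 f2 _ [p1 h1] _ [p2 h2]].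
- by exists (mpoly.mpolyC _ c) => g; rewrite /mx_eval mpoly.mevalC.
- exists (mpoly.mpolyX _ (mpoly.mnm1 (mxvec_index i j))) => g.
  by rewrite /mx_eval mpoly.mevalXU mxvecE.
- by exists (p1 + p2) => g; rewrite /mx_eval rmorphD h1 h2.
- by exists (p1 * p2) => g; rewrite /mx_eval rmorphM h1 h2.
Qed.

Lemma ccvg_polyfun n (T : Type) (F : set_system T) (f : 'M[C]_n -> C) g L : Filter F ->
  polyfun f -> mcvg F g L -> ccvg F (fun x => f (g x)) (f L).
Proof.
move=> FF pf gL; elim: pf => [c|i j|f1 f2 _ h1 _ h2|f1 f2 _ h1 _ h2].
- exact: ccvg_cst.
- exact: gL.
- exact: ccvgD.
- exact: ccvgM.
Qed.

(** Covers real exponentials and the circle-valued ones at once, so that statements pass between the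
    noncompact and the compact one-parameter groups. *)
Definition character (a : R -> C) : Prop := a 0 = 1 /\ forall x y, a (x + y) = a x * a y.

Definition expev (s : seq (C * R)) (a : R -> C) : C := \sum_(p <- s) p.1 * a p.2.

(** Products and sums of eigenvalue characters are again combinations of characters. The list of
    coefficients and frequencies does not depend on the character. *)
Lemma polyfun_expsum n (U g h : 'M[C]_n) (y : 'rV[R]_n) f : polyfun f ->
  exists s, forall a, character a -> f (g *m ufun U a y *m h) = expev s a.
Proof.
elim=> [c|i j|f1 f2 _ [s1 h1] _ [s2 h2]|f1 f2 _ [s1 h1] _ [s2 h2]].
- by exists [:: (c, 0)] => a [a0 _]; rewrite /expev big_seq1 /= a0 mulr1.
- exists [seq ((g *m U) i k * (U^H *m h) k j, y 0 k) | k <- enum 'I_n] => a _.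
  rewrite /expev big_map big_enum /= /ufun !mulmxA -(mulmxA _ U^H h) mul_mx_diag mxE.
  by apply: eq_bigr => k _; rewrite !mxE mulrAC.
- by exists (s1 ++ s2) => a ca; rewrite /expev big_cat /= h1 // h2.
- exists [seq (p.1 * q.1, p.2 + q.2) | p <- s1, q <- s2] => a ca.
  rewrite h1 // h2 // /expev big_distrl /= big_allpairs_dep /=; apply: eq_bigr => p _.
  by rewrite big_distrr; apply: eq_bigr => q _; rewrite ca.2 /= mulrACA.
Qed.

Definition expcoef (s : seq (C * R)) (l : R) : C := \sum_(p <- s | p.2 == l) p.1.

Lemma expevE s a : expev s a = \sum_(l <- undup (map snd s)) expcoef s l * a l.
Proof.
rewrite /expev (eq_big_seq (fun p => \sum_(l <- undup (map snd s) | l == p.2) p.1 * a l)).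
  rewrite (exchange_big_dep xpredT) //=; apply: eq_bigr => l _.
  rewrite /expcoef big_distrl /=; apply: eq_big => // p; exact: eq_sym.
move=> p ps; rewrite -big_filter.
have -> : [seq l <- undup (map snd s) | l == p.2] = [:: p.2].
  apply: perm_small_eq => //; apply: uniq_perm => //; first by rewrite filter_uniq // undup_uniq.
  move=> l; rewrite mem_filter inE mem_undup; case: eqP => //= ->.
  by rewrite map_f.
by rewrite big_seq1.
Qed.

(** The vanishing for all powers of [a] extends to every polynomial in the values of [a]; the
    polynomial that kills every frequency except [l] isolates the coefficient of [l]. *)
Lemma expcoef0 s (a : R -> C) :
  {in map snd s &, injective a} -> (forall m, expev s (fun x => a x ^+ m) = 0) ->
  forall l, expcoef s l = 0.
Proof.
move=> ainj s0 l.
have [ls|ls] := boolP (l \in map snd s); last first.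
  rewrite /expcoef big_seq_cond big_pred0 // => p; apply/negP => /andP[ps /eqP pl].
  by move: ls; rewrite -pl map_f.
have pol (q : {poly C}) : \sum_(p <- s) p.1 * q.[a p.2] = 0.
  rewrite (eq_bigr (fun p : C * R => \sum_(i < size q) q`_i * (p.1 * a p.2 ^+ i))).
    rewrite exchange_big big1 // => i _ /=.
    by have := s0 i; rewrite -big_distrr /expev /= => ->; rewrite mulr0.
  move=> p _; rewrite horner_coef big_distrr /=; apply: eq_bigr => i _; ring.
pose q := \prod_(l' <- undup (map snd s) | l' != l) ('X - (a l')%:P).
have ql l' : l' \in map snd s -> (q.[a l'] == 0) = (l' != l).
  move=> l's; rewrite /q horner_prod; apply/idP/idP.
    rewrite prodf_seq_eq0 => /hasP[z]; rewrite mem_undup => zs /andP[zl].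
    by rewrite !hornerE subr_eq0 => /eqP/ainj -> //.
  move=> l'l; rewrite prodf_seq_eq0; apply/hasP; exists l'; first by rewrite mem_undup.
  by rewrite l'l !hornerE subrr /=.
have := pol q; rewrite (bigID (fun p : C * R => p.2 == l)) /= [X in _ + X]big_seq_cond.
rewrite [X in _ + X]big1 ?addr0 => [|p /andP[ps pl]]; last first.
  by have /eqP -> : q.[a p.2] == 0; [rewrite ql ?map_f|rewrite mulr0].
rewrite (eq_bigr (fun p : C * R => p.1 * q.[a l])); last by move=> p /eqP ->.
by rewrite -big_distrl /= => /eqP; rewrite mulf_eq0 ql // eqxx orbF => /eqP.
Qed.

Lemma expev0 s (a : R -> C) :
  {in map snd s &, injective a} -> (forall m, expev s (fun x => a x ^+ m) = 0) ->
  forall b, expev s b = 0.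
Proof.
move=> ainj s0 b; rewrite expevE big1 // => l _.
by rewrite (expcoef0 ainj s0) mul0r.
Qed.

Definition rchar (t x : R) : C := (expR (t * x))%:C.
Definition ichar (t x : R) : C := Complex (cos (t * x)) (sin (t * x)).

Lemma rchar_character t : character (rchar t).
Proof.
by split=> [|x y]; rewrite /rchar ?mulr0 ?expR0 // mulrDr expRD rmorphM.
Qed.

Lemma ichar_character t : character (ichar t).
Proof.
split=> [|x y]; rewrite /ichar; first by rewrite mulr0 cos0 sin0.
by rewrite mulrDr cosD sinD; apply: complexP => /=; ring.
Qed.

Lemma charX a m x : character a -> a x ^+ m = a (m%:R * x).
Proof.
move=> [a0 aD]; elim: m => [|m IH]; first by rewrite expr0 mul0r a0.
by rewrite exprS IH -natr1 mulrDl mul1r addrC aD.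
Qed.

Lemma rcharX m t x : rchar t x ^+ m = rchar (m%:R * t) x.
Proof. by rewrite (charX _ _ (rchar_character t)) /rchar mulrCA mulrA. Qed.

Lemma icharX m t x : ichar t x ^+ m = ichar (m%:R * t) x.
Proof. by rewrite (charX _ _ (ichar_character t)) /ichar mulrCA mulrA. Qed.

Lemma rchar1_inj : injective (rchar 1).
Proof. by move=> x y /complexI/expR_inj; rewrite !mul1r. Qed.

(** With t = 1/M, where M exceeds all frequencies in modulus, differences of angles lie in (0, 2),
    hence in (0, π), where the sine is positive. *)
Lemma ichar_inj_small (s : seq R) : exists2 t : R, 0 < t & {in s &, injective (ichar t)}.
Proof.
pose M : R := 1 + \sum_(l <- s) `|l|.
have sM l : l \in s -> `|l| < M.
  move=> ls; rewrite /M (big_rem l) //= addrCA ltrDl ltr_wpDr ?ltr01 //.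
  by apply: sumr_ge0.
have M0 : 0 < M by rewrite ltr_wpDr ?ltr01 //; apply: sumr_ge0.
exists (M^-1); first by rewrite invr_gt0.
have key x y : `|x| < M -> `|y| < M -> x < y -> ichar M^-1 x <> ichar M^-1 y.
  move=> xM yM xy [cE sE].
  have e : sin (M^-1 * y - M^-1 * x) = 0.
    by rewrite sinB cE sE mulrC subrr.
  have d0 : 0 < M^-1 * y - M^-1 * x by rewrite -mulrBr mulr_gt0 ?invr_gt0 // subr_gt0.
  have d1 : M^-1 * y - M^-1 * x < pi :> R.
    apply: (@lt_le_trans _ _ 2); last exact: pi_ge2.
    rewrite -mulrBr mulrC ltr_pdivrMr //.
    by move: xM yM; rewrite !ltr_norml => /andP[h1 _] /andP[_ h2]; lra.
  by have := @sin_gt0_pi R (M^-1 * y - M^-1 * x); rewrite d0 d1 e ltxx => /(_ isT).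
move=> x y /sM xM /sM yM E; apply/eqP; rewrite eq_le !leNgt; apply/andP; split; apply/negP => h.
  exact: key yM xM h (esym E).
exact: key xM yM h E.
Qed.

Section Line.
Variables (n : nat) (U g h : 'M[C]_n) (y : 'rV[R]_n) (f : 'M[C]_n -> C).
Hypothesis pf : polyfun f.

(** The integer points of a real one-parameter group are Zariski dense: their values determine all
    coefficients of the exponential sum. [line_imaginary_zero] is the same for the compact group. *)
Lemma line_nat_zero : (forall m : nat, f (g *m ufun U (rchar m%:R) y *m h) = 0) ->
  forall b, character b -> f (g *m ufun U b y *m h) = 0.
Proof.
have [s sE] := polyfun_expsum U g h y pf => f0 b cb; rewrite sE //.
apply: (@expev0 _ (rchar 1)) => [? ? _ _|m]; first exact: rchar1_inj.
rewrite (funext (fun x => rcharX m 1 x)) mulr1 -sE ?f0 //; exact: rchar_character.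
Qed.

Lemma line_imaginary_zero : (forall t : R, f (g *m ufun U (ichar t) y *m h) = 0) ->
  forall b, character b -> f (g *m ufun U b y *m h) = 0.
Proof.
have [s sE] := polyfun_expsum U g h y pf => f0 b cb; rewrite sE //.
have [t t0 ti] := ichar_inj_small (map snd s).
apply: (@expev0 _ (ichar t)) => // m.
rewrite (funext (fun x => icharX m t x)) -sE ?f0 //; exact: ichar_character.
Qed.

(** A nonzero exponential sum is governed by its largest frequency with nonzero coefficient. *)
Lemma line_eventually_neq0 b : character b -> f (g *m ufun U b y *m h) != 0 ->
  \forall m \near \oo, f (g *m ufun U (rchar m%:R) y *m h) != 0.
Proof.
have [s sE] := polyfun_expsum U g h y pf => cb; rewrite sE // => f0.
pose P l := (l \in map snd s) && (expcoef s l != 0).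
have [l0 [Pl0 l0max]] : exists l0, P l0 /\ forall l, P l -> l <= l0.
  have /hasP[l1 l1s nz] : has (fun l => expcoef s l != 0) (map snd s).
    apply: contraNT f0; rewrite -all_predC => /allP z; rewrite expevE big1_seq //= => l.
    by rewrite mem_undup => /z /=; rewrite negbK => /eqP ->; rewrite mul0r.
  pose t := [seq l <- map snd s | expcoef s l != 0].
  have tP l : (l \in t) = P l by rewrite mem_filter andbC.
  have l1t : l1 \in t by rewrite tP /P l1s.
  exists (\big[Order.max/l1]_(l <- t) l); split.
    rewrite -tP big_seq; elim/big_ind: _ => // a c; by case: (leP a c).
  by move=> l; rewrite -tP => lt; exact: le_bigmax_seq.
(* After division by the dominant exponential every other term decays and the leading coefficient
   remains. *)
have cv : ccvg \oo (fun m : nat => expev s (rchar m%:R) * rchar m%:R (- l0)) (expcoef s l0).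
  have -> : expcoef s l0 = \sum_(l <- undup (map snd s)) expcoef s l * (l == l0)%:R.
    rewrite (bigD1_seq l0) ?undup_uniq ?mem_undup ?(andP Pl0).1 //= eqxx mulr1.
    by rewrite big1 ?addr0 // => l /negPf ->; rewrite mulr0.
  under eq_fun do rewrite expevE mulr_suml.
  rewrite big_seq; under eq_fun do rewrite big_seq.
  apply: ccvg_sum => l; rewrite mem_undup => ls.
  have [c0|c0] := eqVneq (expcoef s l) 0.
    by under eq_fun do rewrite c0 !mul0r; rewrite c0 mul0r; exact: ccvg_cst.
  under eq_fun do rewrite -mulrA; apply: ccvgM; first exact: ccvg_cst.
  under eq_fun do rewrite -(rchar_character _).2.
  have [->|ll0] := eqVneq l l0.
    by under eq_fun do rewrite subrr (rchar_character _).1; exact: ccvg_cst.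
  have ll : l < l0 by rewrite lt_neqAle ll0 l0max // /P ls c0.
  apply: ccvg_real; have d0 : 0 < l0 - l by rewrite subr_gt0.
  have -> : (fun m : nat => expR (m%:R * (l - l0))) = (fun m : nat => expR (l - l0) ^+ m).
    by apply/funext => m; rewrite expRM_natl.
  apply: cvg_expr; rewrite ger0_norm ?expR_ge0 // -expR0 ltr_expR; lra.
have /eqP nz0 : expcoef s l0 != 0 by case/andP: Pl0.
have [cr ci] := cv.
have [m0 _ hm0] : \forall m \near \oo, expev s (rchar m%:R) * rchar m%:R (- l0) != 0.
  have z0 : 0 < Num.sqrt (sqn (expcoef s l0)).
    by rewrite sqrtr_gt0 /sqn normc2_gt0 //; exact/eqP.
  have key (u : nat -> R) (c : R) : u x @[x --> \oo] --> c -> c != 0 -> \forall m \near \oo, u m != 0.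
    move=> uc c0; have e0 : 0 < `|c| / 2 by rewrite divr_gt0 // normr_gt0.
    have /rcvgP/(_ _ e0) := uc; apply: filterS => m /= h1; apply: contraTneq h1 => ->.
    by rewrite sub0r normrN -ltNge ltr_pdivrMr // ltr_pMr ?normr_gt0 // ltr1n.
  have [r0|r0] := eqVneq (complex.Re (expcoef s l0)) 0; last first.
    by apply: filterS (key _ _ cr r0) => m; apply: contra_neq => ->.
  have i0 : complex.Im (expcoef s l0) != 0.
    by apply/eqP => i0; apply: nz0; apply: complexP.
  by apply: filterS (key _ _ ci i0) => m; apply: contra_neq => ->.
exists m0 => // m /hm0 /=; rewrite sE; last exact: rchar_character.
by apply: contra_neq => ->; rewrite mul0r.
Qed.

End Line.

End PolynomialFunctions.

(** * Continuity and derivative of the exponential *)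

Section MexpContinuity.
Variable R : realType.
Notation C := R[i].

Lemma mexp_lip n (A B : 'M[C]_n) (M : R) : fnorm A <= M -> fnorm B <= M ->
  fnorm (mexp A - mexp B) <= fnorm (1%:M : 'M[C]_n) * expR M * fnorm (A - B).
Proof.
move=> AM BM; set c := fnorm (1%:M : 'M[C]_n); set d := fnorm (A - B).
have c0 : 0 <= c by exact: fnorm_ge0.
have d0 : 0 <= d by exact: fnorm_ge0.
have M0 : 0 <= M by exact: le_trans (fnorm_ge0 A) AM.
have powB k : fnorm (B ^+ k) <= c * M ^+ k.
  apply: le_trans (fnorm_exp_le B k) _; rewrite ler_wpM2l //.
  by rewrite lerXn2r ?nnegrE ?fnorm_ge0.
have diff k : fnorm (A ^+ k - B ^+ k) <= k%:R * (c * M ^+ k.-1 * d).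
  elim: k => [|k IH]; first by rewrite !expr0 subrr fnorm0 mul0r.
  have -> : A ^+ k.+1 - B ^+ k.+1 = (A *m (A ^+ k - B ^+ k)) + (A - B) *m B ^+ k.
    by rewrite mulmxBr mulmxBl !mxexprS addrA subrK.
  apply: le_trans (fnormD _ _) _; rewrite -natr1 mulrDl mul1r lerD //=.
    apply: le_trans (fnorm_mul _ _) _.
    apply: (@le_trans _ _ (M * (k%:R * (c * M ^+ k.-1 * d)))).
      by apply: ler_pM => //; exact: fnorm_ge0.
    case: k {IH} => [|k] /=; first by rewrite !mul0r mulr0.
    by rewrite exprS !mulrA [M * k.+1%:R]mulrC -!mulrA [M * (c * _)]mulrCA.
  apply: le_trans (fnorm_mul _ _) _; rewrite mulrC -/d.
  by rewrite ler_wpM2r // powB.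
have h : fnorm (expseq A m.+1 - expseq B m.+1) @[m --> \oo] --> fnorm (mexp A - mexp B).
  have sh : (fun m : nat => m.+1) @ \oo --> \oo by have := @cvg_addnl 1.
  apply: cvg_fnorm; exact: (mcvg_comp sh (mcvgB (expmx_cvg A) (expmx_cvg B))).
apply: (rcvg_le _ h (cvg_cst _)); apply: filterE => m /=.
rewrite /expseq /series /= -sumrB big_ltn // !expr0 subrr add0r.
apply: le_trans (fnorm_sum _ _ _) _.
rewrite big_add1 /=.
apply: (@le_trans _ _ (\sum_(0 <= k < m) c * d * exp_coeff M k)).
  apply: ler_sum => k _; rewrite -scalerBr natr_complex invr_complex fnormZ.
  rewrite ger0_norm ?invr_ge0 //; apply: le_trans (ler_wpM2l _ (diff k.+1)) _; rewrite ?invr_ge0 //=.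
  rewrite /exp_coeff /= factS natrM invfM mulrACA mulVf ?pnatr_eq0 // mul1r.
  by rewrite le_eqVlt; apply/orP; left; apply/eqP; ring.
rewrite -mulr_sumr mulrAC ler_wpM2r // ler_wpM2l // /expR.
have nd : nondecreasing_seq (series (exp_coeff M)).
  by apply/nondecreasing_seqP => k; rewrite /series /= big_nat_recr //= lerDl exp_coeff_ge0.
exact: (nondecreasing_cvgn_le nd (@is_cvg_series_exp_coeff R M) m).
Qed.

Lemma mcvg_mexp n (T : Type) (F : set_system T) (f : T -> 'M[C]_n) L : Filter F ->
  mcvg F f L -> mcvg F (fun x => mexp (f x)) (mexp L).
Proof.
move=> FF fL; have /mcvg_fnormP dL := fL.
pose M := fnorm L + 1; pose c := fnorm (1%:M : 'M[C]_n) * expR M.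
apply: (mcvg_squeeze (e := fun x => c * fnorm (f x - L))); last first.
  by rewrite -[X in _ --> X](mulr0 c); apply: cvgM => //; exact: cvg_cst.
have /rcvgP/(_ 1 ltr01) := dL; apply: filterS => x /=; rewrite subr0 ger0_norm ?fnorm_ge0 // => h.
apply: mexp_lip; last by rewrite lerDl.
by rewrite -(subrK L (f x)) (le_trans (fnormD _ _)) // addrC lerD2l.
Qed.

Lemma dnbhs0_id : t @[t --> (0 : R)^'] --> (0 : R).
Proof. exact: cvg_within. Qed.

Lemma dnbhs0_neq : (0 : R)^' [set t : R | t != 0].
Proof. exact: (@nbhs_dnbhs_neq R 0). Qed.

Lemma mexp_deriv n (X : 'M[C]_n) :
  mcvg (0 : R)^' (fun t : R => (t^-1)%:C *: (mexp (t%:C *: X) - 1%:M)) X.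
Proof.
pose c := fnorm (1%:M : 'M[C]_n) * expR 1 * fnorm X ^+ 2.
apply: (mcvg_squeeze (e := fun t => c * `|t|)); last first.
  rewrite -[X in _ --> X](mulr0 c); apply: cvgM; first exact: cvg_cst.
  rewrite -[X in _ --> X](normr0 R); exact: cvg_norm dnbhs0_id.
have e0 : 0 < (fnorm X + 1)^-1 by rewrite invr_gt0 ltr_wpDl ?fnorm_ge0.
have /rcvgP/(_ _ e0) small := dnbhs0_id.
have nz := @dnbhs0_neq.
apply: filterS2 small nz => t /=; rewrite subr0 => tX t0.
have tX1 : fnorm (t%:C *: X) <= 1.
  rewrite fnormZ; apply: (@le_trans _ _ ((fnorm X + 1)^-1 * fnorm X)).
    by rewrite ler_wpM2r ?fnorm_ge0.
  by rewrite ler_pdivrMl ?mulr1 ?lerDl // ltr_wpDl ?fnorm_ge0.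
have := expmx_linear_approx tX1.
have -> : (t^-1)%:C *: (mexp (t%:C *: X) - 1%:M) - X =
   (t^-1)%:C *: (mexp (t%:C *: X) - 1%:M - t%:C *: X).
  by rewrite [in RHS]scalerBr scalerA -rmorphM mulVf // scale1r.
rewrite fnormZ fnormZ normfV exprMn => h.
rewrite ler_pdivrMl ?normr_gt0 //; apply: le_trans h _.
by rewrite /c le_eqVlt; apply/orP; left; apply/eqP; ring.
Qed.

Lemma ccvg_dnbhs0 : ccvg (0 : R)^' (fun t : R => t%:C) 0.
Proof. by apply: ccvg_real; exact: dnbhs0_id. Qed.

Lemma mexp_cvg1 n (X : 'M[C]_n) : mcvg (0 : R)^' (fun t : R => mexp (t%:C *: X)) 1%:M.
Proof.
rewrite -[X in mcvg _ _ X](expmx0 R n) -(scale0r X); apply: mcvg_mexp.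
by apply: mcvgZ; [exact: ccvg_dnbhs0|exact: mcvg_cst].
Qed.

(** The derivative at 0 of E(t)†E(t) = 1. *)
Lemma skew_of_unitary n (X : 'M[C]_n) :
  (forall t : R, is_unitary (mexp (t%:C *: X))) -> X^H = - X.
Proof.
move=> XU; apply/eqP; rewrite -addr_eq0; apply/eqP.
pose Q (t : R) := (t^-1)%:C *: (mexp (t%:C *: X) - 1%:M).
apply: (@mcvg_unique R _ (0 : R)^' _ _ _ (fun t => (Q t)^H *m mexp (t%:C *: X) + Q t)).
  rewrite -[X in _ (X + _)]mulmx1; apply: mcvgD; last exact: mexp_deriv.
  by apply: mcvg_mul; [apply: mcvg_adj; exact: mexp_deriv|exact: mexp_cvg1].
have -> : (fun t => (Q t)^H *m mexp (t%:C *: X) + Q t) = fun=> 0; last exact: mcvg_cst.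
apply/funext => t; rewrite /Q adjZr -scalemxAl -scalerDr adjB adj1 mulmxBl mul1mx.
by rewrite (XU t) addrA subrK subrr scaler0.
Qed.

Lemma expR_small (z : R) : `|expR z - 1| <= 2^-1 -> `|z| <= 2 * `|expR z - 1|.
Proof.
have [z0|z0] := lerP 0 z.
  have e := expR_ge1Dx z; rewrite (ger0_norm z0) (ger0_norm (x := expR z - 1)); last by lra.
  by move=> _; lra.
have e := expR_ge1Dx (- z).
have e1 : expR z < 1 by rewrite -expR0 ltr_expR.
rewrite (ltr0_norm z0) (ltr0_norm (x := expR z - 1)) => [l|]; last by lra.
have := ler_wpM2l (expR_ge0 z) e; rewrite -expRD subrr expR0.
have : 0 <= (expR z - 2^-1) * (- z) by rewrite mulr_ge0 //; lra.
move: (expR z) l => w; lra.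
Qed.

(** Eigenvalue by eigenvalue, from |z| ≤ 2|e^z - 1| when the right-hand modulus is at most 1/2. *)
Lemma log_small n (Z : 'M[C]_n) : Z^H = Z -> fnorm (mexp Z - 1%:M) <= 2^-1 ->
  fnorm Z <= 2 * fnorm (mexp Z - 1%:M).
Proof.
move=> ZH; have [U [y [UU ZE]]] := herm_spectral ZH.
have e1 : mexp Z - 1%:M = U *m dgr (\row_j (expR (y 0 j) - 1)) *m U^H.
  have := @expmx_real _ n U y 1 UU; rewrite scale1r -ZE => ->.
  rewrite -(ufun1 y UU) -ufun_id -/(ufun _ _ _).
  have -> : ufun U (real_complex R) (\row_j (expR (y 0 j) - 1)) =
     ufun U (fun x => (expR (1 * x))%:C - 1) y.
    by congr (_ *m diag_mx _ *m _); apply/rowP => j; rewrite !mxE mul1r rmorphB.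
  rewrite /ufun -mulmxBl -mulmxBr; congr (_ *m _ *m _).
  by apply/matrixP => i j; rewrite !mxE -mulrnBl.
rewrite e1 => h.
have ent j : `|expR (y 0 j) - 1| <= 2^-1.
  apply: le_trans h; rewrite -(@ler_pXn2r _ 2) ?nnegrE ?fnorm_ge0 // fnorm_dgr //.
  rewrite real_normK ?num_real // (bigD1 j) //= mxE lerDl.
  by apply: sumr_ge0 => i _; exact: sqr_ge0.
rewrite -(@ler_pXn2r _ 2) ?nnegrE ?mulr_ge0 ?fnorm_ge0 // exprMn [in leLHS]ZE !fnorm_dgr //.
rewrite mulr_sumr; apply: ler_sum => j _; rewrite mxE -exprMn.
rewrite -[y 0 j ^+ 2]real_normK ?num_real // -[(2 * _) ^+ 2]real_normK ?num_real //.
rewrite ler_pXn2r ?nnegrE // normrM [`|2|]ger0_norm //.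
exact: expR_small (ent j).
Qed.

End MexpContinuity.

(** * The self-adjoint group, its maximal compact subgroup and i𝔨 *)

Section SelfAdjointGroup.
Variables (R : realType) (n : nat) (G : set 'M[R[i]]_n).
Notation C := R[i].
Hypotheses (hGalg : is_algebraic_group G) (hGadj : self_adjoint G).

Lemma G_unit g : G g -> g \in unitmx.
Proof. by case: hGalg => -[h _ _ _] _ /h. Qed.

Lemma G_1 : G 1%:M.
Proof. by case: hGalg => -[]. Qed.

Lemma G_mul g h : G g -> G h -> G (g *m h).
Proof. by case: hGalg => -[_ _ m _] _; exact: m. Qed.

Lemma G_inv g : G g -> G (invmx g).
Proof. by case: hGalg => -[_ _ _ v] _; exact: v. Qed.

Lemma G_adj g : G g -> G g^H.
Proof. by move=> Gg; rewrite -hGadj; exists g => //; rewrite adj_trmxC. Qed.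

Lemma G_zariski : exists S : set ('M[C]_n -> C), (forall f, S f -> polyfun f) /\
  forall g, g \in unitmx -> (forall f, S f -> f g = 0) -> G g.
Proof.
case: hGalg => _ [S GE]; exists [set f | exists2 p, S p & f = mx_eval p].
split=> [f [p _ ->]|g gU h]; first exact: mx_eval_polyfun.
by rewrite GE; split => // p Sp; apply: h; exists p.
Qed.

Lemma G_closed (T : Type) (F : set_system T) (f : T -> 'M[C]_n) L : ProperFilter F ->
  F [set x | G (f x)] -> mcvg F f L -> L \in unitmx -> G L.
Proof.
move=> FF fG fL LU; case: hGalg => _ [S GE]; rewrite GE; split => // p Sp.
have := ccvg_polyfun FF (mx_eval_polyfun p) fL => h; apply: (ccvg_unique (F := F) h).
have [h1 h2] := @ccvg_cst R T F _ 0.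
split; [apply: cvg_trans h1|apply: cvg_trans h2]; apply: near_eq_cvg;
  by apply: filterS fG => x; rewrite GE => -[_ /(_ p Sp) ->].
Qed.

Definition Ku : set 'M[C]_n := [set k | G k /\ is_unitary k].
(** The space i𝔨 described by Hermitian one-parameter groups inside G, with no reference to K; [ikP]
    shows that it is i times the Lie algebra of K. *)
Definition ik : set 'M[C]_n := [set H | H^H = H /\ forall t : R, G (mexp (t%:C *: H))].

Lemma ufun_char_unit (U : 'M[C]_n) b (y : 'rV[R]_n) : is_unitary U -> character b ->
  ufun U b y \in unitmx.
Proof.
move=> UU [b0 bD]; apply: (@cmulmx1_unit _ _ _ (ufun U (fun x => b (- x)) y)).
rewrite ufunM // -[RHS](ufun1 y UU); apply: ufun_eq => j.
by rewrite -bD subrr.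
Qed.

Lemma G_line_nat (U : 'M[C]_n) (y : 'rV[R]_n) : is_unitary U ->
  (forall m : nat, G (ufun U (rchar m%:R) y)) -> forall b, character b -> G (ufun U b y).
Proof.
move=> UU Gm b cb; case: hGalg => _ [S GE]; rewrite GE; split; first exact: ufun_char_unit.
move=> p Sp; have := @line_nat_zero R n U 1%:M 1%:M y _ (mx_eval_polyfun p).
rewrite -[ufun U b y]mul1mx -[1%:M *m _]mulmx1; apply => // m.
by rewrite mul1mx mulmx1; have := Gm m; rewrite {1}GE => -[_]; apply.
Qed.

Lemma G_line_imaginary (U : 'M[C]_n) (y : 'rV[R]_n) : is_unitary U ->
  (forall t : R, G (ufun U (ichar t) y)) -> forall b, character b -> G (ufun U b y).
Proof.
move=> UU Gm b cb; case: hGalg => _ [S GE]; rewrite GE; split; first exact: ufun_char_unit.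
move=> p Sp; have := @line_imaginary_zero R n U 1%:M 1%:M y _ (mx_eval_polyfun p).
rewrite -[ufun U b y]mul1mx -[1%:M *m _]mulmx1; apply => // m.
by rewrite mul1mx mulmx1; have := Gm m; rewrite {1}GE => -[_]; apply.
Qed.

Lemma ik_of_powers H : H^H = H -> (forall m : nat, G (mexp (m%:R%:C *: H))) -> ik H.
Proof.
move=> HH Gm; split=> // t; have [U [y [UU HE]]] := herm_spectral HH.
rewrite HE expmx_real //; apply: (G_line_nat UU) => [m|]; last exact: rchar_character.
by have := Gm m; rewrite HE expmx_real.
Qed.

(** The powers of e^H lie in G, and they are Zariski dense in the whole one-parameter group. *)
Lemma ik_of_exp H : H^H = H -> G (mexp H) -> ik H.
Proof.
move=> HH GH; apply: ik_of_powers => // m; elim: m => [|m IH].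
  by rewrite scale0r expmx0; exact: G_1.
rewrite -natr1 expmx_hermD // (_ : 1%:C *: H = H) ?scale1r //; exact: G_mul.
Qed.

(** The equations of G hold at the integer points of the real line e^{tH}, hence at every character,
    in particular on e^{itH}. *)
Lemma ik_imaginary H : ik H -> forall t : R, Ku (mexp (Complex 0 t *: H)).
Proof.
move=> [HH Gm] t; split; last exact: expmx_herm_unitary.
have [U [y [UU HE]]] := herm_spectral HH; rewrite HE expmx_imaginary //.
apply: (G_line_nat UU) => [m|]; last exact: ichar_character.
by have := Gm m%:R; rewrite HE expmx_real.
Qed.

Lemma ik_of_imaginary H : H^H = H -> (forall t : R, G (mexp (Complex 0 t *: H))) -> ik H.
Proof.
move=> HH Gm; split=> // t; have [U [y [UU HE]]] := herm_spectral HH.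
rewrite HE expmx_real //; apply: (G_line_imaginary UU) => [m|]; last exact: rchar_character.
by have := Gm m; rewrite HE expmx_imaginary.
Qed.

Lemma KuE k : unitary_part G k <-> Ku k.
Proof. by split=> [[Gk /unitarymxE]|[Gk kU]]; split => //; apply/unitarymxE. Qed.

Lemma lie_skew X (T : set 'M[C]_n) : (T `<=` Ku) -> lie_algebra T X -> X^H = - X.
Proof.
by move=> TK XT; apply: skew_of_unitary => t; have := XT t; rewrite mexpE => /TK[].
Qed.

Lemma ilieP (T : set 'M[C]_n) H : T `<=` Ku ->
  ilie T H <-> H^H = H /\ forall t : R, T (mexp (Complex 0 t *: H)).
Proof.
move=> TK; split.
  move=> [X XT <-]; have Xs := lie_skew TK XT; split.
    rewrite adjZ Xs scalerN -scaleNr; congr (_ *: _).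
    by apply: complexP => /=; ring.
  move=> t; have := XT (- t); rewrite mexpE; congr (T (mexp _)).
  by rewrite scalerA; congr (_ *: _); apply: complexP => /=; ring.
move=> [HH HT]; exists (Complex 0 (-1) *: H); last first.
  rewrite scalerA (_ : _ * _ = 1) ?scale1r //; apply: complexP => /=; ring.
move=> t; have := HT (- t); rewrite mexpE; congr (T (mexp _)).
by rewrite scalerA; congr (_ *: _); apply: complexP => /=; ring.
Qed.

Lemma ikP H : ilie (unitary_part G) H <-> ik H.
Proof.
have KK : unitary_part G `<=` Ku by move=> k /KuE.
split=> [/(ilieP _ KK)[HH HT]|ikH].
  by apply: ik_of_imaginary => // t; have /KuE[] := HT t.
by apply/(ilieP _ KK); split; [case: ikH|move=> t; apply/KuE; exact: ik_imaginary].
Qed.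

Lemma ik_lie_algebra H : ik H -> lie_algebra G H.
Proof. by move=> [_ h] t; rewrite mexpE. Qed.

Lemma Ku_mul k l : Ku k -> Ku l -> Ku (k *m l).
Proof. by move=> [Gk kU] [Gl lU]; split; [exact: G_mul|exact: unitary_mul]. Qed.

Lemma Ku_adj k : Ku k -> Ku k^H.
Proof. by move=> [Gk kU]; split; [exact: G_adj|exact: unitary_adj]. Qed.

Lemma Ku_1 : Ku 1%:M.
Proof. by split; [exact: G_1|exact: unitarymx1]. Qed.

Lemma Ku_closed (T : Type) (F : set_system T) (f : T -> 'M[C]_n) L : ProperFilter F ->
  F [set x | Ku (f x)] -> mcvg F f L -> Ku L.
Proof.
move=> FF fK fL; have LU : is_unitary L.
  by apply: unitarymx_closed fL; apply: filterS fK => x [].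
by split=> //; apply: G_closed fL _; [apply: filterS fK => x []|exact: unitary_unit].
Qed.

Lemma ik_scale (a : R) H : ik H -> ik (a%:C *: H).
Proof.
move=> [HH Gm]; split=> [|t]; first by rewrite adjZr HH.
by rewrite scalerA -rmorphM; exact: Gm.
Qed.

Lemma ik_opp H : ik H -> ik (- H).
Proof. by move=> /(ik_scale (-1)); rewrite scaleN1c. Qed.

Lemma ik_0 : ik 0.
Proof. by split=> [|t]; [rewrite adj0|rewrite scaler0 expmx0; exact: G_1]. Qed.

Lemma ik_conj k H : Ku k -> ik H -> ik (k *m H *m k^H).
Proof.
move=> [Gk kU] [HH Gm]; split=> [|t].
  by rewrite !adjM adjK HH mulmxA.
rewrite scalemxAl scalemxAr expmx_conj //.
by apply: G_mul; [exact: G_mul|exact: G_adj].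
Qed.

Lemma ik_closed (T : Type) (F : set_system T) (f : T -> 'M[C]_n) L : ProperFilter F ->
  F [set x | ik (f x)] -> mcvg F f L -> ik L.
Proof.
move=> FF fK fL.
have LH : L^H = L.
  apply: (mcvg_unique (F := F) (mcvg_adj fL)); apply: near_mcvg fL.
  by apply: filterS fK => x [-> _].
split=> // t; apply: (G_closed (F := F) (f := fun x => mexp (t%:C *: f x))).
- by apply: filterS fK => x [_]; apply.
- by apply: mcvg_mexp; apply: mcvgZ => //; exact: ccvg_cst.
- exact: expmx_herm_unit.
Qed.

Lemma G_log x : @posdef R n x -> G x -> exists2 H, ik H & x = mexp H.
Proof.
move=> xp Gx; have [H HH xE] := posdef_log xp.
by exists H => //; apply: ik_of_exp => //; rewrite -xE.
Qed.

Lemma posdef_gram g : g \in unitmx -> @posdef R n (g^H *m g).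
Proof.
move=> gU; split.
  by apply/is_hermitianmxP; rewrite expr0 scale1r adj_trmxC adjM adjK.
move=> u u0; rewrite adj_trmxC; have gu0 : g *m u != 0.
  apply: contra u0 => /eqP gu; rewrite -(mulKmx gU u) gu mulmx0; exact: eqxx.
rewrite !mulmxA -adjM -mulmxA.
have -> : ((g *m u)^H *m (g *m u)) 0 0 = (rinner (g *m u) (g *m u))%:C.
  apply: complexP => /=.
    by rewrite -rinner_adj rinner_tr adjK trace_mx11.
  rewrite mxE Im_sum big1 // => k _; rewrite adjE ImM ReJ ImJ; ring.
rewrite ltcR lt_def rinner_ge0 andbT; apply: contra gu0 => /eqP/rinner_eq0 ->; exact: eqxx.
Qed.

(** The logarithm of g†g lies in i𝔨, so its square root is again in G, and so is the unitary
    factor. *)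
Lemma G_polar g : G g -> exists k, exists H, [/\ Ku k, ik H & g = k *m mexp H].
Proof.
move=> Gg; have [H2 ikH2 E] := G_log (posdef_gram (G_unit Gg)) (G_mul (G_adj Gg) Gg).
have ikH := ik_scale 2^-1 ikH2; set H := 2^-1%:C *: H2 in ikH.
have [H2H _] := ikH2; have [HH HG] := ikH.
have eE : mexp H *m mexp H = g^H *m g by rewrite E -(expmx_half H2H).
have eH : (mexp H)^H = mexp H by have := expmx_herm HH 1; rewrite scale1r.
have GeH : G (mexp H) by have := HG 1; rewrite scale1r.
have eU := G_unit GeH.
exists (g *m invmx (mexp H)), H; split=> //; last by rewrite mulmxKV.
split; first by apply: G_mul => //; exact: G_inv.
have iH : (invmx (mexp H))^H = invmx (mexp H).
  by symmetry; apply: cmulmx1_invmx; rewrite -{1}eH -adjM mulVmx // adj1.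
by rewrite /is_unitary adjM iH mulmxA -(mulmxA _ g^H) -eE mulmxA mulVmx // mul1mx mulmxV.
Qed.

(** The logarithms of the points x_t lie in i𝔨, and log x_t differs from x_t - 1 by a term of second
    order; as i𝔨 is closed, it contains the velocity. This is how i𝔨 is shown to be closed under
    sums, and how tangent vectors of P_n ∩ G are identified. *)
Lemma ik_tangent (T : Type) (F : set_system T) (x : T -> 'M[C]_n) (tau : T -> R) X :
  ProperFilter F -> tau t @[t --> F] --> (0 : R) -> F [set t | tau t != 0] ->
  F [set t | @posdef R n (x t) /\ G (x t)] ->
  mcvg F (fun t => ((tau t)^-1)%:C *: (x t - 1%:M)) X -> ik X.
Proof.
move=> FF tau0 taun xG xX.
have x1 : mcvg F x 1%:M.
  have h : mcvg F (fun t => (tau t)%:C *: (((tau t)^-1)%:C *: (x t - 1%:M)) + 1%:M) 1%:M.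
    rewrite -[X in mcvg _ _ X]add0r -(scale0r X); apply: mcvgD; last exact: mcvg_cst.
    by apply: mcvgZ => //; exact: ccvg_real tau0.
  apply: near_mcvg h; apply: filterS taun => t t0.
  by rewrite scalerA -rmorphM mulfV // scale1r subrK.
have logx t : exists Z, (@posdef R n (x t) /\ G (x t)) -> ik Z /\ x t = mexp Z.
  have [[xp Gx]|nx] := pselect (@posdef R n (x t) /\ G (x t)).
    by have [Z ikZ xE] := G_log xp Gx; exists Z.
  by exists 0.
pose Z t := projT1 (cid (logx t)).
have ZE t : (@posdef R n (x t) /\ G (x t)) -> ik (Z t) /\ x t = mexp (Z t).
  by rewrite /Z; case: cid.
apply: (@ik_closed T F (fun t => ((tau t)^-1)%:C *: Z t)).
  by apply: filterS xG => t /ZE[/(ik_scale (tau t)^-1)].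
pose Q t := ((tau t)^-1)%:C *: (x t - 1%:M).
have -> : (fun t => ((tau t)^-1)%:C *: Z t) = (fun t => Q t - (Q t - ((tau t)^-1)%:C *: Z t)).
  by apply/funext => t; rewrite opprB addrCA subrr addr0.
rewrite -[X]subr0; apply: mcvgB => //.
(* The 4 is the square of the factor 2 in [log_small]. *)
pose c := fnorm (1%:M : 'M[C]_n) * expR 1 * 4.
apply: (mcvg_squeeze (e := fun t => c * (fnorm (Q t) ^+ 2 * `|tau t|))); last first.
  rewrite -[X in _ --> X](mulr0 c); apply: cvgM; first exact: cvg_cst.
  rewrite -[X in _ --> X](mulr0 (fnorm X ^+ 2)); apply: cvgM.
    by rewrite expr2; under eq_fun do rewrite expr2; apply: cvgM; exact: cvg_fnorm.
  by rewrite -[X in _ --> X](normr0 R); exact: cvg_norm.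
have e0 : 0 < 2^-1 :> R by rewrite invr_gt0.
have /mcvg_fnormP/rcvgP/(_ _ e0) h1 := x1.
apply: filterS3 h1 taun xG => t /= + t0 /ZE[[ZH _] xE].
rewrite !subr0 ger0_norm ?fnorm_ge0 // => hx.
have := log_small ZH; rewrite -xE => /(_ hx) Zx.
have Z1 : fnorm (Z t) <= 1 by apply: le_trans Zx _; rewrite mulrC -ler_pdivlMr // mul1r.
have := expmx_linear_approx Z1; rewrite -xE => app.
rewrite /Q -scalerBr fnormZ; rewrite fnormZ exprMn normfV.
have tp : 0 < `|tau t| by rewrite normr_gt0.
set s := `|tau t| in tp *.
have -> : c * (s^-1 ^+ 2 * fnorm (x t - 1%:M) ^+ 2 * s) = s^-1 * (c * fnorm (x t - 1%:M) ^+ 2).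
  by field; exact: lt0r_neq0.
rewrite ler_wpM2l ?invr_ge0 ?(ltW tp) //; apply: le_trans app _.
rewrite /c -!mulrA ler_wpM2l ?fnorm_ge0 // ler_wpM2l ?expR_ge0 //.
have -> : 4 = 2 ^+ 2 :> R by rewrite expr2 -natrM.
by rewrite -exprMn lerXn2r ?nnegrE ?mulr_ge0 ?fnorm_ge0.
Qed.

(** The curve e^{tX/2} e^{tY} e^{tX/2} consists of positive definite elements of G and has velocity
    X + Y at 0. *)
Lemma ik_add X Y : ik X -> ik Y -> ik (X + Y).
Proof.
move=> ikX ikY; have [XH XG] := ikX; have [YH YG] := ikY.
pose A (t : R) := mexp (t%:C *: (2^-1%:C *: X)); pose B (t : R) := mexp (t%:C *: Y).
pose B2 (t : R) := mexp ((t / 2)%:C *: Y).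
have BE t : B t = (B2 t)^H *m B2 t.
  by rewrite /B2 expmx_herm // -expmx_hermD // -splitr.
have AH t : (A t)^H = A t by rewrite /A scalerA -rmorphM; exact: (expmx_herm XH).
have AG t : G (A t) by rewrite /A scalerA -rmorphM; exact: XG.
apply: (@ik_tangent R (0 : R)^' (fun t => A t *m B t *m A t) id).
- exact: dnbhs0_id.
- exact: dnbhs0_neq.
- apply: filterE => t; split; last exact: (G_mul (G_mul (AG t) (YG t)) (AG t)).
  have -> : A t *m B t *m A t = (B2 t *m A t)^H *m (B2 t *m A t).
    by rewrite BE adjM AH !mulmxA.
  exact: (posdef_gram (G_unit (G_mul (YG _) (AG t)))).
pose QA t := (t^-1)%:C *: (A t - 1%:M); pose QB t := (t^-1)%:C *: (B t - 1%:M).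
have -> : (fun t => (t^-1)%:C *: (A t *m B t *m A t - 1%:M)) =
    (fun t => QA t *m (B t *m A t) + (QB t *m A t + QA t)).
  apply/funext => t; rewrite /QA /QB -!scalemxAl -!scalerDr; congr (_ *: _).
  by rewrite !mulmxBl !mul1mx mulmxA !subrKA.
have -> : X + Y = 2^-1%:C *: X *m (1%:M *m 1%:M) + (Y *m 1%:M + 2^-1%:C *: X).
  rewrite !mulmx1 addrCA -scalerDl -rmorphD.
  have h : 2^-1 + 2^-1 = 1 :> R by rewrite [RHS]splitr mul1r.
  by rewrite h addrC (scale1r X).
have cA : mcvg (0 : R)^' A 1%:M by exact: mexp_cvg1.
have cB : mcvg (0 : R)^' B 1%:M by exact: mexp_cvg1.
have dA : mcvg (0 : R)^' QA (2^-1%:C *: X) by exact: mexp_deriv.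
have dB : mcvg (0 : R)^' QB Y by exact: mexp_deriv.
apply: mcvgD; first by apply: mcvg_mul => //; exact: mcvg_mul.
by apply: mcvgD => //; exact: mcvg_mul.
Qed.

Lemma ik_sub X Y : ik X -> ik Y -> ik (X - Y).
Proof. by move=> ikX ikY; apply: ik_add => //; exact: ik_opp. Qed.

(** The derivative at 0 of the conjugation of H by e^{itA}. *)
Lemma ik_bracket A H : ik A -> ik H -> ik (Complex 0 1 *: (A *m H - H *m A)).
Proof.
move=> ikA ikH; have [AH _] := ikA.
pose E (t : R) := mexp (t%:C *: (Complex 0 1 *: A)).
have EK t : Ku (E t).
  rewrite /E scalerA (_ : _ * _ = Complex 0 t); first exact: ik_imaginary.
  by apply: complexP => /=; ring.
apply: (@ik_closed R (0 : R)^' (fun t => (t^-1)%:C *: (E t *m H *m (E t)^H - H))).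
  by apply: filterE => t; apply: ik_scale; apply: ik_sub => //; exact: ik_conj.
pose Q t := (t^-1)%:C *: (E t - 1%:M).
have -> : (fun t => (t^-1)%:C *: (E t *m H *m (E t)^H - H)) =
    (fun t => Q t *m H *m (E t)^H + H *m (Q t)^H).
  apply/funext => t; rewrite /Q adjZr -!scalemxAl -scalemxAr -scalerDr; congr (_ *: _).
  by rewrite !mulmxBl mul1mx adjB adj1 mulmxBr mulmx1 subrKA.
have -> : Complex 0 1 *: (A *m H - H *m A) =
    (Complex 0 1 *: A) *m H *m (1%:M)^H + H *m (Complex 0 1 *: A)^H.
  rewrite adj1 mulmx1 adjZ AH -scalemxAl -scalemxAr scalerBr; congr (_ + _).
  by rewrite -scaleNr; congr (_ *: _); apply: complexP => /=; rewrite ?oppr0.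
have cE : mcvg (0 : R)^' E 1%:M by exact: mexp_cvg1.
have dE : mcvg (0 : R)^' Q (Complex 0 1 *: A) by exact: mexp_deriv.
apply: mcvgD.
  by apply: mcvg_mul; [apply: mcvg_mul => //; exact: mcvg_cst|exact: mcvg_adj].
by apply: mcvg_mul; [exact: mcvg_cst|exact: mcvg_adj].
Qed.

End SelfAdjointGroup.

(** * Derivatives at the identity *)

Section RealDerivative.
Variable R : realType.

Lemma is_derive_quotient (f : R -> R) (x df : R) :
  h^-1 * (f (h + x) - f x) @[h --> (0 : R)^'] --> df -> is_derive x 1 f df.
Proof.
move=> h0.
have e : (fun h : R => h^-1 *: ((f \o shift x) (h *: 1) - f x)) =
    (fun h => h^-1 * (f (h + x) - f x)).
  by apply/funext => h; rewrite /= /GRing.scale /= mulr1.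
have dv : derivable f x 1 by rewrite /derivable e; apply/cvg_ex; exists df.
apply: DeriveDef => //; rewrite /derive e; exact: cvg_lim.
Qed.

End RealDerivative.

Section Differential.
Variable R : realType.
Notation C := R[i].
Notation FF := ((0 : R)^').

(** The chain rule at the identity by structural induction. One complex linear functional serves all
    curves, which is what makes the Lie algebra representation complex linear. *)
Lemma polyfun_diff n (f : 'M[C]_n -> C) : polyfun f ->
  exists l : 'M[C]_n -> C, (forall (a : C) X Y, l (a *: X + Y) = a * l X + l Y) /\
  forall (c : R -> 'M[C]_n) X, mcvg FF c 1%:M ->
    mcvg FF (fun t => (t^-1)%:C *: (c t - 1%:M)) X ->
    ccvg FF (fun t => (t^-1)%:C * (f (c t) - f 1%:M)) (l X).
Proof.
elim=> [a|i j|f1 f2 p1 [l1 [L1 D1]] p2 [l2 [L2 D2]]|f1 f2 p1 [l1 [L1 D1]] p2 [l2 [L2 D2]]].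
- exists (fun=> 0); split=> [b X Y|c X _ _]; first by rewrite mulr0 addr0.
  by under eq_fun do rewrite subrr mulr0; exact: ccvg_cst.
- exists (fun X => X i j); split=> [b X Y|c X _ h]; first by rewrite !mxE.
  by have := h i j; under eq_fun do rewrite mxE [X in _ * X]mxE [X in _ + X]mxE.
- exists (fun X => l1 X + l2 X); split=> [b X Y|c X c1 cX]; first by rewrite L1 L2; ring.
  have e : (fun t => (t^-1)%:C * (f1 (c t) + f2 (c t) - (f1 1%:M + f2 1%:M))) =
     (fun t => (t^-1)%:C * (f1 (c t) - f1 1%:M) + (t^-1)%:C * (f2 (c t) - f2 1%:M)).
    by apply/funext => t; ring.
  by rewrite e; apply: ccvgD; [exact: D1|exact: D2].
- exists (fun X => l1 X * f2 1%:M + f1 1%:M * l2 X); split=> [b X Y|c X c1 cX].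
    by rewrite L1 L2; ring.
  have e : (fun t => (t^-1)%:C * (f1 (c t) * f2 (c t) - f1 1%:M * f2 1%:M)) =
     (fun t => ((t^-1)%:C * (f1 (c t) - f1 1%:M)) * f2 (c t) +
               f1 1%:M * ((t^-1)%:C * (f2 (c t) - f2 1%:M))).
    by apply/funext => t; ring.
  rewrite e; apply: ccvgD; apply: ccvgM.
  - exact: D1.
  - exact: ccvg_polyfun.
  - exact: ccvg_cst.
  - exact: D2.
Qed.

Lemma mexp_inj n (A B : 'M[C]_n) : (forall t : R, mexp (t%:C *: A) = mexp (t%:C *: B)) -> A = B.
Proof.
move=> AB; apply: (mcvg_unique (F := FF) (mexp_deriv A)).
have -> : (fun t : R => (t^-1)%:C *: (mexp (t%:C *: A) - 1%:M)) =
          (fun t : R => (t^-1)%:C *: (mexp (t%:C *: B) - 1%:M)).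
  by apply/funext => t; rewrite AB.
exact: mexp_deriv.
Qed.

End Differential.

(** * The differential of a rational representation *)

Section Representation.
Variables (R : realType) (n d : nat) (G : set 'M[R[i]]_n).
Notation C := R[i].
Notation FF := ((0 : R)^').
Hypotheses (hGalg : is_algebraic_group G) (hGadj : self_adjoint G).
Variables (rho Pi : 'M[C]_n -> 'M[C]_d).
Hypothesis rho1 : rho 1%:M = 1%:M.
Hypothesis rhoM : forall g h, G g -> G h -> rho (g *m h) = rho g *m rho h.
Hypothesis rho_rat : forall i j, exists2 f, polyfun f & exists k : nat,
  forall g, G g -> rho g i j = f g / \det g ^+ k.
Hypothesis rhoU : forall k, Ku G k -> is_unitary (rho k).
Hypothesis rhoPi : forall X, lie_algebra G X ->
  mcvg FF (fun t => (t^-1)%:C *: (rho (mexp (t%:C *: X)) - 1%:M)) (Pi X).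

(** [Pi] is constrained only on the Lie algebra; [La] is a complex linear map on all matrices
    agreeing with it there, so factors i can be moved through. Writing an entry as f / det^k, one
    differentiates f = ρ det^k by the product rule. *)
Lemma rho_diff : exists La : 'M[C]_n -> 'M[C]_d,
  (forall (a : C) X Y, La (a *: X + Y) = a *: La X + La Y) /\
  forall X, lie_algebra G X -> Pi X = La X.
Proof.
have ent i j : exists l : 'M[C]_n -> C, (forall (a : C) X Y, l (a *: X + Y) = a * l X + l Y) /\
    forall X, lie_algebra G X -> Pi X i j = l X.
  have [f pf [k fk]] := rho_rat i j.
  have pD : polyfun (fun g : 'M[C]_n => \det g ^+ k).
    by apply: polyfun_exp; apply: polyfun_det => a b; exact: polyfun_coord.
  have [lf [Lf Df]] := polyfun_diff pf; have [lD [LD DD]] := polyfun_diff pD.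
  pose u0 := rho 1%:M i j.
  exists (fun X => lf X - u0 * lD X); split=> [a X Y|X GX]; first by rewrite Lf LD; ring.
  have c1 := mexp_cvg1 X; have cX := mexp_deriv X.
  have h1 := Df _ _ c1 cX; have h2 := DD _ _ c1 cX.
  have h3 : ccvg FF (fun t : R => \det (mexp (t%:C *: X)) ^+ k) (\det (1%:M : 'M[C]_n) ^+ k).
    exact: ccvg_polyfun pD c1.
  have h4 : ccvg FF (fun t => (t^-1)%:C * (rho (mexp (t%:C *: X)) i j - u0)) (Pi X i j).
    by have := rhoPi GX i j; rewrite /u0 rho1; under eq_fun do rewrite mxE [X in _ * X]mxE [X in _ + X]mxE.
  have e : (fun t => (t^-1)%:C * (f (mexp (t%:C *: X)) - f 1%:M)) =
     (fun t => (t^-1)%:C * (rho (mexp (t%:C *: X)) i j - u0) * \det (mexp (t%:C *: X)) ^+ k +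
       u0 * ((t^-1)%:C * (\det (mexp (t%:C *: X)) ^+ k - \det (1%:M : 'M[C]_n) ^+ k))).
    apply/funext => t.
    have Gt : G (mexp (t%:C *: X)) by have := GX t; rewrite mexpE.
    have fE g : G g -> f g = rho g i j * \det g ^+ k.
      move=> Gg; rewrite fk // divfK // expf_neq0 // -unitfE -unitmxE.
      exact: G_unit hGalg _ Gg.
    rewrite (fE _ Gt) (fE _ (G_1 hGalg)) -/u0 det1 expr1n; ring.
  rewrite e in h1.
  have h5 := ccvgD (ccvgM h4 h3) (ccvgM (ccvg_cst u0) h2).
  have -> : lf X = Pi X i j * \det (1%:M : 'M[C]_n) ^+ k + u0 * lD X.
    by apply: ccvg_unique h1 _; exact: h5.
  by rewrite det1 expr1n mulr1 addrK.
pose l i j := projT1 (cid (ent i j)).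
have lP i j := projT2 (cid (ent i j)).
exists (fun X => \matrix_(i, j) l i j X); split=> [a X Y|X GX].
  by apply/matrixP => i j; rewrite !mxE; exact: (lP i j).1.
by apply/matrixP => i j; rewrite mxE; exact: (lP i j).2.
Qed.

Variable La : 'M[C]_n -> 'M[C]_d.
Hypothesis LaL : forall (a : C) X Y, La (a *: X + Y) = a *: La X + La Y.
Hypothesis PiLa : forall X, lie_algebra G X -> Pi X = La X.

Lemma La0 : La 0 = 0.
Proof. by have := LaL (-1) 0 0; rewrite scaler0 addr0 scaleN1r addNr. Qed.

Lemma LaD X Y : La (X + Y) = La X + La Y.
Proof. by have := LaL 1 X Y; rewrite !scale1r. Qed.

Lemma LaZ a X : La (a *: X) = a *: La X.
Proof. by have := LaL a X 0; rewrite La0 !addr0. Qed.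

Lemma LaN X : La (- X) = - La X.
Proof. by rewrite -scaleN1r LaZ scaleN1r. Qed.

Lemma LaB X Y : La (X - Y) = La X - La Y.
Proof. by rewrite LaD LaN. Qed.

Lemma rho_deriv X : lie_algebra G X ->
  mcvg FF (fun t => (t^-1)%:C *: (rho (mexp (t%:C *: X)) - 1%:M)) (La X).
Proof. by move=> GX; rewrite -(PiLa GX); exact: rhoPi. Qed.

Lemma rho_cvg1 X : lie_algebra G X -> mcvg FF (fun t => rho (mexp (t%:C *: X))) 1%:M.
Proof.
move=> GX; have h := rho_deriv GX.
have h2 : mcvg FF (fun t : R => t%:C *: ((t^-1)%:C *: (rho (mexp (t%:C *: X)) - 1%:M)) + 1%:M) 1%:M.
  rewrite -[X in mcvg _ _ X]add0r -(scale0r (La X)); apply: mcvgD; last exact: mcvg_cst.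
  by apply: mcvgZ => //; exact: ccvg_dnbhs0.
apply: near_mcvg h2; have := dnbhs0_neq R; apply: filterS => t t0.
by rewrite scalerA -rmorphM mulfV // scale1r subrK.
Qed.

Lemma lie_i H : ik G H -> lie_algebra G (Complex 0 1 *: H).
Proof.
move=> ikH t; rewrite mexpE scalerA (_ : _ * _ = Complex 0 t).
  by have [] := ik_imaginary hGalg ikH t.
by apply: complexP => /=; ring.
Qed.

(** Along e^{itH} the representation is unitary, so La(iH) is skew; linearity over ℂ takes the i
    out. *)
Lemma La_herm H : ik G H -> (La H)^H = La H.
Proof.
move=> ikH; have GX := lie_i ikH; set X := Complex 0 1 *: H in GX.
pose Q t := (t^-1)%:C *: (rho (mexp (t%:C *: X)) - 1%:M).
have XU t : is_unitary (rho (mexp (t%:C *: X))).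
  apply: rhoU; rewrite /X scalerA (_ : _ * _ = Complex 0 t); first exact: ik_imaginary.
  by apply: complexP => /=; ring.
have dQ : mcvg FF Q (La X) by exact: rho_deriv.
have h : (La X)^H *m 1%:M + La X = 0.
  apply: (@mcvg_unique R _ FF _ _ _ (fun t => (Q t)^H *m rho (mexp (t%:C *: X)) + Q t)).
    by apply: mcvgD => //; apply: mcvg_mul; [exact: mcvg_adj|exact: rho_cvg1].
  have -> : (fun t => (Q t)^H *m rho (mexp (t%:C *: X)) + Q t) = fun=> 0; last exact: mcvg_cst.
  apply/funext => t; rewrite /Q adjZr -scalemxAl -scalerDr adjB adj1 mulmxBl mul1mx.
  by rewrite (XU t) subrKA subrr scaler0.
move: h; rewrite mulmx1 /X LaZ adjZ -[conjc _]/(Complex 0 (-1)).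
have -> : Complex 0 (-1) = - (Complex 0 1) :> C by apply: complexP => /=; rewrite ?oppr0.
rewrite scaleNr addrC => /eqP; rewrite subr_eq0 => /eqP h.
have i0 : Complex 0 1 != 0 :> C by apply/eqP => -[] /eqP; rewrite oner_eq0.
by apply: (scalerI i0); rewrite h.
Qed.

(** The product of ρ(e^{tH}) with e^{-t La(H)} has derivative zero everywhere and equals 1 at t =
    0. *)
Lemma rho_exp H : ik G H -> forall t : R, rho (mexp (t%:C *: H)) = mexp (t%:C *: La H).
Proof.
move=> ikH; have LH := La_herm ikH; have [HH HG] := ikH.
have GX := ik_lie_algebra ikH.
pose E (t : R) := rho (mexp (t%:C *: H)); pose A := La H; pose B t := mexp ((- t)%:C *: A).
have ED s t : E (s + t) = E s *m E t by rewrite /E expmx_hermD // rhoM.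
have BD s t : B (s + t) = B t *m B s by rewrite /B opprD addrC expmx_hermD.
have NE t : E 0 = 1%:M /\ B t *m mexp (t%:C *: A) = 1%:M.
  by rewrite /E /B scale0r expmx0 rho1 -{2}(opprK t) expmx_hermNK.
have dE := rho_deriv GX.
have cE := rho_cvg1 GX.
have dB : mcvg FF (fun t => (t^-1)%:C *: (B t - 1%:M)) (- A).
  have := mexp_deriv (- A); apply: near_mcvg; apply: filterE => t.
  by rewrite /B rmorphN scaleNr scalerN.
have BE t : B t *m E t = 1%:M.
  have dz s : mcvg FF (fun h => (h^-1)%:C *: (B (h + s) *m E (h + s) - B s *m E s)) 0.
    have -> : (fun h : R => (h^-1)%:C *: (B (h + s) *m E (h + s) - B s *m E s)) =
       (fun h => B s *m ((h^-1)%:C *: (B h - 1%:M) *m E h + (h^-1)%:C *: (E h - 1%:M)) *m E s).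
      apply/funext => h; rewrite BD ED.
      rewrite -scalemxAl -scalerDr mulmxBl mul1mx subrKA -scalemxAr -scalemxAl.
      by rewrite mulmxBr mulmxBl mulmx1 !mulmxA.
    have -> : 0 = B s *m (- A *m 1%:M + A) *m E s by rewrite mulmx1 addNr mulmx0 mul0mx.
    apply: mcvg_mul; last exact: mcvg_cst.
    apply: mcvg_mul; first exact: mcvg_cst.
    by apply: mcvgD => //; exact: mcvg_mul.
  have B0 : B 0 *m E 0 = 1%:M by rewrite (NE 0).1 mulmx1 /B oppr0 scale0r expmx0.
  rewrite -[RHS]B0; apply/matrixP => i j; apply: complexP.
    apply: (@is_derive_0_is_cst R (fun s => complex.Re ((B s *m E s) i j)) t 0) => s.
    apply: is_derive_quotient; have [+ _] := dz s i j; rewrite [X in complex.Re X]mxE.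
    by under eq_fun do rewrite mxE ReZ [X in complex.Re X]mxE [X in _ + X]mxE ReB.
  apply: (@is_derive_0_is_cst R (fun s => complex.Im ((B s *m E s) i j)) t 0) => s.
  apply: is_derive_quotient; have [_ +] := dz s i j; rewrite [X in complex.Im X]mxE.
  by under eq_fun do rewrite mxE ImZ [X in complex.Im X]mxE [X in _ + X]mxE ImB.
move=> t; have uB : B t \in unitmx by exact: cmulmx1_unit (BE t).
by apply: (can_inj (mulKmx uB)); rewrite -/A -/(E t) BE (NE t).2.
Qed.

(** Both sides generate the same one-parameter group, and [mexp_inj] recovers the generator. *)
Lemma La_conj k H : Ku G k -> ik G H -> La (k *m H *m k^H) = rho k *m La H *m (rho k)^H.
Proof.
move=> Kk ikH; have [Gk kU] := Kk; have Kk' := Ku_adj hGadj Kk.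
have rk : rho k^H = (rho k)^H.
  have kk : rho k *m rho k^H = 1%:M.
    by rewrite -rhoM ?(unitary_mul_adj kU) // ; exact: G_adj.
  have rkU := rhoU Kk.
  have uk : rho k \in unitmx by exact: unitary_unit.
  by apply: (can_inj (mulKmx uk)); rewrite kk (unitary_mul_adj rkU).
have [HH HG] := ikH.
apply: mexp_inj => t; rewrite -(rho_exp (ik_conj hGalg hGadj Kk ikH)).
have -> : t%:C *: (k *m H *m k^H) = k *m (t%:C *: H) *m k^H.
  by rewrite -scalemxAr -scalemxAl.
have -> : t%:C *: (rho k *m La H *m (rho k)^H) = rho k *m (t%:C *: La H) *m (rho k)^H.
  by rewrite -scalemxAr -scalemxAl.
rewrite expmx_conj // (expmx_conj _ (rhoU Kk)) -rk -(rho_exp ikH).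
by rewrite (rhoM (G_mul hGalg Gk (HG t)) (G_adj hGadj Gk)) (rhoM Gk (HG t)).
Qed.

(** By polar decomposition it suffices to see that ρ is unitary on K and Hermitian on exponentials
    of i𝔨. *)
Lemma rho_adj g : G g -> rho g^H = (rho g)^H.
Proof.
move=> Gg; have [k [H [Kk ikH gE]]] := G_polar hGalg hGadj Gg.
have [Gk kU] := Kk; have [HH HG] := ikH; have eH := HG 1; rewrite scale1r in eH.
have rk : rho k^H = (rho k)^H.
  have kk : rho k *m rho k^H = 1%:M.
    by rewrite -rhoM ?(unitary_mul_adj kU) // ; exact: G_adj.
  have rkU := rhoU Kk.
  have uk : rho k \in unitmx by exact: unitary_unit.
  by apply: (can_inj (mulKmx uk)); rewrite kk (unitary_mul_adj rkU).
have e1 : (mexp H)^H = mexp H by have := expmx_herm HH 1; rewrite scale1r.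
have e2 : (rho (mexp H))^H = rho (mexp H).
  have := rho_exp ikH 1; rewrite !scale1r => ->.
  by have := expmx_herm (La_herm ikH) 1; rewrite scale1r.
by rewrite gE adjM e1 (rhoM eH (G_adj hGadj Gk)) rk (rhoM Gk eH) adjM e2.
Qed.

Lemma rho_unit g : G g -> rho g \in unitmx.
Proof.
move=> Gg; apply: (@cmulmx1_unit _ _ _ (rho (invmx g))).
by rewrite -rhoM ?(mulmxV (G_unit hGalg Gg)) //; exact: G_inv.
Qed.

End Representation.

(** * One step of gradient descent *)

Section Descent.
Variable R : realType.
Notation C := R[i].
Notation FF := ((0 : R)^').

Lemma rinner_gt0 n p (w : 'M[C]_(n, p)) : w != 0 -> 0 < rinner w w.
Proof.
move=> w0; rewrite lt_def rinner_ge0 andbT; apply: contra w0 => /eqP/rinner_eq0 ->.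
exact: eqxx.
Qed.

(** The free parameter of [rinner_expmx_ge] is taken to be the mean of A in the state w. *)
Lemma jensen n (A : 'M[C]_n) (w : 'cV[C]_n) : A^H = A -> w != 0 ->
  expR (rinner w (A *m w) / rinner w w) * rinner w w <= rinner w (mexp A *m w).
Proof.
move=> AH w0; have q := rinner_gt0 w0.
have := rinner_expmx_ge w (rinner w (A *m w) / rinner w w) AH.
apply: le_trans; rewrite ler_wpM2l ?expR_ge0 //.
by rewrite mulrBl mul1r divfK ?gt_eqF // subrK.
Qed.

(** Here a = ‖Aw‖², b = ‖Bw‖², c = ⟨Aw, Bw⟩, q = ‖w‖², while al and be are the quadratic forms of A
    and B at w. After multiplication by 2Lq² the claim is a sum of nonnegative terms: the variance
    of A - B, the square of be, and the slack in the bound b ≤ Lyq. *)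
Lemma cov_ge0 (L q a b c al be y : R) : 0 < L -> 0 < q ->
  (al - be) ^+ 2 <= q * (a - c - (c - b)) -> b <= L * y * q ->
  0 <= - 2 * ((2 * L)^-1 * (c - 2^-1 * a)) / q +
       2 * ((2 * L)^-1 * al * (be - 2^-1 * al)) / q ^+ 2 + 2^-1 * y.
Proof.
move=> L0 q0 h1 h2.
have s : 0 < 2 * L * q ^+ 2 by rewrite !mulr_gt0 // exprn_gt0.
rewrite -(pmulr_rge0 _ s).
have -> : 2 * L * q ^+ 2 * (- 2 * ((2 * L)^-1 * (c - 2^-1 * a)) / q +
       2 * ((2 * L)^-1 * al * (be - 2^-1 * al)) / q ^+ 2 + 2^-1 * y) =
   (q * (a - c - (c - b)) - (al - be) ^+ 2) + be ^+ 2 + q * (L * y * q - b).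
  by field; rewrite ?gt_eqF.
apply: addr_ge0; first by apply: addr_ge0; rewrite ?subr_ge0 ?sqr_ge0.
by apply: mulr_ge0; rewrite ?subr_ge0 // ltW.
Qed.

Lemma cauchy_schwarz_sub n p (w x : 'M[C]_(n, p)) :
  rinner w x ^+ 2 <= rinner w w * rinner x x.
Proof.
rewrite -!fnorm_sqr -exprMn -[rinner w x ^+ 2]real_normK ?num_real //.
apply: lerXn2r; rewrite ?nnegrE ?normr_ge0 //; last exact: normr_rinner_le.
by apply: mulr_ge0; exact: fnorm_ge0.
Qed.

Lemma step_arith (p q r s : R) :
  q - (r - s) + p - 2^-1 * (q + r) <= p - 2^-1 * r + 2^-1 * (q - (r - s)) -> s <= r.
Proof. lra. Qed.

Section Flow.
Variables (n : nat) (D : 'M[C]_n) (w : 'cV[C]_n).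
Hypotheses (DH : D^H = D) (w0 : w != 0).

Definition flow (t : R) : 'cV[C]_n := mexp ((- t)%:C *: D) *m w.

Lemma flow_neq0 t : flow t != 0.
Proof.
apply: contra w0 => /eqP f0; rewrite -(mulKmx (expmx_herm_unit DH (- t)) w) -/(flow t) f0.
by rewrite mulmx0.
Qed.

Lemma flow_quotient t : mcvg FF (fun h => (h^-1)%:C *: (flow (h + t) - flow t)) (- (D *m flow t)).
Proof.
have -> : (fun h : R => (h^-1)%:C *: (flow (h + t) - flow t)) =
    (fun h => ((h^-1)%:C *: (mexp (h%:C *: (- D)) - 1%:M)) *m flow t).
  apply/funext => h; rewrite -scalemxAl mulmxBl mul1mx /flow mulmxA.
  have -> : h%:C *: - D = (- h)%:C *: D by rewrite scalerN -scaleNr -rmorphN.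
  by rewrite -(expmx_hermD DH) -opprD.
rewrite -mulNmx; apply: mcvg_mul; [exact: mexp_deriv|exact: mcvg_cst].
Qed.

Lemma flow_cvg t : mcvg FF (fun h => flow (h + t)) (flow t).
Proof.
have h2 : mcvg FF (fun h => h%:C *: ((h^-1)%:C *: (flow (h + t) - flow t)) + flow t) (flow t).
  rewrite -[X in mcvg _ _ X]add0r -(scale0r (- (D *m flow t))).
  apply: mcvgD; last exact: mcvg_cst.
  by apply: mcvgZ; [exact: ccvg_dnbhs0|exact: flow_quotient].
apply: near_mcvg h2; have := dnbhs0_neq R; apply: filterS => h h0.
by rewrite scalerA -rmorphM mulfV // scale1r subrK.
Qed.

Lemma flow_quadratic (E : 'M[C]_n) (t : R) : E^H = E ->
  is_derive t (1:R) (fun t => rinner (flow t) (E *m flow t)) (- 2 * rinner (D *m flow t) (E *m flow t)).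
Proof.
move=> EH; apply: is_derive_quotient.
pose Q h := (h^-1)%:C *: (flow (h + t) - flow t).
have -> : (fun h => h^-1 * (rinner (flow (h + t)) (E *m flow (h + t)) - rinner (flow t) (E *m flow t))) =
    (fun h => rinner (Q h) (E *m flow (h + t)) + rinner (E *m flow t) (Q h)).
  apply/funext => h; rewrite /Q rinnerZl rinnerZr -mulrDr; congr (_ * _).
  rewrite rinnerBl rinnerBr; have := rinner_mull2 E (flow (h + t)) (flow t); rewrite EH => ->.
  by rewrite (rinnerC (E *m flow t) (flow t)) subrKA.
have -> : - 2 * rinner (D *m flow t) (E *m flow t) =
    rinner (- (D *m flow t)) (E *m flow t) + rinner (E *m flow t) (- (D *m flow t)).
  by rewrite rinnerNl rinnerNr (rinnerC (E *m _)); ring.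
have dQ : mcvg FF Q (- (D *m flow t)) by exact: flow_quotient.
apply: cvgD; apply: cvg_rinner => //; last exact: mcvg_cst.
by apply: mcvg_mul; [exact: mcvg_cst|exact: flow_cvg].
Qed.

(** The expectation of [E] in the state reached by the flow at time t; by [psi_derive] its
    derivative is -2 times the covariance of D and E. *)
Definition psi (E : 'M[C]_n) t : R :=
  rinner (flow t) (E *m flow t) / rinner (flow t) (flow t).

Lemma psi_derive (E : 'M[C]_n) (t : R) : E^H = E -> is_derive t (1:R) (psi E)
  (- 2 * rinner (D *m flow t) (E *m flow t) / rinner (flow t) (flow t) +
   2 * (rinner (flow t) (D *m flow t) * rinner (flow t) (E *m flow t)) /
   rinner (flow t) (flow t) ^+ 2).
Proof.
move=> EH; have h1 := flow_quadratic t EH.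
have h2 := flow_quadratic t (@adj1 R n).
have q0 : rinner (flow t) (1%:M *m flow t) != 0.
  by rewrite mul1mx gt_eqF // rinner_gt0 // flow_neq0.
have h3 := is_deriveM h1 (is_deriveV q0 h2).
move: h3; set f := (X in is_derive _ _ X _) => h3.
have <- : f = psi E.
  apply/funext => s; rewrite /psi.
  transitivity (rinner (flow s) (E *m flow s) / rinner (flow s) (1%:M *m flow s)) => //.
  by rewrite mul1mx.
apply: is_derive_eq h3 _; rewrite !mul1mx in q0 *.
rewrite /GRing.scale /= (rinnerC (D *m flow t) (flow t)).
by field.
Qed.

Lemma psi_mono (E : 'M[C]_n) (b : R) : E^H = E ->
  (forall t, 0 <= - 2 * rinner (D *m flow t) (E *m flow t) / rinner (flow t) (flow t) +
   2 * (rinner (flow t) (D *m flow t) * rinner (flow t) (E *m flow t)) /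
   rinner (flow t) (flow t) ^+ 2 + b) -> psi E 0 <= psi E 1 + b.
Proof.
move=> EH h; pose f t := psi E t + b * t.
have df t : is_derive t (1:R) f ((- 2 * rinner (D *m flow t) (E *m flow t) / rinner (flow t) (flow t) +
   2 * (rinner (flow t) (D *m flow t) * rinner (flow t) (E *m flow t)) /
   rinner (flow t) (flow t) ^+ 2) + b).
  have h1 := psi_derive t EH.
  have h2 := is_deriveZ b (is_derive_id t (1 : R)).
  by apply: is_derive_eq (is_deriveD h1 h2) _; rewrite /GRing.scale /= mulr1.
have cf : {within `[0, 1], continuous f}.
  apply: derivable_within_continuous => x _; by have [] := df x.
have [c _ fc] := MVT_segment ler01 (fun x _ => df x) cf.
have := h c; rewrite -[X in 0 <= X]mulr1 -[X in _ * X](subr0 1) -fc /f mulr0 mulr1 addr0.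
by rewrite subr_ge0.
Qed.

End Flow.

Section Step.
Variables (n d : nat) (ikn : set 'M[C]_n) (La : 'M[C]_n -> 'M[C]_d) (L : R).
Variable mu : 'cV[C]_d -> 'M[C]_n.
Hypothesis L0 : 0 < L.
Hypothesis ikB : forall X Y, ikn X -> ikn Y -> ikn (X - Y).
Hypothesis LaB : forall X Y, La (X - Y) = La X - La Y.
Hypothesis LaH : forall X, ikn X -> (La X)^H = La X.
Hypothesis La_bound : forall X (w : 'cV[C]_d), ikn X ->
  rinner (La X *m w) (La X *m w) <= L * rinner X X * rinner w w.
Hypothesis mu_ik : forall w, w != 0 -> ikn (mu w).
Hypothesis muE : forall w X, w != 0 -> ikn X -> rinner (mu w) X = rinner w (La X *m w) / rinner w w.

Variable w : 'cV[C]_d.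
Hypothesis w0 : w != 0.
Let w' := mexp (- ((2 * L)^-1)%:C *: La (mu w)) *m w.

Let D := ((2 * L)^-1)%:C *: La (mu w).

Let DH : D^H = D.
Proof. by rewrite /D adjZr LaH //; exact: mu_ik. Qed.

Let w'E : w' = flow D w 1.
Proof. by rewrite /w' /flow /D scaleN1c scaleNr. Qed.

Lemma step_neq0 : w' != 0.
Proof. by rewrite w'E; exact: flow_neq0. Qed.

(** Let u and u' be the moments before and after the step and Y = u - u'. Along the flow from w to
    w' the expectation of La(Y) - La(u)/2, increased by t‖Y‖²/2, does not decrease. Comparing the
    ends gives ‖Y‖² ≤ ⟨Y, u⟩, that is ⟨Y, u'⟩ ≥ 0. *)
Lemma step_gradient : rinner (mu w') (mu w') <= rinner (mu w') (mu w).
Proof.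
set u := mu w; set u' := mu w'.
have iku : ikn u by exact: mu_ik.
have iku' : ikn u' by apply: mu_ik; exact: step_neq0.
have ikY : ikn (u - u') by exact: ikB.
set Y := u - u' in ikY *.
have AH := LaH iku; have BH := LaH ikY.
(* The shift by half of A completes the square in [cov_ge0]. *)
pose A := La u; pose B := La Y; pose E := B - 2^-1%:C *: A.
have EH : E^H = E by rewrite /E adjB adjZr /A /B AH BH.
have f0 : flow D w 0 = w by rewrite /flow oppr0 scale0r expmx0 mul1mx.
have psi0 X : ikn X -> psi D w (La X) 0 = rinner u X.
  by move=> ikX; rewrite /psi f0 /u muE.
have psi1 X : ikn X -> psi D w (La X) 1 = rinner u' X.
  by move=> ikX; rewrite /psi -w'E /u' muE //; exact: step_neq0.
have psiE t : psi D w E t = psi D w B t - 2^-1 * psi D w A t.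
  rewrite /psi /E mulmxBl rinnerBr -scalemxAl rinnerZr mulrBl mulrA; done.
have h t : 0 <= - 2 * rinner (D *m flow D w t) (E *m flow D w t) / rinner (flow D w t) (flow D w t) +
   2 * (rinner (flow D w t) (D *m flow D w t) * rinner (flow D w t) (E *m flow D w t)) /
   rinner (flow D w t) (flow D w t) ^+ 2 + 2^-1 * rinner Y Y.
  have z0 := flow_neq0 DH w0 t; set z := flow D w t in z0 *.
  have cs := cauchy_schwarz_sub z ((A - B) *m z).
  rewrite mulmxBl !rinnerBr !rinnerBl (rinnerC (B *m z) (A *m z)) in cs.
  have bd := La_bound z ikY; rewrite -/B in bd.
  have := cov_ge0 L0 (rinner_gt0 z0) cs bd.
  rewrite /D /E -/A -scalemxAl rinnerZl mulmxBl !rinnerBr -scalemxAl !rinnerZr.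
  by rewrite !mulrA.
have := psi_mono DH w0 EH h; rewrite !psiE !psi0 // !psi1 //.
have e1 : rinner u Y = rinner Y Y + rinner u' Y by rewrite -rinnerDl /Y subrK.
have e2 : rinner u u = rinner Y u + rinner u' u by rewrite -rinnerDl /Y subrK.
have e3 : rinner Y Y = rinner Y u - rinner Y u' by rewrite -rinnerBr.
have e4 : rinner Y u' = rinner u' u - rinner u' u' by rewrite /Y rinnerBl (rinnerC u).
by rewrite e1 e2 e3 e4; exact: step_arith.
Qed.

(** Jensen's inequality at the endpoint: w is e^{A/(2L)} w', so ‖w‖² is the quadratic form of
    e^{A/L} at w', whose mean exponent is the inner product of the two moments over L. *)
Lemma step_value : ln (rinner w' w') <= ln (rinner w w) - rinner (mu w') (mu w) / L.
Proof.
have w'0 := step_neq0; have iku := mu_ik w0.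
pose A := La (mu w); have AH : A^H = A by exact: LaH.
have wE : rinner w w = rinner w' (mexp (L^-1%:C *: A) *m w').
  have hl : ((2 * L)^-1 + (2 * L)^-1 : R) = L^-1.
    by rewrite invfM -mulrDl; have -> : 2^-1 + 2^-1 = 1 :> R; [rewrite [RHS]splitr mul1r|rewrite mul1r].
  have ew : w = mexp ((2 * L)^-1%:C *: A) *m w'.
    rewrite /w' mulmxA -rmorphN -/A; have := expmx_hermNK AH (2 * L)^-1 => ->.
    by rewrite mul1mx.
  rewrite -hl expmx_hermD // {1 2}ew rinner_mull expmx_herm // mulmxA; done.
have BH : (L^-1%:C *: A)^H = L^-1%:C *: A by rewrite adjZr AH.
have := jensen BH w'0; rewrite -wE -scalemxAl rinnerZr -mulrA -/A -muE //.
set m := rinner _ _; move=> h.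
have q := rinner_gt0 w0; have q' := rinner_gt0 w'0.
rewrite -ler_ln ?posrE // in h; last by rewrite mulr_gt0 ?expR_gt0.
rewrite lnM ?posrE ?expR_gt0 // expRK in h.
by rewrite lerBrDr addrC mulrC.
Qed.

End Step.

End Descent.

(** * The Iwasawa decomposition from asymptotics of polar decompositions *)

Section Iwasawa.
Variables (R : realType) (n : nat) (G : set 'M[R[i]]_n).
Notation C := R[i].
Hypotheses (hGalg : is_algebraic_group G) (hGadj : self_adjoint G).

Lemma eventually_ultra : exists U : set_system nat, UltraFilter U /\ \oo `<=` U.
Proof. exact: ultraFilterLemma. Qed.

(** Where e ≤ 1 the hypothesis bounds e² by c/r, and where e > 1 it bounds e itself by c/r, with c =
    (2y + 1)w. *)
Lemma asymptotic_small (e : nat -> R) (y w : R) : (forall r, 0 <= e r) -> 0 <= y -> 0 <= w ->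
  (forall r, e r.+1 ^+ 2 <= (2 * y + e r.+1) * w / r.+1%:R) -> e r.+1 @[r --> \oo] --> (0 : R).
Proof.
move=> e0 y0 w0 he; pose c := (2 * y + 1) * w.
have c0 : 0 <= c by rewrite mulr_ge0 // addr_ge0 // mulr_ge0.
have cv : c * (r.+1%:R)^-1 @[r --> \oo] --> (0 : R).
  rewrite -[X in _ --> X](mulr0 c); apply: cvgM; first exact: cvg_cst.
  exact: cvg_harmonic.
apply/rcvgP => eps eps0; pose eps' := Num.min eps (eps ^+ 2).
have eps'0 : 0 < eps' by rewrite lt_min eps0 exprn_gt0.
have /rcvgP/(_ _ eps'0) := cv; apply: filterS => r /=; rewrite !subr0.
rewrite ger0_norm; last by rewrite mulr_ge0 ?invr_ge0.
rewrite le_min => /andP[h1 h2]; rewrite ger0_norm //.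
have [e1|e1] := leP (e r.+1) 1.
  rewrite -(@ler_pXn2r _ 2) ?nnegrE ?(ltW eps0) //; apply: le_trans h2; apply: le_trans (he r) _.
  by rewrite ler_wpM2r ?invr_ge0 // ler_wpM2r // lerD2l.
apply: le_trans h1; have ep : 0 < e r.+1 by exact: lt_trans e1.
rewrite -(ler_pM2l ep) -expr2; apply: le_trans (he r) _.
rewrite mulrA ler_wpM2r ?invr_ge0 // /c mulrA ler_wpM2r // mulrDr mulr1 lerD2r.
by rewrite ler_peMl ?mulr_ge0 // ltW.
Qed.

Lemma rescaled_bound (r e m y w : R) : 0 < r -> 0 <= w ->
  (r * e) ^+ 2 <= (r * m + r * y) * w -> m <= y + e -> e ^+ 2 <= (2 * y + e) * w / r.
Proof.
move=> r0 w0 h tri; rewrite ler_pdivlMr // -(ler_pM2l r0).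
have -> : r * (e ^+ 2 * r) = (r * e) ^+ 2 by ring.
apply: le_trans h _; rewrite -mulrDr -mulrA ler_wpM2l ?(ltW r0) // ler_wpM2r //.
by rewrite mulrDl mul1r [X in _ <= X]addrAC lerD2r.
Qed.

Lemma commute_dgr_entries (A : 'M[C]_n) (y z : 'rV[R]_n) : dgr y *m A = A *m dgr z ->
  forall a b, A a b != 0 -> y 0 a = z 0 b.
Proof.
move=> E a b ab; have := congr1 (fun M : 'M[C]_n => M a b) E.
rewrite mul_diag_mx mul_mx_diag !mxE [RHS]mulrC => /(mulIf ab) [].
by [].
Qed.

(** Modulo K on the left, g lies in the parabolic subgroup of Y: k†g maps each eigenspace of Y into
    the sum of those with at least the same eigenvalue. The element k is a limit of the unitary
    parts k_r of g e^{rY/2} = k_r e^{Z_r}, since 2Z_r/r tends to Y. *)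
Lemma iwasawa (g Y V : 'M[C]_n) (y : 'rV[R]_n) : G g -> ik G Y -> is_unitary V ->
  Y = V *m dgr y *m V^H ->
  exists2 k, Ku G k & forall a b, y 0 a < y 0 b -> (V^H *m k^H *m g *m V) a b = 0.
Proof.
move=> Gg ikY VU YE; have [YH YG] := ikY.
pose E (r : nat) := mexp ((r%:R / 2)%:C *: Y).
have EG r : G (E r) by exact: YG.
have EH r : (E r)^H = E r by exact: expmx_herm.
have pol r := G_polar hGalg hGadj (G_mul hGalg Gg (EG r)).
pose k r := projT1 (cid (pol r)).
have kP r := projT2 (cid (pol r)).
pose Z r := projT1 (cid (kP r)).
have ZP r : [/\ Ku G (k r), ik G (Z r) & g *m E r = k r *m mexp (Z r)].
  exact: (projT2 (cid (kP r))).
have [kg [Hg [Kkg ikHg gE]]] := G_polar hGalg hGadj Gg.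
pose W := 2%:C *: Hg.
have [HgH _] := ikHg.
have WH : W^H = W by rewrite adjZr HgH.
have two (X : 'M[C]_n) : X^H = X -> mexp (2%:C *: X) = mexp X *m mexp X.
  move=> XH; have := expmx_hermD XH 1 1; rewrite scale1r => <-; congr (mexp (_%:C *: _)).
have mH (X : 'M[C]_n) : X^H = X -> (mexp X)^H = mexp X.
  by move=> XH; have := expmx_herm XH 1; rewrite scale1r.
have gW : g^H *m g = mexp W.
  have [_ kgU] := Kkg.
  by rewrite gE adjM mH // mulmxA -(mulmxA _ kg^H) kgU mulmx1 /W two.
pose A r := 2%:C *: Z r.
have AE r : mexp (A r) = (E r)^H *m mexp W *m E r.
  have [[_ kU] [ZH _] gZ] := ZP r.
  rewrite /A two // -{1}(mH _ ZH) -[(mexp (Z r))^H]mulmx1 -kU mulmxA -adjM -mulmxA -gZ adjM.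
  by rewrite -gW !mulmxA.
have BE r : mexp ((r%:R : R)%:C *: Y) = (E r)^H *m E r.
  by rewrite EH -expmx_hermD // -splitr.
(* Both exponentials have the base point E_r and differ there by the fixed e^W, so [fnorm_log_sub]
   makes the distance of A_r from rY grow more slowly than r. *)
have close r : fnorm (A r - (r%:R : R)%:C *: Y) ^+ 2 <=
    (fnorm (A r) + fnorm ((r%:R : R)%:C *: Y)) * fnorm W.
  have [_ [ZH _] _] := ZP r.
  apply: (fnorm_log_sub (h := E r)) => //.
  - by rewrite /A adjZr ZH.
  - by rewrite adjZr YH.
  - exact: G_unit hGalg _ (EG r).
pose M r := (r%:R^-1 : R)%:C *: A r.
pose e r := fnorm (M r - Y).
have e0 : e r.+1 @[r --> \oo] --> (0 : R).
  apply: (@asymptotic_small e (fnorm Y) (fnorm W)); rewrite ?fnorm_ge0 // => r; first exact: fnorm_ge0.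
  have r0 : (r.+1%:R : R) != 0 by rewrite pnatr_eq0.
  have AM : A r.+1 = (r.+1%:R : R)%:C *: M r.+1.
    by rewrite /M scalerA -rmorphM mulfV // scale1r.
  have nz (X : 'M[C]_n) : fnorm ((r.+1%:R : R)%:C *: X) = r.+1%:R * fnorm X.
    by rewrite fnormZ ger0_norm.
  have := close r.+1; rewrite AM -scalerBr !nz -/(e r.+1) => h.
  have tri : fnorm (M r.+1) <= fnorm Y + e r.+1.
    by rewrite -{1}(subrK Y (M r.+1)) addrC; exact: fnormD.
  by apply: (rescaled_bound _ _ h tri); rewrite ?ltr0n ?fnorm_ge0.
have [U [UU oU]] := eventually_ultra.
have UP : ProperFilter U by exact: ultra_proper.
have MY : mcvg U (fun r => M r.+1) Y.
  by apply: (mcvg_sub oU); apply/mcvg_fnormP.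
have kK r : Ku G (k r) by have [] := ZP r.
have [k0 kk0] : exists k0, mcvg U (fun r => k r.+1) k0.
  apply: (@ultra_mcvg_bounded _ _ _ _ _ _ _ (fnorm (1%:M : 'M[C]_n))); apply: filterE => r.
  by have [_ kU] := kK r.+1; rewrite fnorm_unitary.
have Kk0 : Ku G k0 by apply: (Ku_closed hGalg _ _ kk0); exact: filterE (fun r => kK r.+1).
have MH r : (M r)^H = M r.
  by have [_ [ZH _] _] := ZP r; rewrite /M /A !adjZr ZH.
have dec r := herm_spectral (MH r).
pose u r := projT1 (cid (dec r)).
pose m r := projT1 (cid (projT2 (cid (dec r)))).
have dP r : is_unitary (u r) /\ M r = u r *m dgr (m r) *m (u r)^H.
  exact: (projT2 (cid (projT2 (cid (dec r))))).
have [u0 uu0] : exists u0, mcvg U (fun r => u r.+1) u0.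
  apply: (@ultra_mcvg_bounded _ _ _ _ _ _ _ (fnorm (1%:M : 'M[C]_n))); apply: filterE => r.
  by have [uU _] := dP r.+1; rewrite fnorm_unitary.
have u0U : is_unitary u0.
  by apply: unitarymx_closed uu0; apply: filterE => r; have [] := dP r.+1.
have dm : mcvg U (fun r => dgr (m r.+1)) (u0^H *m Y *m u0).
  have -> : (fun r => dgr (m r.+1)) = (fun r => (u r.+1)^H *m M r.+1 *m u r.+1).
    apply/funext => r; have [uU ->] := dP r.+1.
    by rewrite !mulmxA uU mul1mx -mulmxA uU mulmx1.
  by apply: mcvg_mul => //; apply: mcvg_mul => //; exact: mcvg_adj.
pose m0 : 'rV[R]_n := \row_j complex.Re ((u0^H *m Y *m u0) j j).
have mm0 j : m r.+1 0 j @[r --> U] --> m0 0 j.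
  have [h _] := dm j j; rewrite mxE; move: h.
  by under eq_fun do rewrite !mxE eqxx mulr1n.
have dm0 : u0^H *m Y *m u0 = dgr m0.
  apply: (mcvg_unique (F := U) dm) => a b; rewrite [X in ccvg _ _ X]mxE.
  under eq_fun do rewrite mxE.
  have [->|ab] := eqVneq a b; last by under eq_fun do rewrite mulr0n; exact: ccvg_cst.
  rewrite !mulr1n; under eq_fun do rewrite mulr1n mxE.
  by rewrite mxE; apply: ccvg_real; exact: mm0.
pose P r := (u r)^H *m (k r)^H *m g *m V.
pose P0 := u0^H *m k0^H *m g *m V.
have PP0 : mcvg U (fun r => P r.+1) P0.
  apply: mcvg_mul; last exact: mcvg_cst.
  apply: mcvg_mul; last exact: mcvg_cst.
  by apply: mcvg_mul; exact: mcvg_adj.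
(* In the eigenframes the polar identity says that an entry of k_r†g is an exponential of r times a
   gap of eigenvalues, times an entry of a unitary matrix. *)
have rel r j b : P r.+1 j b =
    (expR (r.+1%:R * (m r.+1 0 j - y 0 b) / 2))%:C * ((u r.+1)^H *m V) j b.
  have [uU ME] := dP r.+1; have [[_ kU] [ZH _] gZ] := ZP r.+1.
  set t : R := r.+1%:R / 2.
  have ZM : Z r.+1 = t%:C *: M r.+1.
    have r0 : (r.+1%:R : R) != 0 by rewrite pnatr_eq0.
    have tE : t * (r.+1%:R)^-1 * 2 = 1 by rewrite /t mulrAC divfK ?pnatr_eq0 // mulfV.
    by rewrite /M /A !scalerA -!rmorphM tE scale1r.
  have : (u r.+1)^H *m ((k r.+1)^H *m (g *m E r.+1)) *m V = (u r.+1)^H *m mexp (Z r.+1) *m V.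
    by rewrite gZ (mulmxA (k r.+1)^H) kU mul1mx.
  rewrite ZM ME expmx_real // /E YE expmx_real // /ufun.
  rewrite !mulmxA uU mul1mx -(mulmxA _ V^H V) VU mulmx1 -/(P r.+1) -(mulmxA (diag_mx _)).
  move=> /(congr1 (fun M : 'M[C]_n => M j b)); rewrite mul_mx_diag mul_diag_mx !mxE => h.
  rewrite -/(P r.+1) in h.
  have ey : expR (t * y 0 b) != 0 by rewrite gt_eqF // expR_gt0.
  have eyC : (expR (t * y 0 b))%:C != 0 :> C by apply/eqP => -[] /eqP; rewrite (negPf ey).
  apply: (mulIf eyC); rewrite h [RHS]mulrAC; congr (_ * _).
  by rewrite -(rmorphM (real_complex R)) -expRD; congr ((expR _)%:C); rewrite /t; ring.
(* If the limiting gap is negative the exponential kills the entry. *)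
have Pz j b : m0 0 j < y 0 b -> P0 j b = 0.
  move=> mlt; pose de := (y 0 b - m0 0 j) / 2.
  have de0 : 0 < de by rewrite divr_gt0 // subr_gt0.
  have h1 : U [set r | m r.+1 0 j - y 0 b <= - de].
    have /rcvgP/(_ _ de0) := mm0 j; apply: filterS => r /=; rewrite ler_norml => /andP[_].
    by rewrite /de; clear; move: (m _ _ _) (m0 _ _) (y _ _) => p q s; lra.
  have cz : expR (- de / 2 * r.+1%:R) @[r --> U] --> (0 : R).
    have h2 : expR (- de / 2) ^+ r.+1 @[r --> \oo] --> (0 : R).
      have := @cvg_expr R (expR (- de / 2)); rewrite ger0_norm ?expR_ge0 //.
      have -> : expR (- de / 2) < 1 by rewrite -expR0 ltr_expR pmulr_llt0 ?invr_gt0 // oppr_lt0.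
      by move=> /(_ isT); rewrite -(cvg_shiftS _).
    move=> B Bn; have h3 : \oo [set r : nat | B (expR (- de / 2) ^+ r.+1)] by exact: h2 B Bn.
    suff h4 : \oo [set r : nat | B (expR (- de / 2 * r.+1%:R))] by exact: oU h4.
    by apply: filterS h3 => r /=; rewrite expRM_natr.
  have cP : ccvg U (fun r => (expR (r.+1%:R * (m r.+1 0 j - y 0 b) / 2))%:C) 0.
    apply: ccvg_real; apply: (rcvg_dom (f := fun r => expR (- de / 2 * r.+1%:R))) => //.
    apply: filterS h1 => r /= hr; rewrite subr0 ger0_norm ?expR_ge0 // ler_expR.
    rewrite [X in _ <= X]mulrC mulrA ler_wpM2r ?invr_ge0 // ler_wpM2l //.
  apply: (ccvg_unique (F := U) (PP0 j b)).
  under eq_fun do rewrite rel.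
  rewrite -(mul0r ((u0^H *m V) j b)); apply: ccvgM => //.
  by apply: mcvg_mul; [exact: mcvg_adj|exact: mcvg_cst].
exists k0 => // a b yab.
have -> : V^H *m k0^H *m g *m V = (V^H *m u0) *m P0.
  by rewrite /P0 !mulmxA -(mulmxA V^H u0) (unitary_mul_adj u0U) mulmx1.
rewrite mxE big1 // => j _.
have [->|nz] := eqVneq ((V^H *m u0) a j) 0; first by rewrite mul0r.
(* Y is diagonal in both frames, so a nonzero (a, j) entry of the change of frame forces the j-th
   eigenvalue to be y_a, which is below y_b. *)
have com : dgr y *m (V^H *m u0) = V^H *m u0 *m dgr m0.
  rewrite -dm0 YE !mulmxA -(mulmxA V^H u0) (unitary_mul_adj u0U) mulmx1.
  by rewrite VU mul1mx.
by rewrite Pz ?mulr0 // -(commute_dgr_entries com nz).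
Qed.

End Iwasawa.

(** * Compact matrix groups and their one-parameter subgroups *)

Section CompactGroups.
Variables (R : realType) (n : nat).
Notation C := R[i].
Implicit Types (S K : set 'M[C]_n) (H X : 'M[C]_n).

Definition limit_closed S : Prop :=
  forall (F : set_system nat) (f : nat -> 'M[C]_n) L, ProperFilter F ->
    F [set x | S (f x)] -> mcvg F f L -> S L.

(** Closed subgroups of the unitary group, with closedness stated by limits along filters on ℕ and
    inversion by the adjoint. *)
Definition compact_group K : Prop :=
  [/\ K `<=` @is_unitary R n, K 1%:M, forall k l, K k -> K l -> K (k *m l),
      forall k, K k -> K k^H & limit_closed K].

Definition il K H : Prop := H^H = H /\ forall t : R, K (mexp (Complex 0 t *: H)).

Lemma compact_argmin S (f : 'M[C]_n -> R) (M m : R) :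
  (forall x, S x -> fnorm x <= M) -> (forall x, S x -> m <= f x) -> limit_closed S ->
  (forall (F : set_system nat) (g : nat -> 'M[C]_n) L, ProperFilter F ->
     mcvg F g L -> f (g x) @[x --> F] --> f L) ->
  (exists x, S x) -> exists2 x, S x & forall y, S y -> f x <= f y.
Proof.
move=> SM fm Sc fc [x0 Sx0]; pose E := [set f x | x in S].
have E0 : E !=set0 by exists (f x0); exists x0.
have hE : has_inf E by split=> //; exists m => _ [x Sx <-]; exact: fm.
have adh (r : nat) : exists x, S x /\ f x < inf E + r.+1%:R^-1.
  have r0 : 0 < (r.+1%:R^-1 : R) by rewrite invr_gt0.
  by have [_ [x Sx <-] h] := inf_adherent r0 hE; exists x.
pose x r := projT1 (cid (adh r)); have xP r : S (x r) /\ f (x r) < inf E + r.+1%:R^-1.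
  exact: projT2 (cid (adh r)).
have [U [UU oU]] := eventually_ultra.
have UP : ProperFilter U by exact: ultra_proper.
have [L xL] : exists L, mcvg U x L.
  apply: (@ultra_mcvg_bounded _ _ _ _ _ _ _ M); apply: filterE => r.
  by apply: SM; have [] := xP r.
have SL : S L by apply: (Sc U x) => //; apply: filterE => r; have [] := xP r.
exists L => // y Sy.
have le_inf : f L <= inf E + 0.
  apply: (@rcvg_le _ _ U (fun r => f (x r)) (fun r => inf E + r.+1%:R^-1)).
  - exact: fc.
  - apply: cvgD; first exact: cvg_cst.
    by have h := @cvg_harmonic R; move=> B Bn; apply: oU; exact: h B Bn.
  - by apply: filterE => r; have [_ /ltW] := xP r.
rewrite addr0 in le_inf; apply: le_trans le_inf _; apply: ge_inf; last by exists y.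
by have [] := hE.
Qed.

Lemma expmx_imagD H (s t : R) : H^H = H ->
  mexp (Complex 0 (s + t) *: H) = mexp (Complex 0 s *: H) *m mexp (Complex 0 t *: H).
Proof.
move=> /herm_spectral[U [y [UU ->]]]; rewrite !expmx_imaginary // ufunM //.
apply: ufun_eq => j; have := (ichar_character (y 0 j)).2 s t.
by rewrite /ichar ![y 0 j * _]mulrC.
Qed.

Lemma expmx_imagX H (s : R) m : H^H = H ->
  mexp (Complex 0 (m%:R * s) *: H) = mexp (Complex 0 s *: H) ^+ m.
Proof.
move=> HH; elim: m => [|m IH].
  by rewrite mul0r expr0 (_ : Complex 0 0 = 0) // scale0r expmx0.
by rewrite -natr1 mulrDl mul1r addrC expmx_imagD // IH mxexprS.
Qed.

Lemma fnorm_distC (A B : 'M[C]_n) : fnorm (A - B) = fnorm (B - A).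
Proof. by rewrite -fnormN opprB. Qed.

Lemma addmx_cancel (A B D : 'M[C]_n) : A + B + D = A -> B + D = 0.
Proof. by move=> h; apply: (@addrI _ A); rewrite addrA addr0. Qed.

Lemma scalemx_mulmx (a b : C) (A B : 'M[C]_n) : (a *: A) *m (b *: B) = a *: (b *: (A *m B)).
Proof. by rewrite -scalemxAl -scalemxAr. Qed.

Section Tangent.
Variables (K : set 'M[C]_n) (F : set_system nat) (k : nat -> 'M[C]_n) (d : nat -> R) (W : 'M[C]_n).
Hypothesis (KK : compact_group K).
Context {FF : ProperFilter F}.
Hypotheses (kK : F [set x | K (k x)]) (d_gt0 : F [set x | 0 < d x])
  (d0 : d x @[x --> F] --> (0 : R))
  (kW : mcvg F (fun x => (d x)^-1%:C *: (k x - 1%:M)) W).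

Let H := Complex 0 (-1) *: W.

Let WE (s : R) : s%:C *: W = Complex 0 s *: H.
Proof. by rewrite /H scalerA; congr (_ *: _); apply: complexP => /=; ring. Qed.

(** With k = 1 + dQ, unitarity reads Q† + Q + dQ†Q = 0, and the last term disappears in the
    limit. *)
Lemma limit_tangent_herm : H^H = H.
Proof.
have [KU _ _ _ _] := KK.
have Ws : W^H + W = 0.
  pose Q x := (d x)^-1%:C *: (k x - 1%:M).
  apply: (@mcvg_unique R _ F _ _ _ (fun x => (Q x)^H + Q x + (d x)%:C *: ((Q x)^H *m Q x))).
    rewrite -[X in mcvg _ _ X]addr0 -[X in mcvg _ _ (_ + X)](scale0r (W^H *m W)).
    apply: mcvgD; first by apply: mcvgD => //; exact: mcvg_adj.
    apply: mcvgZ; first exact: ccvg_real.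
    by apply: mcvg_mul => //; exact: mcvg_adj.
  apply: (near_mcvg (f := fun=> 0)); last exact: mcvg_cst.
  apply: filterS2 kK d_gt0 => x /KU kU dx; symmetry.
  have kE : k x = 1%:M + (d x)%:C *: Q x.
    by rewrite /Q scalerA -rmorphM mulfV ?gt_eqF // scale1r addrC subrK.
  have := kU; rewrite /is_unitary kE adjD adj1 adjZr mulmxDl !mulmxDr !mul1mx mulmx1.
  rewrite scalemx_mulmx => /addmx_cancel.
  rewrite -!scalerDr => /(congr1 (fun Z => (d x)^-1%:C *: Z)).
  rewrite scaler0 scalerA -rmorphM mulVf ?gt_eqF // scale1r addrA [X in X + _]addrC; done.
rewrite /H adjZ; have -> : W^H = - W by apply/eqP; rewrite -addr_eq0 Ws.
by rewrite scalerN -scaleNr; congr (_ *: _); apply: complexP => /=; ring.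
Qed.

(** Both k and e^{dW} have the first-order part 1 + dW, so they differ by o(d). *)
Lemma limit_tangent_close :
  (d x)^-1 * fnorm (k x - mexp ((d x)%:C *: W)) @[x --> F] --> (0 : R).
Proof.
pose c := fnorm (1%:M : 'M[C]_n) * expR 1 * fnorm W ^+ 2.
pose e x := fnorm ((d x)^-1%:C *: (k x - 1%:M) - W) + c * d x.
have e0 : e x @[x --> F] --> (0 : R).
  rewrite -[X in _ --> X]addr0; apply: cvgD; first exact/mcvg_fnormP.
  by rewrite -[X in _ --> X](mulr0 c); apply: cvgM => //; exact: cvg_cst.
apply: rcvg_dom e0.
have small : F [set x | d x * fnorm W <= 1].
  have q : 0 < (fnorm W + 1)^-1 by rewrite invr_gt0 ltr_wpDl ?fnorm_ge0.
  have /rcvgP/(_ _ q) := d0; apply: filterS => x /=; rewrite subr0 => h.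
  apply: (@le_trans _ _ ((fnorm W + 1)^-1 * fnorm W)).
    by rewrite ler_wpM2r ?fnorm_ge0 //; apply: le_trans h; exact: ler_norm.
  by rewrite ler_pdivrMl ?mulr1 ?lerDl // ltr_wpDl ?fnorm_ge0.
apply: filterS2 small d_gt0 => x sm dx /=.
have dn : `|d x| = d x by rewrite gtr0_norm.
have z0 : 0 <= (d x)^-1 * fnorm (k x - mexp ((d x)%:C *: W)).
  by rewrite mulr_ge0 ?fnorm_ge0 // invr_ge0 ltW.
rewrite subr0 ger0_norm //.
have h1 : fnorm ((d x)%:C *: W) <= 1 by rewrite fnormZ dn.
have := expmx_linear_approx h1; rewrite fnormZ dn exprMn => h2.
have -> : (d x)^-1 * fnorm (k x - mexp ((d x)%:C *: W)) =
    fnorm ((d x)^-1%:C *: (k x - mexp ((d x)%:C *: W))).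
  by rewrite fnormZ ger0_norm // invr_ge0 ltW.
have -> : (d x)^-1%:C *: (k x - mexp ((d x)%:C *: W)) =
    ((d x)^-1%:C *: (k x - 1%:M) - W) -
    (d x)^-1%:C *: (mexp ((d x)%:C *: W) - 1%:M - (d x)%:C *: W).
  have key : (d x)^-1%:C *: ((d x)%:C *: W) = W.
    by rewrite scalerA -rmorphM mulVf ?gt_eqF // scale1r.
  rewrite -[X in _ = _ - X - _]key -!scalerBr; congr (_ *: _).
  by rewrite -!(addrA _ (- 1%:M)) -opprD opprB addrA subrK.
apply: le_trans (fnormB _ _) _; rewrite /e lerD2l fnormZ ger0_norm ?invr_ge0 ?(ltW dx) //.
rewrite ler_pdivrMl //; apply: le_trans h2 _.
by rewrite /c le_eqVlt; apply/orP; left; apply/eqP; ring.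
Qed.

(** For t ≥ 0 the power of k with exponent ⌊t/d⌋ lies in K and differs from the corresponding power
    of e^{dW} by at most ⌊t/d⌋ o(d), which tends to 0; the latter power tends to e^{itH}. Negative
    times follow by adjoints. *)
Lemma limit_tangent_il : il K H.
Proof.
have HH := limit_tangent_herm; have [KU K1 KM KJ Kc] := KK.
have pos t : 0 <= t -> K (mexp (Complex 0 t *: H)).
  move=> t0; pose m x := Num.truncn (t / d x).
  have mP : F [set x | (m x)%:R * d x <= t /\ t - (m x)%:R * d x <= d x].
    apply: filterS d_gt0 => x dx.
    have /andP[h1 h2] := truncn_itv (divr_ge0 t0 (ltW dx)).
    move: h1 h2; rewrite ler_pdivlMr // ltr_pdivrMr // -natr1 mulrDl mul1r => h1 h2.
    by split=> //; rewrite lerBlDl ltW.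
  apply: (Kc F (fun x => k x ^+ m x)).
    apply: filterS kK => x Kk /=; elim: (m x) => [|j IH]; first by rewrite expr0.
    by rewrite mxexprS; exact: KM.
  have cv : mcvg F (fun x => mexp (Complex 0 ((m x)%:R * d x) *: H)) (mexp (Complex 0 t *: H)).
    apply: mcvg_mexp; apply: mcvgZ; last exact: mcvg_cst.
    split; first exact: cvg_cst.
    apply: rcvg_dom d0; apply: filterS2 mP d_gt0 => x [h1 h2] dx /=.
    by rewrite ler0_norm ?subr_le0 // opprB.
  have -> : (fun x => k x ^+ m x) = fun x => (k x ^+ m x - mexp (Complex 0 ((m x)%:R * d x) *: H)) +
      mexp (Complex 0 ((m x)%:R * d x) *: H) by apply/funext => x; rewrite subrK.
  rewrite -[X in mcvg _ _ X]add0r; apply: mcvgD => //.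
  pose e x := t * ((d x)^-1 * fnorm (k x - mexp ((d x)%:C *: W))).
  apply: (mcvg_squeeze (e := e)); last first.
    rewrite -[X in _ --> X](mulr0 t); apply: cvgM; first exact: cvg_cst.
    exact: limit_tangent_close.
  apply: filterS2 (filterI kK mP) d_gt0 => x [/KU kU [h1 h2]] dx.
  rewrite subr0 expmx_imagX //; apply: le_trans (fnorm_exp_diff _ kU (expmx_herm_unitary HH _)) _.
  rewrite /e -WE mulrA ler_wpM2r ?fnorm_ge0 // ler_pdivlMr //.
split=> // t; have [|t0] := leP 0 t; first exact: pos.
have := KJ _ (pos (- t) _); rewrite oppr_ge0 (ltW t0) => /(_ isT).
suff -> : (mexp (Complex 0 (- t) *: H))^H = mexp (Complex 0 t *: H) by [].
have UU := expmx_herm_unitary HH (- t).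
rewrite -[LHS]mulmx1 -(expmx0 R n) -(scale0r H) (_ : 0 = Complex 0 (- t + t) :> C); last first.
  by rewrite addNr.
by rewrite expmx_imagD // mulmxA UU mul1mx.
Qed.

End Tangent.

(* Cartan's argument: translate an element near 1 outside K1 by the nearest
   point of K1, and rescale; the limit is tangent to K but transverse to K1. *)
Lemma exp_generated_nbhd K K1 : compact_group K -> compact_group K1 -> K1 `<=` K ->
  (forall H, il K H -> il K1 H) ->
  exists2 e : R, 0 < e & forall k, K k -> fnorm (k - 1%:M) < e -> K1 k.
Proof.
move=> cK cK1 sub ilK; apply: contrapT => nex.
have [KU _ KM KJ _] := cK; have [K1U K11 K1M K1J K1c] := cK1.
have bad (r : nat) : exists k, [/\ K k, fnorm (k - 1%:M) < r.+1%:R^-1 & ~ K1 k].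
  apply: contrapT => h; apply: nex; exists r.+1%:R^-1; first by rewrite invr_gt0.
  by move=> k Kk kr; apply: contrapT => nk; apply: h; exists k.
pose k r := projT1 (cid (bad r)).
have kP r : [/\ K (k r), fnorm (k r - 1%:M) < r.+1%:R^-1 & ~ K1 (k r)].
  exact: projT2 (cid (bad r)).
have clos r : exists2 h, K1 h & forall s, K1 s -> fnorm (h - k r) <= fnorm (s - k r).
  apply: (@compact_argmin K1 (fun s => fnorm (s - k r)) (fnorm (1%:M : 'M[C]_n)) 0) => //.
  - by move=> s /K1U sU; rewrite fnorm_unitary.
  - by move=> s _; exact: fnorm_ge0.
  - by move=> F g L FF gL; apply: cvg_fnorm; apply: mcvgB => //; exact: mcvg_cst.
  - by exists 1%:M.
pose h r := projT1 (cid2 (clos r)).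
have hP r : K1 (h r) by rewrite /h; case: (cid2 _).
have hm r s : K1 s -> fnorm (h r - k r) <= fnorm (s - k r).
  by rewrite /h; case: (cid2 _) => /= x _; apply.
pose k' r := (h r)^H *m k r; pose d r := fnorm (k' r - 1%:M).
have K1s r s : K1 s -> fnorm (h r *m s - k r) = fnorm (s - k' r).
  move=> K1s; have hU := K1U _ (hP r).
  rewrite -[RHS](fnorm_unitaryl _ hU) mulmxBr /k' mulmxA (unitary_mul_adj hU) mul1mx; done.
have dE r : d r = fnorm (h r - k r).
  by rewrite -[h r]mulmx1 K1s // /d -fnormN opprB.
have dmin r s : K1 s -> d r <= fnorm (k' r - s).
  by move=> K1s'; rewrite dE [X in _ <= X]fnorm_distC -K1s //; apply: hm; exact: K1M.
have d_gt0 r : 0 < d r.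
  rewrite lt_def fnorm_ge0 andbT; apply/eqP => /fnorm_eq0/eqP; rewrite subr_eq0 => /eqP kE.
  have [_ _] := kP r; apply; have := hP r; suff -> : k r = h r by [].
  by rewrite -[RHS]mulmx1 -kE /k' mulmxA (unitary_mul_adj (K1U _ (hP r))) mul1mx.
have d_lt r : d r <= r.+1%:R^-1.
  have [_ /ltW kr _] := kP r; rewrite dE; apply: le_trans (hm r _ K11) _.
  by rewrite -fnormN opprB.
have d0 : d r @[r --> \oo] --> (0 : R).
  apply: (rcvg_dom (f := fun r : nat => (r.+1%:R : R)^-1)); last exact: cvg_harmonic.
  by apply: filterE => r /=; rewrite subr0 ger0_norm ?fnorm_ge0.
have k'K r : K (k' r).
  by apply: KM; [apply: KJ; apply: sub; exact: hP|have [] := kP r].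
have [U [UU oU]] := eventually_ultra.
have UP : ProperFilter U by exact: ultra_proper.
have [W kW] : exists W, mcvg U (fun r => (d r)^-1%:C *: (k' r - 1%:M)) W.
  apply: (@ultra_mcvg_bounded _ _ _ _ _ _ _ 1); apply: filterE => r.
  by rewrite fnormZ ger0_norm ?invr_ge0 ?fnorm_ge0 // mulVf ?gt_eqF.
have Ud0 : d r @[r --> U] --> (0 : R) by move=> B Bn; apply: oU; exact: d0 B Bn.
have Uk : U [set r | K (k' r)] by apply: filterE.
have Ud : U [set r | 0 < d r] by apply: filterE.
have iW := ilK _ (limit_tangent_il cK Uk Ud Ud0 kW).
have lc : (d r)^-1 * fnorm (k' r - mexp ((d r)%:C *: W)) @[r --> U] --> (0 : R).
  exact: limit_tangent_close Ud Ud0 kW.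
have half0 : 0 < 2^-1 :> R by rewrite invr_gt0.
have /rcvgP/(_ _ half0) cl := lc; have [r /=] := filter_ex cl.
have d' : 0 <= (d r)^-1 by rewrite invr_ge0 ltW.
rewrite subr0 ger0_norm ?mulr_ge0 ?fnorm_ge0 // => hr.
have K1e : K1 (mexp ((d r)%:C *: W)).
  have [_ /(_ (d r))] := iW; rewrite scalerA.
  by rewrite (_ : _ * _ = (d r)%:C) //; apply: complexP => /=; ring.
have := dmin r _ K1e => h1.
have : 1 <= 2^-1 :> R.
  by apply: le_trans hr; rewrite -(@mulVf _ (d r)) ?gt_eqF // ler_wpM2l.
by lra.
Qed.

(** The smallest compact group containing all one-parameter subgroups of K; it takes the place of
    the identity component. *)
Definition exp_generated K : set 'M[C]_n :=
  [set k | forall S, compact_group S -> (forall H, il K H -> il S H) -> S k].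

Lemma exp_generated_sub K : compact_group K -> exp_generated K `<=` K.
Proof. by move=> cK k; apply. Qed.

Lemma exp_generated_il K H : il K H -> il (exp_generated K) H.
Proof. by move=> KH; split; [case: KH|move=> t S cS ilS; have [_] := ilS _ KH]. Qed.

Lemma exp_generated_group K : compact_group K -> compact_group (exp_generated K).
Proof.
move=> cK; split.
- by move=> k /(exp_generated_sub cK); case: cK => KU _ _ _ _; exact: KU.
- by move=> S [].
- by move=> k l hk hl S cS ilS; have [_ _ SM _ _] := cS; apply: SM; [exact: hk|exact: hl].
- by move=> k hk S cS ilS; have [_ _ _ SJ _] := cS; apply: SJ; exact: hk.
- move=> F f L FF hF fL S cS ilS; have [_ _ _ _ Sc] := cS; apply: Sc fL.
  by apply: filterS hF => x; apply.
Qed.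

(** A translate of [exp_generated_nbhd]: the radius is the same at every point of the group, so the
    subgroup is open in K. *)
Lemma exp_generated_ball K : compact_group K ->
  exists2 e : R, 0 < e & forall k l, K k -> exp_generated K l -> fnorm (k - l) < e -> exp_generated K k.
Proof.
move=> cK; have cE := exp_generated_group cK.
have [e e0 eP] := exp_generated_nbhd cK cE (exp_generated_sub cK) (@exp_generated_il K).
exists e => // k l Kk El kl; have [EU _ EM EJ _] := cE; have [_ _ KM KJ _] := cK.
have lU := EU _ El; have -> : k = l *m (l^H *m k) by rewrite mulmxA (unitary_mul_adj lU) mul1mx.
apply: EM => //; apply: eP.
  by apply: KM => //; apply: KJ; exact: exp_generated_sub El.
rewrite -(fnorm_unitaryl _ lU) mulmxBr mulmxA (unitary_mul_adj lU) mul1mx mulmx1; done.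
Qed.

End CompactGroups.

(** * Tori and their Lie algebras *)

Section Tori.
Variables (R : realType) (n : nat).
Notation C := R[i].
Implicit Types (S K T : set 'M[C]_n) (H X : 'M[C]_n).

Lemma closure_seq S x : closure S x ->
  exists f : nat -> 'M[C]_n, (forall r, S (f r)) /\ mcvg \oo f x.
Proof.
move=> /closureP h.
have ex (r : nat) : exists y, S y /\ fnorm (y - x) <= (r.+1%:R : R)^-1.
  have r0 : 0 < ((r.+1%:R : R)^-1) by rewrite invr_gt0.
  by have [y Sy yx] := h _ r0; exists y; split=> //; exact: ltW.
exists (fun r => projT1 (cid (ex r))); split=> [r|]; first by case: (cid (ex r)) => y [].
apply: (mcvg_squeeze (e := fun r : nat => (r.+1%:R : R)^-1)); last exact: cvg_harmonic.
by apply: filterE => r; case: (cid (ex r)) => y [].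
Qed.

Lemma closure_limit S (F : set_system nat) (f : nat -> 'M[C]_n) L : ProperFilter F ->
  F [set x | S (f x)] -> mcvg F f L -> closure S L.
Proof.
move=> FF Sf fL; apply/closureP => e e0.
have e2 : 0 < e / 2 by rewrite divr_gt0.
have /mcvg_fnormP/rcvgP/(_ _ e2) near := fL.
have [x [Sx /=]] := filter_ex (filterI Sf near).
rewrite subr0 ger0_norm ?fnorm_ge0 // => h; exists (f x) => //.
by apply: le_lt_trans h _; rewrite ltr_pdivrMr // ltr_pMr // ltr1n.
Qed.

Lemma closed_limitP S : closed S <-> limit_closed S.
Proof.
split=> [/closure_id cS F f L FF Sf fL|cS].
  by rewrite cS; exact: closure_limit fL.
apply/closure_id/seteqP; split=> [|x /closure_seq[f [Sf fx]]]; first exact: subset_closure.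
by apply: (cS \oo f) => //; apply: filterE.
Qed.

Lemma compact_group_inv K k : compact_group K -> K k -> invmx k = k^H.
Proof.
by move=> [KU _ _ _ _] /KU kU; apply: cmulmx1_invmx; rewrite unitary_mul_adj.
Qed.

Lemma torus_compact K T : compact_group K -> is_torus K T -> compact_group T.
Proof.
move=> cK [TK [_ T1 TM TV] Tc _ _]; split => //.
- by have [KU _ _ _ _] := cK; move=> t /TK/KU.
- by move=> t Tt; rewrite -(compact_group_inv cK (TK _ Tt)); exact: TV.
- exact/closed_limitP.
Qed.

(** The group generated by the exponentials is open and closed in the connected torus. *)
Lemma torus_exp K T : compact_group K -> is_torus K T -> T `<=` exp_generated T.
Proof.
move=> cK tT; have cT := torus_compact cK tT; have [_ _ _ Tcon _] := tT.
have cE := exp_generated_group cT; have ET := exp_generated_sub cT.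
have [e e0 eP] := exp_generated_ball cT.
have [_ E1 _ _ Ec] := cE.
suff -> : exp_generated T = T by [].
apply: Tcon; first by exists 1%:M.
  exists [set x | exists2 l, exp_generated T l & fnorm (x - l) < e].
    rewrite openE => x [l El xl]; apply/mx_nbhsP.
    exists (e - fnorm (x - l)); first by rewrite subr_gt0.
    move=> y yx; exists l => //; have -> : y - l = (y - x) + (x - l) by rewrite addrA subrK.
    by apply: le_lt_trans (fnormD _ _) _; rewrite -ltrBrDr.
  apply/seteqP; split=> [l El|k [Tk [l El kl]]]; last exact: eP El kl.
  by split; [exact: ET|exists l => //; rewrite subrr fnorm0].
exists (exp_generated T); first exact/closed_limitP.
by apply/seteqP; split=> [l El|l []] //; split => //; exact: ET.
Qed.

Lemma commute_exp_deriv (A X : 'M[C]_n) :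
  (forall t : R, A *m mexp (t%:C *: X) = mexp (t%:C *: X) *m A) -> A *m X = X *m A.
Proof.
move=> h; pose Q (t : R) := (t^-1)%:C *: (mexp (t%:C *: X) - 1%:M).
apply: (@mcvg_unique R _ (0 : R)^' _ _ _ (fun t => A *m Q t)).
  by apply: mcvg_mul; [exact: mcvg_cst|exact: mexp_deriv].
have -> : (fun t => A *m Q t) = (fun t => Q t *m A).
  apply/funext => t; rewrite /Q -scalemxAr -scalemxAl mulmxBr mulmxBl h.
  by rewrite mulmx1 mul1mx.
by apply: mcvg_mul; [exact: mexp_deriv|exact: mcvg_cst].
Qed.

Lemma imagZ (t : R) X : Complex 0 t *: X = t%:C *: (Complex 0 1 *: X).
Proof. by rewrite scalerA; congr (_ *: _); apply: complexP => /=; ring. Qed.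

Lemma imag_inj X Y : Complex 0 1 *: X = Complex 0 1 *: Y :> 'M[C]_n -> X = Y.
Proof.
move=> /(congr1 (fun Z => Complex 0 (-1) *: Z)); rewrite !scalerA.
have -> : Complex 0 (-1) * Complex 0 1 = 1 :> C by apply: complexP => /=; ring.
by rewrite !scale1r.
Qed.

Lemma commute_imag_deriv (A X : 'M[C]_n) :
  (forall t : R, A *m mexp (Complex 0 t *: X) = mexp (Complex 0 t *: X) *m A) -> A *m X = X *m A.
Proof.
move=> h; have := @commute_exp_deriv A (Complex 0 1 *: X).
rewrite -scalemxAr -scalemxAl => hc; apply: imag_inj; apply: hc => t.
by rewrite -imagZ.
Qed.

Lemma harmonic_dnbhs0 : (r.+1%:R : R)^-1 @[r --> \oo] --> (0 : R)^'.
Proof.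
move=> A; rewrite /dnbhs /within /= => hA.
have h : \oo [set r : nat | (r.+1%:R : R)^-1 != 0 -> A (r.+1%:R : R)^-1] by exact: (@cvg_harmonic R) _ hA.
suff : \oo [set r : nat | A (r.+1%:R : R)^-1] by [].
by apply: filterS h => r; apply; rewrite invr_eq0 pnatr_eq0.
Qed.

(** The products e^{idX} e^{idY} lie in K and are tangent to i(X + Y) as d tends to 0. *)
Lemma il_add K X Y : compact_group K -> il K X -> il K Y -> il K (X + Y).
Proof.
move=> cK [XH KX] [YH KY]; have [_ _ KM _ _] := cK.
pose d (r : nat) := (r.+1%:R : R)^-1.
pose k (r : nat) := mexp (Complex 0 (d r) *: X) *m mexp (Complex 0 (d r) *: Y).
pose W := Complex 0 1 *: X + Complex 0 1 *: Y.
have -> : X + Y = Complex 0 (-1) *: W.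
  rewrite /W -scalerDr scalerA (_ : _ * _ = 1) ?scale1r //.
  by apply: complexP => /=; ring.
apply: (@limit_tangent_il R n K \oo k d W) => //.
- by apply: filterE => r; exact: KM.
- by apply: filterE => r; rewrite /= invr_gt0.
- exact: cvg_harmonic.
pose Q (Z : 'M[C]_n) (t : R) := (t^-1)%:C *: (mexp (t%:C *: (Complex 0 1 *: Z)) - 1%:M).
have lim (Z : 'M[C]_n) : mcvg \oo (fun r => Q Z (d r)) (Complex 0 1 *: Z).
  exact: (mcvg_comp harmonic_dnbhs0 (mexp_deriv _)).
have -> : (fun r => (d r)^-1%:C *: (k r - 1%:M)) =
    (fun r => Q X (d r) *m mexp ((d r)%:C *: (Complex 0 1 *: Y)) + Q Y (d r)).
  apply/funext => r; rewrite /Q -scalemxAl -scalerDr mulmxBl mul1mx addrA subrK.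
  by rewrite /k imagZ (imagZ _ Y).
apply: mcvgD; last exact: lim.
rewrite -[X in mcvg _ _ X]mulmx1; apply: mcvg_mul; first exact: lim.
exact: (mcvg_comp harmonic_dnbhs0 (mexp_cvg1 _)).
Qed.

Section TorusAlgebra.
Variables (K T : set 'M[C]_n).
Hypotheses (cK : compact_group K) (tT : is_torus K T).

Lemma il_comm X Y : il T X -> il T Y -> X *m Y = Y *m X.
Proof.
move=> [_ TX] [_ TY]; have [_ _ _ _ Tcomm] := tT.
apply: commute_imag_deriv => t; symmetry; apply: commute_imag_deriv => s.
exact: Tcomm.
Qed.

Lemma il_scale (a : R) X : il T X -> il T (a%:C *: X).
Proof.
move=> [XH TX]; split=> [|t]; first by rewrite adjZr XH.
rewrite scalerA (_ : _ * _ = Complex 0 (t * a)) //.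
by apply: complexP => /=; ring.
Qed.

Lemma il_0 : il T 0.
Proof.
have [_ T1 _ _ _] := torus_compact cK tT.
by split=> [|t]; rewrite ?adj0 // scaler0 expmx0.
Qed.

(** If X commutes with the Lie algebra of T, the closure of the products of T with e^{isX} is a
    torus containing T, so by maximality it is T. *)
Lemma il_max X : is_maximal_torus K T -> il K X ->
  (forall Y, il T Y -> X *m Y = Y *m X) -> il T X.
Proof.
move=> [_ Tmax] [XH KX] XT; have cT := torus_compact cK tT.
have [TK [_ _ _ _] Tc Tcon Tcomm] := tT.
have [KU K1 KM KJ Kc] := cK; have [TU T1 TM TJ _] := cT.
(* The elements of T commuting with X form a compact group that contains every one-parameter
   subgroup of T, hence all of T. *)
have XTc t : T t -> X *m t = t *m X.
  move=> Tt; have St := torus_exp cK tT Tt.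
  pose S := [set k | T k /\ X *m k = k *m X].
  suff [] : S t by [].
  apply: St; last first.
    move=> Y tY; have [YH TY] := tY; split => // s; split; first exact: TY.
    by apply: expmx_comm; rewrite -scalemxAr XT // -scalemxAl.
  split.
  - by move=> k [/TU].
  - by split => //; rewrite mulmx1 mul1mx.
  - move=> k l [Tk Xk] [Tl Xl]; split; first exact: TM.
    by rewrite mulmxA Xk -mulmxA Xl mulmxA.
  - move=> k [Tk Xk]; split; first exact: TJ.
    by rewrite -{1}XH -adjM -Xk adjM XH.
  - move=> F f L FF Sf fL; split.
      by have [_ _ _ _ c] := cT; apply: (c F f L) => //; apply: filterS Sf => x [].
    apply: (@mcvg_unique R _ F _ _ _ (fun r => X *m f r)).
      by apply: mcvg_mul => //; exact: mcvg_cst.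
    apply: (near_mcvg (f := fun r => f r *m X)); first by apply: filterS Sf => x [_ ->].
    by apply: mcvg_mul => //; exact: mcvg_cst.
pose e (s : R) := mexp (Complex 0 s *: X).
pose A := [set t *m e s | t in T & s in [set: R]].
have eK s : K (e s) by exact: KX.
have e0 : e 0 = 1%:M by rewrite /e (_ : Complex 0 0 = 0) // scale0r expmx0.
have eD s s' : e (s + s') = e s *m e s' by exact: expmx_imagD.
have te t s : T t -> t *m e s = e s *m t.
  by move=> Tt; apply: expmx_comm; rewrite -scalemxAr -scalemxAl XTc.
have eJ s : (e s)^H = e (- s).
  have eU := KU _ (eK s); rewrite -[LHS]mulmx1 -e0 -(subrr s) eD mulmxA eU mul1mx; done.
have TA : T `<=` A by move=> t Tt; exists t => //; exists 0 => //; rewrite e0 mulmx1.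
have Acon : connected A.
  have -> : A = \bigcup_(t in T) (T `|` [set t *m e s | s in [set: R]]).
    apply/seteqP; split=> [_ [t Tt [s _ <-]]|x [t Tt [Tx|[s _ <-]]]].
    - by exists t => //; right; exists s.
    - exact: TA.
    - by exists t => //; exists s.
  apply: bigcup_connected; first by exists 1%:M => t Tt; left.
  move=> t Tt; apply: connectedU => //.
    by exists t; split=> //; exists 0 => //; rewrite e0 mulmx1.
  apply: connected_continuous_connected; first exact/connected_intervalP.
  apply: continuous_subspaceT => s; apply/mcvgE.
  apply: mcvg_mul; first exact: mcvg_cst.
  apply: mcvg_mexp; apply: mcvgZ; last exact: mcvg_cst.
  by split; [exact: cvg_cst|exact: cvg_id].
have AM x y : A x -> A y -> A (x *m y).
  move=> [t Tt [s _ <-]] [t' Tt' [s' _ <-]]; exists (t *m t'); first exact: TM.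
  by exists (s + s') => //; rewrite eD !mulmxA; congr (_ *m e s'); rewrite -!mulmxA te.
have AJ x : A x -> A x^H.
  move=> [t Tt [s _ <-]]; exists t^H; first exact: TJ.
  by exists (- s) => //; rewrite adjM eJ te //; exact: TJ.
have AC x y : A x -> A y -> x *m y = y *m x.
  move=> [t Tt [s _ <-]] [t' Tt' [s' _ <-]].
  have E (a a' : 'M[C]_n) r r' : T a' -> a *m e r *m (a' *m e r') = a *m a' *m e (r + r').
    by move=> Ta'; rewrite eD !mulmxA; congr (_ *m e r'); rewrite -!mulmxA te.
  by rewrite (E t t' s s' Tt') (E t' t s' s Tt) (Tcomm t t' Tt Tt') addrC.
have AK : A `<=` K by move=> _ [t Tt [s _ <-]]; apply: KM; [exact: TK|exact: eK].
have cAK : closure A `<=` K.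
  by move=> x /closure_seq[f [Af fx]]; apply: (Kc \oo f) => //; apply: filterE => r; exact: AK.
have tA : is_torus K (closure A).
  split.
  - exact: cAK.
  - split.
    + by move=> x /cAK/KU xU; exact: unitary_unit.
    + by apply: subset_closure; exact: TA.
    + move=> x y /closure_seq[f [Af fx]] /closure_seq[g [Ag gy]].
      apply: (@closure_limit _ \oo (fun r => f r *m g r)); last exact: mcvg_mul.
      by apply: filterE => r; exact: AM.
    + move=> x cx; rewrite (compact_group_inv cK (cAK _ cx)).
      have [f [Af fx]] := closure_seq cx.
      apply: (@closure_limit _ \oo (fun r => (f r)^H)); last exact: mcvg_adj.
      by apply: filterE => r; exact: AJ.
  - exact: closed_closure.
  - exact: (connected_closure Acon).
  - move=> x y /closure_seq[f [Af fx]] /closure_seq[g [Ag gy]].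
    apply: (@mcvg_unique R _ \oo _ _ _ (fun r => f r *m g r)); first exact: mcvg_mul.
    have -> : (fun r => f r *m g r) = (fun r => g r *m f r) by apply/funext => r; exact: AC.
    exact: mcvg_mul.
have AT := Tmax _ tA (subset_trans TA (@subset_closure _ A)).
split=> // s; rewrite -AT; apply: subset_closure.
by exists 1%:M => //; exists s => //; rewrite mul1mx.
Qed.

End TorusAlgebra.

End Tori.

(** * Irreducibility of the Zariski-connected group *)

Section Irreducibility.
Variables (R : realType) (n : nat) (G : set 'M[R[i]]_n).
Notation C := R[i].
Hypotheses (hGalg : is_algebraic_group G) (hGadj : self_adjoint G).
Implicit Types (f : 'M[C]_n -> C) (X : 'M[C]_n).

Definition exp_factor (E : 'M[C]_n) : Prop := exists X, ik G X /\
  exists t : R, E = mexp (t%:C *: X) \/ E = mexp (Complex 0 t *: X).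

Inductive exp_word : 'M[C]_n -> Prop :=
| exp_word1 : exp_word 1%:M
| exp_wordM a E : exp_word a -> exp_factor E -> exp_word (a *m E).

Lemma exp_factor_adj E : exp_factor E -> exp_factor E^H.
Proof.
move=> [X [ikX [t [->|->]]]]; have [XH _] := ikX; exists X; split=> //.
  by exists t; left; rewrite expmx_herm.
exists (- t); right; have UU := expmx_herm_unitary XH t.
rewrite -[LHS]mulmx1 -(expmx0 R n) -(scale0r X) (_ : 0 = Complex 0 (t - t) :> C); last first.
  by rewrite subrr.
by rewrite expmx_imagD // mulmxA UU mul1mx.
Qed.

Lemma exp_word_mul a b : exp_word a -> exp_word b -> exp_word (a *m b).
Proof.
move=> wa; elim=> [|b' E _ IH fE]; first by rewrite mulmx1.
by rewrite mulmxA; exact: exp_wordM.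
Qed.

Lemma exp_word_factor E : exp_factor E -> exp_word E.
Proof. by move=> fE; rewrite -[E]mul1mx; apply: exp_wordM => //; exact: exp_word1. Qed.

Lemma exp_word_adj a : exp_word a -> exp_word a^H.
Proof.
elim=> [|b E _ IH fE]; first by rewrite adj1; exact: exp_word1.
rewrite adjM; apply: exp_word_mul => //; exact/exp_word_factor/exp_factor_adj.
Qed.

Lemma exp_word_G a : exp_word a -> G a.
Proof.
elim=> [|b E _ Gb [X [ikX [t [->|->]]]]]; first exact: (G_1 hGalg).
  by apply: (G_mul hGalg) => //; have [_] := ikX.
by apply: (G_mul hGalg) => //; have [] := ik_imaginary hGalg ikX t.
Qed.

(** The Zariski closure, within the invertible matrices, of the group generated by exponentials. It
    is irreducible by [exp_word_common] and will turn out to be all of G. *)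
Definition exp_zariski (g : 'M[C]_n) : Prop := g \in unitmx /\
  forall f, polyfun f -> (forall a, exp_word a -> f a = 0) -> f g = 0.

Lemma exp_zariski_word a : exp_word a -> exp_zariski a.
Proof. by move=> wa; split; [exact/(G_unit hGalg)/exp_word_G|move=> f _; apply]. Qed.

Lemma exp_zariski_sub g : exp_zariski g -> G g.
Proof.
move=> [gU gf]; have [_ [S GE]] := hGalg.
rewrite GE; split => // p Sp; apply: gf; first exact: mx_eval_polyfun.
by move=> a /exp_word_G; rewrite {1}GE => -[_]; apply.
Qed.

Lemma polyfun_left (a : 'M[C]_n) f : polyfun f -> polyfun (fun x => f (a *m x)).
Proof. by move=> pf; apply: polyfun_ext (polyfun_mulmx a 1%:M pf) _ => x; rewrite mulmx1. Qed.

Lemma polyfun_right (a : 'M[C]_n) f : polyfun f -> polyfun (fun x => f (x *m a)).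
Proof. by move=> pf; apply: polyfun_ext (polyfun_mulmx 1%:M a pf) _ => x; rewrite mul1mx. Qed.

Lemma polyfun_conj f : polyfun f -> polyfun (fun x : 'M[C]_n => conjc (f x^H)).
Proof.
elim=> [c|i j|f1 f2 _ h1 _ h2|f1 f2 _ h1 _ h2].
- exact: polyfun_cst.
- by apply: polyfun_ext (@polyfun_coord R n j i) _ => x; rewrite adjE conjcK.
- by apply: polyfun_ext (polyfun_add h1 h2) _ => x; rewrite rmorphD.
- by apply: polyfun_ext (polyfun_mul h1 h2) _ => x; rewrite rmorphM.
Qed.

Lemma exp_zariski_mul g h : exp_zariski g -> exp_zariski h -> exp_zariski (g *m h).
Proof.
move=> [gU gf] [hU hf]; split; first by rewrite unitmx_mul gU hU.
move=> f pf f0; apply: (gf (fun x => f (x *m h))); first exact: polyfun_right.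
move=> a wa; apply: (hf (fun x => f (a *m x))); first exact: polyfun_left.
by move=> b wb; apply: f0; exact: exp_word_mul.
Qed.

Lemma exp_zariski_adj g : exp_zariski g -> exp_zariski g^H.
Proof.
move=> zg; split; first by apply: (G_unit hGalg); apply: (G_adj hGadj); exact: exp_zariski_sub.
move=> f pf f0; have [_ /(_ _ (polyfun_conj pf)) h] := zg.
have : conjc (f g^H) = 0 by apply: h => a wa; rewrite f0 ?conjc0 //; exact: exp_word_adj.
by move=> /(congr1 (@conjc R)); rewrite conjcK conjc0.
Qed.

Let K := Ku G.

Lemma Ku_compact : compact_group K.
Proof.
split.
- by move=> k [].
- exact: (Ku_1 hGalg).
- exact: (Ku_mul hGalg).
- exact: (Ku_adj hGadj).
- by move=> F f L FF; exact: (Ku_closed hGalg).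
Qed.

Lemma il_Ku X : il K X <-> ik G X.
Proof.
split=> [[XH KX]|ikX]; last by split; [case: ikX|exact: (ik_imaginary hGalg)].
by apply: (ik_of_imaginary hGalg) => // t; have [] := KX t.
Qed.

(** The part of K inside the closure is compact and contains all one-parameter subgroups of K, so
    Cartan's argument applies. *)
Lemma exp_zariski_nbhd : exists2 e : R, 0 < e &
  forall k, K k -> fnorm (k - 1%:M) < e -> exp_zariski k.
Proof.
pose S := [set k | K k /\ exp_zariski k].
have cK := Ku_compact; have [KU K1 KM KJ Kc] := cK.
have cS : compact_group S.
  split.
  - by move=> k [/KU].
  - by split=> //; exact/exp_zariski_word/exp_word1.
  - by move=> k l [Kk zk] [Kl zl]; split; [exact: KM|exact: exp_zariski_mul].
  - by move=> k [Kk zk]; split; [exact: KJ|exact: exp_zariski_adj].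
  - move=> F f L FF Sf fL; have KL : K L by apply: (Kc F f L) => //; apply: filterS Sf => x [].
    split=> //; split; first by apply: unitary_unit; exact: KU.
    move=> p pp p0; apply: (@ccvg_unique _ _ F _ (fun x => p (f x))).
      exact: ccvg_polyfun.
    have [c1 c2] := @ccvg_cst R nat F _ 0.
    split; [apply: cvg_trans c1|apply: cvg_trans c2]; apply: near_eq_cvg;
      by apply: filterS Sf => x [_ [_ ->]].
have [e e0 eP] := exp_generated_nbhd cK cS (fun k (Sk : S k) => proj1 Sk) (fun X KX =>
  conj (proj1 KX) (fun t => conj (proj2 KX t) (exp_zariski_word (exp_word_factor
    (ex_intro _ X (conj (proj1 (il_Ku X) KX) (ex_intro _ t (or_intror erefl)))))))).
by exists e => // k Kk ke; have [] := eP k Kk ke.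
Qed.

(** Total boundedness of K: if no finite net existed, the sets of points far from finite families
    would generate a proper filter, and a limit point of it would be far from itself. *)
Lemma Ku_net (e : R) : 0 < e -> exists s : seq 'M[C]_n,
  forall k, K k -> exists2 l, l \in s & K l /\ fnorm (k - l) < e.
Proof.
move=> e0; apply: contrapT => nex.
pose B (s : seq 'M[C]_n) := [set k | K k /\ forall l, l \in s -> K l -> e <= fnorm (k - l)].
have B0 s : B s !=set0.
  apply: contrapT => h; apply: nex; exists s => k Kk; apply: contrapT => h2.
  apply: h; exists k; split=> // l ls Kl; rewrite leNgt; apply/negP => h3.
  by apply: h2; exists l.
pose F : set_system 'M[C]_n := [set A | exists s, B s `<=` A].
have FF : ProperFilter F.
  split; first by move=> [s /(_ _)]; have [k Bk] := B0 s; move=> /(_ _ Bk).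
  split; first by exists [::].
    move=> P Q [s sP] [s' sQ]; exists (s ++ s') => k [Kk h]; split.
      by apply: sP; split=> // l ls; apply: h; rewrite mem_cat ls.
    by apply: sQ; split=> // l ls; apply: h; rewrite mem_cat ls orbT.
  by move=> P Q PQ [s sP]; exists s => k /sP/PQ.
have [U [UU FU]] := ultraFilterLemma FF.
have UP : ProperFilter U by exact: ultra_proper.
have UK : U [set k | K k] by apply: FU; exists [::] => k [].
have [L kL] : exists L, mcvg U id L.
  apply: (@ultra_mcvg_bounded _ _ _ _ _ _ _ (fnorm (1%:M : 'M[C]_n))).
  by apply: filterS UK => k [_ kU]; rewrite fnorm_unitary.
have KL : K L by exact: (Ku_closed hGalg UP UK kL).
have e2 : 0 < e / 2 by rewrite divr_gt0.
have /mcvg_fnormP/rcvgP/(_ _ e2) near := kL.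
have far : U (B [:: L]) by apply: FU; exists [:: L].
have [k [/= h1 [_ h2]]] := filter_ex (filterI near far).
have := h2 L; rewrite mem_head => /(_ isT KL); move: h1.
rewrite subr0 ger0_norm ?fnorm_ge0 // => h1 h3.
by have := le_trans h3 h1; lra.
Qed.

Lemma zariski_closed_polyfun (Z : set 'M[C]_n) : Z `<=` [set g | g \in unitmx] ->
  (forall g, g \in unitmx -> ~ Z g -> exists f, [/\ polyfun f, f g != 0 & forall x, Z x -> f x = 0]) ->
  zariski_closed Z.
Proof.
move=> ZU h; exists [set p | forall x, Z x -> mx_eval p x = 0].
apply/seteqP; split=> [g Zg|g [gU gp]]; first by split; [exact: ZU|move=> p; apply].
apply: contrapT => nZ; have [f [pf fg fZ]] := h g gU nZ.
have [p pE] := polyfun_mx_eval pf; move/eqP: fg; apply; rewrite pE; apply: gp => x Zx.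
by rewrite -pE fZ.
Qed.

(** By a finite net of K and the polar decomposition, finitely many cosets of the closure cover G.
    The closure and the union of its other cosets are disjoint in G and Zariski closed, so
    connectedness leaves only the first. *)
Lemma exp_zariski_full : zariski_connected G -> G `<=` exp_zariski.
Proof.
move=> Gcon; have [e e0 eP] := exp_zariski_nbhd; have [s sP] := Ku_net e0.
have [KU K1 KM KJ _] := Ku_compact.
have ikz X (t : R) : ik G X -> exp_zariski (mexp (t%:C *: X)).
  by move=> ikX; apply/exp_zariski_word/exp_word_factor; exists X; split=> //; exists t; left.
pose bad l := K l /\ ~ exp_zariski l.
(* The union of the cosets represented by net points outside the closure. *)
pose Z2 := [set g | g \in unitmx /\ exists2 l, l \in s & bad l /\ exp_zariski (l^H *m g)].
have z1 : exp_zariski 1%:M by exact/exp_zariski_word/exp_word1.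
have Z1c : zariski_closed exp_zariski.
  apply: zariski_closed_polyfun => [g [] //|g gU nz].
  apply: contrapT => h; apply: nz; split=> // f pf f0; apply: contrapT => /eqP fg.
  by apply: h; exists f; split=> // x [_]; apply.
have Z2c : zariski_closed Z2.
  apply: zariski_closed_polyfun => [g [] //|g gU nz].
  have : forall l, l \in s -> bad l -> ~ exp_zariski (l^H *m g).
    by move=> l ls bl zl; apply: nz; split=> //; exists l.
  move=> hb; suff [f [pf fg fz]] : exists f, [/\ polyfun f, f g != 0 &
      forall x, (exists2 l, l \in s & bad l /\ exp_zariski (l^H *m x)) -> f x = 0].
    by exists f; split=> // x [_]; exact: fz.
  elim: (s) hb => [|l s' IH] hb.
    by exists (fun=> 1); split; [exact: polyfun_cst|exact: oner_neq0|move=> x []].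
  have [f [pf fg fz]] := IH (fun l' ls => hb l' (mem_behead (s := l :: s') ls)).
  have [bl|nb] := pselect (bad l); last first.
    exists f; split=> // x [l']; rewrite inE => /orP[/eqP ->|ls] [bl' zl'] //.
    by apply: fz; exists l'.
  have nzl := hb l (mem_head _ _) bl.
  have lgU : l^H *m g \in unitmx.
    by rewrite unitmx_mul gU andbT; apply: unitary_unit; apply: unitary_adj; apply: KU; case: bl.
  have [f' [pf' f'g f'z]] : exists f', [/\ polyfun f', f' (l^H *m g) != 0 &
      forall a, exp_word a -> f' a = 0].
    apply: contrapT => h; apply: nzl; split=> // f' pf' f'0; apply: contrapT => /eqP f'g.
    by apply: h; exists f'.
  exists (fun x => f' (l^H *m x) * f x); split; last first.
  - move=> x [l']; rewrite inE => /orP[/eqP ->|ls] [bl' zl'].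
      by have [_ ->] := zl'; rewrite ?mul0r.
    by rewrite fz ?mulr0 //; exists l'.
  - by rewrite mulf_neq0.
  - by apply: polyfun_mul => //; exact: polyfun_left.
have cover : G `<=` exp_zariski `|` Z2.
  move=> g Gg; have [k [H [Kk ikH gE]]] := G_polar hGalg hGadj Gg.
  have [l ls [Kl kl]] := sP k Kk.
  have zlk : exp_zariski (l^H *m k).
    apply: eP; first by apply: KM => //; exact: KJ.
    have lU := KU _ Kl; rewrite -(fnorm_unitaryl _ lU) mulmxBr mulmxA.
    by rewrite (unitary_mul_adj lU) mul1mx mulmx1.
  have zH : exp_zariski (mexp H) by have := ikz H 1 ikH; rewrite scale1r.
  have zlg : exp_zariski (l^H *m g) by rewrite gE mulmxA; exact: exp_zariski_mul.
  have [zl|nzl] := pselect (exp_zariski l); [left|right].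
    rewrite -[g]mul1mx -(unitary_mul_adj (KU _ Kl)) -mulmxA; exact: exp_zariski_mul.
  by split; [exact: (G_unit hGalg)|exists l].
have disj : G `&` exp_zariski `&` Z2 = set0.
  apply/seteqP; split=> // g [[Gg zg] [_ [l ls [[Kl nzl] zlg]]]]; apply: nzl.
  have [k [H [Kk ikH gE]]] := G_polar hGalg hGadj Gg; have [HH _] := ikH.
  have gH : g *m mexp ((-1)%:C *: H) = k.
    by have := expmx_hermNK HH 1; rewrite scale1r gE -mulmxA => ->; rewrite mulmx1.
  have zk : exp_zariski k by rewrite -gH; apply: exp_zariski_mul => //; exact: ikz.
  have zlk : exp_zariski (l^H *m k).
    by rewrite -gH mulmxA; apply: exp_zariski_mul => //; exact: ikz.
  have -> : l = k *m (l^H *m k)^H.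
    by rewrite adjM adjK mulmxA (unitary_mul_adj (KU _ Kk)) mul1mx.
  by apply: exp_zariski_mul => //; exact: exp_zariski_adj.
have [//|GZ2] := Gcon _ _ Z1c Z2c cover disj.
have : (G `&` exp_zariski `&` Z2) 1%:M.
  by split; [split=> //; exact: (G_1 hGalg)|apply: GZ2; exact: (G_1 hGalg)].
by rewrite disj.
Qed.

Lemma line_factor f a b X E (t : R) : ik G X -> polyfun f ->
  (E = mexp (t%:C *: X) \/ E = mexp (Complex 0 t *: X)) -> f (a *m E *m b) != 0 ->
  \forall m \near \oo, f (a *m mexp (m%:R%:C *: X) *m b) != 0.
Proof.
move=> [XH _] pf; have [U [y [UU ->]]] := herm_spectral XH.
rewrite expmx_real // expmx_imaginary // => hE fE.
have [c [cc EE]] : exists c, character c /\ E = ufun U c y.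
  case: hE => ->; [exists (rchar t)|exists (ichar t)]; split=> //.
    exact: rchar_character.
  exact: ichar_character.
rewrite EE in fE; have := line_eventually_neq0 pf cc fE.
by apply: filterS => m; rewrite expmx_real.
Qed.

(** Induction on the word: once both functions are nonzero at b and bE respectively, E is replaced
    by e^{mX} with m large, where both exponential sums in m are governed by their leading terms. *)
Lemma exp_word_common f1 f2 a : exp_word a -> polyfun f1 -> polyfun f2 ->
  f1 1%:M != 0 -> f2 a != 0 -> exists2 b, exp_word b & f1 b != 0 /\ f2 b != 0.
Proof.
move=> wa pf1; elim: wa f2 => [|c E wc IH fE] f2 pf2 h1 h2.
  by exists 1%:M => //; exact: exp_word1.
have [b wb [f1b f2b]] := IH _ (polyfun_right E pf2) h1 h2.
have [X [ikX [t tE]]] := fE.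
have l1 : \forall m \near \oo, f1 (b *m mexp ((m%:R : R)%:C *: X) *m 1%:M) != 0.
  apply: (line_factor (E := 1%:M) (t := 0)) => //; last by rewrite !mulmx1.
  by left; rewrite scale0r expmx0.
have l2 : \forall m \near \oo, f2 (b *m mexp ((m%:R : R)%:C *: X) *m 1%:M) != 0.
  by apply: (line_factor (E := E) (t := t)) => //; rewrite mulmx1.
have [m [/= h3 h4]] := filter_ex (filterI l1 l2); rewrite !mulmx1 in h3 h4.
exists (b *m mexp ((m%:R : R)%:C *: X)) => //.
by apply: exp_wordM => //; exists X; split=> //; exists m%:R; left.
Qed.

(** Two nonempty Zariski open subsets of G meet: words in exponentials are Zariski dense in G and
    have this property by [exp_word_common]. *)
Lemma G_irreducible f1 f2 g1 g2 : zariski_connected G -> polyfun f1 -> polyfun f2 ->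
  G g1 -> f1 g1 != 0 -> G g2 -> f2 g2 != 0 -> exists2 g, G g & f1 g != 0 /\ f2 g != 0.
Proof.
move=> Gcon pf1 pf2 Gg1 h1 Gg2 h2.
have pf1' := polyfun_left g1 pf1; have pf2' := polyfun_left g1 pf2.
have g1U := G_unit hGalg Gg1.
(* Translating by g1 makes the first function nonzero at the identity; density of words provides one
   where the second is nonzero. *)
have [a [wa f2a]] : exists a, exp_word a /\ f2 (g1 *m a) != 0.
  apply: contrapT => h; have : exp_zariski (invmx g1 *m g2).
    by apply: exp_zariski_full => //; apply: (G_mul hGalg) => //; exact: (G_inv hGalg).
  move=> [_ /(_ _ pf2') hz]; move/eqP: h2; apply.
  rewrite -[g2](mulKVmx g1U); apply: hz => a wa; apply: contrapT => /eqP f2a.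
  by apply: h; exists a.
have h1' : f1 (g1 *m 1%:M) != 0 by rewrite mulmx1.
have [b wb [f1b f2b]] := exp_word_common wa pf1' pf2' h1' f2a.
by exists (g1 *m b) => //; apply: (G_mul hGalg) => //; exact: exp_word_G.
Qed.

End Irreducibility.

(** * Simultaneous diagonalisation and generic combinations *)

Lemma common_trig (C : numClosedFieldType) n (As : seq 'M[C]_n) :
  {in As &, forall A B, A *m B = B *m A} ->
  exists2 P : 'M[C]_n, P \is unitarymx & forall A, A \in As -> is_trig_mx (P *m A *m P^t*).
Proof.
move=> /cotrigonalization[P PU /allP PA]; exists P => // A /PA.
by rewrite /similar_to /= conjymx.
Qed.

Lemma finite_spanning (F : fieldType) n (S : set 'rV[F]_n) :
  exists m (B : 'M[F]_(m, n)), (forall i, S (row i B)) /\ forall x, S x -> (x <= B)%MS.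
Proof.
suff H k m (B : 'M[F]_(m, n)) : (forall i, S (row i B)) -> (n - \rank B <= k)%N ->
    exists m (B : 'M[F]_(m, n)), (forall i, S (row i B)) /\ forall x, S x -> (x <= B)%MS.
  by apply: (H n 0%N 0) => [[]//|]; rewrite leq_subr.
elim: k m B => [|k IH] m B SB rB.
  exists m, B; split=> // x _; apply: submx_full.
  by rewrite /row_full eqn_leq rank_leq_col -subn_eq0 -leqn0 rB.
have [h|nh] := pselect (forall x, S x -> (x <= B)%MS); first by exists m, B.
have [x [Sx xB]] : exists x, S x /\ ~~ (x <= B)%MS.
  apply: contrapT => h; apply: nh => x Sx; apply: contrapT => /negP xB; apply: h.
  by exists x.
apply: (IH _ (col_mx B x)) => [i|].
  by case: (split_ordP i) => j ->; rewrite ?rowKu ?rowKd // row_id.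
have : (B < col_mx B x)%MS.
  by rewrite ltmxE -!addsmxE addsmxSl /=; apply: contra xB; apply: submx_trans (addsmxSr _ _).
move=> /rank_ltmx lt.
rewrite leq_subLR; move: rB; rewrite leq_subLR addnS -addSn => h.
by apply: leq_trans h _; rewrite leq_add2r.
Qed.

Section MomentCurve.
Variable R : realType.

(** A point of the moment curve: its coordinates are positive for s > 0, and it meets any hyperplane
    for finitely many s only. *)
Definition moment_row m (s : R) : 'rV[R]_m := \row_i s ^+ i.

Lemma poly_nonroot (p : {poly R}) : p != 0 -> exists2 s : R, 0 < s & p.[s] != 0.
Proof.
move=> p0; apply: contrapT => nex.
pose rs := [seq (k.+1%:R : R) | k <- iota 0 (size p)].
have := @max_poly_roots _ p rs p0.
rewrite size_map size_iota ltnn => h; suff : false by []; apply: h.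
  apply/allP => _ /mapP[k _ ->]; apply: contrapT => /negP nr; apply: nex.
  by exists k.+1%:R; rewrite ?ltr0n.
by rewrite map_inj_uniq ?iota_uniq // => i j /eqP; rewrite eqr_nat eqSS => /eqP.
Qed.

(** Each nonzero linear form becomes a nonzero polynomial in s; the product of finitely many of them
    has a positive non-root. *)
Lemma moment_avoid (I : finType) (P : pred I) m (q : I -> 'cV[R]_m) :
  (forall i, P i -> q i != 0) ->
  exists2 s : R, 0 < s & forall i, P i -> moment_row m s *m q i != 0.
Proof.
move=> q0; pose p i : {poly R} := \sum_(k < m) q i k 0 *: 'X^k.
have pE i s : (moment_row m s *m q i) 0 0 = (p i).[s].
  rewrite mxE horner_sum; apply: eq_bigr => k _; rewrite hornerZ hornerXn mxE mulrC; done.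
have p0 i : P i -> p i != 0.
  move=> /q0; apply: contra => /eqP pi0; apply/eqP/matrixP => k j; rewrite mxE (ord1 j).
  have := congr1 (fun r : {poly R} => r`_k) pi0; rewrite coef0 coef_sum => <-.
  rewrite (bigD1 k) //= coefZ coefXn eqxx mulr1 big1 ?addr0 // => l lk.
  by rewrite coefZ coefXn [(_ == _)%N]eq_sym -[(_ == _)%N]/(l == k) (negPf lk) mulr0.
have [s s0 sp] : exists2 s : R, 0 < s & (\prod_(i | P i) p i).[s] != 0.
  by apply: poly_nonroot; apply/prodf_neq0 => i; exact: p0.
exists s => // i Pi; move: sp; rewrite horner_prod => /prodf_neq0/(_ i Pi).
by apply: contra => /eqP h; rewrite -pE h mxE.
Qed.

End MomentCurve.

Section Frames.
Variables (R : realType) (n : nat).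
Notation C := R[i].

Lemma dgrD (x y : 'rV[R]_n) : dgr (x + y) = dgr x + dgr y.
Proof. by apply/matrixP => a b; rewrite !mxE -mulrnDl -rmorphD. Qed.

Lemma dgrZ (a : R) (x : 'rV[R]_n) : dgr (a *: x) = a%:C *: dgr x.
Proof. by apply/matrixP => i j; rewrite !mxE rmorphM mulrnAr. Qed.

Lemma dgr_inj : injective (@dgr R n).
Proof.
move=> x y /matrixP h; apply/rowP => j; have := h j j; rewrite !mxE eqxx !mulr1n.
by move=> /complexI.
Qed.

Lemma dgr0 : dgr (0 : 'rV[R]_n) = 0.
Proof. by apply/matrixP => i j; rewrite !mxE mul0rn. Qed.

Lemma entries_commute_dgr (A : 'M[C]_n) (y z : 'rV[R]_n) :
  (forall a b, A a b != 0 -> y 0 a = z 0 b) -> dgr y *m A = A *m dgr z.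
Proof.
move=> h; apply/matrixP => a b; rewrite mul_diag_mx mul_mx_diag !mxE.
have [->|ab] := eqVneq (A a b) 0; first by rewrite mulr0 mul0r.
by rewrite (h a b ab) mulrC.
Qed.

Lemma conj_fixed (z : C) : conjc z = z -> (complex.Re z)%:C = z.
Proof. by move=> /(congr1 (@complex.Im R)); rewrite ImJ => h; apply: complexP => //=; lra. Qed.

Lemma dgr_herm_trig (D : 'M[C]_n) : D^H = D -> (forall a b : 'I_n, (a < b)%N -> D a b = 0) ->
  dgr (\row_j complex.Re (D j j)) = D.
Proof.
move=> DH trig; apply/matrixP => a b; rewrite !mxE; have [->|ab] := eqVneq a b.
  by rewrite mulr1n; apply: conj_fixed; rewrite -adjE DH.
rewrite mulr0n; have := ab; rewrite neq_ltn => /orP[ab'|ba]; first by rewrite trig.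
by rewrite -DH adjE trig // conjc0.
Qed.

(** A finite spanning subfamily is trigonalised simultaneously in a unitary frame; in that frame
    Hermitian matrices of the span are diagonal. *)
Lemma commuting_frame (S : set 'M[C]_n) : (forall X, S X -> X^H = X) ->
  (forall X Y, S X -> S Y -> X *m Y = Y *m X) ->
  exists2 V : 'M[C]_n, is_unitary V & forall X, S X -> exists x, X = V *m dgr x *m V^H.
Proof.
move=> SH Scomm; have [m [B [SB spB]]] := finite_spanning [set mxvec X | X in S].
pose A i := vec_mx (row i B).
have SA i : S (A i) by have [X SX E] := SB i; rewrite /A -E mxvecK.
have [P /unitarymxE PU PA] : exists2 P : 'M[C]_n, P \is unitarymx &
    forall X, X \in [seq A i | i <- enum 'I_m] -> is_trig_mx (P *m X *m P^t*).
  by apply: common_trig => _ _ /mapP[i _ ->] /mapP[j _ ->]; exact: Scomm.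
exists P^H; first exact: unitary_adj.
move=> X SX; pose D := P *m X *m P^H.
have DH : D^H = D by rewrite /D !adjM adjK SH // mulmxA.
have trig (a b : 'I_n) : (a < b)%N -> D a b = 0.
  move=> ab; have /submxP[d dE] := spB (mxvec X) (ex_intro2 _ _ X SX erefl).
  have XE : X = \sum_i d 0 i *: A i.
    rewrite -[X]mxvecK dE (mulmx_sum_row d B) linear_sum; apply: eq_bigr => i _.
    by rewrite linearZ.
  rewrite /D XE mulmx_sumr mulmx_suml summxE big1 // => i _.
  rewrite -scalemxAr -scalemxAl mxE; have := PA (A i) (map_f _ (mem_enum _ i)).
  by rewrite adj_trmxC => /is_trig_mxP ->; rewrite ?mulr0.
exists (\row_j complex.Re (D j j)); rewrite adjK.
rewrite dgr_herm_trig //.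
by rewrite /D !mulmxA PU mul1mx -mulmxA PU mulmx1.
Qed.

End Frames.

(** * Maximal tori: regular elements and conjugacy *)

Section MaximalTorus.
Variables (R : realType) (n : nat) (G : set 'M[R[i]]_n).
Notation C := R[i].
Hypotheses (hGalg : is_algebraic_group G) (hGadj : self_adjoint G).

(** First-order condition at the maximum: along conjugation by e^{itA} with A = i[Y, c] the
    derivative of ⟨c, ·⟩ is ‖[c, Y]‖², which cannot be positive. *)
Lemma maximizer_commutes c Y : ik G c -> ik G Y ->
  (forall k, Ku G k -> rinner c (k *m Y *m k^H) <= rinner c Y) -> c *m Y = Y *m c.
Proof.
move=> ikc ikY cmax; have [cH _] := ikc; have [YH _] := ikY.
pose A := Complex 0 1 *: (Y *m c - c *m Y).
have ikA : ik G A by exact: (ik_bracket hGalg).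
pose iA := Complex 0 1 *: A.
have iAE : iA = c *m Y - Y *m c.
  rewrite /iA /A scalerA (_ : _ * _ = -1); last by apply: complexP => /=; ring.
  by rewrite scaleN1r opprB.
have iAH : iA^H = - iA by rewrite iAE adjB !adjM cH YH opprB.
pose d (r : nat) := (r.+1%:R : R)^-1.
pose k r := mexp ((d r)%:C *: iA).
have kK r : Ku G (k r) by have := ik_imaginary hGalg ikA (d r); rewrite imagZ.
pose Q r := (d r)^-1%:C *: (k r - 1%:M).
have Qc : mcvg \oo Q iA by exact: (mcvg_comp (@harmonic_dnbhs0 R) (mexp_deriv iA)).
have kc : mcvg \oo k 1%:M by exact: (mcvg_comp (@harmonic_dnbhs0 R) (mexp_cvg1 iA)).
have lim : mcvg \oo (fun r => Q r *m Y *m (k r)^H + Y *m (Q r)^H) (iA *m Y *m 1%:M^H + Y *m iA^H).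
  apply: mcvgD; apply: mcvg_mul.
  - by apply: mcvg_mul => //; exact: mcvg_cst.
  - exact: mcvg_adj.
  - exact: mcvg_cst.
  - exact: mcvg_adj.
have le0 : rinner c (iA *m Y *m 1%:M^H + Y *m iA^H) <= 0.
  apply: (@rcvg_le R nat \oo (fun r => rinner c (Q r *m Y *m (k r)^H + Y *m (Q r)^H)) (fun=> 0)).
  - by apply: cvg_rinner => //; exact: mcvg_cst.
  - exact: cvg_cst.
  apply: filterE => r /=.
  have -> : Q r *m Y *m (k r)^H + Y *m (Q r)^H = (d r)^-1%:C *: (k r *m Y *m (k r)^H - Y).
    rewrite /Q adjZr -!scalemxAl -scalemxAr -scalerDr; congr (_ *: _).
    by rewrite adjB adj1 !mulmxBl mulmxBr mul1mx mulmx1 addrA subrK.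
  rewrite rinnerZr rinnerBr mulr_ge0_le0 ?invr_ge0 // ?subr_le0 ?ler0n //.
  exact: cmax.
have LE : rinner c (iA *m Y *m 1%:M^H + Y *m iA^H) = rinner iA iA.
  rewrite adj1 mulmx1 iAH mulmxN rinnerBr rinner_mulr2 rinner_mull2 YH -rinnerBl.
  by rewrite -iAE.
apply/eqP; rewrite -subr_eq0 -iAE; apply/eqP/rinner_eq0.
by apply: le_anti; rewrite rinner_ge0 -LE le0.
Qed.

Variable T : set 'M[C]_n.
Hypothesis mT : is_maximal_torus (Ku G) T.

Let cK := Ku_compact hGalg hGadj.
Let tT : is_torus (Ku G) T := proj1 mT.
Let cT := torus_compact cK tT.

Lemma il_torus_ik X : il T X -> ik G X.
Proof.
move=> [XH TX]; apply/(il_Ku hGalg); split=> // t.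
by have [TK _ _ _ _] := tT; exact: TK.
Qed.

Lemma torus_frame : exists2 V : 'M[C]_n, is_unitary V &
  forall X, il T X -> exists x, X = V *m dgr x *m V^H.
Proof.
apply: commuting_frame => [X []//|X Y].
exact: (il_comm tT).
Qed.

Section Coordinates.
Variable V : 'M[C]_n.
Hypotheses (VU : is_unitary V) (VT : forall X, il T X -> exists x, X = V *m dgr x *m V^H).

Definition tcoord (y : 'rV[R]_n) : Prop := il T (V *m dgr y *m V^H).

Lemma tcoord_comb m (a : 'rV[R]_m) (E : 'M[R]_(m, n)) :
  (forall i, tcoord (row i E)) -> tcoord (a *m E).
Proof.
move=> TE; rewrite mulmx_sum_row; elim/big_ind: _ => [|x y tx ty|i _].
- by rewrite /tcoord dgr0 mulmx0 mul0mx; exact: (il_0 cK tT).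
- by rewrite /tcoord dgrD mulmxDr mulmxDl; exact: (il_add cT).
- by rewrite /tcoord dgrZ -scalemxAr -scalemxAl; exact: (il_scale _ (TE i)).
Qed.

Lemma frame_inj x y : V *m dgr x *m V^H = V *m dgr y *m V^H -> x = y.
Proof.
move=> /(congr1 (fun Z => V^H *m Z *m V)); rewrite !mulmxA VU !mul1mx -!mulmxA VU !mulmx1.
exact: dgr_inj.
Qed.

(** The coordinates of [x] coincide only where those of every element of the torus algebra do, so
    what commutes with x commutes with the whole torus algebra. *)
Definition regular (x : 'rV[R]_n) : Prop :=
  forall a b, x 0 a = x 0 b -> forall y, tcoord y -> y 0 a = y 0 b.

Lemma regular_centralizer x X : tcoord x -> regular x -> ik G X ->
  (V *m dgr x *m V^H) *m X = X *m (V *m dgr x *m V^H) -> il T X.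
Proof.
move=> tx rx ikX comm; apply: (il_max cK tT mT); first exact/(il_Ku hGalg).
move=> Y TY; have [y YE] := VT TY; rewrite YE in TY *.
pose X' := V^H *m X *m V.
have XE : X = V *m X' *m V^H.
  by rewrite /X' !mulmxA (unitary_mul_adj VU) mul1mx -mulmxA (unitary_mul_adj VU) mulmx1.
have conjM (A B : 'M[C]_n) : (V *m A *m V^H) *m (V *m B *m V^H) = V *m (A *m B) *m V^H.
  by rewrite !mulmxA -(mulmxA (V *m A)) VU mulmx1.
have h : dgr x *m X' = X' *m dgr x.
  move: comm; rewrite XE !conjM => /(congr1 (fun Z => V^H *m Z *m V)).
  by rewrite !mulmxA VU !mul1mx -!mulmxA VU !mulmx1.
rewrite XE !conjM; congr (_ *m _ *m _); symmetry; apply: entries_commute_dgr => a b ab.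
by apply: rx => //; exact: commute_dgr_entries h _ _ ab.
Qed.

(** Two coordinates that differ somewhere on the torus algebra give a nonzero difference of columns
    of [E], avoided by the moment curve. Its positive coefficients matter later, when the rows of
    [E] lie in a cone. *)
Lemma regular_comb m (E : 'M[R]_(m, n)) : (forall i, tcoord (row i E)) ->
  (forall y, tcoord y -> (y <= E)%MS) ->
  exists2 s : R, 0 < s & regular (moment_row m s *m E).
Proof.
move=> TE spE.
pose q (p : 'I_n * 'I_n) := col p.1 E - col p.2 E.
have [s s0 sq] := @moment_avoid R _ (fun p => q p != 0) m q (fun i h => h).
have qE (u : 'rV[R]_m) p : (u *m q p) 0 0 = (u *m E) 0 p.1 - (u *m E) 0 p.2.
  by rewrite /q mulmxBr !colE !mulmxA -!colE; move: (u *m E) => Z; rewrite !mxE.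
exists s => // a b ab y /spE/submxP[d ->].
have [qz|qnz] := eqVneq (q (a, b)) 0.
  by apply/eqP; rewrite -subr_eq0 -(qE d (a, b)) qz mulmx0 mxE.
have /eqP[] := sq _ qnz; apply/matrixP => i j; rewrite !ord1 qE ab subrr mxE; done.
Qed.

Lemma exists_regular : exists2 x, tcoord x & regular x.
Proof.
have [m [E [TE spE]]] := finite_spanning [set y | tcoord y].
have [s _ rs] := regular_comb TE spE.
by exists (moment_row m s *m E) => //; exact: tcoord_comb.
Qed.

End Coordinates.

Lemma orbit_maximizer c X : exists2 k, Ku G k &
  forall l, Ku G l -> rinner c (l *m X *m l^H) <= rinner c (k *m X *m k^H).
Proof.
have [KU K1 _ _ Kc] := cK.
have [k Kk kmin] : exists2 k, Ku G k & forall l, Ku G l ->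
    - rinner c (k *m X *m k^H) <= - rinner c (l *m X *m l^H).
  apply: (@compact_argmin R n (Ku G) (fun k => - rinner c (k *m X *m k^H))
     (fnorm (1%:M : 'M[C]_n)) (- (fnorm c * fnorm X))).
  - by move=> k /KU kU; rewrite fnorm_unitary.
  - move=> k /KU kU; rewrite lerN2 -(fnorm_conj X kU); exact: rinner_le_fnorm.
  - exact: Kc.
  - move=> F g L FF gL; apply: cvgN; apply: cvg_rinner; first exact: mcvg_cst.
    apply: mcvg_mul; last exact: mcvg_adj.
    by apply: mcvg_mul => //; exact: mcvg_cst.
  - by exists 1%:M.
by exists k => // l Kl; rewrite -lerN2; exact: kmin.
Qed.

(** A maximiser of ⟨c, ·⟩ on the orbit, for regular c, commutes with c and so lies in the torus
    algebra. *)
Lemma conj_into_torus X : ik G X -> exists2 k, Ku G k & il T (k *m X *m k^H).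
Proof.
move=> ikX; have [V VU VT] := torus_frame; have [x tx rx] := exists_regular V.
pose c := V *m dgr x *m V^H; have ikc : ik G c by exact: il_torus_ik.
have [k Kk kmax] := orbit_maximizer c X; exists k => //.
have ikk : ik G (k *m X *m k^H) by exact: (ik_conj hGalg hGadj).
apply: (regular_centralizer VU VT tx rx ikk); apply: maximizer_commutes => // l Kl.
have := kmax (l *m k) (Ku_mul hGalg Kl Kk); rewrite adjM !mulmxA; done.
Qed.

End MaximalTorus.

(** * Minors of unitary frames under a one-parameter flow *)

Section FrameAsymptotics.
Variable R : realType.
Notation C := R[i].

Lemma sqnM (z w : C) : sqn (z * w) = sqn z * sqn w.
Proof. by case: z w => [a b] [c e]; rewrite /sqn /=; ring. Qed.

Lemma sqn_ge0 (z : C) : 0 <= sqn z.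
Proof. by rewrite /sqn addr_ge0 ?sqr_ge0. Qed.

Lemma sqn_gt0 (z : C) : z != 0 -> 0 < sqn z.
Proof. exact: normc2_gt0. Qed.

Lemma sqn_real (a : R) : sqn a%:C = a ^+ 2.
Proof. by rewrite /sqn /= expr0n addr0. Qed.

Lemma sqn_prod I (r : seq I) (P : pred I) (f : I -> C) :
  sqn (\prod_(i <- r | P i) f i) = \prod_(i <- r | P i) sqn (f i).
Proof.
elim/big_rec2: _ => [|i x y _ <-]; last by rewrite sqnM.
by rewrite -[1]/(1%:C) sqn_real expr1n.
Qed.

Lemma sqn_conj (z : C) : sqn (conjc z) = sqn z.
Proof. by case: z => a b; rewrite /sqn /= sqrrN. Qed.

Lemma gram_diag m n (A : 'M[C]_(m, n)) (a : 'I_n) : (A^H *m A) a a = (\sum_i sqn (A i a))%:C.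
Proof. by rewrite mxE rmorph_sum; apply: eq_bigr => i _; rewrite adjE normc2. Qed.

Lemma unitary_col n (Q : 'M[C]_n) (a : 'I_n) : is_unitary Q -> \sum_i sqn (Q i a) = 1.
Proof.
move=> QU; have := gram_diag Q a; rewrite QU mxE eqxx => /(congr1 (@complex.Re R)) /=.
by move=> <-.
Qed.

Lemma unitary_row n (Q : 'M[C]_n) (a : 'I_n) : is_unitary Q -> \sum_i sqn (Q a i) = 1.
Proof.
move=> /unitary_adj/(unitary_col a) <-; apply: eq_bigr => i _.
by rewrite adjE sqn_conj.
Qed.

Lemma sqn_det_unitary n (Q : 'M[C]_n) : is_unitary Q -> sqn (\det Q) = 1.
Proof.
move=> QU; have := congr1 (@determinant _ n) QU.
rewrite det_mulmx det1 det_adj normc2 => /(congr1 (@complex.Re R)) /= <-; done.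
Qed.

(** Hadamard's inequality: in a QR factorisation of the padded block, each diagonal entry of r is
    bounded by the length of a column, which is at most 1. *)
Lemma minor_unitary_le n j (Q : 'M[C]_n) : is_unitary Q -> sqn (minor j Q) <= 1.
Proof.
move=> QU; have [q [r [qU ru E]]] := upper_qr (blk j Q).
rewrite /minor E det_mulmx sqnM sqn_det_unitary // mul1r -minor_full minor_upper //.
rewrite sqn_prod; apply: prodr_ile1 => a _; rewrite sqn_ge0 /=.
have h : \sum_i sqn (r i a) = \sum_i sqn (blk j Q i a).
  have := gram_diag (blk j Q) a; rewrite E adjM -mulmxA (mulmxA q^H) qU mul1mx gram_diag.
  by rewrite -E => -[].
apply: (@le_trans _ _ (\sum_i sqn (r i a))).
  by rewrite (bigD1 a) //= lerDl; apply: sumr_ge0 => i _; exact: sqn_ge0.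
rewrite h; have [aj|ja] := ltnP a j.
  rewrite -(unitary_col a QU); apply: ler_sum => i _; rewrite mxE aj andbT.
  case: ifP => // ij; rewrite (_ : i == a = false) ?sqn_real ?expr0n ?sqn_ge0 //.
  by apply: contraFF ij => /eqP ->.
rewrite (bigD1 a) //= big1 => [|i ia].
  by rewrite mxE ltnNge ja andbF eqxx addr0 (sqn_real 1) expr1n.
by rewrite mxE (ltnNge a) ja andbF (negPf ia) (sqn_real 0) expr0n.
Qed.

Lemma minor_dgr n j (z : 'rV[R]_n) (A : 'M[C]_n) :
  minor j (dgr z *m A) = (\prod_(a < n | (a < j)%N) z 0 a)%:C * minor j A.
Proof.
have up : upper (dgr z) by move=> a b ba; rewrite !mxE -val_eqE gtn_eqF // mulr0n.
have dH : (dgr z)^H = dgr z.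
  by apply/matrixP => a b; rewrite adjE !mxE eq_sym; case: eqP => [->|_];
    rewrite ?mulr1n ?mulr0n ?conj_real ?conjc0.
rewrite -[LHS]conjcK -minor_adj adjM dH minorM; last exact: upper_bupper.
have -> : conjc (minor j A^H * minor j (dgr z)) = conjc (minor j A^H) * conjc (minor j (dgr z)).
  by rewrite rmorphM.
rewrite -!minor_adj adjK dH mulrC; congr (_ * _).
rewrite minor_upper // rmorph_prod; apply: eq_bigr => a _.
by rewrite !mxE eqxx mulr1n.
Qed.

Lemma abel_sumE (y f : nat -> R) n : \sum_(i < n.+1) y i * (f i.+1 - f i) =
  y n * f n.+1 - y 0%N * f 0%N + \sum_(j < n) (y j - y j.+1) * f j.+1.
Proof.
elim: n => [|n IH]; first by rewrite big_ord_recr big_ord0 /= big_ord0; ring.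
by rewrite big_ord_recr /= IH [in RHS]big_ord_recr /=; ring.
Qed.

Lemma abel_term_le (y f : nat -> R) n j : nonincr n y -> (forall i, 0 <= f i) ->
  f 0%N = 0 -> f n = 0 -> (j.+1 < n)%N ->
  (y j - y j.+1) * f j.+1 <= \sum_(i < n) y i * (f i.+1 - f i).
Proof.
case: n => // n ym f0 f00 fn jn; rewrite abel_sumE fn f00 !mulr0 subrr add0r.
rewrite (bigD1 (Ordinal (jn : (j < n)%N))) //= lerDl; apply: sumr_ge0 => i _.
by rewrite mulr_ge0 // subr_ge0; apply: ym; rewrite leqnSn ltnS ltn_ord.
Qed.

(** Rows and columns of |Q_ab|² sum to 1, so the sum of |Q_ab|²(y_a - y_b) is zero; all its terms
    being nonnegative, each vanishes. *)
Lemma block_unitary_entries n (y : 'rV[R]_n) (Q : 'M[C]_n) : is_unitary Q ->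
  (forall a b, y 0 a < y 0 b -> Q a b = 0) -> forall a b, Q a b != 0 -> y 0 a = y 0 b.
Proof.
move=> QU Qb a b ab.
have s0 : \sum_a \sum_b sqn (Q a b) * (y 0 a - y 0 b) = 0.
  transitivity (\sum_a \sum_b sqn (Q a b) * y 0 a - \sum_b \sum_a sqn (Q a b) * y 0 b).
    rewrite [X in _ = _ - X]exchange_big /= -sumrB; apply: eq_bigr => i _; rewrite -sumrB.
    by apply: eq_bigr => l _; rewrite mulrBr.
  apply/eqP; rewrite subr_eq0; apply/eqP; apply: eq_bigr => i _.
  by rewrite -!mulr_suml unitary_row // unitary_col.
have ge0 i l : 0 <= sqn (Q i l) * (y 0 i - y 0 l).
  have [lt|le] := ltP (y 0 i) (y 0 l); last by rewrite mulr_ge0 ?sqn_ge0 ?subr_ge0.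
  by rewrite Qb // (sqn_real 0) expr0n mul0r.
have h1 := @psumr_eq0P _ _ _ _ (fun i _ => sumr_ge0 _ (fun l _ => ge0 i l)) s0 a isT.
have := @psumr_eq0P _ _ _ _ (fun l _ => ge0 a l) h1 b isT.
by move=> /eqP; rewrite mulf_eq0 gt_eqF ?sqn_gt0 //= subr_eq0 => /eqP.
Qed.

(** Induction on the column: earlier columns in the same or a higher level vanish in row [a], and
    the diagonal of [r] is nonzero. *)
Lemma block_qr n (y : nat -> R) (q r : 'M[C]_n) : nonincr n y -> upper r -> r \in unitmx ->
  (forall a b : 'I_n, y a < y b -> (q *m r) a b = 0) ->
  forall a b : 'I_n, y a < y b -> q a b = 0.
Proof.
move=> ym ru rU qr a [b bn]; elim/ltn_ind: b bn => b IH bn ab.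
have := qr a (Ordinal bn) ab; rewrite mxE (bigD1 (Ordinal bn)) //= big1 ?addr0 => [/eqP|c cb].
  rewrite mulf_eq0 => /orP[/eqP //|/eqP rbb].
  move: rU; rewrite unitmxE unitfE -minor_full minor_upper // => /prodf_neq0 h.
  by have := h (Ordinal bn) (ltn_ord _); rewrite rbb eqxx.
have [cltb|] := ltnP c b; last first.
  rewrite leq_eqVlt => /orP[/eqP bc|bc]; last by rewrite ru // mulr0.
  by move: cb; rewrite -val_eqE /= -bc eqxx.
have yc : y a < y c by apply: lt_le_trans ab _; apply: ym; rewrite (ltnW cltb) bn.
by case: c cltb yc {cb} => c cn /= cltb yc; rewrite (IH c) // mul0r.
Qed.

End FrameAsymptotics.

Section FlowFrames.
Variables (R : realType) (n : nat).
Notation C := R[i].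

Lemma sum_lt_split (x : 'I_n -> R) (i : 'I_n) :
  \sum_(a < n | (a < i.+1)%N) x a - \sum_(a < n | (a < i)%N) x a = x i.
Proof.
rewrite (bigD1 i) //= -[RHS]addr0 -addrA; congr (_ + _); apply/eqP; rewrite subr_eq0; apply/eqP.
by apply: eq_bigl => a; rewrite ltnS [in RHS]ltn_neqAle andbC.
Qed.

Lemma rinner_frames (V : 'M[C]_n) (x z : 'rV[R]_n) : is_unitary V ->
  rinner (V *m dgr x *m V^H) (V *m dgr z *m V^H) = \sum_j x 0 j * z 0 j.
Proof.
move=> VU; rewrite rinner_unitaryr ?rinner_unitaryl //; last exact: unitary_adj.
rewrite rinner_herm_diag; apply: eq_bigr => j _.
by rewrite !mxE eqxx mulr1n.
Qed.

Lemma gap_le0 (S p : nat -> R) M : (forall s, p s <= M) ->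
  (forall s, 2 * (M - p s.+1) <= S s - S s.+1) -> forall s, S s <= S 0%N.
Proof.
move=> pM gap; elim=> // s; apply: le_trans.
by have := gap s; have := pM s.+1; lra.
Qed.

Lemma nonincreasing_gap (S p : nat -> R) M : (forall s, 0 <= S s) -> (forall s, p s <= M) ->
  (forall s, 2 * (M - p s.+1) <= S s - S s.+1) -> p s @[s --> \oo] --> M.
Proof.
move=> S0 pM gap.
have dec : nonincreasing_seq S.
  by apply/nonincreasing_seqP => s; have := gap s; have := pM s.+1; lra.
have cS : cvgn S.
  by apply: nonincreasing_is_cvgn => //; exists 0 => _ [s _ <-].
have d0 : S s - S s.+1 @[s --> \oo] --> (0 : R).
  rewrite -[X in _ --> X](subrr (limn S)); apply: cvgB => //.
  by rewrite (cvg_shiftS S).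
rewrite -(cvg_shiftS p); apply: rcvg_dom d0; apply: filterE => s /=.
by have := gap s; have := pM s.+1 => h1 h2; rewrite ler0_norm ?subr_le0 // opprB; lra.
Qed.

Lemma ln_balance (u v m t : R) : 0 < u -> 0 < v -> 0 < m -> u * v = expR t ^+ 2 * m ->
  ln v = 2 * t + ln m + - ln u.
Proof.
move=> u0 v0 m0 /(congr1 (@ln R)).
rewrite lnM ?posrE // lnM ?posrE ?exprn_gt0 ?expR_gt0 // lnXn ?expR_gt0 // expRK -mulr_natl.
by move: (ln u) (ln v) (ln m) => *; lra.
Qed.

Lemma gram_cancel (E B H : 'M[C]_n) : E^H = E -> E *m B *m E = 1%:M ->
  (E *m H)^H *m B *m (E *m H) = H^H *m H.
Proof.
move=> EH EBE; rewrite adjM EH !mulmxA -(mulmxA _ E B) -(mulmxA _ _ E) EBE.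
by rewrite mulmx1.
Qed.

Lemma expmx_cancel2 (A : 'M[C]_n) : A^H = A ->
  mexp (1%:C *: A) *m mexp ((-2)%:C *: A) *m mexp (1%:C *: A) = 1%:M.
Proof.
move=> AH; rewrite -!expmx_hermD // (_ : 1 + -2 + 1 = 0 :> R) ?scale0r ?expmx0 //; ring.
Qed.

Section Frames.
Variables (V g c : 'M[C]_n) (y : nat -> R) (ga : 'rV[R]_n) (q : nat -> 'M[C]_n).
Hypotheses (VU : is_unitary V) (ym : nonincr n y) (cE : c = V *m dgr ga *m V^H).
Hypotheses (gU : g \in unitmx) (gm : forall j, (j <= n)%N -> minor j (V^H *m g *m V) != 0).
Hypothesis qU : forall s, is_unitary (q s).
Let h (s : nat) := mexp ((s%:R : R)%:C *: c) *m g.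
Let Y := V *m dgr (rv n y) *m V^H.
Hypothesis qb : forall s (a b : 'I_n), y a < y b -> (V^H *m (q s)^H *m h s *m V) a b = 0.
Hypothesis qmax : forall s, rinner (q s *m Y *m (q s)^H) c <= rinner Y c.

Let cH : c^H = c. Proof. by rewrite cE herm_dgr. Qed.

Let hU s : h s \in unitmx.
Proof. by rewrite /h unitmx_mul gU andbT; exact: expmx_herm_unit. Qed.

(** Replaces the block factorisation by K with a genuine QR factorisation in the frame V. The extra
    unitary factor is block triangular, hence block diagonal, and commutes with diag(y). *)
Lemma flow_qr s : exists Q r : 'M[C]_n, [/\ is_unitary Q, upper r, r \in unitmx,
  h s *m V = V *m Q *m r & V *m Q *m dgr (rv n y) *m (V *m Q)^H = q s *m Y *m (q s)^H].
Proof.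
have [w [r [wU ru PE]]] := upper_qr (V^H *m (q s)^H *m h s *m V).
pose Q := V^H *m q s *m V *m w.
have QU : is_unitary Q.
  by apply: unitary_mul => //; apply: unitary_mul => //; apply: unitary_mul => //; exact: unitary_adj.
have VQ : V *m Q = q s *m V *m w by rewrite /Q !mulmxA (unitary_mul_adj VU) mul1mx.
have hE : h s *m V = V *m Q *m r.
  rewrite VQ -(mulmxA _ w) -PE !mulmxA -(mulmxA (q s) V) (unitary_mul_adj VU) mulmx1.
  by rewrite (unitary_mul_adj (qU s)) mul1mx.
have VQU : is_unitary (V *m Q) by exact: unitary_mul.
have rU : r \in unitmx by exact: (unit_upper VU (hU s) VQU hE).
exists Q, r; split => //.
have wb : forall a b : 'I_n, y a < y b -> w a b = 0.
  by apply: block_qr ru rU _ => // a b ab; rewrite -PE qb.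
have wy : dgr (rv n y) *m w = w *m dgr (rv n y).
  apply: entries_commute_dgr; apply: block_unitary_entries => // a b.
  by rewrite !mxE; exact: wb.
rewrite VQ -(mulmxA _ w) -wy !adjM !mulmxA -(mulmxA _ w) (unitary_mul_adj wU) mulmx1.
by rewrite /Y ?mulmxA.
Qed.

Let Q s := projT1 (cid (flow_qr s)).
Let r s := projT1 (cid (projT2 (cid (flow_qr s)))).

Let QrP s : [/\ is_unitary (Q s), upper (r s), r s \in unitmx,
  h s *m V = V *m Q s *m r s & V *m Q s *m dgr (rv n y) *m (V *m Q s)^H = q s *m Y *m (q s)^H].
Proof. exact: projT2 (cid (projT2 (cid (flow_qr s)))). Qed.

Let l j := ln (sqn (minor j (V^H *m g *m V))).
Let Ga j := \sum_(a < n | (a < j)%N) ga 0 a.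

Let minor_h s j : minor j (Q s) * minor j (r s) = (expR (s%:R * Ga j))%:C * minor j (V^H *m g *m V).
Proof.
have [_ ru _ hE _] := QrP s.
rewrite -minorM; last exact: upper_bupper.
have -> : Q s *m r s = V^H *m (h s *m V) by rewrite hE !mulmxA VU mul1mx.
rewrite /h cE expmx_real // -(ufun_comp V (fun x => expR (s%:R * x)) (real_complex R)) ufun_id.
rewrite !mulmxA VU mul1mx -!(mulmxA (dgr _)) minor_dgr; congr (_%:C * _).
rewrite /Ga mulr_sumr (big_morph (@expR R) (@expRD R) (@expR0 R)).
by apply: eq_bigr => a _; rewrite mxE.
Qed.

Let Q_neq0 s j : (j <= n)%N -> minor j (Q s) != 0.
Proof.
move=> jn; have := minor_h s j; have := gm jn; move: (minor j (V^H *m g *m V)) => m m0 E.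
apply/eqP => Q0; move: E; rewrite Q0 mul0r => /esym/eqP; rewrite mulf_eq0 (negPf m0) orbF.
by move=> /eqP/(congr1 (@complex.Re R)) /= /eqP; rewrite gt_eqF // expR_gt0.
Qed.

Let f s j := - ln (sqn (minor j (Q s))).

Let f_ge0 s j : 0 <= f s j.
Proof. by have [QU _ _ _ _] := QrP s; rewrite oppr_ge0 ln_le0 // minor_unitary_le. Qed.

Let f_0 s : f s 0 = 0.
Proof. by rewrite /f minor0 (sqn_real 1) expr1n ln1 oppr0. Qed.

Let f_n s : f s n = 0.
Proof. by have [QU _ _ _ _] := QrP s; rewrite /f minor_full sqn_det_unitary // ln1 oppr0. Qed.

(** The Lyapunov function of the flow: it weighs how close the leading minors of [Q s] at the drops
    of y are to zero. *)
Let S s := \sum_(i < n) y i * (f s i.+1 - f s i).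

Let ln_minor_r s j : (j <= n)%N -> ln (sqn (minor j (r s))) = 2 * s%:R * Ga j + l j + f s j.
Proof.
move=> jn; have E := congr1 (@sqn R) (minor_h s j).
rewrite !sqnM sqn_real in E; have Q0 := sqn_gt0 (Q_neq0 s jn); have g0 := sqn_gt0 (gm jn).
have r0 : 0 < sqn (minor j (r s)).
  by have [_ ru rU _ _] := QrP s; apply: sqn_gt0; exact: minor_upper_neq0.
by rewrite (ln_balance Q0 r0 g0 E) mulrA.
Qed.

Let M := rinner Y c.

Let ME : M = \sum_(i < n) y i * ga 0 i.
Proof. by rewrite /M /Y cE rinner_frames //; apply: eq_bigr => i _; rewrite mxE. Qed.

Let b s := bus y (V^H *m ((h s)^H *m h s) *m V).
Let c0 := \sum_(i < n) y i * (l i.+1 - l i).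

(** The diagonal flow multiplies minors by explicit exponentials, so the Busemann function grows
    linearly in s up to the correction [S]. *)
Let bE s : b s = 2 * s%:R * M + c0 + S s.
Proof.
have [QU ru rU hE _] := QrP s.
have -> : b s = bus y ((r s)^H *m r s).
  congr (bus y _); have -> : V^H *m ((h s)^H *m h s) *m V = (h s *m V)^H *m (h s *m V).
    by rewrite adjM !mulmxA.
  have VQU : is_unitary (V *m Q s) by exact: unitary_mul.
  by rewrite hE adjM mulmxA -(mulmxA (r s)^H) VQU mulmx1.
rewrite ME /c0 /S mulr_sumr -!big_split /=; apply: eq_bigr => i _.
have rr j : complex.Re (minor j ((r s)^H *m r s)) = sqn (minor j (r s)).
  rewrite minorM; last exact: upper_bupper.
  by rewrite minor_adj normc2.
rewrite !rr !ln_minor_r ?(ltnW (ltn_ord i)) //.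
have Gi : Ga i.+1 - Ga i = ga 0 i by rewrite /Ga (sum_lt_split (fun a => ga 0 a)).
rewrite -Gi; move: (Ga i.+1) (Ga i) (l i.+1) (l i) (f s i.+1) (f s i) (y i) (s%:R).
by move=> *; ring.
Qed.

(** The gradient inequality [bus_step] for the backward step from h_{s+1} to h_s, whose displacement
    is -2c. *)
Let gap s : 2 * (M - rinner (q s.+1 *m Y *m (q s.+1)^H) c) <= S s - S s.+1.
Proof.
have [QU ru rU hE qE] := QrP s.+1.
have VQU : is_unitary (V *m Q s.+1) by exact: unitary_mul.
have BH : ((-2)%:C *: c)^H = (-2)%:C *: c by rewrite adjZr cH.
have := bus_step ym VQU ru rU BH hE; rewrite qE rinnerZr -/(b s.+1).
have -> : (h s.+1)^H *m mexp ((-2)%:C *: c) *m h s.+1 = (h s)^H *m h s.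
  have E : h s.+1 = mexp (1%:C *: c) *m h s.
    by rewrite /h mulmxA -(expmx_hermD cH) -nat1r.
  by rewrite E; apply: gram_cancel; [exact: expmx_herm|exact: expmx_cancel2].
rewrite -/(b s) !bE -(natr1 s); move: (rinner _ _) (S s) (S s.+1) (s%:R) M c0.
by move=> p u v t m k; lra.
Qed.

Let S_ge0 s : 0 <= S s.
Proof. exact: (abel_sum_ge0 ym (f_ge0 s) (f_0 s) (f_n s)). Qed.

Let S_le s : S s <= S 0%N.
Proof. exact: (gap_le0 (p := fun s => rinner (q s *m Y *m (q s)^H) c) qmax gap). Qed.

(** [S] is nonnegative and decreases by at least twice the defect M - ⟨q Y q†, c⟩, so the defect
    tends to 0; and S ≤ S 0 keeps the minors at the drops of y away from zero. *)
Lemma flow_frames : exists Q : nat -> 'M[C]_n, [/\ forall s, is_unitary (Q s),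
  forall s, V *m Q s *m dgr (rv n y) *m (V *m Q s)^H = q s *m Y *m (q s)^H,
  forall j, (j.+1 < n)%N -> y j.+1 < y j ->
    exists2 e, 0 < e & forall s, e <= sqn (minor j.+1 (Q s)) &
  rinner (q s *m Y *m (q s)^H) c @[s --> \oo] --> rinner Y c].
Proof.
exists Q; split; try by move=> s; have [] := QrP s.
  move=> j jn yj; have d0 : 0 < y j - y j.+1 by rewrite subr_gt0.
  exists (expR (- (S 0%N / (y j - y j.+1)))); first exact: expR_gt0.
  move=> s; rewrite -ler_ln ?posrE ?expR_gt0 ?sqn_gt0 ?Q_neq0 // ?(ltnW jn) //.
  rewrite expRK lerNl -/(f s j.+1) ler_pdivlMr // mulrC.
  by apply: le_trans (S_le s); exact: (abel_term_le ym (f_ge0 s) (f_0 s) (f_n s) jn).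
exact: (nonincreasing_gap (p := fun s => rinner (q s *m Y *m (q s)^H) c) S_ge0 qmax gap).
Qed.

End Frames.

End FlowFrames.

(** * Uniqueness of the orbit maximiser in a torus algebra *)

Section Uniqueness.
Variables (R : realType) (n : nat).
Notation C := R[i].

Lemma frame_shift (k V B q E g : 'M[C]_n) : is_unitary k ->
  (k *m V *m B)^H *m (q *m k^H)^H *m (E *m (g *m k^H)) *m (k *m V *m B) =
  B^H *m (V^H *m q^H *m (E *m g) *m V) *m B.
Proof.
move=> kU; rewrite !adjM adjK !mulmxA -(mulmxA _ k^H k) kU mulmx1.
by rewrite -(mulmxA _ k^H k) kU mulmx1.
Qed.

Lemma orbit_shift (k q Y : 'M[C]_n) : is_unitary k ->
  (q *m k^H) *m (k *m Y *m k^H) *m (q *m k^H)^H = q *m Y *m q^H.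
Proof.
move=> kU; rewrite adjM adjK !mulmxA -(mulmxA _ k^H k) kU mulmx1.
by rewrite -(mulmxA _ k^H k) kU mulmx1.
Qed.

Lemma det_support (W : 'M[C]_n) : \det W != 0 -> exists s : 'S_n, forall a, W a (s a) != 0.
Proof.
move=> W0; apply: contrapT => nex; move/eqP: W0; apply.
rewrite /determinant big1 // => s _; apply/eqP; rewrite mulf_eq0; apply/orP; right.
apply/negPn/negP => /prodf_neq0 h; apply: nex; exists s => a; exact: h.
Qed.

Lemma unitary_det_neq0 (W : 'M[C]_n) : is_unitary W -> \det W != 0.
Proof. by move=> /unitary_unit; rewrite unitmxE unitfE. Qed.

Lemma frames_perm (W : 'M[C]_n) (x z : 'rV[R]_n) : is_unitary W ->
  dgr x *m W = W *m dgr z -> exists s : 'S_n, x = col_perm s z.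
Proof.
move=> /unitary_det_neq0/det_support[s sW] E; exists s; apply/rowP => a; rewrite mxE.
exact: commute_dgr_entries E _ _ (sW a).
Qed.

(** The intertwiner has a nonzero permutation product in its determinant, so the rows are
    permutations of each other; both being sorted, they agree. *)
Lemma sorted_frames_unique (W : 'M[C]_n) (y y' : nat -> R) : is_unitary W ->
  nonincr n y -> nonincr n y' -> dgr (rv n y) *m W = W *m dgr (rv n y') -> rv n y = rv n y'.
Proof.
move=> WU ym ym' /(frames_perm WU)[s sE].
pose t (z : nat -> R) := mkseq z n.
have st z : nonincr n z -> sorted (fun a b : R => b <= a) (t z).
  move=> zm; apply/(sortedP 0) => i; rewrite size_mkseq => ni.
  by rewrite !nth_mkseq ?(ltnW ni) //; apply: zm; rewrite leqnSn.
have pe : perm_eq (t y) (t y').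
  have tE z : t z = [tuple z i | i < n] :> seq R.
    by apply: (@eq_from_nth _ 0) => [|i]; rewrite size_mkseq ?size_tuple // => ni;
      rewrite nth_mkseq // -[X in nth _ _ X]/(nat_of_ord (Ordinal ni)) -tnth_nth tnth_mktuple.
  rewrite !tE; apply/tuple_permP; exists s.
  congr (tval _); apply: eq_from_tnth => i; rewrite !tnth_mktuple.
  by have := congr1 (fun r : 'rV[R]_n => r 0 i) sE; rewrite !mxE.
have tt : t y = t y'.
  apply: (@sorted_eq _ (fun a b : R => b <= a)); rewrite ?st //.
    by move=> a b d ba ad; exact: le_trans ad ba.
  by move=> a b /andP[ba ab]; apply/le_anti; rewrite ab ba.
apply/rowP => j; rewrite !mxE; have := congr1 (fun r => nth 0 r j) tt.
by rewrite !nth_mkseq.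
Qed.

(** The last index with the same value as index [a]; after it the sequence ends or drops. *)
Lemma drop_index (y : nat -> R) (a : 'I_n) : nonincr n y ->
  exists j, [/\ (a <= j)%N, (j < n)%N, y j = y a & j.+1 = n \/ ((j.+1 < n)%N /\ y j.+1 < y j)].
Proof.
move=> ym; pose P j := (a < j)%N && ((j == n) || (y j < y a)).
have exP : exists j, P j by exists n; rewrite /P ltn_ord eqxx.
case: (ex_minnP exP) => -[|j] /andP[aj Pj] jmin //; exists j.
have jn : (j < n)%N by apply: jmin; rewrite /P ltn_ord eqxx.
have yj : y j = y a.
  have h1 : y j <= y a by apply: ym; rewrite -ltnS aj jn.
  apply/le_anti; rewrite h1 /= leNgt; apply/negP => lt.
  have aj' : (a < j)%N.
    by move: aj; rewrite ltnS leq_eqVlt => /orP[/eqP E|//]; rewrite E ltxx in lt.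
  by have := jmin j; rewrite /P aj' lt orbT ltnn => /(_ isT).
split=> //; have [->|nj] := eqVneq j.+1 n; [by left|right].
by move: Pj; rewrite (negPf nj) /= yj => ->; rewrite ltn_neqAle nj jn.
Qed.

(** The nonzero minor ending at the level of a gives row a of Q a nonzero entry in some column b up
    to that level, so z_a = y_b ≥ y_a. The traces agree, so all these inequalities are
    equalities. *)
Lemma frame_dominates (Q : 'M[C]_n) (y : nat -> R) (z : 'rV[R]_n) : is_unitary Q ->
  nonincr n y -> dgr z *m Q = Q *m dgr (rv n y) ->
  (forall j, (j.+1 < n)%N -> y j.+1 < y j -> minor j.+1 Q != 0) -> z = rv n y.
Proof.
move=> QU ym E Qm.
have ge a : rv n y 0 a <= z 0 a.
  have [j [aj jn yj jP]] := drop_index a ym.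
  have mj : minor j.+1 Q != 0.
    by case: jP => [->|[]]; [rewrite minor_full; exact: unitary_det_neq0|exact: Qm].
  have [b bQ] : exists b, blk j.+1 Q a b != 0.
    have [s sQ] := det_support mj; by exists (s a).
  move: bQ; rewrite mxE ltnS aj /= ltnS; have [bj|jb] := leqP b j; last first.
    by rewrite (_ : a == b = false) ?eqxx //; apply/negbTE; rewrite neq_ltn (leq_ltn_trans aj jb).
  move=> ab; rewrite (commute_dgr_entries E ab) !mxE -yj; apply: ym.
  by rewrite bj jn.
have tr : \sum_a (z 0 a - rv n y 0 a) = 0.
  have h : dgr z = Q *m dgr (rv n y) *m Q^H by rewrite -E -mulmxA (unitary_mul_adj QU) mulmx1.
  have := congr1 (fun M : 'M[C]_n => complex.Re (\tr M)) h.
  rewrite mxtrace_mulC mulmxA QU mul1mx /mxtrace !Re_sum => h2.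
  rewrite sumrB; apply/eqP; rewrite subr_eq0; apply/eqP.
  transitivity (\sum_i complex.Re (dgr z i i)).
    by apply: eq_bigr => i _; rewrite !mxE eqxx mulr1n.
  by rewrite h2; apply: eq_bigr => i _; rewrite !mxE eqxx mulr1n.
apply/rowP => a; apply/eqP; rewrite -subr_eq0; apply/eqP.
have ge0 i : 0 <= z 0 i - rv n y 0 i by rewrite subr_ge0.
exact: (@psumr_eq0P _ _ _ _ (fun i _ => ge0 i) tr a isT).
Qed.

Variable G : set 'M[C]_n.
Hypotheses (hGalg : is_algebraic_group G) (hGadj : self_adjoint G).
Variable T : set 'M[C]_n.
Hypothesis mT : is_maximal_torus (Ku G) T.

Definition regular_in_torus (c : 'M[C]_n) : Prop :=
  il T c /\ forall X, ik G X -> c *m X = X *m c -> il T X.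

Definition orbit_max (c Y : 'M[C]_n) : Prop :=
  forall k, Ku G k -> rinner c (k *m Y *m k^H) <= rinner c Y.

(** A limit Y₀ of the conjugates is again a maximiser by [flow_frames], so it lies in the torus
    algebra and is diagonal in the frame V. The minors of the limiting frame survive at the drops of
    y, and [frame_dominates] gives Y₀ = Y. *)
Lemma flow_limit (V Y g c : 'M[C]_n) (y : nat -> R) (ga : 'rV[R]_n) (q : nat -> 'M[C]_n)
    (U : set_system nat) : UltraFilter U -> \oo `<=` U ->
  is_unitary V -> (forall X, il T X -> exists x, X = V *m dgr x *m V^H) -> nonincr n y ->
  Y = V *m dgr (rv n y) *m V^H -> regular_in_torus c -> c = V *m dgr ga *m V^H -> g \in unitmx ->
  (forall j, (j <= n)%N -> minor j (V^H *m g *m V) != 0) ->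
  (forall s, Ku G (q s)) ->
  (forall s (a b : 'I_n), y a < y b ->
     (V^H *m (q s)^H *m (mexp ((s%:R : R)%:C *: c) *m g) *m V) a b = 0) ->
  ik G Y -> orbit_max c Y -> mcvg U (fun s => q s *m Y *m (q s)^H) Y.
Proof.
move=> UU oU VU VT ym YE [tc creg] cE gU gm qK qb ikY Ymax.
have UP : ProperFilter U by exact: ultra_proper.
have qU s : is_unitary (q s) by have [] := qK s.
have ikc := il_torus_ik hGalg mT tc.
have qmax s : rinner (q s *m Y *m (q s)^H) c <= rinner Y c.
  by rewrite !(rinnerC _ c); exact: Ymax.
have := flow_frames VU ym cE gU gm qU qb; rewrite -YE => /(_ qmax)[Q [QU QY Qm lim]].
have [Q0 QQ0] : exists Q0, mcvg U Q Q0.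
  apply: (@ultra_mcvg_bounded _ _ _ _ _ _ _ (fnorm (1%:M : 'M[C]_n))); apply: filterE => r.
  by rewrite fnorm_unitary.
have [q0 qq0] : exists q0, mcvg U q q0.
  apply: (@ultra_mcvg_bounded _ _ _ _ _ _ _ (fnorm (1%:M : 'M[C]_n))); apply: filterE => r.
  by rewrite fnorm_unitary.
have Kq0 : Ku G q0 by apply: (Ku_closed hGalg _ _ qq0); exact: filterE (fun s => qK s).
have Q0U : is_unitary Q0 by apply: (unitarymx_closed _ _ QQ0); exact: filterE (fun s => QU s).
have limY : mcvg U (fun s => q s *m Y *m (q s)^H) (q0 *m Y *m q0^H).
  apply: mcvg_mul; last exact: mcvg_adj.
  by apply: mcvg_mul => //; exact: mcvg_cst.
have Y0E : V *m Q0 *m dgr (rv n y) *m (V *m Q0)^H = q0 *m Y *m q0^H.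
  apply: (mcvg_unique (F := U) _ limY); rewrite -(funext QY).
  apply: mcvg_mul; last by apply: mcvg_adj; apply: mcvg_mul => //; exact: mcvg_cst.
  apply: mcvg_mul; last exact: mcvg_cst.
  by apply: mcvg_mul => //; exact: mcvg_cst.
have Y0c : rinner c (q0 *m Y *m q0^H) = rinner c Y.
  rewrite !(rinnerC c).
  have l1 : rinner (q s *m Y *m (q s)^H) c @[s --> U] --> rinner (q0 *m Y *m q0^H) c.
    by apply: cvg_rinner => //; exact: mcvg_cst.
  have l2 : rinner (q s *m Y *m (q s)^H) c @[s --> U] --> rinner Y c.
    by move=> B Bn; apply: oU; exact: lim B Bn.
  exact: (@cvg_unique _ (@norm_hausdorff _ R) _ _ _ _ l1 l2).
have ikY0 : ik G (q0 *m Y *m q0^H) by exact: (ik_conj hGalg hGadj).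
have comm := @maximizer_commutes R n G hGalg hGadj c (q0 *m Y *m q0^H) ikc ikY0.
have tY0 : il T (q0 *m Y *m q0^H).
  apply: creg => //; apply: comm => k Kk; rewrite Y0c.
  have -> : k *m (q0 *m Y *m q0^H) *m k^H = (k *m q0) *m Y *m (k *m q0)^H by rewrite adjM !mulmxA.
  by apply: Ymax; exact: (Ku_mul hGalg).
have [z zE] := VT _ tY0.
suff zy : z = rv n y by move: limY; rewrite zE zy -YE.
apply: (frame_dominates Q0U ym).
  have : V *m dgr z *m V^H = V *m (Q0 *m dgr (rv n y) *m Q0^H) *m V^H.
    by rewrite -zE -Y0E adjM !mulmxA.
  move=> /(congr1 (fun Z => V^H *m Z *m V *m Q0)).
  rewrite !mulmxA VU !mul1mx -!mulmxA (mulmxA V^H V) VU !mul1mx.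
  by rewrite Q0U mulmx1.
move=> j jn yj; have [e e0 eQ] := Qm j jn yj; apply/eqP => Q00.
have lm : ccvg U (fun s => minor j.+1 (Q s)) (minor j.+1 Q0).
  apply: ccvg_det => a b; rewrite mxE; under eq_fun do rewrite mxE.
  by case: ifP => _; [exact: QQ0|exact: ccvg_cst].
have [lr li] := lm; rewrite Q00 in lr li.
have ls : sqn (minor j.+1 (Q s)) @[s --> U] --> (0 ^+ 2 + 0 ^+ 2 : R).
  by apply: cvgD; rewrite /GRing.exp /=; apply: cvgM.
have : e <= 0 ^+ 2 + 0 ^+ 2 :> R.
  by apply: (rcvg_le UP (cvg_cst e) ls); apply: filterE => s /=; exact: eQ.
by rewrite expr0n addr0 leNgt e0.
Qed.

Hypothesis hGconn : zariski_connected G.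

Lemma sorted_torus_frame Y : il T Y -> exists V y, [/\ is_unitary V, nonincr n y,
  Y = V *m dgr (rv n y) *m V^H & forall X, il T X -> exists x, X = V *m dgr x *m V^H].
Proof.
move=> tY; have [V VU VT] := torus_frame mT; have [x xE] := VT _ tY.
have [p [y ym yE]] := sort_row x; have [pU pE] := col_perm_frame p VU.
exists (col_perm p V), y; split=> //; first by rewrite yE pE.
by move=> X /VT[z ->]; exists (col_perm p z); rewrite pE.
Qed.

Lemma minors_polyfun (A B : 'M[C]_n) : polyfun (fun g => \prod_(j < n.+1) minor j (A *m g *m B)).
Proof.
apply: polyfun_prod => j; apply: polyfun_det => a b.
have [h|h] := boolP ((a < j)%N && (b < j)%N).
  apply: polyfun_ext (polyfun_mulmx A B (@polyfun_coord R n a b)) _ => g.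
  by rewrite [RHS]mxE h.
by apply: polyfun_ext (@polyfun_cst R n (a == b)%:R) _ => g; rewrite [RHS]mxE (negPf h).
Qed.

Lemma minor1 j : minor j (1%:M : 'M[C]_n) = 1.
Proof.
rewrite /minor (_ : blk j 1%:M = 1%:M) ?det1 //; apply/matrixP => a b; rewrite !mxE.
by case: ifP.
Qed.

(** The same conjugates q_s Y q_s† can be written with Y' and the translated element g k†. If g is
    generic for both descriptions, [flow_limit] says that they converge to Y and to Y'. *)
Lemma maximizer_unique (c Y k : 'M[C]_n) (Y' := k *m Y *m k^H) : regular_in_torus c ->
  il T Y -> Ku G k -> il T Y' -> orbit_max c Y -> orbit_max c Y' -> Y = Y'.
Proof.
move=> creg tY Kk tY' Ymax Ymax'; have [tc _] := creg.
have [V [y [VU ym YE VT]]] := sorted_torus_frame tY.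
have [V' [y' [VU' ym' YE' VT']]] := sorted_torus_frame tY'.
have [_ kU] := Kk.
pose B := V^H *m k^H *m V'.
have BU : is_unitary B.
  by apply: unitary_mul => //; apply: unitary_mul; exact: unitary_adj.
have VB : V' = k *m V *m B.
  by rewrite /B !mulmxA -(mulmxA k V) (unitary_mul_adj VU) mulmx1 (unitary_mul_adj kU) mul1mx.
have yB' : dgr (rv n y) *m B = B *m dgr (rv n y').
  have e1 : V^H *m k^H *m (k *m (V *m dgr (rv n y) *m V^H) *m k^H) *m V' = dgr (rv n y) *m B.
    by rewrite /B !mulmxA -(mulmxA V^H k^H k) kU mulmx1 VU mul1mx.
  have e2 : V^H *m k^H *m (V' *m dgr (rv n y') *m V'^H) *m V' = B *m dgr (rv n y').
    by rewrite /B !mulmxA -(mulmxA _ V'^H V') VU' mulmx1.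
  by rewrite -e1 -e2 -YE -YE'.
have yy := sorted_frames_unique BU ym ym' yB'.
rewrite -yy in YE' yB'.
have [ga gaE] := VT _ tc; have [ga' gaE'] := VT' _ tc.
pose f1 g := \prod_(j < n.+1) minor j (V^H *m g *m V).
pose f2 g := \prod_(j < n.+1) minor j (V'^H *m g *m (k^H *m V')).
have f11 : f1 1%:M != 0.
  by apply/prodf_neq0 => j _; rewrite mulmx1 VU minor1 oner_neq0.
have f2k : f2 k != 0.
  apply/prodf_neq0 => j _; rewrite mulmxA -(mulmxA _ k) (unitary_mul_adj kU) mulmx1 VU' minor1.
  exact: oner_neq0.
have [Gk _] := Kk.
(* One function is nonzero at 1 and the other at k; irreducibility gives one g whose minors are
   nonzero in the frame of Y and, after right multiplication by k†, in that of Y'. *)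
have [g Gg [g1 g2]] := G_irreducible hGalg hGadj hGconn (minors_polyfun V^H V)
   (minors_polyfun V'^H (k^H *m V')) (G_1 hGalg) f11 Gk f2k.
have ikY := il_torus_ik hGalg mT tY; have ikY' := il_torus_ik hGalg mT tY'.
have ikc := il_torus_ik hGalg mT tc.
have Gh (s : nat) : G (mexp ((s%:R : R)%:C *: c) *m g).
  by apply: (G_mul hGalg) => //; have [_] := ikc.
have iw s := iwasawa hGalg hGadj (Gh s) ikY VU YE.
pose q s := projT1 (cid2 (iw s)).
have qP s : Ku G (q s) /\ forall a b : 'I_n, y a < y b ->
    (V^H *m (q s)^H *m (mexp ((s%:R : R)%:C *: c) *m g) *m V) a b = 0.
  rewrite /q; case: (cid2 _) => /= u Ku_u hu; split=> // a b ab.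
  by have := hu a b; rewrite !mxE !mulmxA in hu *; move=> h; apply: h.
have [U [UU oU]] := eventually_ultra; have UP : ProperFilter U by exact: ultra_proper.
have l1 : mcvg U (fun s => q s *m Y *m (q s)^H) Y.
  apply: (flow_limit UU oU VU VT ym YE creg gaE (G_unit hGalg Gg)) => //.
  - by move=> j jn; have /prodf_neq0/(_ (Ordinal (jn : (j < n.+1)%N)) isT) := g1.
  - by move=> s; have [] := qP s.
  - by move=> s; have [] := qP s.
pose q' s := q s *m k^H.
have l2 : mcvg U (fun s => q' s *m Y' *m (q' s)^H) Y'.
  apply: (flow_limit (g := g *m k^H) UU oU VU' VT' ym YE' creg gaE') => //.
  - by rewrite unitmx_mul (G_unit hGalg Gg) /=; apply: unitary_unit; exact: unitary_adj.
  - move=> j jn; have /prodf_neq0/(_ (Ordinal (jn : (j < n.+1)%N)) isT) := g2.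
    by rewrite !mulmxA.
  - by move=> s; have [Kq _] := qP s; apply: (Ku_mul hGalg) => //; exact: (Ku_adj hGadj).
  move=> s a b ab; have [_ qb] := qP s.
  pose P := V^H *m (q s)^H *m (mexp ((s%:R : R)%:C *: c) *m g) *m V.
  have -> : V'^H *m (q' s)^H *m (mexp ((s%:R : R)%:C *: c) *m (g *m k^H)) *m V' = B^H *m P *m B.
    by rewrite /q' /P VB; exact: frame_shift.
  have BE i l : B i l != 0 -> y i = y l.
    by move=> Bil; have := commute_dgr_entries yB' Bil; rewrite !mxE.
  rewrite mxE big1 // => l _; rewrite mxE.
  have [->|Blb] := eqVneq (B l b) 0; first by rewrite mulr0.
  rewrite big1 ?mul0r // => i _; rewrite adjE.
  have [->|Bia] := eqVneq (B i a) 0; first by rewrite conjc0 mul0r.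
  by rewrite qb ?mulr0 // (BE _ _ Bia) (BE _ _ Blb).
have E s : q' s *m Y' *m (q' s)^H = q s *m Y *m (q s)^H.
  by rewrite /q' /Y'; exact: orbit_shift.
by rewrite (funext E) in l2; exact: (mcvg_unique (F := U) l1 l2).
Qed.

End Uniqueness.

(** * Closedness of the Weyl chamber *)

Section Chamber.
Variables (R : realType) (n : nat) (G : set 'M[R[i]]_n).
Notation C := R[i].
Hypotheses (hGalg : is_algebraic_group G) (hGadj : self_adjoint G).
Hypothesis hGconn : zariski_connected G.
Variable T : set 'M[C]_n.
Hypothesis mT : is_maximal_torus (Ku G) T.

Lemma il_closed (S : set 'M[C]_n) (F : set_system nat) (f : nat -> 'M[C]_n) L : compact_group S ->
  ProperFilter F -> F [set r | il S (f r)] -> mcvg F f L -> il S L.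
Proof.
move=> [_ _ _ _ Sc] FF Sf fL; split.
  apply: (mcvg_unique (F := F) (mcvg_adj fL)); apply: near_mcvg fL.
  by apply: filterS Sf => r [-> _].
move=> t; apply: (Sc F (fun r => mexp (Complex 0 t *: f r))).
  by apply: filterS Sf => r [_]; apply.
by apply: mcvg_mexp; apply: mcvgZ => //; exact: ccvg_cst.
Qed.

Lemma conj_commute (W A B : 'M[C]_n) : is_unitary W -> A = W *m B *m W^H ->
  B *m W^H = W^H *m A.
Proof. by move=> WU ->; rewrite !mulmxA WU mul1mx. Qed.

Let cT : compact_group T := torus_compact (Ku_compact hGalg hGadj) (proj1 mT).

Lemma orbit_max_closed c (F : set_system nat) (f : nat -> 'M[C]_n) L : ProperFilter F ->
  F [set r | orbit_max G c (f r)] -> mcvg F f L -> orbit_max G c L.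
Proof.
move=> FF Mf fL k Kk.
apply: (@rcvg_le R nat F (fun r => rinner c (k *m f r *m k^H)) (fun r => rinner c (f r))).
- apply: cvg_rinner; first exact: mcvg_cst.
  apply: mcvg_mul; last exact: mcvg_cst.
  by apply: mcvg_mul => //; exact: mcvg_cst.
- by apply: cvg_rinner => //; exact: mcvg_cst.
- by apply: filterS Mf => r; apply.
Qed.

Lemma orbit_max_self c : orbit_max G c c.
Proof.
move=> k [_ kU]; apply: le_trans (rinner_le_fnorm _ _) _.
by rewrite fnorm_conj // -fnorm_sqr expr2.
Qed.

Lemma orbit_max_exists c X : regular_in_torus G T c -> ik G X ->
  exists2 k, Ku G k & il T (k *m X *m k^H) /\ orbit_max G c (k *m X *m k^H).
Proof.
move=> [tc creg] ikX; have [k Kk kmax] := orbit_maximizer hGalg hGadj c X; exists k => //.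
have ikk : ik G (k *m X *m k^H) by exact: (ik_conj hGalg hGadj).
have km : orbit_max G c (k *m X *m k^H).
  by move=> l Kl; have := kmax (l *m k) (Ku_mul hGalg Kl Kk); rewrite adjM !mulmxA.
split=> //; apply: creg => //; apply: (maximizer_commutes hGalg hGadj) => //.
exact: (il_torus_ik hGalg mT).
Qed.

Variable D : set 'M[C]_n.
Hypotheses (DT : forall X, D X -> il T X)
  (DZ : forall (a : R) X, 0 <= a -> D X -> D (a%:C *: X))
  (DD : forall X Y, D X -> D Y -> D (X + Y))
  (Dex : forall X, ik G X -> exists2 k, Ku G k & D (k *m X *m k^H))
  (Duniq : forall P k, D P -> Ku G k -> D (k *m P *m k^H) -> P = k *m P *m k^H).

Section ChamberFrame.
Variable V : 'M[C]_n.
Hypotheses (VU : is_unitary V) (VT : forall X, il T X -> exists x, X = V *m dgr x *m V^H).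

Let dc (y : 'rV[R]_n) : Prop := D (V *m dgr y *m V^H).

Let dc0 : dc 0.
Proof.
have ik0 : ik G 0 by exact: (ik_0 hGalg).
by have [k _] := Dex ik0; rewrite mulmx0 mul0mx /dc dgr0 mulmx0 mul0mx.
Qed.

Lemma chamber_comb m (a : 'rV[R]_m) (B : 'M[R]_(m, n)) :
  (forall i, dc (row i B)) -> (forall i, 0 <= a 0 i) -> dc (a *m B).
Proof.
move=> DB a0; rewrite mulmx_sum_row; elim/big_ind: _ => [|x y tx ty|i _] //.
- by rewrite /dc dgrD mulmxDr mulmxDl; exact: DD.
- by rewrite /dc dgrZ -scalemxAr -scalemxAl; apply: DZ => //; exact: DB.
Qed.

(** Each element of the torus algebra is conjugate into the chamber, so its eigenvalue row is a
    permutation of one from the chamber. Were the span of the chamber too small, finitely many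
    subspaces of smaller dimension would cover the torus algebra. *)
Lemma chamber_spanning : exists m (B : 'M[R]_(m, n)), (forall i, dc (row i B)) /\
  forall y, tcoord T V y -> (y <= B)%MS.
Proof.
have [m [B [DB spB]]] := finite_spanning [set y | dc y].
have [p [E [TE spE]]] := finite_spanning [set y | tcoord T V y].
exists m, B; split=> // y /spE yE; apply: submx_trans yE _.
have BE : (B <= E)%MS by apply/row_subP => i; apply: spE; exact: (DT (DB i)).
apply: contrapT => /negP EB.
pose Bs (s : 'S_n) := B *m perm_mx s.
have nEB s : ~~ (E <= Bs s)%MS.
  apply: contra EB => /mxrankS; rewrite mxrankMfree; last by rewrite row_free_unit unitmx_perm.
  by move=> EB; rewrite -(geq_leqif (mxrank_leqif_sup BE)).
have colx s : exists j, col j (E *m cokermx (Bs s)) != 0.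
  apply: contrapT => h; move: (nEB s); rewrite submxE => /eqP; apply.
  apply/matrixP => i j; rewrite [RHS]mxE; have [z|nz] := eqVneq (col j (E *m cokermx (Bs s))) 0.
    by have := congr1 (fun M : 'cV[R]_p => M i 0) z; rewrite !mxE.
  by exfalso; apply: h; exists j.
pose j s := projT1 (cid (colx s)).
have jP s : col (j s) (E *m cokermx (Bs s)) != 0 by exact: projT2 (cid (colx s)).
have [t t0 tP] := @moment_avoid R _ (fun s : 'S_n => true) p _ (fun s _ => jP s).
(* A torus element outside the permuted span for every permutation. *)
pose x := moment_row p t *m E.
have tx : tcoord T V x by exact: (tcoord_comb hGalg hGadj mT).
have [k [_ kU] DP] := Dex (il_torus_ik hGalg mT tx).
have [z zE] := VT (DT DP).
have dz : dc z by rewrite /dc -zE.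
pose W := V^H *m k *m V.
have WU : is_unitary W.
  by apply: unitary_mul => //; apply: unitary_mul => //; exact: unitary_adj.
have zW : dgr x *m W^H = W^H *m dgr z.
  have h : dgr z = W *m dgr x *m W^H.
    have -> : dgr z = V^H *m (V *m dgr z *m V^H) *m V.
      by rewrite !mulmxA VU mul1mx -mulmxA VU mulmx1.
    by rewrite -zE /W !adjM adjK !mulmxA.
  exact: conj_commute h.
have [s sE] := frames_perm (unitary_adj WU) zW.
have /submxP[d dE] := spB _ dz.
have xB : (x <= Bs s^-1%g)%MS by rewrite sE col_permE dE -mulmxA submxMl.
have xz : moment_row p t *m (E *m cokermx (Bs s^-1%g)) = 0.
  by rewrite mulmxA; apply/eqP; rewrite -submxE.
by have /eqP[] := tP s^-1%g isT; rewrite colE mulmxA xz mul0mx.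
Qed.

Lemma frame_coord X x : X = V *m dgr x *m V^H ->
  x = \row_j complex.Re ((V^H *m X *m V) j j).
Proof.
move=> ->; apply/rowP => j; rewrite mxE.
have -> : V^H *m (V *m dgr x *m V^H) *m V = dgr x.
  by rewrite !mulmxA VU mul1mx -mulmxA VU mulmx1.
by rewrite !mxE eqxx mulr1n.
Qed.

(** [c] is a combination of a spanning family from the chamber with strictly positive coefficients
    taken from the moment curve: this makes it regular, and small changes of it within the torus
    algebra keep the coefficients nonnegative. *)
Lemma chamber_interior : exists c, [/\ D c, regular_in_torus G T c &
  forall (P : 'M[C]_n) (t : R) (F : set_system nat) (f : nat -> 'M[C]_n), D P -> 0 < t -> t <= 1 ->
    ProperFilter F -> F [set r | il T (f r)] ->
    mcvg F f ((1 - t)%:C *: P + t%:C *: c) -> F [set r | D (f r)]].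
Proof.
have [m [B [DB spB]]] := chamber_spanning.
have TB i : tcoord T V (row i B) := DT (DB i).
have [s s0 sreg] := regular_comb TB spB.
pose w : 'rV[R]_m := moment_row m s; pose c := V *m dgr (w *m B) *m V^H.
have w0 i : 0 < w 0 i by rewrite mxE exprn_gt0.
have tw : tcoord T V (w *m B) by exact: (tcoord_comb hGalg hGadj mT).
exists c; split.
- by apply: chamber_comb => // i; exact: ltW.
- split=> // X ikX; exact: (regular_centralizer hGalg hGadj mT VU VT tw sreg ikX).
move=> P t F f DP t0 t1 FF Tf fz; set z := _ + _ in fz.
have tz : il T z.
  apply: il_add => //; first by apply: il_scale; exact: DT.
  exact: il_scale.
pose de r := f r + (-1)%:C *: z.
pose y r : 'rV[R]_n := \row_j complex.Re ((V^H *m de r *m V) j j).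
have de0 : mcvg F de 0.
  rewrite -(subrr z) -[X in mcvg _ _ (_ + X)]scaleN1c; apply: mcvgD => //; exact: mcvg_cst.
have y0 j : y r 0 j @[r --> F] --> (0 : R).
  have h : mcvg F (fun r => V^H *m de r *m V) (V^H *m 0 *m V).
    apply: mcvg_mul; last exact: mcvg_cst.
    by apply: mcvg_mul => //; exact: mcvg_cst.
  have [] := h j j; rewrite mulmx0 mul0mx [X in complex.Re X]mxE /= => hr _.
  by under eq_fun do rewrite mxE.
pose a r : 'rV[R]_m := y r *m pinvmx B.
have a0 i : a r 0 i @[r --> F] --> (0 : R).
  have h : ccvg F (fun r => (a r 0 i)%:C) (\sum_(j < n) 0 * (pinvmx B j i)%:C).
    have -> : (fun r => (a r 0 i)%:C) = (fun r => \sum_j (y r 0 j)%:C * (pinvmx B j i)%:C).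
      by apply/funext => r; rewrite mxE rmorph_sum; apply: eq_bigr => j _; rewrite rmorphM.
    apply: ccvg_sum => j _; apply: ccvgM; last exact: ccvg_cst.
    by apply: ccvg_real; exact: y0.
  by have [] := h; rewrite big1 // => j _; rewrite mul0r.
(* The perturbation in coordinates of the spanning family must not exceed the share t w_i that c
   contributes. *)
have small : F [set r | forall i, `|a r 0 i| <= t * w 0 i].
  apply: filter_forall => i; have ti : 0 < t * w 0 i by rewrite mulr_gt0.
  by have /rcvgP/(_ _ ti) := a0 i; apply: filterS => r /=; rewrite subr0.
apply: filterS2 small Tf => r ar Tr /=.
have Tde : il T (de r) by apply: il_add => //; exact: il_scale.
have [x xE] := VT Tde; have xy : x = y r by exact: frame_coord.
have yB : y r = a r *m B.
  rewrite /a mulmxKpV //; apply: spB; rewrite -xy /tcoord -xE; exact: Tde.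
have -> : f r = (1 - t)%:C *: P + V *m dgr ((t *: w + a r) *m B) *m V^H.
  have -> : f r = z + de r by rewrite /de scaleN1c addrC subrK.
  rewrite xE xy yB mulmxDl dgrD mulmxDr mulmxDl -scalemxAl dgrZ -scalemxAr -scalemxAl addrA.
  by [].
apply: DD; first by apply: DZ => //; rewrite subr_ge0.
apply: chamber_comb => // i; rewrite !mxE.
by have := ar i; rewrite ler_norml !mxE => /andP[h _]; rewrite -lerBlDl sub0r.
Qed.

End ChamberFrame.

(** Move on the segment from c towards P and let t₀ be the infimum of the parameters where the point
    is a maximiser. If t₀ > 0, take parameters tending to t₀ from below: the maximisers on their
    orbits converge, by uniqueness, to the point at t₀, so some of them lie in the chamber and equal
    the points of the segment, a contradiction. Hence t₀ = 0, where the point is P. *)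
Lemma chamber_orbit_max c : D c -> regular_in_torus G T c ->
  (forall (P : 'M[C]_n) (t : R) (F : set_system nat) (f : nat -> 'M[C]_n), D P -> 0 < t -> t <= 1 ->
    ProperFilter F -> F [set r | il T (f r)] ->
    mcvg F f ((1 - t)%:C *: P + t%:C *: c) -> F [set r | D (f r)]) ->
  forall P, D P -> orbit_max G c P.
Proof.
move=> Dc creg cint P DP; apply: contrapT => nP.
pose z (t : R) := (1 - t)%:C *: P + t%:C *: c.
have Dz t : 0 <= t -> t <= 1 -> D (z t).
  by move=> t0 t1; apply: DD; apply: DZ; rewrite ?subr_ge0.
pose A := [set t : R | 0 <= t /\ t <= 1 /\ orbit_max G c (z t)].
have A1 : A 1.
  split=> //; split=> //; rewrite /z subrr scale0r add0r scale1r; exact: orbit_max_self.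
have hA : has_inf A by split; [exists 1|exists 0 => t []].
pose t0 := inf A.
have t00 : 0 <= t0 by apply: lb_le_inf; [exists 1|move=> t []].
have t01 : t0 <= 1 by apply: ge_inf => //; case: hA.
have zcvg (F : set_system nat) (t : nat -> R) l : ProperFilter F -> t r @[r --> F] --> l ->
    mcvg F (fun r => z (t r)) (z l).
  move=> FF tl; apply: mcvgD; apply: mcvgZ; try exact: mcvg_cst; apply: ccvg_real => //.
  by apply: cvgB => //; exact: cvg_cst.
have At0 : orbit_max G c (z t0).
  have adh (r : nat) : exists t, A t /\ `|t - t0| <= (r.+1%:R : R)^-1.
    have r0 : 0 < (r.+1%:R^-1 : R) by rewrite invr_gt0.
    have [t At lt] := inf_adherent r0 hA; exists t; split=> //.
    have ge : t0 <= t by apply: ge_inf => //; case: hA.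
    by rewrite ger0_norm ?subr_ge0 // lerBlDl ltW.
  pose t r := projT1 (cid (adh r)).
  have tP r : A (t r) /\ `|t r - t0| <= (r.+1%:R : R)^-1 by exact: projT2 (cid (adh r)).
  have tc : t r @[r --> \oo] --> t0.
    apply: (rcvg_dom (f := fun r : nat => (r.+1%:R : R)^-1)); last exact: cvg_harmonic.
    by apply: filterE => r; have [] := tP r.
  apply: (orbit_max_closed _ _ (zcvg \oo t t0 _ tc)).
  by apply: filterE => r; have [[_ [_ h]] _] := tP r.
have t0_gt : 0 < t0.
  rewrite lt_def t00 andbT; apply/eqP => E; apply: nP; move: At0.
  by rewrite E /z subr0 scale1r scale0r addr0.
(* Parameters in [0, t₀) tending to t₀; by the choice of t₀ the points there are not maximisers. *)
pose t (r : nat) := t0 * (1 - (r.+2%:R : R)^-1).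
have inv1 (r : nat) : (r.+2%:R : R)^-1 <= 1 by rewrite invf_le1 ?ler1n.
have inv0 (r : nat) : 0 < (r.+2%:R : R)^-1 by rewrite invr_gt0.
have tge r : 0 <= t r by rewrite mulr_ge0 // subr_ge0.
have tlt r : t r < t0 by rewrite /t mulrBr mulr1 ltrBlDr ltrDl mulr_gt0.
have tle r : t r <= 1 by apply: le_trans t01; exact: ltW.
have nA r : ~ orbit_max G c (z (t r)).
  move=> mz; have : t0 <= t r by apply: ge_inf; [case: hA|split].
  by rewrite leNgt tlt.
have tc : t r @[r --> \oo] --> t0.
  suff : t r @[r --> \oo] --> t0 * (1 - 0) by rewrite subr0 mulr1.
  apply: cvgM; first exact: cvg_cst.
  apply: cvgB; first exact: cvg_cst.
  have hm : (r.+1%:R : R)^-1 @[r --> \oo] --> (0 : R) by exact: cvg_harmonic.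
  by rewrite -(cvg_shiftS (fun r : nat => (r.+1%:R : R)^-1)) in hm.
have ikz r : ik G (z (t r)) by apply: (il_torus_ik hGalg mT); apply: DT; exact: Dz.
have ex r := orbit_max_exists creg (ikz r).
pose k r := projT1 (cid2 (ex r)).
have kP r : Ku G (k r) /\ il T (k r *m z (t r) *m (k r)^H) /\
    orbit_max G c (k r *m z (t r) *m (k r)^H).
  by rewrite /k; case: (cid2 _).
have [U [UU oU]] := eventually_ultra; have UP : ProperFilter U by exact: ultra_proper.
have [k0 kk0] : exists k0, mcvg U k k0.
  apply: (@ultra_mcvg_bounded _ _ _ _ _ _ _ (fnorm (1%:M : 'M[C]_n))); apply: filterE => r.
  by have [[_ kU] _] := kP r; rewrite fnorm_unitary.
have Kk0 : Ku G k0 by apply: (Ku_closed hGalg _ _ kk0); apply: filterE => r; have [] := kP r.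
have zU : mcvg U (fun r => z (t r)) (z t0) by apply: (mcvg_sub oU); exact: zcvg.
pose z' r := k r *m z (t r) *m (k r)^H.
have z'U : mcvg U z' (k0 *m z t0 *m k0^H).
  by apply: mcvg_mul; [exact: mcvg_mul|exact: mcvg_adj].
have Tz' : U [set r | il T (z' r)] by apply: filterE => r; have [_ []] := kP r.
have Mz' : U [set r | orbit_max G c (z' r)] by apply: filterE => r; have [_ []] := kP r.
have E : z t0 = k0 *m z t0 *m k0^H.
  apply: (maximizer_unique hGalg hGadj mT hGconn creg) => //.
  - by apply: DT; exact: Dz.
  - exact: (il_closed cT UP Tz' z'U).
  - exact: (orbit_max_closed UP Mz' z'U).
rewrite -E in z'U.
have [r Dz'] := filter_ex (cint P t0 U z' DP t0_gt t01 UP Tz' z'U).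
have [Kk [_ mk]] := kP r; apply: (nA r).
by rewrite (Duniq (Dz _ (tge r) (tle r)) Kk Dz').
Qed.

(** Chamber points maximise ⟨c, ·⟩ on their orbits and limits inherit this; the limit and P then are
    two maximisers in one orbit. *)
Lemma chamber_limit_unique (F : set_system nat) (f : nat -> 'M[C]_n) P k : ProperFilter F ->
  F [set r | D (f r)] -> mcvg F f (k *m P *m k^H) -> D P -> Ku G k -> P = k *m P *m k^H.
Proof.
move=> FF Df fL DP Kk; have [V VU VT] := torus_frame mT.
have [c [Dc creg cint]] := chamber_interior VU VT.
have cmax := chamber_orbit_max Dc creg cint.
apply: (maximizer_unique hGalg hGadj mT hGconn creg) => //.
- exact: DT.
- by apply: (il_closed cT FF _ fL); apply: filterS Df => r; exact: DT.
- exact: cmax.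
- by apply: (orbit_max_closed FF _ fL); apply: filterS Df => r; exact: cmax.
Qed.

End Chamber.

(** * The weight bound on the differential *)

Section Weights.
Variables (R : realType) (n d : nat) (G : set 'M[R[i]]_n).
Notation C := R[i].
Hypotheses (hGalg : is_algebraic_group G) (hGadj : self_adjoint G).
Variable T : set 'M[C]_n.
Hypothesis mT : is_maximal_torus (Ku G) T.

Lemma quad_lin0 (a b : R) : 0 <= b -> (forall t, 0 <= t ^+ 2 * b - 2 * t * a) -> a = 0.
Proof.
move=> b0 h; have b1 : 0 < b + 1 by rewrite ltr_wpDl.
have := h (a / (b + 1)).
have -> : (a / (b + 1)) ^+ 2 * b - 2 * (a / (b + 1)) * a = - (a ^+ 2 * ((b + 2) / (b + 1) ^+ 2)).
  by field; rewrite gt_eqF.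
rewrite oppr_ge0 => h2; apply/eqP; rewrite -sqrf_eq0; apply/eqP/le_anti; rewrite sqr_ge0 andbT.
by move: h2; rewrite pmulr_lle0 // divr_gt0 ?exprn_gt0 // ltr_wpDl.
Qed.

(** The orthogonal projection to the torus algebra as a nearest point. Radius 2‖X‖ suffices:
    anything longer is farther from X than 0 is. *)
Lemma torus_projection X : exists2 om, il T om & forall Y, il T Y -> rinner om Y = rinner X Y.
Proof.
have cK := Ku_compact hGalg hGadj; have cT := torus_compact cK (proj1 mT).
pose S := [set Y | il T Y /\ fnorm Y <= 2 * fnorm X].
have x0 : 0 <= fnorm X by exact: fnorm_ge0.
have S0 : S 0 by split; [exact: (il_0 cK (proj1 mT))|rewrite fnorm0 mulr_ge0].
have [om [tom bom] omin] : exists2 om, S om & forall Y, S Y ->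
    rinner (om - X) (om - X) <= rinner (Y - X) (Y - X).
  apply: (@compact_argmin R n S (fun Y => rinner (Y - X) (Y - X)) (2 * fnorm X) 0).
  - by move=> Y [].
  - by move=> Y _; exact: rinner_ge0.
  - move=> F f L FF Sf fL; split.
      by apply: (il_closed cT FF _ fL); apply: filterS Sf => r [].
    apply: (@rcvg_le R nat F (fun r => fnorm (f r)) (fun=> 2 * fnorm X)).
    + exact: cvg_fnorm.
    + exact: cvg_cst.
    + by apply: filterS Sf => r [].
  - move=> F f L FF fL; have h : mcvg F (fun r => f r - X) (L - X).
      by apply: mcvgB => //; exact: mcvg_cst.
    exact: cvg_rinner.
  - by exists 0.
exists om => // Y tY.
have omin' Z : il T Z -> rinner (om - X) (om - X) <= rinner (Z - X) (Z - X).
  move=> tZ; have [le|lt] := leP (fnorm Z) (2 * fnorm X); first exact: omin.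
  apply: le_trans (omin 0 S0) _; rewrite sub0r -!fnorm_sqr fnormN.
  rewrite lerXn2r ?nnegrE ?fnorm_ge0 //.
  have h : fnorm Z <= fnorm (Z - X) + fnorm X by rewrite -{1}(subrK X Z); exact: fnormD.
  by move: (fnorm Z) (fnorm X) (fnorm (Z - X)) lt h => a b c; lra.
have h0 : rinner (om - X) Y = 0.
  apply: (@quad_lin0 _ (rinner Y Y)); first exact: rinner_ge0.
  move=> t; have tZ : il T (om + (- t)%:C *: Y).
    by apply: il_add => //; exact: il_scale.
  have := omin' _ tZ; have -> : om + (- t)%:C *: Y - X = (om - X) + (- t)%:C *: Y by rewrite addrAC.
  move: (om - X) => D; rewrite rinnerDl !rinnerDr !rinnerZl !rinnerZr (rinnerC Y D).
  by move: (rinner D D) (rinner D Y) (rinner Y Y) => p q r; lra.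
by apply/eqP; rewrite -subr_eq0 -rinnerBl h0.
Qed.

Variables (rho La : 'M[C]_n -> 'M[C]_d) (mu : 'cV[C]_d -> 'M[C]_n) (N : R).
Hypothesis rhoM : forall g h, G g -> G h -> rho (g *m h) = rho g *m rho h.
Hypothesis rhoU : forall k, Ku G k -> is_unitary (rho k).
Hypothesis LaH : forall X, ik G X -> (La X)^H = La X.
Hypothesis rho_exp : forall X, ik G X -> forall t : R,
  rho (mexp (t%:C *: X)) = mexp (t%:C *: La X).
Hypothesis La_conj : forall k X, Ku G k -> ik G X ->
  La (k *m X *m k^H) = rho k *m La X *m (rho k)^H.
Hypothesis muE : forall w X, w != 0 -> ik G X ->
  rinner (mu w) X = rinner w (La X *m w) / rinner w w.
Hypothesis weights : forall om, il T om -> (exists2 w : 'cV[C]_d, w != 0 &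
  forall Y, il T Y -> La Y *m w = (rinner om Y)%:C *: w) -> fnorm om <= N.

Let tik X : il T X -> ik G X.
Proof. exact: il_torus_ik. Qed.

Lemma torus_La_comm X Y : il T X -> il T Y -> La X *m La Y = La Y *m La X.
Proof.
move=> tX tY; have XY := il_comm (proj1 mT) tX tY.
apply: commute_exp_deriv => t; symmetry; apply: commute_exp_deriv => s.
have [_ Gs] := tik tX; have [_ Gt] := tik tY.
rewrite -(rho_exp (tik tX)) -(rho_exp (tik tY)) -!rhoM //; congr (rho _).
apply: expmx_comm; rewrite -scalemxAr -scalemxAl; congr (_ *: _); symmetry.
by apply: expmx_comm; rewrite -scalemxAr -scalemxAl XY.
Qed.

Lemma dgr_bound (l : 'rV[R]_d) (w : 'cV[C]_d) (M : R) : 0 <= M -> (forall j, `|l 0 j| <= M) ->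
  rinner (dgr l *m w) (dgr l *m w) <= M ^+ 2 * rinner w w.
Proof.
move=> M0 lM; rewrite !rinnerE mulr_sumr; apply: ler_sum => i _.
rewrite mulr_sumr; apply: ler_sum => j _; rewrite mul_diag_mx !mxE ReM ImM /= !mul0r subr0 addr0.
have -> : l 0 i * complex.Re (w i j) * (l 0 i * complex.Re (w i j)) +
   l 0 i * complex.Im (w i j) * (l 0 i * complex.Im (w i j)) =
   l 0 i ^+ 2 * (complex.Re (w i j) * complex.Re (w i j) + complex.Im (w i j) * complex.Im (w i j)).
  by ring.
rewrite ler_wpM2r //; first by rewrite addr_ge0 // -expr2 sqr_ge0.
by rewrite -[l 0 i ^+ 2]real_normK ?num_real // lerXn2r ?nnegrE.
Qed.

(** The operators La(Y) for Y in the torus algebra commute and are Hermitian, so they have a common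
    orthonormal eigenframe, and each joint eigenvalue is the pairing with a weight. *)
Lemma torus_La_bound X (w : 'cV[C]_d) : il T X -> 0 <= N ->
  rinner (La X *m w) (La X *m w) <= N ^+ 2 * rinner X X * rinner w w.
Proof.
move=> tX N0.
have [U UU UT] : exists2 U : 'M[C]_d, is_unitary U &
    forall Z, [set La Y | Y in [set Y | il T Y]] Z -> exists l, Z = U *m dgr l *m U^H.
  apply: commuting_frame => [_ [Y tY <-]|_ _ [Y tY <-] [Z tZ <-]]; first exact: LaH (tik tY).
  exact: torus_La_comm.
have UL Y : il T Y -> exists l, La Y = U *m dgr l *m U^H by move=> tY; apply: UT; exists Y.
have eig Y l j : La Y = U *m dgr l *m U^H -> La Y *m col j U = (l 0 j)%:C *: col j U.
  move=> ->; rewrite colE mulmxA -(mulmxA _ U^H U) UU mulmx1 -!mulmxA scalemxAr; congr (_ *m _).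
  by apply/matrixP => a b; rewrite mul_diag_mx !mxE; case: eqVneq => [->|]; rewrite ?mulr0.
have [l lE] := UL X tX.
have bound j : `|l 0 j| <= N * fnorm X.
  have c0 : col j U != 0.
    apply/eqP => c0; have := unitary_col j UU; rewrite big1 ?(oner_eq0 R) => [/esym/eqP|i _].
      by rewrite oner_eq0.
    have -> : U i j = col j U i 0 by rewrite mxE.
    by rewrite c0 mxE (sqn_real 0) expr0n.
  (* The eigenvalue at the j-th vector is Y ↦ ⟨μ(u_j), Y⟩; the projection of this moment to the
     torus algebra represents it, hence is a weight. *)
  have [om tom omE] := torus_projection (mu (col j U)).
  have val Y m : il T Y -> La Y = U *m dgr m *m U^H -> rinner om Y = m 0 j.
    move=> tY mE; rewrite (omE Y tY) (muE c0 (tik tY)) (eig Y m j mE) rinnerZr mulfK //.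
    by rewrite gt_eqF // rinner_gt0.
  have omN : fnorm om <= N.
    apply: weights => //; exists (col j U) => // Y tY; have [m mE] := UL Y tY.
    by rewrite (val Y m tY mE); exact: eig.
  rewrite -(val X l) //; apply: le_trans (normr_rinner_le _ _) _.
  by rewrite ler_wpM2r ?fnorm_ge0.
rewrite lE -!mulmxA (rinner_unitaryl _ _ UU) -(fnorm_sqr X) -exprMn.
rewrite -[X in _ <= _ * X](rinner_unitaryl _ _ (unitary_adj UU)).
by apply: dgr_bound => //; rewrite mulr_ge0 ?fnorm_ge0.
Qed.

Lemma La_bound X (w : 'cV[C]_d) : ik G X -> 0 <= N ->
  rinner (La X *m w) (La X *m w) <= N ^+ 2 * rinner X X * rinner w w.
Proof.
move=> ikX N0; have [k Kk tX] := conj_into_torus hGalg hGadj mT ikX; have [_ kU] := Kk.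
have rU := rhoU Kk.
have h := torus_La_bound (rho k *m w) tX N0.
rewrite La_conj // -!mulmxA (mulmxA (rho k)^H) rU mul1mx !(rinner_unitaryl _ _ rU) in h.
rewrite (rinner_unitaryl _ _ kU) (rinner_unitaryr _ _ (unitary_adj kU)) in h.
exact: h.
Qed.

End Weights.

(** * Log-convexity along geodesics *)

Section LogConvexity.
Variable R : realType.
Notation C := R[i].

(** Convexity of the exponential between 0 and x, from the tangent line at λx taken at both ends. *)
Lemma expR_chord (la x : R) : 0 <= la -> la <= 1 -> expR (la * x) <= (1 - la) + la * expR x.
Proof.
move=> l0 l1; have h1 := expR_ge1Dx (- (la * x)); have h2 := expR_ge1Dx ((1 - la) * x).
rewrite -(ler_pM2r (expR_gt0 (- (la * x)))) -expRD addrN expR0 mulrDl -mulrA -expRD.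
have -> : x - la * x = (1 - la) * x by ring.
have g1 : (1 - la) * (1 - la * x) <= (1 - la) * expR (- (la * x)).
  by rewrite ler_wpM2l ?subr_ge0.
have g2 : la * (1 + (1 - la) * x) <= la * expR ((1 - la) * x) by rewrite ler_wpM2l.
by apply: le_trans (lerD g1 g2); rewrite le_eqVlt; apply/orP; left; apply/eqP; ring.
Qed.

(** Hölder's inequality for the spectral measure of B at w. Shifting the exponents by [tau]
    equalises the two end values, and then the chord inequality can be integrated. *)
Lemma log_convex n (B : 'M[C]_n) (w : 'cV[C]_n) (la : R) : B^H = B -> w != 0 ->
  0 <= la -> la <= 1 ->
  ln (rinner w (mexp (la%:C *: B) *m w)) <=
  (1 - la) * ln (rinner w w) + la * ln (rinner w (mexp (1%:C *: B) *m w)).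
Proof.
move=> BH w0 l0 l1; have [U [b [UU BE]]] := herm_spectral BH.
pose p i := sqn ((U^H *m w) i 0).
have p0 i : 0 <= p i by exact: sqn_ge0.
have val t : rinner w (mexp (t%:C *: B) *m w) = \sum_i expR (t * b 0 i) * p i.
  rewrite BE expmx_real // -(ufun_comp U (fun x => expR (t * x)) (real_complex R)) ufun_id.
  rewrite -!mulmxA rinner_mull2; move: (U^H *m w) @p p0 {BE} => z p p0.
  rewrite rinnerE; apply: eq_bigr => i _; rewrite big_ord1 mul_diag_mx !mxE.
  by rewrite ReM ImM /= /p /sqn; ring.
have S0 : rinner w w = \sum_i p i.
  have := val 0; rewrite scale0r expmx0 mul1mx => ->.
  by apply: eq_bigr => i _; rewrite mul0r expR0 mul1r.
have w_gt := rinner_gt0 w0.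
have BH1 : (1%:C *: B)^H = 1%:C *: B by rewrite adjZr BH.
have S1_gt : 0 < rinner w (mexp (1%:C *: B) *m w).
  by apply: lt_le_trans (jensen BH1 w0); rewrite mulr_gt0 ?expR_gt0.
have BHl : (la%:C *: B)^H = la%:C *: B by rewrite adjZr BH.
have Sl_gt : 0 < rinner w (mexp (la%:C *: B) *m w).
  by apply: lt_le_trans (jensen BHl w0); rewrite mulr_gt0 ?expR_gt0.
set tau := ln (rinner w (mexp (1%:C *: B) *m w)) - ln (rinner w w).
suff h : rinner w (mexp (la%:C *: B) *m w) <= expR (la * tau) * rinner w w.
  rewrite -ler_ln ?posrE ?mulr_gt0 ?expR_gt0 // lnM ?posrE ?expR_gt0 // expRK in h.
  by apply: le_trans h _; rewrite le_eqVlt; apply/orP; left; apply/eqP; rewrite /tau; ring.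
have tauE : expR (- tau) * rinner w (mexp (1%:C *: B) *m w) = rinner w w.
  by rewrite /tau opprB expRD expRN !lnK ?posrE // mulfVK // gt_eqF.
have -> : rinner w w = (1 - la) * rinner w w + la * (expR (- tau) * rinner w (mexp (1%:C *: B) *m w)).
  by rewrite tauE; ring.
rewrite !val S0 !mulr_sumr -big_split /= mulr_sumr; apply: ler_sum => i _.
have -> : expR (la * b 0 i) = expR (la * tau) * expR (la * (b 0 i - tau)).
  by rewrite -expRD; congr expR; ring.
rewrite -mulrA ler_wpM2l ?expR_ge0 //.
have -> : (1 - la) * p i + la * (expR (- tau) * (expR (1 * b 0 i) * p i)) =
    ((1 - la) + la * expR (b 0 i - tau)) * p i.
  by rewrite mul1r expRD; ring.
by rewrite ler_wpM2r // expR_chord.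
Qed.

(** Turns an exponential comparison valid for all r into a comparison of rates. *)
Lemma exp_bounded_le0 (de c : R) : (forall r : nat, expR (r%:R * de) <= c) -> de <= 0.
Proof.
move=> h; rewrite leNgt; apply/negP => d0.
have c0 : 0 <= c by apply: le_trans (h 0%N); exact: expR_ge0.
have := h (Num.truncn (c / de)).+1; apply/negP; rewrite -ltNge.
apply: lt_le_trans (expR_ge1Dx _); rewrite ltr_wpDl // -ltr_pdivrMr //.
by have /andP[] := truncn_itv (divr_ge0 c0 (ltW d0)).
Qed.

Lemma sqnD_le (z w : C) : sqn (z + w) <= 2 * (sqn z + sqn w).
Proof.
case: z w => [a b] [c e]; rewrite /sqn /= -subr_ge0.
have -> : 2 * (a ^+ 2 + b ^+ 2 + (c ^+ 2 + e ^+ 2)) - ((a + c) ^+ 2 + (b + e) ^+ 2) =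
  (a - c) ^+ 2 + (b - e) ^+ 2 by ring.
by rewrite addr_ge0 ?sqr_ge0.
Qed.

Lemma polyfun_bounded n (f : 'M[C]_n -> C) (M : R) : polyfun f ->
  exists B, forall x, fnorm x <= M -> sqn (f x) <= B.
Proof.
elim=> [c|i j|f1 f2 _ [B1 h1] _ [B2 h2]|f1 f2 _ [B1 h1] _ [B2 h2]].
- by exists (sqn c).
- exists (M ^+ 2) => x xM; have M0 : 0 <= M := le_trans (fnorm_ge0 x) xM.
  apply: (@le_trans _ _ (fnorm x ^+ 2)); last by rewrite lerXn2r ?nnegrE ?fnorm_ge0.
  by rewrite fnorm_sqr; exact: entry_le_rinner.
- exists (2 * (B1 + B2)) => x xM; apply: le_trans (sqnD_le _ _) _.
  by rewrite ler_wpM2l // lerD // ?h1 ?h2.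
- exists (B1 * B2) => x xM; rewrite sqnM; have b1 := h1 x xM.
  by apply: ler_pM; rewrite ?sqn_ge0 ?h2.
Qed.

End LogConvexity.

(** * The descent sequence and its limiting direction *)

Section Descent.
Variables (R : realType) (n d : nat) (G : set 'M[R[i]]_n).
Notation C := R[i].
Hypotheses (hGalg : is_algebraic_group G) (hGadj : self_adjoint G).
Variables (rho La : 'M[C]_n -> 'M[C]_d) (mu : 'cV[C]_d -> 'M[C]_n) (L : R).
Hypothesis rho1 : rho 1%:M = 1%:M.
Hypothesis rhoM : forall g h, G g -> G h -> rho (g *m h) = rho g *m rho h.
Hypothesis rho_rat : forall i j, exists2 f, polyfun f & exists k : nat,
  forall g, G g -> rho g i j = f g / \det g ^+ k.
Hypothesis rhoU : forall k, Ku G k -> is_unitary (rho k).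
Hypothesis rhoJ : forall g, G g -> rho g^H = (rho g)^H.
Hypothesis LaB : forall X Y, La (X - Y) = La X - La Y.
Hypothesis LaH : forall X, ik G X -> (La X)^H = La X.
Hypothesis rho_exp : forall X, ik G X -> forall t : R,
  rho (mexp (t%:C *: X)) = mexp (t%:C *: La X).
Hypothesis La_conj : forall k X, Ku G k -> ik G X ->
  La (k *m X *m k^H) = rho k *m La X *m (rho k)^H.
Hypothesis mu_ik : forall w, w != 0 -> ik G (mu w).
Hypothesis muE : forall w X, w != 0 -> ik G X ->
  rinner (mu w) X = rinner w (La X *m w) / rinner w w.
Hypothesis L0 : 0 < L.
Hypothesis La_bd : forall X (w : 'cV[C]_d), ik G X ->
  rinner (La X *m w) (La X *m w) <= L * rinner X X * rinner w w.
Variable v : 'cV[C]_d.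
Hypothesis v0 : v != 0.

Lemma orbit_neq0 g (w : 'cV[C]_d) : G g -> w != 0 -> rho g *m w != 0.
Proof.
move=> Gg w0; have u : rho g \in unitmx.
  apply: (@cmulmx1_unit _ _ _ (rho (invmx g))).
  by rewrite -rhoM ?(mulmxV (G_unit hGalg Gg)) //; exact: (G_inv hGalg Gg).
by apply: contra w0 => /eqP h; rewrite -(mulKmx u w) h mulmx0.
Qed.

(** Differences of points of i𝔨 stay in i𝔨, where the weight bound makes La Lipschitz. *)
Lemma La_cvg (F : set_system nat) (f : nat -> 'M[C]_n) X : ProperFilter F ->
  F [set r | ik G (f r)] -> mcvg F f X -> mcvg F (fun r => La (f r)) (La X).
Proof.
move=> FF Ff fX; have ikX : ik G X by exact: (ik_closed hGalg FF Ff fX).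
have col j : mcvg F (fun r => La (f r) *m (delta_mx j 0 : 'cV[C]_d)) (La X *m delta_mx j 0).
  pose c := Num.sqrt (L * rinner (delta_mx j 0 : 'cV[C]_d) (delta_mx j 0)).
  apply: (mcvg_squeeze (e := fun r => c * fnorm (f r - X))); last first.
    rewrite -[X in _ --> X](mulr0 c); apply: cvgM; first exact: cvg_cst.
    exact/mcvg_fnormP.
  apply: filterS Ff => r ikr; rewrite -mulmxBl -LaB.
  have c0 : 0 <= L * rinner (delta_mx j 0 : 'cV[C]_d) (delta_mx j 0).
    by rewrite mulr_ge0 ?rinner_ge0 // ltW.
  rewrite -(@ler_pXn2r _ 2) ?nnegrE ?mulr_ge0 ?fnorm_ge0 ?sqrtr_ge0 //.
  rewrite exprMn sqr_sqrtr // !fnorm_sqr mulrAC; apply: La_bd.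
  exact: (ik_sub hGalg ikr ikX).
move=> i j; have := col j i 0; rewrite -colE mxE.
by under eq_fun do rewrite -colE mxE.
Qed.

Lemma moment_conj k (w : 'cV[C]_d) X : Ku G k -> w != 0 -> ik G X ->
  rinner (mu (rho k^H *m w)) X = rinner (mu w) (k *m X *m k^H).
Proof.
move=> Kk w0 ikX; have Kk' := Ku_adj hGadj Kk; have [Gk' _] := Kk'; have [Gk _] := Kk.
rewrite muE ?orbit_neq0 // muE //; last exact: (ik_conj hGalg hGadj).
rewrite La_conj // (rinner_unitaryl _ _ (rhoU Kk')) (rhoJ Gk); congr (_ / _).
by rewrite -!mulmxA [in RHS]rinner_mull2.
Qed.

Variable g : nat -> 'M[C]_n.
Hypotheses (g0 : g 0%N = 1%:M)
  (gS : forall k, g k.+1 = mexp (- ((2 * L)^-1)%:C *: mu (rho (g k) *m v)) *m g k).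
Variable H : nat -> 'M[C]_n.
Hypothesis hH : forall k, (0 < k)%N ->
  ik G (H k) /\ (g k)^H *m g k = mexp ((k%:R / L)%:C *: H k).

Lemma descent_G k : G (g k).
Proof.
elim: k => [|k IH]; first by rewrite g0; exact: (G_1 hGalg).
rewrite gS -rmorphN; apply: (G_mul hGalg) => //.
have [_ h] := mu_ik (orbit_neq0 IH v0); exact: h.
Qed.

Let w k := rho (g k) *m v.
Let m k := mu (w k).

Let w_neq0 k : w k != 0. Proof. by apply: orbit_neq0 => //; exact: descent_G. Qed.

Let ikm k : ik G (m k). Proof. exact: mu_ik. Qed.

Let wS k : w k.+1 = mexp (- ((2 * L)^-1)%:C *: La (m k)) *m w k.
Proof.
rewrite /w gS -rmorphN rhoM ?(rho_exp (ikm k)) ?mulmxA //; last exact: descent_G.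
by have [_ h] := ikm k; exact: h.
Qed.

Lemma descent_gradient k : rinner (m k.+1) (m k.+1) <= rinner (m k.+1) (m k).
Proof.
have := step_gradient L0 (ik_sub hGalg) LaH La_bd mu_ik muE (w_neq0 k).
by rewrite -[mu (w k)]/(m k) -wS.
Qed.

Lemma descent_value k :
  ln (rinner (w k.+1) (w k.+1)) <= ln (rinner (w k) (w k)) - rinner (m k.+1) (m k) / L.
Proof.
have := step_value L LaH mu_ik muE (w_neq0 k).
by rewrite -[mu (w k)]/(m k) -wS.
Qed.

(** Cauchy-Schwarz in [descent_gradient]. *)
Lemma descent_norm_le k : fnorm (m k.+1) <= fnorm (m k).
Proof.
have h := le_trans (descent_gradient k) (rinner_le_fnorm _ _).
rewrite -fnorm_sqr expr2 in h; have [z|nz] := eqVneq (fnorm (m k.+1)) 0.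
  by rewrite z fnorm_ge0.
by rewrite ler_pM2l // lt_def nz fnorm_ge0 in h.
Qed.

Definition kappa : R := limn (fun k => fnorm (mu (rho (g k) *m v))).

Lemma kappa_cvg : fnorm (m k) @[k --> \oo] --> kappa.
Proof.
have h : cvgn (fun k => fnorm (m k)).
  apply: nonincreasing_is_cvgn; first by apply/nonincreasing_seqP; exact: descent_norm_le.
  by exists 0 => _ [s _ <-]; exact: fnorm_ge0.
exact: h.
Qed.

Lemma kappa_le k : kappa <= fnorm (m k).
Proof.
have dec : forall j, fnorm (m (j + k)%N) <= fnorm (m k).
  by elim=> // j; rewrite addSn; apply: le_trans; exact: descent_norm_le.
apply: (@rcvg_le R nat \oo (fun j => fnorm (m (j + k)%N)) (fun=> fnorm (m k))).
- have h := kappa_cvg; rewrite -(cvg_shiftn k) in h; exact: h.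
- exact: cvg_cst.
- by apply: filterE => j; exact: dec.
Qed.

Lemma kappa_ge0 : 0 <= kappa.
Proof.
apply: (@rcvg_le R nat \oo (fun=> 0) (fun j => fnorm (m j))).
- exact: cvg_cst.
- exact: kappa_cvg.
- by apply: filterE => j; exact: fnorm_ge0.
Qed.

(** Each step gains at least κ²/L, because the inner product of consecutive moments is at least the
    squared norm of the later one. *)
Lemma descent_log k :
  ln (rinner (w k) (w k)) <= ln (rinner v v) - k%:R * (kappa ^+ 2 / L).
Proof.
elim: k => [|k IH]; first by rewrite /w g0 rho1 mul1mx mul0r subr0.
have h1 := descent_value k; have h2 := descent_gradient k.
have h3 : kappa ^+ 2 <= rinner (m k.+1) (m k).
  apply: le_trans h2; rewrite -fnorm_sqr lerXn2r ?nnegrE ?fnorm_ge0 ?kappa_ge0 //.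
  exact: kappa_le.
have h4 : kappa ^+ 2 / L <= rinner (m k.+1) (m k) / L.
  by rewrite ler_wpM2r // invr_ge0 ltW.
apply: le_trans h1 _; rewrite -natr1 mulrDl mul1r.
move: (ln _) (ln _) (_ / L) (_ / L) (k%:R * _) IH h4 => a b e f p IH h4; lra.
Qed.

(** The points x_i form a path in P_n from the identity whose i-th step has length ‖m_i‖/L; the
    distance of its end x_{k+1} from the identity is (k+1)‖H_{k+1}‖/L. *)
Lemma descent_direction_le k : fnorm (H k.+1) <= arithmetic_mean (fun i => fnorm (m i)) k.
Proof.
have [[HH _] gH] := hH (ltn0Sn k).
have XH : (((k.+1)%:R / L)%:C *: H k.+1)^H = ((k.+1)%:R / L)%:C *: H k.+1 by rewrite adjZr HH.
pose A i := (- L^-1)%:C *: m i.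
have AH i : (A i)^H = A i by rewrite adjZr; have [-> _] := ikm i.
have gA i : g i.+1 = mexp (2^-1%:C *: A i) *m g i.
  by rewrite gS /A scalerA -rmorphM mulrN -invfM -rmorphN.
have := fnorm_log_le XH AH g0 gA (esym gH).
have L1 : 0 <= L^-1 by rewrite invr_ge0 ltW.
rewrite fnormZ ger0_norm ?divr_ge0 ?(ltW L0) // => h.
have e : \sum_(i < k.+1) fnorm (A i) = L^-1 * \sum_(i < k.+1) fnorm (m i).
  by rewrite mulr_sumr; apply: eq_bigr => i _; rewrite fnormZ normrN ger0_norm.
have e2 (t : R) : k.+1%:R / L * t = L^-1 * (k.+1%:R * t) by ring.
rewrite e e2 ler_pM2l ?invr_gt0 // in h.
have -> : arithmetic_mean (fun i => fnorm (m i)) k = k.+1%:R^-1 * \sum_(i < k.+1) fnorm (m i).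
  by rewrite /arithmetic_mean /series /= big_mkord.
by rewrite ler_pdivlMl ?ltr0n.
Qed.

Section UltraLimit.
Variables (U : set_system nat) (H0 : 'M[C]_n).
Context {UU : UltraFilter U}.
Hypotheses (oU : \oo `<=` U) (HH0 : mcvg U H H0).

Let UP : ProperFilter U := ultra_proper.

Let U_pos : U [set k | (0 < k)%N].
Proof. by apply: oU; exists 1%N. Qed.

Lemma limit_direction_ik : ik G H0.
Proof. by apply: (ik_closed hGalg UP _ HH0); apply: filterS U_pos => k /hH[]. Qed.

(** The Cesàro means of the moment norms have the same limit κ. *)
Lemma limit_direction_le : fnorm H0 <= kappa.
Proof.
have am := cesaro kappa_cvg.
have lim1 : fnorm (H k) @[k --> U] --> fnorm H0 by exact: cvg_fnorm.
apply: (@rcvg_le R nat U (fun k => fnorm (H k)) (fun k => arithmetic_mean (fun i => fnorm (m i)) k.-1)).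
- exact: lim1.
- have h : arithmetic_mean (fun i => fnorm (m i)) k.-1 @[k --> \oo] --> kappa.
    by rewrite -(cvg_shiftS (fun k => arithmetic_mean (fun i => fnorm (m i)) k.-1)).
  by move=> B Bn; apply: oU; exact: h B Bn.
- by apply: filterS U_pos => -[//|k] _; exact: descent_direction_le.
Qed.

Lemma orbit_exp_norm X (t : R) (u : 'cV[C]_d) : ik G X ->
  rinner u (mexp (t%:C *: La X) *m u) =
  rinner (rho (mexp ((t / 2)%:C *: X)) *m u) (rho (mexp ((t / 2)%:C *: X)) *m u).
Proof.
move=> ikX; have XH := LaH ikX; rewrite rho_exp //.
by rewrite rinner_mull mulmxA expmx_herm // -expmx_hermD // -splitr.
Qed.

(** For k ≥ sL the point e^{sH_k} lies at parameter sL/k on the geodesic from I to x_k;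
    log-convexity interpolates the bound of [descent_log], and k tends to infinity. *)
Lemma limit_direction_decay (s : R) : 0 <= s ->
  rinner v (mexp (s%:C *: La H0) *m v) <= expR (ln (rinner v v) - s * kappa ^+ 2).
Proof.
move=> s0; have lim : rinner v (mexp (s%:C *: La (H k)) *m v) @[k --> U] -->
    rinner v (mexp (s%:C *: La H0) *m v).
  apply: cvg_rinner; first exact: mcvg_cst.
  apply: mcvg_mul; last exact: mcvg_cst.
  apply: mcvg_mexp; apply: mcvgZ; first exact: ccvg_cst.
  by apply: La_cvg => //; apply: filterS U_pos => k /hH[].
apply: (@rcvg_le R nat U _ (fun=> expR (ln (rinner v v) - s * kappa ^+ 2)) _ _ UP lim (cvg_cst _)).
have big : U [set k | s * L <= k%:R].
  apply: oU; exists (Num.truncn (s * L)).+1 => // k /= kl.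
  have /andP[_ /ltW h] := truncn_itv (mulr_ge0 s0 (ltW L0)).
  by apply: le_trans h _; rewrite ler_nat.
apply: filterS2 U_pos big => k k0 /= sk; have [ikH gH] := hH k0; have LH := LaH ikH.
have kR : 0 < (k%:R : R) by rewrite ltr0n.
pose B := (k%:R / L)%:C *: La (H k); pose la := s * L / k%:R.
have BH : B^H = B by rewrite adjZr LH.
have l0 : 0 <= la by rewrite divr_ge0 ?mulr_ge0 // ltW.
have l1 : la <= 1 by rewrite ler_pdivrMr // mul1r.
have sB : s%:C *: La (H k) = la%:C *: B.
  by rewrite scalerA -rmorphM; congr (_%:C *: _); rewrite /la; field; rewrite !gt_eqF.
have gw : rinner v (mexp (1%:C *: B) *m v) = rinner (w k) (w k).
  have Gk := descent_G k; have Gk' := G_adj hGadj Gk.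
  by rewrite scale1r /B -(rho_exp ikH) -gH (rhoM Gk' Gk) (rhoJ Gk) -mulmxA /w [RHS]rinner_mull.
have h := log_convex BH v0 l0 l1; rewrite gw -sB in h.
have h2 := descent_log k.
have pos : 0 < rinner v (mexp (s%:C *: La (H k)) *m v).
  have SH : (s%:C *: La (H k))^H = s%:C *: La (H k) by rewrite adjZr LH.
  by apply: lt_le_trans (jensen SH v0); rewrite mulr_gt0 ?expR_gt0 ?rinner_gt0.
rewrite -ler_ln ?posrE ?expR_gt0 // expRK; apply: le_trans h _.
have h3 : la * ln (rinner (w k) (w k)) <= la * (ln (rinner v v) - k%:R * (kappa ^+ 2 / L)).
  by rewrite ler_wpM2l.
have e : la * (k%:R * (kappa ^+ 2 / L)) = s * kappa ^+ 2.
  by rewrite /la; field; rewrite !gt_eqF.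
rewrite mulrBr e in h3; apply: le_trans (lerD (lexx _) h3) _.
by rewrite le_eqVlt; apply/orP; left; apply/eqP; ring.
Qed.

(** Write h = kb with b in the parabolic subgroup of H₀. Conjugation by e^{rH₀/2} keeps b bounded,
    so e^{rH₀/2}b acts on v as contractingly as e^{rH₀/2} up to a constant. Jensen's inequality
    compares this with e^{r⟨μ(π(b)v), H₀⟩}, and equivariance of μ returns to h. *)
Lemma moment_halfspace h : G h -> exists2 k, Ku G k &
  rinner (mu (rho h *m v)) (k *m H0 *m k^H) <= - kappa ^+ 2.
Proof.
move=> Gh; have ikH0 := limit_direction_ik; have [H0H H0G] := ikH0.
have ikY := ik_opp ikH0; have [YH _] := ikY.
have [V [y [VU YE]]] := herm_spectral YH.
have [k Kk kz] := iwasawa hGalg hGadj Gh ikY VU YE.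
exists k => //; have [Gk kU] := Kk; have Gk' := G_adj hGadj Gk.
pose b := k^H *m h; have Gb : G b by exact: (G_mul hGalg).
pose E (t : R) := mexp (t%:C *: H0).
have GE t : G (E t) by exact: H0G.
have EK t : E t *m E (- t) = 1%:M by exact: expmx_hermNK.
have EKd t : \det (E t) * \det (E (- t)) = 1 by rewrite -det_mulmx EK det1.
pose c (r : nat) := E (r%:R / 2) *m b *m E (- (r%:R / 2)).
have Gc r : G (c r) by apply: (G_mul hGalg) => //; exact: (G_mul hGalg).
have H0E : H0 = (-1)%:C *: (V *m dgr y *m V^H) by rewrite -YE scaleN1c opprK.
have EE t : E t = V *m dgr (map_mx (fun x => expR (- t * x)) y) *m V^H.
  rewrite /E H0E scalerA -rmorphM mulrN1 expmx_real //.
  by rewrite -(ufun_comp V (fun x => expR (- t * x)) (real_complex R)) ufun_id.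
(* Nonzero entries of b satisfy y_i ≥ y_j in the eigenframe of -H₀, and conjugation multiplies them
   by e^{-r(y_i - y_j)/2} ≤ 1. *)
have cb r : fnorm (c r) <= fnorm b.
  have e1 : fnorm (c r) = fnorm (V^H *m c r *m V).
    by rewrite (fnorm_unitaryr _ VU) (fnorm_unitaryl _ (unitary_adj VU)).
  have e2 : fnorm b = fnorm (V^H *m b *m V).
    by rewrite (fnorm_unitaryr _ VU) (fnorm_unitaryl _ (unitary_adj VU)).
  rewrite e1 e2; have -> : V^H *m c r *m V =
      dgr (map_mx (fun x => expR (- (r%:R / 2) * x)) y) *m (V^H *m b *m V) *m
      dgr (map_mx (fun x => expR ((r%:R / 2) * x)) y).
    rewrite /c !EE opprK; move: (dgr _) (dgr _) => D1 D2.
    by rewrite !mulmxA VU mul1mx -!mulmxA VU mulmx1.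
  have bz i j : y 0 i < y 0 j -> (V^H *m b *m V) i j = 0 by rewrite /b mulmxA; exact: kz.
  move: (V^H *m b *m V) bz => B bz.
  rewrite -(@ler_pXn2r _ 2) ?nnegrE ?fnorm_ge0 // !fnorm_sqr !rinnerE.
  apply: ler_sum => i _; apply: ler_sum => j _.
  rewrite mul_mx_diag mxE mul_diag_mx mxE !mxE.
  have [lt|le] := ltP (y 0 i) (y 0 j).
    by rewrite bz // mulr0 mul0r.
  set p := expR _; set q := expR _.
  have pq : p * q <= 1.
    rewrite /p /q -expRD -expR0 ler_expR mulNr addrC -mulrBr.
    by rewrite mulr_ge0_le0 ?subr_le0 // divr_ge0.
  have pq0 : 0 <= p * q by rewrite mulr_ge0 ?expR_ge0.
  have -> : p%:C * B i j * q%:C = (p * q)%:C * B i j by rewrite mulrAC -rmorphM.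
  rewrite ReM ImM /= !mul0r subr0 addr0.
  move: (complex.Re (B i j)) (complex.Im (B i j)) (p * q) pq pq0 => a e t t1 t0.
  have -> : t * a * (t * a) + t * e * (t * e) = t ^+ 2 * (a * a + e * e) by ring.
  by rewrite ler_piMl ?expr_le1 // -!expr2 addr_ge0 ?sqr_ge0.
(* Matrix entries of the representation are polynomials over powers of the determinant, and the
   conjugates of b all have the same determinant. *)
have [M2 M2P] : exists M2 : R, forall r, fnorm (rho (c r)) ^+ 2 <= M2.
  have ent i j : exists B, forall r, sqn (rho (c r) i j) <= B.
    have [f pf [e fE]] := rho_rat i j; have [B BP] := polyfun_bounded (fnorm b) pf.
    exists (B * sqn ((\det b ^+ e)^-1)) => r; rewrite fE // sqnM.
    have -> : \det (c r) = \det b.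
      by rewrite /c !det_mulmx mulrAC EKd mul1r.
    by rewrite ler_wpM2r ?sqn_ge0 // BP.
  pose Bf i j := projT1 (cid (ent i j)).
  have BfP i j r : sqn (rho (c r) i j) <= Bf i j by exact: (projT2 (cid (ent i j))).
  exists (\sum_i \sum_j Bf i j) => r; rewrite fnorm_sqr rinnerE.
  apply: ler_sum => i _; apply: ler_sum => j _; apply: le_trans (BfP i j r).
  by rewrite /sqn !expr2.
have w'0 := orbit_neq0 Gb v0; pose w' := rho b *m v.
pose m0 := rinner (mu w') H0.
(* Jensen's inequality on the left, the decay along H₀ on the right. *)
have main (r : nat) : expR (r%:R * m0) * rinner w' w' <=
    M2 * expR (ln (rinner v v) - r%:R * kappa ^+ 2).
  have AH : (r%:R%:C *: La H0)^H = r%:R%:C *: La H0 by rewrite adjZr LaH.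
  have := jensen AH w'0; rewrite -scalemxAl rinnerZr -mulrA -muE // -/w' -/m0 => J.
  apply: le_trans J _; rewrite orbit_exp_norm //.
  have -> : rho (mexp ((r%:R / 2)%:C *: H0)) *m w' =
      rho (c r) *m (rho (mexp ((r%:R / 2)%:C *: H0)) *m v).
    have Ge : G (mexp ((r%:R / 2)%:C *: H0)) := GE (r%:R / 2).
    rewrite /w' !mulmxA -(rhoM Ge Gb) -(rhoM (Gc r) Ge).
    congr (rho _ *m _); rewrite /c -/(E (r%:R / 2)) -!mulmxA.
    by have := EK (- (r%:R / 2)); rewrite opprK => ->; rewrite mulmx1.
  rewrite -[X in X <= _]fnorm_sqr; set u := _ *m v.
  apply: (@le_trans _ _ (fnorm (rho (c r)) ^+ 2 * fnorm u ^+ 2)).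
    by rewrite -exprMn lerXn2r ?nnegrE ?mulr_ge0 ?fnorm_ge0 // fnorm_mul.
  apply: ler_pM; rewrite ?sqr_ge0 //.
  have := limit_direction_decay (ler0n R r); by rewrite (orbit_exp_norm _ _ ikH0) -[X in X <= _]fnorm_sqr.
rewrite -(moment_conj Kk (orbit_neq0 Gh v0) ikH0).
have -> : rho k^H *m (rho h *m v) = w' by rewrite /w' /b mulmxA (rhoM Gk' Gh).
rewrite -/m0 -subr_le0 opprK.
have ww : 0 < rinner w' w' := rinner_gt0 w'0.
apply: (@exp_bounded_le0 _ _ (M2 * rinner v v / rinner w' w')) => r.
rewrite ler_pdivlMr // mulrDr expRD.
have h1 := main r; rewrite expRD lnK ?posrE ?rinner_gt0 // in h1.
rewrite -mulrA [X in _ * X]mulrC mulrA.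
have -> : M2 * rinner v v = M2 * (rinner v v * expR (- (r%:R * kappa ^+ 2))) * expR (r%:R * kappa ^+ 2).
  by rewrite -!mulrA -expRD addNr expR0 mulr1.
by rewrite ler_wpM2r ?expR_ge0.
Qed.

(** Expanding ‖μ + kH₀k†‖² with [moment_halfspace] and ‖H₀‖ ≤ κ bounds it by ‖μ‖² - κ², whose limit
    l² - κ² is not positive. *)
Lemma moment_asymptotic (F : set_system nat) (h : nat -> 'M[C]_n) (l : R) : ProperFilter F ->
  (forall r, G (h r)) -> fnorm (mu (rho (h r) *m v)) @[r --> F] --> l -> 0 <= l -> l <= kappa ->
  exists k : nat -> 'M[C]_n, (forall r, Ku G (k r)) /\
    mcvg F (fun r => mu (rho (h r) *m v) + k r *m H0 *m (k r)^H) 0.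
Proof.
move=> FF Gh hl l0 lk.
pose k r := projT1 (cid2 (moment_halfspace (Gh r))).
have kP r : Ku G (k r) /\ rinner (mu (rho (h r) *m v)) (k r *m H0 *m (k r)^H) <= - kappa ^+ 2.
  by rewrite /k; case: (cid2 _).
exists k; split=> [r|]; first by have [] := kP r.
pose q r := fnorm (mu (rho (h r) *m v) + k r *m H0 *m (k r)^H).
have qle r : q r ^+ 2 <= fnorm (mu (rho (h r) *m v)) ^+ 2 - kappa ^+ 2.
  have [[_ kU] hk] := kP r; rewrite /q fnorm_sqr rinnerDl !rinnerDr.
  rewrite (rinnerC (k r *m H0 *m _) (mu _)) -(fnorm_sqr (k r *m H0 *m _)) fnorm_conj // -fnorm_sqr.
  have h0 : fnorm H0 ^+ 2 <= kappa ^+ 2.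
    by rewrite lerXn2r ?nnegrE ?fnorm_ge0 ?kappa_ge0 // limit_direction_le.
  move: (fnorm (mu _) ^+ 2) (rinner _ _) (fnorm H0 ^+ 2) (kappa ^+ 2) hk h0 => p x z c; lra.
have lim : fnorm (mu (rho (h r) *m v)) ^+ 2 - kappa ^+ 2 @[r --> F] --> l ^+ 2 - kappa ^+ 2.
  apply: cvgB; last exact: cvg_cst.
  by rewrite /GRing.exp /=; apply: cvgM.
have l2 : l ^+ 2 - kappa ^+ 2 <= 0.
  by rewrite subr_le0 lerXn2r ?nnegrE ?kappa_ge0.
apply/mcvg_fnormP/rcvgP => e e0.
have e2 : 0 < e ^+ 2 by rewrite exprn_gt0.
have /rcvgP/(_ _ e2) := lim; apply: filterS => r /= he.
rewrite !subr0 ger0_norm ?fnorm_ge0 // -(@ler_pXn2r _ 2) ?nnegrE ?fnorm_ge0 ?(ltW e0) //.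
apply: le_trans (qle r) _; move: he; rewrite ler_norml => /andP[_].
by move: (_ ^+ 2 - _) (_ ^+ 2 - _) (e ^+ 2) l2 => a b c; lra.
Qed.

End UltraLimit.

End Descent.

(** * Orthonormal coordinates on the representation space *)

Section OrthonormalCoordinates.
Variables (R : realType) (V : vectType R[i]) (ip : V -> V -> R[i]).
Notation C := R[i].
Hypothesis ipL : forall (a : C) u v w, ip (a *: u + v) w = a * ip u w + ip v w.
Hypothesis ipC : forall u w, ip u w = conjc (ip w u).
Hypothesis ip_gt0 : forall u, u != 0 -> 0 < ip u u.

Let d := \dim (fullv : {vspace V}).
Let e := vbasis (fullv : {vspace V}).
Let cv (w : V) : 'cV[C]_d := \col_i coord e i w.
Let vc (x : 'cV[C]_d) : V := \sum_(i < d) x i 0 *: e`_i.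

Let cvK w : vc (cv w) = w.
Proof.
rewrite [RHS](coord_vbasis (memvf w)) /vc; apply: eq_bigr => i _.
by rewrite mxE.
Qed.

Let vcK x : cv (vc x) = x.
Proof.
apply/colP => i; rewrite mxE /vc coord_sum_free //.
exact: basis_free (vbasisP _).
Qed.

Let ip0l w : ip 0 w = 0.
Proof. by have := ipL (-1) 0 0 w; rewrite scaler0 addr0 mulN1r addNr. Qed.

Let ip_suml (x : 'cV[C]_d) w : ip (vc x) w = \sum_(i < d) x i 0 * ip e`_i w.
Proof.
rewrite /vc; elim: (index_enum _) => [|i r IH]; first by rewrite !big_nil ip0l.
by rewrite !big_cons ipL IH.
Qed.

Let Gm : 'M[C]_d := \matrix_(i < d, j < d) ip e`_j e`_i.

Let ip_gram (x y : 'cV[C]_d) : ip (vc x) (vc y) = (y^H *m (Gm *m x)) 0 0.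
Proof.
rewrite ip_suml mxE (eq_bigr (fun i : 'I_d => \sum_(j < d) conjc (y j 0) * (ip e`_i e`_j * x i 0))); last first.
  move=> i _; rewrite ipC ip_suml rmorph_sum mulr_sumr; apply: eq_bigr => j _.
  by rewrite rmorphM [in RHS]ipC; ring.
rewrite exchange_big; apply: eq_bigr => j _; rewrite adjE mxE mulr_sumr.
by apply: eq_bigr => i _; rewrite mxE.
Qed.

(** Coordinates in any basis, multiplied by the positive square root of the Gram matrix, become
    orthonormal. *)
Lemma orthonormal_coordinates : exists k (crd : V -> 'cV[C]_k) (dcr : 'cV[C]_k -> V),
  [/\ cancel crd dcr, cancel dcr crd,
      forall (a : C) u w, crd (a *: u + w) = a *: crd u + crd w &
      forall u w, ip u w = \tr (crd u *m (crd w)^H)].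
Proof.
have GH : Gm^H = Gm by apply/matrixP => i j; rewrite adjE !mxE -ipC.
have GP : @posdef R d Gm.
  split; first by apply/is_hermitianmxP; rewrite expr0 scale1r adj_trmxC GH.
  move=> u u0; rewrite adj_trmxC -mulmxA -ip_gram; apply: ip_gt0.
  by apply: contra u0 => /eqP u0; rewrite -(vcK u) u0; apply/eqP/colP => i; rewrite !mxE linear0.
have [Z ZH GE] := posdef_log GP; pose S := mexp (2^-1%:C *: Z).
have SH : S^H = S by exact: expmx_herm.
have SS : S *m S = Gm by rewrite GE; exact: expmx_half.
have SU : S \in unitmx by exact: expmx_herm_unit.
exists d, (fun w => S *m cv w), (fun x => vc (invmx S *m x)); split.
- by move=> w; rewrite mulKmx.
- by move=> x; rewrite vcK mulKVmx.
- move=> a u w; rewrite scalemxAr -mulmxDr; congr (_ *m _).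
  by apply/colP => i; rewrite !mxE linearP.
move=> u w; rewrite -{1}(cvK u) -{1}(cvK w) ip_gram -SS.
by rewrite mxtrace_mulC adjM SH -!mulmxA /mxtrace big_ord1.
Qed.

End OrthonormalCoordinates.

Section CoordinateMatrix.
Variables (R : realType) (V : vectType R[i]) (d : nat).
Notation C := R[i].
Variables (crd : V -> 'cV[C]_d) (dcr : 'cV[C]_d -> V).
Hypotheses (crdK : cancel crd dcr) (dcrK : cancel dcr crd).
Hypothesis crdL : forall (a : C) u w, crd (a *: u + w) = a *: crd u + crd w.

Lemma crd0 : crd 0 = 0.
Proof. by have := crdL (-1) 0 0; rewrite scaler0 addr0 scaleN1r addNr. Qed.

Lemma crdZ a u : crd (a *: u) = a *: crd u.
Proof. by have := crdL a u 0; rewrite crd0 !addr0. Qed.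

Lemma crdD u w : crd (u + w) = crd u + crd w.
Proof. by have := crdL 1 u w; rewrite !scale1r. Qed.

Lemma crdB u w : crd (u - w) = crd u - crd w.
Proof. by rewrite crdD -scaleN1r crdZ scaleN1r. Qed.

Lemma dcr_comb (x : 'cV[C]_d) : dcr x = \sum_j x j 0 *: dcr (delta_mx j 0).
Proof.
apply: (can_inj crdK); rewrite dcrK (big_morph crd crdD crd0) [LHS]matrix_sum_delta.
by apply: eq_bigr => j _; rewrite big_ord1 crdZ dcrK.
Qed.

Definition mxof (f : 'End(V)) : 'M[C]_d := \matrix_(i, j) crd (f (dcr (delta_mx j 0))) i 0.

Lemma mxofE (f : 'End(V)) w : crd (f w) = mxof f *m crd w.
Proof.
rewrite -[in LHS](crdK w) dcr_comb linear_sum (big_morph crd crdD crd0).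
apply/colP => i; rewrite summxE mxE; apply: eq_bigr => j _.
by rewrite linearZ crdZ !mxE mulrC.
Qed.

Lemma mxof_eq (A B : 'M[C]_d) : (forall w, A *m crd w = B *m crd w) -> A = B.
Proof.
move=> h; apply/matrixP => i j; have := h (dcr (delta_mx j 0)).
by rewrite dcrK -!colE => /colP/(_ i); rewrite !mxE.
Qed.

End CoordinateMatrix.

(** * Geodesics of P_n at Gram points *)

Section SquareRoot.
Variable R : realType.
Notation C := R[i].

Lemma posdef_herm n (x : 'M[C]_n) : @posdef R n x -> x^H = x.
Proof. by move=> /posdef_log[Z ZH ->]; rewrite -(scale1r Z); exact: (@expmx_herm R n Z ZH 1). Qed.

Lemma posdef_unit n (x : 'M[C]_n) : @posdef R n x -> x \in unitmx.
Proof. by move=> /posdef_log[Z ZH ->]; rewrite -(scale1r Z); exact: (@expmx_herm_unit R n Z ZH 1). Qed.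

Lemma sqrtmxP n (x : 'M[C]_n) : @posdef R n x ->
  @posdef R n (sqrtmx x) /\ sqrtmx x *m sqrtmx x = x.
Proof.
move=> /posdef_log[Z ZH xE]; rewrite /sqrtmx.
apply: (@xgetPex _ 0 [set s | @posdef R n s /\ s *m s = x]).
exists (mexp (2^-1%:C *: Z)); split; first exact: expmx_herm_posdef.
by rewrite expmx_half.
Qed.

Lemma polar_square n (g s : 'M[C]_n) : g \in unitmx -> s \in unitmx -> s^H = s ->
  s *m s = g^H *m g ->
  [/\ (g *m invmx s)^H *m (g *m invmx s) = 1%:M, (g *m invmx s) *m (g *m invmx s)^H = 1%:M,
    invmx s *m g^H = (g *m invmx s)^H, s *m (g *m invmx s)^H = g^H & (g *m invmx s) *m s = g].
Proof.
move=> gU sU sH ss; have iH : (invmx s)^H = invmx s.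
  by symmetry; apply: cmulmx1_invmx; rewrite -{1}sH -adjM mulVmx // adj1.
have e : (g *m invmx s)^H *m (g *m invmx s) = 1%:M.
  by rewrite adjM iH mulmxA -(mulmxA _ g^H) -ss mulmxA mulVmx // mul1mx mulmxV.
split; [by []|exact: mulmx1C|by rewrite adjM iH| |by rewrite mulmxKV].
by rewrite adjM iH mulKVmx.
Qed.

Lemma conj_three n (u g m s : 'M[C]_n) : invmx s *m g^H = u^H -> g *m invmx s = u ->
  invmx s *m (g^H *m m *m g) *m invmx s = u^H *m m *m u.
Proof. by move=> h1 h2; rewrite -h1 -[in RHS]h2 !mulmxA. Qed.

Lemma sandwich_assoc n (s u g m : 'M[C]_n) : s *m u^H = g^H -> u *m s = g ->
  s *m (u^H *m m *m u) *m s = g^H *m m *m g.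
Proof. by move=> <- <-; rewrite !mulmxA. Qed.

(** The group acts on P_n by isometries x ↦ g†xg, so geodesics from g†g are translates of those from
    I. In the polar decomposition g = us the formula at the square root s differs only by the
    unitary u, which cancels. *)
Lemma pd_exp_gram n (g A : 'M[C]_n) : g \in unitmx ->
  pd_exp (g^H *m g) (g^H *m A *m g) = g^H *m mexp A *m g.
Proof.
move=> gU; have [sp ss] := sqrtmxP (posdef_gram gU).
have [e1 e2 e3 e4 e5] := polar_square gU (posdef_unit sp) (posdef_herm sp) ss.
rewrite /pd_exp; set s := sqrtmx _ in sp ss e1 e2 e3 e4 e5 *.
set u := g *m invmx s in e1 e2 e3 e4 e5.
rewrite (conj_three A e3 (erefl u)) mexpE expmx_conj //; exact: sandwich_assoc.
Qed.

Lemma pd_metric_gram n (g A B : 'M[C]_n) : g \in unitmx -> A^H = A ->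
  pd_metric (g^H *m g) (g^H *m B *m g) (g^H *m A *m g) = rinner B A.
Proof.
move=> gU AH; have gU' : g^H \in unitmx.
  apply: (@cmulmx1_unit _ _ _ (invmx g)^H); by rewrite -adjM mulVmx // adj1.
rewrite /pd_metric rinner_tr AH.
have -> : invmx (g^H *m g) = invmx g *m invmx g^H.
  apply: cmulmx1_invmx; rewrite -mulmxA (mulmxA g) mulmxV // mul1mx mulmxV //.
have -> : invmx g *m invmx g^H *m (g^H *m B *m g) *m (invmx g *m invmx g^H) *m (g^H *m A *m g)
   = invmx g *m (B *m A *m g).
  by rewrite -!mulmxA (mulKmx gU') (mulKVmx gU) (mulKmx gU').
by rewrite mxtrace_mulC mulmxK.
Qed.

End SquareRoot.

(** * The gradient of the Kempf-Ness function *)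

Section Gradient.
Variables (R : realType) (n d : nat) (G : set 'M[R[i]]_n).
Notation C := R[i].
Notation FF := ((0 : R)^').
Hypotheses (hGalg : is_algebraic_group G) (hGadj : self_adjoint G).
Variables (rho La : 'M[C]_n -> 'M[C]_d) (mu : 'cV[C]_d -> 'M[C]_n).
Hypothesis rhoM : forall g h, G g -> G h -> rho (g *m h) = rho g *m rho h.
Hypothesis rhoJ : forall g, G g -> rho g^H = (rho g)^H.
Hypothesis LaH : forall X, ik G X -> (La X)^H = La X.
Hypothesis rho_exp : forall X, ik G X -> forall t : R,
  rho (mexp (t%:C *: X)) = mexp (t%:C *: La X).
Hypothesis mu_ik : forall w, w != 0 -> ik G (mu w).
Hypothesis muE : forall w X, w != 0 -> ik G X ->
  rinner (mu w) X = rinner w (La X *m w) / rinner w w.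
Variable v : 'cV[C]_d.

Lemma quadratic_exp_derive (D : 'M[C]_d) (w : 'cV[C]_d) :
  is_derive (0 : R) (1 : R) (fun t : R => rinner (mexp (t%:C *: D) *m w) w) (rinner (D *m w) w).
Proof.
apply: is_derive_quotient.
have h : mcvg FF (fun t : R => (t^-1)%:C *: (mexp (t%:C *: D) - 1%:M) *m w) (D *m w).
  by apply: mcvg_mul; [exact: mexp_deriv|exact: mcvg_cst].
have -> : (fun t : R => t^-1 * (rinner (mexp ((t + 0)%:C *: D) *m w) w -
    rinner (mexp ((0 : R)%:C *: D) *m w) w)) =
    (fun t => rinner ((t^-1)%:C *: (mexp (t%:C *: D) - 1%:M) *m w) w).
  by apply/funext => t; rewrite addr0 scale0r expmx0 -rinnerBl -mulmxBl -scalemxAl rinnerZl.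
by apply: cvg_rinner; [exact: h|exact: mcvg_cst].
Qed.

Lemma log_quadratic_derive (D : 'M[C]_d) (w : 'cV[C]_d) : w != 0 ->
  is_derive (0 : R) (1 : R) (fun t : R => ln (rinner (mexp (t%:C *: D) *m w) w))
    (rinner (D *m w) w / rinner w w).
Proof.
move=> w0; have h1 := quadratic_exp_derive D w.
have q0 := rinner_gt0 w0.
pose f t := rinner (mexp (t%:C *: D) *m w) w.
have f0 : f 0 = rinner w w by rewrite /f scale0r expmx0 mul1mx.
have h2 : is_derive (f 0) (1 : R) (@ln R) (f 0)^-1 by apply: is_derive1_ln; rewrite f0.
have := is_derive1_comp h2 h1; rewrite f0 mulrC; exact.
Qed.

(** Translation by the inverse of g moves the curve to the identity, where [ik_tangent] applies. *)
Lemma tangent_gram g Y : G g -> tangent_space (@posdef R n `&` G) (g^H *m g) Y ->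
  exists2 B, ik G B & Y = g^H *m B *m g.
Proof.
move=> Gg [c [cM c0 cY]]; have gU := G_unit hGalg Gg; pose h := invmx g.
have Gh : G h by exact: (G_inv hGalg Gg).
have hU := G_unit hGalg Gh.
have cY' : mcvg FF (fun t : R => (t^-1)%:C *: (c t - c 0)) Y by exact/mcvgE.
have gh : g *m h = 1%:M by rewrite mulmxV.
have hg : h^H *m g^H = 1%:M by rewrite -adjM gh adj1.
have hg' : g^H *m h^H = 1%:M by exact: mulmx1C.
exists (h^H *m Y *m h); last first.
  by rewrite !mulmxA hg' mul1mx -mulmxA (mulVmx gU) mulmx1.
apply: (ik_tangent hGalg (F := FF) (x := fun t => h^H *m c t *m h) (tau := id)).
- exact: dnbhs0_id.
- exact: dnbhs0_neq.
- apply: filterS (filterT : FF setT) => t _; split.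
    have [sp ss] := sqrtmxP (cM t).1.
    have -> : h^H *m c t *m h = (sqrtmx (c t) *m h)^H *m (sqrtmx (c t) *m h).
      by rewrite -{1}ss adjM (posdef_herm sp) !mulmxA.
    by apply: posdef_gram; rewrite unitmx_mul (posdef_unit sp).
  apply: (G_mul hGalg) => //; apply: (G_mul hGalg); last exact: (cM t).2.
  exact: (G_adj hGadj).
have -> : (fun t : R => (t^-1)%:C *: (h^H *m c t *m h - 1%:M)) =
    (fun t => h^H *m ((t^-1)%:C *: (c t - c 0)) *m h).
  apply/funext => t; rewrite -scalemxAr -scalemxAl mulmxBr mulmxBl c0; congr (_ *: (_ - _)).
  by rewrite mulmxA hg mul1mx gh.
by apply: mcvg_mul; [apply: mcvg_mul; [exact: mcvg_cst|]|exact: mcvg_cst].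
Qed.

Lemma curve_gram g A : G g -> ik G A ->
  curve_through (@posdef R n `&` G) (g^H *m g) (g^H *m A *m g)
    (fun t : R => g^H *m mexp (t%:C *: A) *m g).
Proof.
move=> Gg ikA; have [AH Ae] := ikA; split.
- move=> t; split.
    rewrite -(expmx_half (B := t%:C *: A)); last by rewrite adjZr AH.
    set E := mexp _; have EH : E^H = E.
      by rewrite /E expmx_herm // adjZr AH.
    have -> : g^H *m (E *m E) *m g = (E *m g)^H *m (E *m g).
      by rewrite adjM EH !mulmxA.
    apply: posdef_gram; rewrite unitmx_mul (G_unit hGalg Gg) andbT /E.
    by apply: expmx_herm_unit; rewrite adjZr AH.
  apply: (G_mul hGalg) => //; apply: (G_mul hGalg); last exact: Ae.
  exact: (G_adj hGadj).
- by rewrite scale0r expmx0 mulmx1.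
apply/mcvgE.
have -> : (fun t : R => (t^-1)%:C *:
   (g^H *m mexp (t%:C *: A) *m g - g^H *m mexp ((0 : R)%:C *: A) *m g)) =
   (fun t => g^H *m ((t^-1)%:C *: (mexp (t%:C *: A) - 1%:M)) *m g).
  apply/funext => t; rewrite scale0r expmx0 -mulmxBl -mulmxBr.
  by rewrite -scalemxAr -scalemxAl.
by apply: mcvg_mul; [apply: mcvg_mul; [exact: mcvg_cst|exact: mexp_deriv]|exact: mcvg_cst].
Qed.

(** Test the gradient on the curves g†e^{tA}g with A in i𝔨: the derivative of f is ⟨μ(π(g)v), A⟩,
    and the inner product on i𝔨 is nondegenerate. *)
Lemma kempf_ness_gradient (f : 'M[C]_n -> R) g Y : G g -> rho g *m v != 0 ->
  (forall y, f y = ln (rinner (rho y *m v) v)) ->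
  is_gradient_at (@posdef R n `&` G) f (g^H *m g) Y ->
  Y = g^H *m mu (rho g *m v) *m g.
Proof.
move=> Gg w0 fE [/(tangent_gram Gg)[B ikB ->]] fY; congr (_ *m _ *m _).
set w := rho g *m v in w0 *.
have key A : ik G A -> rinner B A = rinner (mu w) A.
  move=> ikA; have [AH Ae] := ikA.
  have h1 := fY _ _ (curve_gram Gg ikA).
  have h2 := log_quadratic_derive (La A) w0.
  have e : f \o (fun t : R => g^H *m mexp (t%:C *: A) *m g) =
      (fun t : R => ln (rinner (mexp (t%:C *: La A) *m w) w)).
    apply/funext => t; rewrite /= fE; congr ln.
    rewrite (rhoM (G_mul hGalg (G_adj hGadj Gg) (Ae t)) Gg) (rhoM (G_adj hGadj Gg) (Ae t)).
    by rewrite rho_exp // (rhoJ Gg) /w -!mulmxA [in LHS]rinner_mull adjK.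
  rewrite e in h1; have := @derive_val _ _ _ _ _ _ _ h1; rewrite (@derive_val _ _ _ _ _ _ _ h2).
  rewrite (pd_metric_gram _ (G_unit hGalg Gg) AH) => <-.
  by rewrite muE // (rinnerC w).
have ikm := mu_ik w0; have ikS := ik_sub hGalg ikB ikm.
apply/eqP; rewrite -subr_eq0; apply/eqP; apply: rinner_eq0.
by rewrite {1}rinnerBl key // subrr.
Qed.

End Gradient.

(** * Convergence of the spectra *)

Section SpectralLimit.
Variables (R : realType) (n : nat) (G : set 'M[R[i]]_n).
Notation C := R[i].
Hypotheses (hGalg : is_algebraic_group G) (hGadj : self_adjoint G).
Hypothesis hGconn : zariski_connected G.
Variable T : set 'M[C]_n.
Hypothesis mT : is_maximal_torus (Ku G) T.
Variables (D : set 'M[C]_n) (spec : 'M[C]_n -> 'M[C]_n).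
Hypotheses (DT : forall X, D X -> il T X)
  (DZ : forall (a : R) X, 0 <= a -> D X -> D (a%:C *: X))
  (DD : forall X Y, D X -> D Y -> D (X + Y))
  (Duniq : forall P k, D P -> Ku G k -> D (k *m P *m k^H) -> P = k *m P *m k^H)
  (spec_in : forall X, ik G X -> D (spec X))
  (spec_conj : forall X, ik G X -> exists2 k, Ku G k & spec X = k *m X *m k^H).

Lemma Ku_ultra_limit (U : set_system nat) (k : nat -> 'M[C]_n) : UltraFilter U ->
  (forall r, Ku G (k r)) -> exists2 q, Ku G q & mcvg U k q.
Proof.
move=> UU kK; have UP : ProperFilter U by exact: ultra_proper.
have [q kq] : exists q, mcvg U k q.
  apply: (@ultra_mcvg_bounded R nat U UU n n k (fnorm (1%:M : 'M[C]_n))).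
  by apply: filterE => r; rewrite fnorm_unitary //; have [_ h] := kK r; exact: h.
exists q => //; apply: (Ku_closed hGalg UP _ kq); exact: filterE.
Qed.

Lemma fnorm_conj_Ku k X : Ku G k -> fnorm (k *m X *m k^H) = fnorm X.
Proof. by move=> [_ kU]; exact: fnorm_conj. Qed.

Lemma conj_assoc (a b X : 'M[C]_n) : a *m (b *m X *m b^H) *m a^H = (a *m b) *m X *m (a *m b)^H.
Proof. by rewrite adjM !mulmxA. Qed.

Lemma conj_adjK k X : Ku G k -> k^H *m (k *m X *m k^H) *m k = X.
Proof.
move=> [_ kU]; have kU' := unitary_adjK kU.
by rewrite !mulmxA kU' mul1mx -mulmxA kU' mulmx1.
Qed.

(** The limit is conjugate to X, hence to spec X, which is in the chamber; [chamber_limit_unique]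
    identifies the two. *)
Lemma chamber_limit (F : set_system nat) (f : nat -> 'M[C]_n) X k : ProperFilter F ->
  ik G X -> Ku G k -> F [set r | D (f r)] -> mcvg F f (k *m X *m k^H) -> mcvg F f (spec X).
Proof.
move=> FF ikX Kk Df fX; have [s Ks sE] := spec_conj ikX.
have Kks : Ku G (k *m s^H) by exact: (Ku_mul hGalg Kk (Ku_adj hGadj Ks)).
have e : k *m X *m k^H = (k *m s^H) *m spec X *m (k *m s^H)^H.
  by rewrite -conj_assoc adjK sE conj_adjK.
rewrite e in fX; rewrite (chamber_limit_unique hGalg hGadj hGconn mT DT DZ DD _ Duniq FF Df fX _ Kks) //.
  move=> Y ikY; have [l Kl lE] := spec_conj ikY; exists l => //.
  by rewrite -lE; exact: spec_in.
exact: spec_in.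
Qed.

Variables (m : 'M[C]_n -> 'M[C]_n) (g H : nat -> 'M[C]_n) (kap M : R).
Hypothesis m_ik : forall h, G h -> ik G (m h).
Hypothesis gG : forall k, G (g k).
Hypothesis H_ik : forall k, (0 < k)%N -> ik G (H k).
Hypothesis H_bd : forall k, (0 < k)%N -> fnorm (H k) <= M.
Hypothesis kap_cvg : fnorm (m (g k)) @[k --> \oo] --> kap.
Hypothesis limit_direction : forall (U : set_system nat) H0, UltraFilter U -> \oo `<=` U ->
  mcvg U H H0 -> [/\ ik G H0, fnorm H0 <= kap &
    forall (F : set_system nat) (h : nat -> 'M[C]_n) (l : R), ProperFilter F ->
      (forall r, G (h r)) -> fnorm (m (h r)) @[r --> F] --> l -> 0 <= l -> l <= kap ->
      exists k : nat -> 'M[C]_n, (forall r, Ku G (k r)) /\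
        mcvg F (fun r => m (h r) + k r *m H0 *m (k r)^H) 0].
Variable pstar : 'M[C]_n.
Hypothesis hp : is_min_norm_point (closure [set spec (m h) | h in G]) pstar.

Let kap0 : 0 <= kap.
Proof.
apply: (@rcvg_le R nat \oo (fun=> 0) (fun k => fnorm (m (g k)))).
- exact: cvg_cst.
- exact: kap_cvg.
- by apply: filterE => k; exact: fnorm_ge0.
Qed.

Section OneUltrafilter.
Variables (U : set_system nat) (H0 : 'M[C]_n).
Hypotheses (UU : UltraFilter U) (oU : \oo `<=` U) (HH0 : mcvg U H H0).

Let ikH0 : ik G H0.
Proof. by have [h _ _] := limit_direction UU oU HH0; exact: h. Qed.

Let ikN : ik G (- H0).
Proof. exact: ik_opp ikH0. Qed.

(** The conjugators that bring the moments into the chamber and those of the asymptotic statement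
    both converge along the ultrafilter, so the spectra tend to a conjugate of -H₀. *)
Lemma spec_moment_limit (F : set_system nat) (h : nat -> 'M[C]_n) (l : R) : UltraFilter F ->
  (forall r, G (h r)) -> fnorm (m (h r)) @[r --> F] --> l -> 0 <= l -> l <= kap ->
  mcvg F (fun r => spec (m (h r))) (spec (- H0)).
Proof.
move=> FU Gh hl l0 lk; have FP : ProperFilter F by exact: ultra_proper.
have [_ _ asym] := limit_direction UU oU HH0.
have [k [kK kc]] := asym F h l FP Gh hl l0 lk.
pose s r := projT1 (cid2 (spec_conj (m_ik (Gh r)))).
have sP r : Ku G (s r) /\ spec (m (h r)) = s r *m m (h r) *m (s r)^H.
  by rewrite /s; case: (cid2 _).
have skK r : Ku G (s r *m k r) by exact: (Ku_mul hGalg (proj1 (sP r)) (kK r)).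
have [q Kq kq] := Ku_ultra_limit FU skK.
apply: (@chamber_limit F _ (- H0) q) => //.
  by apply: filterE => r; apply: spec_in; exact: m_ik.
have -> : (fun r => spec (m (h r))) = (fun r =>
    s r *m (m (h r) + k r *m H0 *m (k r)^H) *m (s r)^H + (s r *m k r) *m (- H0) *m (s r *m k r)^H).
  apply/funext => r; have [_ ->] := sP r.
  by rewrite mulmxDr mulmxDl conj_assoc mulmxN mulNmx addrK.
rewrite -[X in mcvg _ _ X]add0r; apply: mcvgD; last first.
  by apply: mcvg_mul; [apply: mcvg_mul; [exact: kq|exact: mcvg_cst]|exact: mcvg_adj].
have [q' Kq' sq'] := Ku_ultra_limit FU (fun r => proj1 (sP r)).
rewrite -[X in mcvg _ _ X](mul0mx _ q'^H) -[X in mcvg _ _ (X *m _)](mulmx0 _ q').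
by apply: mcvg_mul; [apply: mcvg_mul; [exact: sq'|exact: kc]|exact: mcvg_adj].
Qed.

Lemma spec_moment_descent : mcvg U (fun k => spec (m (g k))) (spec (- H0)).
Proof.
apply: (spec_moment_limit UU gG (l := kap)) => //.
by move=> A An; apply: oU; exact: kap_cvg.
Qed.

Lemma spec_direction_limit : mcvg U (fun k => spec (- H k)) (spec (- H0)).
Proof.
have UP : ProperFilter U by exact: ultra_proper.
have pos : U [set k | (0 < k)%N] by apply: oU; exists 1%N.
have ex k : exists s, Ku G s /\ ((0 < k)%N -> spec (- H k) = s *m (- H k) *m s^H).
  have [k0|k0] := boolP (0 < k)%N.
    by have [s Ks sE] := spec_conj (ik_opp (H_ik k0)); exists s.
  by exists 1%:M; split => //; exact: (Ku_1 hGalg).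
pose s k := projT1 (cid (ex k)).
have sP k : Ku G (s k) /\ ((0 < k)%N -> spec (- H k) = s k *m (- H k) *m (s k)^H).
  by rewrite /s; case: (cid _).
have [q Kq sq] := Ku_ultra_limit UU (fun k => proj1 (sP k)).
apply: (@chamber_limit U _ (- H0) q) => //.
  by apply: filterS pos => k k0; apply: spec_in; apply: ik_opp; exact: H_ik.
apply: (@near_mcvg _ _ _ _ _ _ (fun k => s k *m (- H k) *m (s k)^H)).
  by apply: filterS pos => k k0; have [_ ->] := sP k.
by apply: mcvg_mul; [apply: mcvg_mul; [exact: sq|exact: mcvgN]|exact: mcvg_adj].
Qed.

(** spec(-H₀) is a limit of points of the polytope and has norm at most κ, so ‖p*‖ ≤ κ. A sequence
    realising p* is then subject to [spec_moment_limit] too, and limits are unique. *)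
Lemma min_norm_point_limit : spec (- H0) = pstar.
Proof.
have UP : ProperFilter U by exact: ultra_proper.
have [pc pmin] := hp.
have Pcl : closure [set spec (m h) | h in G] (spec (- H0)).
  apply/closureP => e e0; have /mcvg_fnormP/rcvgP/(_ _ (divr_gt0 e0 (ltr0Sn _ 1))) := spec_moment_descent.
  move=> /filter_ex[k /=]; rewrite subr0 ger0_norm ?fnorm_ge0 // => hk.
  exists (spec (m (g k))); first by exists (g k).
  by apply: le_lt_trans hk _; lra.
have [_ H0k _] := limit_direction UU oU HH0.
have pk : fnorm pstar <= kap.
  have := pmin _ Pcl; rewrite !mx_fnormE => /le_trans; apply.
  have [s Ks ->] := spec_conj ikN; by rewrite fnorm_conj_Ku // fnormN.
(* Group elements whose spectra converge to p*, which is only a point of the closure. *)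
have near j : exists2 h, G h & fnorm (spec (m h) - pstar) < j.+1%:R^-1.
  have j0 : 0 < j.+1%:R^-1 :> R by rewrite invr_gt0.
  have [_ [h Gh <-] hh] := (closureP _ _).1 pc _ j0; by exists h.
pose h j := projT1 (cid2 (near j)).
have hP j : G (h j) /\ fnorm (spec (m (h j)) - pstar) < j.+1%:R^-1.
  by rewrite /h; case: (cid2 _).
have hc : mcvg U (fun j => spec (m (h j))) pstar.
  apply: (mcvg_squeeze (e := fun j => j.+1%:R^-1)).
    by apply: filterE => j; have [_ /ltW] := hP j.
  by move=> A An; apply: oU; exact: cvg_harmonic.
have hn : fnorm (m (h j)) @[j --> U] --> fnorm pstar.
  have -> : (fun j => fnorm (m (h j))) = (fun j => fnorm (spec (m (h j)))).
    apply/funext => j; have [Gh _] := hP j; have [s Ks ->] := spec_conj (m_ik Gh).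
    by rewrite fnorm_conj_Ku.
  exact: cvg_fnorm hc.
have := spec_moment_limit UU (fun j => proj1 (hP j)) hn (fnorm_ge0 _) pk.
by move=> /mcvg_unique; apply.
Qed.

End OneUltrafilter.

Theorem spectral_limits : spec (m (g k)) @[k --> \oo] --> pstar /\
  spec (- H k) @[k --> \oo] --> pstar.
Proof.
have lim (U : set_system nat) : UltraFilter U -> \oo `<=` U -> exists H0, mcvg U H H0.
  move=> UU oU; apply: (@ultra_mcvg_bounded R nat U UU n n H M).
  apply: oU; exists 1%N => // k /=; exact: H_bd.
split; apply: cvg_ultraP => U UU oU; have [H0 HH0] := lim U UU oU;
  rewrite -(min_norm_point_limit UU oU HH0); apply/mcvgE.
- exact: spec_moment_descent.
- exact: spec_direction_limit.
Qed.

End SpectralLimit.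

Lemma arithmetic_mean_le (R : realType) (a : nat -> R) M k :
  (forall i, a i <= M) -> arithmetic_mean a k <= M.
Proof.
move=> aM; rewrite /arithmetic_mean /series /= ler_pdivrMl ?ltr0n //.
have -> : k.+1%:R * M = \sum_(i < k.+1) M by rewrite sumr_const card_ord mulr_natl.
by rewrite big_mkord; apply: ler_sum => i _; exact: aM.
Qed.

Lemma descent_gram (R : realType) n (g m : 'M[R[i]]_n) (L : R) : g \in unitmx -> m^H = m ->
  pd_exp (g^H *m g) (- (L^-1)%:C *: (g^H *m m *m g)) =
  (mexp (- ((2 * L)^-1)%:C *: m) *m g)^H *m (mexp (- ((2 * L)^-1)%:C *: m) *m g).
Proof.
move=> gU mH; pose B := (- L^-1)%:C *: m; have BH : B^H = B by rewrite adjZr mH.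
have -> : - (L^-1)%:C *: (g^H *m m *m g) = g^H *m B *m g.
  by rewrite /B rmorphN -scalemxAr -scalemxAl.
have -> : - ((2 * L)^-1)%:C *: m = 2^-1%:C *: B.
  by rewrite /B scalerA -rmorphM -rmorphN mulrN -invfM.
rewrite pd_exp_gram // -(expmx_half BH).
have EH := expmx_herm BH 2^-1; move: (mexp (2^-1%:C *: B)) EH => E EH.
by rewrite adjM EH !mulmxA.
Qed.

(** * The theorem in orthonormal coordinates *)

Section CoordinateLimits.
Variables (R : realType) (n d : nat) (G : set 'M[R[i]]_n).
Notation C := R[i].
Hypotheses (hGalg : is_algebraic_group G) (hGadj : self_adjoint G).
Hypothesis hGconn : zariski_connected G.
Variables (rho Pi : 'M[C]_n -> 'M[C]_d) (mu : 'cV[C]_d -> 'M[C]_n) (N : R).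
Hypothesis rho1 : rho 1%:M = 1%:M.
Hypothesis rhoM : forall g h, G g -> G h -> rho (g *m h) = rho g *m rho h.
Hypothesis rho_rat : forall i j, exists2 f, polyfun f & exists k : nat,
  forall g, G g -> rho g i j = f g / \det g ^+ k.
Hypothesis rhoU : forall k, Ku G k -> is_unitary (rho k).
Hypothesis rhoPi : forall X, lie_algebra G X ->
  mcvg (0 : R)^' (fun t => (t^-1)%:C *: (rho (mexp (t%:C *: X)) - 1%:M)) (Pi X).
Hypothesis mu_ik : forall w, w != 0 -> ik G (mu w).
Hypothesis muPi : forall w X, w != 0 -> ik G X ->
  rinner (mu w) X = rinner w (Pi X *m w) / rinner w w.
Variable T : set 'M[C]_n.
Hypothesis mT : is_maximal_torus (Ku G) T.
Hypothesis weights : forall om, il T om -> (exists2 w : 'cV[C]_d, w != 0 &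
  forall Y, il T Y -> Pi Y *m w = (rinner om Y)%:C *: w) -> fnorm om <= N.
Hypothesis N0 : 0 <= N.
Variable T' : set 'M[C]_n.
Hypothesis mT' : is_maximal_torus (Ku G) T'.
Variables (D : set 'M[C]_n) (spec : 'M[C]_n -> 'M[C]_n).
Hypotheses (DT : forall X, D X -> il T' X)
  (DZ : forall (a : R) X, 0 <= a -> D X -> D (a%:C *: X))
  (DD : forall X Y, D X -> D Y -> D (X + Y))
  (Duniq : forall P k, D P -> Ku G k -> D (k *m P *m k^H) -> P = k *m P *m k^H)
  (spec_in : forall X, ik G X -> D (spec X))
  (spec_conj : forall X, ik G X -> exists2 k, Ku G k & spec X = k *m X *m k^H).
Variable v : 'cV[C]_d.
Hypothesis v0 : v != 0.
Hypothesis unstable : forall e : R, 0 < e -> exists2 h, G h & fnorm (rho h *m v) < e.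
Variables (f : 'M[C]_n -> R) (grad : 'M[C]_n -> 'M[C]_n) (pstar : 'M[C]_n).
Hypothesis fE : forall y, f y = ln (rinner (rho y *m v) v).
Hypothesis hgrad : forall y, (@posdef R n `&` G) y ->
  is_gradient_at (@posdef R n `&` G) f y (grad y).
Hypothesis hp : is_min_norm_point (closure [set spec (mu (rho h *m v)) | h in G]) pstar.
Variables x g H : nat -> 'M[C]_n.
Let L := N ^+ 2.
Hypotheses (x0 : x 0%N = 1%:M) (xS : forall k, x k.+1 = pd_exp (x k) (- (L^-1)%:C *: grad (x k)))
  (g0 : g 0%N = 1%:M)
  (gS : forall k, g k.+1 = mexp (- ((2 * L)^-1)%:C *: mu (rho (g k) *m v)) *m g k).
Hypothesis hH : forall k, (0 < k)%N -> ik G (H k) /\ x k = mexp ((k%:R / L)%:C *: H k).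

Theorem coordinate_limits :
  spec (mu (rho (g k) *m v)) @[k --> \oo] --> pstar /\ spec (- H k) @[k --> \oo] --> pstar.
Proof.
have [La [LaL PiLa]] := rho_diff hGalg rho1 rho_rat rhoPi.
have Lab := LaB LaL.
have LaH := La_herm hGalg rhoU rhoPi LaL PiLa.
have rexp := rho_exp hGalg rho1 rhoM rhoU rhoPi LaL PiLa.
have Lcj := La_conj hGalg hGadj rho1 rhoM rhoU rhoPi LaL PiLa.
have rhoJ := rho_adj hGalg hGadj rho1 rhoM rhoU rhoPi LaL PiLa.
have muE w X : w != 0 -> ik G X -> rinner (mu w) X = rinner w (La X *m w) / rinner w w.
  by move=> w0 ikX; rewrite -(PiLa _ (ik_lie_algebra ikX)) muPi.
have wts om : il T om -> (exists2 w : 'cV[C]_d, w != 0 &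
    forall Y, il T Y -> La Y *m w = (rinner om Y)%:C *: w) -> fnorm om <= N.
  move=> tom [w w0 hw]; apply: weights => //; exists w => // Y tY.
  by rewrite (PiLa _ (ik_lie_algebra (il_torus_ik hGalg mT tY))) hw.
have Lbd X (w : 'cV[C]_d) : ik G X ->
    rinner (La X *m w) (La X *m w) <= L * rinner X X * rinner w w.
  by move=> ikX; exact: (La_bound hGalg hGadj mT rhoM rhoU LaH rexp Lcj muE wts).
(* If N were 0, the weight bound would make La vanish on i𝔨; by polar decomposition G would act by
   unitaries and could not shorten v. *)
have L0 : 0 < L.
  rewrite /L exprn_gt0 // lt_def N0 andbT; apply/negP => /eqP NE.
  have La0 X : ik G X -> La X = 0.
    move=> ikX; have h (w : 'cV[C]_d) : La X *m w = 0.
      have := Lbd X w ikX; rewrite /L NE expr0n /= !mul0r => h.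
      by apply: rinner_eq0; apply/le_anti; rewrite h rinner_ge0.
    apply/matrixP => i j; have := h (delta_mx j 0); rewrite -colE.
    by move=> /colP/(_ i); rewrite !mxE.
  have v0' : 0 < fnorm v by rewrite lt_def fnorm_ge0 andbT; apply: contra v0 => /eqP/fnorm_eq0 ->.
  have [h Gh] := unstable v0'; have [k [X [Kk ikX ->]]] := G_polar hGalg hGadj Gh.
  have [Gk kU] := Kk; have [_ GX] := ikX; have := GX 1; rewrite scale1r => GX1.
  have := rexp X ikX 1; rewrite scale1r (La0 X ikX) scaler0 expmx0 => rX.
  by rewrite rhoM // rX mulmx1 fnorm_unitaryl ?ltxx //; exact: rhoU.
have gG := descent_G hGalg rho1 rhoM mu_ik v0 g0 gS.
have w0 k : rho (g k) *m v != 0 by exact: (orbit_neq0 hGalg rho1 rhoM (gG k) v0).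
(* The descent on P_n ∩ G is the image of the descent on G under g ↦ g†g, which explains the factor
   1/2 in the exponent of the latter. *)
have xg k : x k = (g k)^H *m g k.
  elim: k => [|k IH]; first by rewrite x0 g0 adj1 mulmx1.
  have Mk : (@posdef R n `&` G) ((g k)^H *m g k).
    split; first exact: (posdef_gram (G_unit hGalg (gG k))).
    exact: (G_mul hGalg (G_adj hGadj (gG k)) (gG k)).
  have gr := kempf_ness_gradient hGalg hGadj rhoM rhoJ rexp mu_ik muE (gG k) (w0 k) fE (hgrad Mk).
  rewrite xS IH gr gS; have [muH _] := mu_ik (w0 k).
  rewrite descent_gram //; exact: (G_unit hGalg (gG k)).
have hHg k : (0 < k)%N -> ik G (H k) /\ (g k)^H *m g k = mexp ((k%:R / L)%:C *: H k).
  by move=> k0; rewrite -xg; exact: hH.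
have mle k : fnorm (mu (rho (g k) *m v)) <= fnorm (mu (rho (g 0%N) *m v)).
  elim: k => // k; apply: le_trans.
  exact: (descent_norm_le hGalg rho1 rhoM LaH rexp mu_ik muE L0 Lbd v0 g0 gS).
apply: (spectral_limits hGalg hGadj hGconn mT' DT DZ DD Duniq spec_in spec_conj
  (m := fun h => mu (rho h *m v)) (kap := kappa rho mu v g) (M := fnorm (mu (rho (g 0%N) *m v)))) => //.
- by move=> h Gh; apply: mu_ik; exact: (orbit_neq0 hGalg rho1 rhoM Gh v0).
- by move=> k /hHg[].
- move=> [//|k] _; apply: le_trans (descent_direction_le hGalg rho1 rhoM mu_ik L0 v0 g0 gS hHg k) _.
  exact: arithmetic_mean_le.
- exact: (kappa_cvg hGalg rho1 rhoM LaH rexp mu_ik muE L0 Lbd v0 g0 gS).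
move=> U H0 UU oU HH0; split.
- exact: (limit_direction_ik hGalg hHg oU HH0).
- exact: (limit_direction_le hGalg rho1 rhoM LaH rexp mu_ik muE L0 Lbd v0 g0 gS hHg oU HH0).
- move=> F h l FF Gh hl l0 lk.
  exact: (moment_asymptotic hGalg hGadj rho1 rhoM rho_rat rhoU rhoJ Lab LaH rexp Lcj mu_ik muE
    L0 Lbd v0 g0 gS hHg oU HH0 FF Gh hl l0 lk).
Qed.

End CoordinateLimits.

(** * Transport from the abstract representation space *)

Section Coordinates.
Variables (R : realType) (V : vectType R[i]) (ip : {dot V for @Num.conj R[i]}).
Notation C := R[i].

Lemma dot_linearl (a : C) u v w : ip (a *: u + v) w = a * ip u w + ip v w.
Proof. exact: linearPl. Qed.

Lemma dot_conj u w : ip u w = conjc (ip w u).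
Proof. by rewrite hermC expr0 mul1r. Qed.

Lemma dot_gt0 u : u != 0 -> 0 < ip u u.
Proof. by move=> u0; rewrite dnorm_gt0. Qed.

Variables (d : nat) (crd : V -> 'cV[C]_d) (dcr : 'cV[C]_d -> V).
Hypotheses (crdK : cancel crd dcr) (dcrK : cancel dcr crd).
Hypothesis crdL : forall (a : C) u w, crd (a *: u + w) = a *: crd u + crd w.
Hypothesis ip_crd : forall u w, ip u w = \tr (crd u *m (crd w)^H).

Lemma Re_dot u w : complex.Re (ip u w) = rinner (crd u) (crd w).
Proof. by rewrite ip_crd rinner_tr. Qed.

Lemma hnormE w : hnorm ip w = fnorm (crd w).
Proof. by rewrite /hnorm Re_dot fnorm_def. Qed.

Lemma dot_quotient (a : R) u w : w != 0 -> a%:C = ip w u / ip w w ->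
  a = rinner (crd w) (crd u) / rinner (crd w) (crd w).
Proof.
move=> w0 /(congr1 (@complex.Re R)) /= ->.
have wE : ip w w = (rinner (crd w) (crd w))%:C.
  apply: complexP; rewrite ?Re_dot //=.
  by have := dot_gt0 w0; rewrite ltcE => /andP[/eqP].
by rewrite wE invr_complex mulrC ReZ Re_dot mulrC.
Qed.

Variables (n : nat) (G : set 'M[C]_n) (pi Pi : 'M[C]_n -> 'End(V)).
Let rho g := mxof crd dcr (pi g).

Lemma coordinate_rational i j : is_rational_rep G pi -> exists2 f, polyfun f & exists k : nat,
  forall g, G g -> rho g i j = f g / \det g ^+ k.
Proof.
move=> [_ _ rat]; pose phi0 (w : V) : R[i]^o := crd w i 0.
have phiL : linear phi0 by move=> a u w; rewrite /phi0 crdL !mxE.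
pose m := GRing.isLinear.Build R[i] V R[i]^o *:%R phi0 phiL.
pose phi : {linear V -> R[i]^o} := HB.pack phi0 m.
have [p [k pk]] := rat (linfun phi) (dcr (delta_mx j 0)).
exists (mx_eval p); first exact: mx_eval_polyfun.
by exists k => g /pk; rewrite lfunE /= /phi0 /rho /mxof mxE.
Qed.

Lemma coordinate_unitary k : (forall u w, ip (pi k u) (pi k w) = ip u w) -> is_unitary (rho k).
Proof.
move=> h; have iso (x y : 'cV[C]_d) : rinner (rho k *m x) (rho k *m y) = rinner x y.
  rewrite -(dcrK x) -(dcrK y) -!(mxofE crdK dcrK crdL) -!Re_dot; congr complex.Re; exact: h.
rewrite /is_unitary; apply: (mxof_eq dcrK) => w; rewrite mul1mx -mulmxA.
apply/eqP; rewrite -subr_eq0; apply/eqP; apply: rinner_eq0.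
by rewrite {1}rinnerBl rinner_mull adjK iso subrr.
Qed.

Lemma coordinate_deriv X : is_lie_rep ip G pi Pi -> lie_algebra G X ->
  mcvg (0 : R)^' (fun t => (t^-1)%:C *: (rho (mexp (t%:C *: X)) - 1%:M)) (mxof crd dcr (Pi X)).
Proof.
move=> hPi GX; set Q := (X in mcvg _ X _); move=> i j.
have h := hPi X (dcr (delta_mx j 0)) GX.
have {h} : mcvg (0 : R)^' (fun t => Q t *m delta_mx j 0) (mxof crd dcr (Pi X) *m (delta_mx j 0 : 'cV[C]_d)).
  apply/mcvg_fnormP.
  suff -> : (fun t : R => fnorm (Q t *m (delta_mx j 0 : 'cV[C]_d) - mxof crd dcr (Pi X) *m delta_mx j 0)) =
    (fun t : R => hnorm ip ((t^-1)%:C *: (pi (expmx (t%:C *: X)) (dcr (delta_mx j 0)) -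
       dcr (delta_mx j 0)) - Pi X (dcr (delta_mx j 0)))) by exact: h.
  apply/funext => t.
  rewrite hnormE (crdB crdL) (crdZ crdL) (crdB crdL) !(mxofE crdK dcrK crdL) dcrK mexpE.
  by rewrite /Q -scalemxAl mulmxBl mul1mx.
move=> /(_ i 0); rewrite -colE mxE.
by under eq_fun do rewrite -colE mxE.
Qed.

End Coordinates.

Theorem theorem4p7 (R : realType) (n : nat) (G : set 'M[R[i]]_n)
  (V : vectType R[i]) (ip : {dot V for @Num.conj R[i]})
  (pi Pi : 'M[R[i]]_n -> 'End(V)) (mu : V -> 'M[R[i]]_n)
  (T : set 'M[R[i]]_n) (N : R)
  (C : set 'M[R[i]]_n) (spec : 'M[R[i]]_n -> 'M[R[i]]_n)
  (v : V) (pstar : 'M[R[i]]_n) (grad : 'M[R[i]]_n -> 'M[R[i]]_n)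
  (x g H : nat -> 'M[R[i]]_n)
  (K := unitary_part G) (M := @posdef R n `&` G) (L := N ^+ 2)
  (hGalg : is_algebraic_group G) (hGconn : zariski_connected G)
  (hGred : is_reductive G) (hGadj : self_adjoint G)
  (hpi : is_rational_rep G pi) (hip : invariant_product K pi ip)
  (hPi : is_lie_rep ip G pi Pi) (hmu : is_moment_map ip K Pi mu)
  (hT : is_maximal_torus K T) (hN : is_max_weight_norm T Pi N)
  (hC : is_weyl_chamber K C) (hspec : is_spec K C spec)
  (hv : v != 0)
  (hpstar : is_min_norm_point (moment_polytope G pi mu spec v) pstar)
  (hgrad : forall y, M y -> is_gradient_at M (kempf_ness ip pi v) y (grad y))
  (hx0 : x 0%N = 1%:M)
  (hxS : forall k, x k.+1 = pd_exp (x k) (- (L^-1)%:C *: grad (x k)))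
  (hg0 : g 0%N = 1%:M)
  (hgS : forall k,
     g k.+1 = expmx (- ((2 * L)^-1)%:C *: mu (pi (g k) v)) *m g k)
  (hH : forall k, (0 < k)%N ->
     ilie K (H k) /\ x k = expmx ((k%:R / L)%:C *: H k))
  (hinf : inf [set hnorm ip (pi h v) | h in G] = 0) :
  (spec (mu (pi (g k) v)) @[k --> \oo] --> pstar) /\
  (spec (- H k) @[k --> \oo] --> pstar).

Proof.
have KE : unitary_part G = Ku G by apply/seteqP; split => k /KuE.
have [d [crd [dcr [crdK dcrK crdL ip_crd]]]] :=
  orthonormal_coordinates (dot_linearl ip) (dot_conj ip) (@dot_gt0 R V ip).
pose rho h := mxof crd dcr (pi h); pose Pi' X := mxof crd dcr (Pi X).
pose mu' (w : 'cV[R[i]]_d) := mu (dcr w).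
have rhoE h w : rho h *m crd w = crd (pi h w) by rewrite (mxofE crdK dcrK crdL).
have PiE X w : Pi' X *m crd w = crd (Pi X w) by rewrite (mxofE crdK dcrK crdL).
have dcr0 w : w != 0 -> dcr w != 0.
  by apply: contra => /eqP w0; rewrite -(dcrK w) w0 (crd0 crdL).
have mu'E h : mu' (rho h *m crd v) = mu (pi h v) by rewrite rhoE /mu' crdK.
have [pi1 piM _] := hpi; have [[om0 _ omE] omN] := hN; have [wmT wmax] := hT.
have TK : T `<=` Ku G by rewrite -KE; case: wmT.
have [[T' mT' CT'] [CZ CD] Cex] := hC; rewrite /K KE in mT'.
have T'K : T' `<=` Ku G by case: mT' => [[]].
have ikK X : ik G X -> ilie K X by move=> ikX; apply/(ikP hGalg).
have Cik X : C X -> ik G X.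
  by move=> CX; apply: (il_torus_ik hGalg mT'); apply/(ilieP _ T'K); exact: CT'.
suff -> : (fun k => spec (mu (pi (g k) v))) = (fun k => spec (mu' (rho (g k) *m crd v))).
  apply: (@coordinate_limits R n d G hGalg hGadj hGconn rho Pi' mu' N _ _ _ _ _ _ _ T _ _ _ T' _
    C spec _ _ _ _ _ _ (crd v) _ _ (kempf_ness ip pi v) grad pstar _ _ _ x g H) => //.
  - by apply: (mxof_eq dcrK) => w; rewrite rhoE mul1mx pi1.
  - move=> h1 h2 Gh1 Gh2; apply: (mxof_eq dcrK) => w.
    by rewrite -mulmxA !rhoE piM.
  - by move=> i j; exact: coordinate_rational.
  - move=> k Kk; apply: (coordinate_unitary crdK dcrK crdL ip_crd) => u w.
    by apply: hip; rewrite /K KE.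
  - by move=> X GX; exact: (coordinate_deriv crdK dcrK crdL ip_crd hPi GX).
  - by move=> w /dcr0/hmu[h _]; apply/(ikP hGalg).
  - move=> w X w0 ikX; have [_ h] := hmu _ (dcr0 _ w0); have := h _ (ikK X ikX).
    move=> /(dot_quotient ip_crd (dcr0 _ w0)); rewrite mx_innerE dcrK -PiE dcrK; exact.
  - by rewrite -KE.
  - move=> om tom [w w0 hw]; rewrite -mx_fnormE; apply: omN; split; first exact/(ilieP _ TK).
    exists (dcr w); first exact: dcr0.
    move=> Y /(ilieP _ TK) tY; apply: (can_inj crdK).
    by rewrite -PiE dcrK hw // (crdZ crdL) dcrK mx_innerE.
  - by rewrite -omE mx_fnormE fnorm_ge0.
  - by move=> X CX; apply/(ilieP _ T'K); exact: CT'.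
  (* Both matrices are chamber representatives of the orbit of P, so each equals the unique one. *)
  - move=> P k CP Kk CkP; have [P' [_ Pu]] := Cex P (ikK P (Cik P CP)).
    have PP : P' = P.
      apply: Pu; split=> //; exists 1%:M; last by rewrite adj_trmxC adj1 mul1mx mulmx1.
      by rewrite /K KE; exact: (Ku_1 hGalg).
    rewrite -[LHS]PP; apply: Pu; split=> //.
    by exists k; [rewrite /K KE|rewrite adj_trmxC].
  - by move=> X /ikK/hspec[].
  - by move=> X /ikK/hspec[_ [k Kk ->]]; exists k; [rewrite -KE|rewrite adj_trmxC].
  - by apply: contra hv => /eqP v0; rewrite -(crdK v) v0 -(crd0 crdL) crdK.
  (* The infimum is informative only for a nonempty set bounded below; then its vanishing yields
     arbitrarily short vectors in the orbit. *)
  - move=> e e0; have hi : has_inf [set hnorm ip (pi h v) | h in G].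
      split; first by exists (hnorm ip (pi 1%:M v)); exists 1%:M => //; exact: (G_1 hGalg).
      by exists 0 => _ [h _ <-]; rewrite (hnormE ip_crd) fnorm_ge0.
    have [_ [h Gh <-]] := inf_adherent e0 hi; rewrite hinf add0r (hnormE ip_crd) => he.
    by exists h; rewrite ?rhoE.
  - by move=> y; rewrite /kempf_ness (Re_dot ip_crd) rhoE.
  - suff -> : (fun h => spec (mu' (rho h *m crd v))) = (fun h => spec (mu (pi h v))) by [].
    by apply/funext => h; rewrite mu'E.
  - by move=> k; rewrite mu'E -mexpE; exact: hgS.
  - by move=> k /hH[/(ikP hGalg) ikH ->]; rewrite mexpE.
by apply/funext => k; rewrite mu'E.
Qed.
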